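(* Assume that there is a subset $\mathcal T_1\subset\sigma(H_0)$ such that for every $\lambda\in\sigma(H_0)\setminus\mathcal T_1$: (i) $M^{\mathbf C}_{\lambda,sng}$ is discrete; (ii) each connected component of $M^{\mathbf C}_{\lambda,reg}$ intersects $\mathbf T^d$ and the intersection is a $(d-1)$-dimensional real analytic submanifold of $\mathbf T^d$. Let $\lambda\in\sigma(H_0)\setminus\mathcal T_1$. If $u\in\mathcal B^*_0(\mathbf T^d)$ ($\mathbf C^s$-valued) satisfies $$(H_0(x)-\lambda)u=f(x)\quad\text{on }\mathbf T^d$$ for some ($\mathbf C^s$-valued) trigonometric polynomial $f(x)$, then $u$ is also a trigonometric polynomial.
   Context: Let $d\ge2$, $s\ge1$, $\mathbf T^d=\mathbf R^d/(2\pi\mathbf Z)^d$, and $\mathbf T^d_{\mathbf C}=\mathbf C^d/(2\pi\mathbf Z)^d$. $H_0(x)$, $x\in\mathbf T^d$, is an $s\times s$ Hermitian matrix whose entries are polynomials in $e^{\pm ix_1},\dots,e^{\pm ix_d}$ (hence it extends analytically to $z\in\mathbf T^d_{\mathbf C}$). $H_0$ is the bounded self-adjoint operator of multiplication by $H_0(x)$ on $L^2(\mathbf T^d)^s$, and $\sigma(H_0)=\bigcup_{x\in\mathbf T^d}\sigma_p(H_0(x))$, where $\sigma_p(H_0(x))$ is the set of eigenvalues of the matrix $H_0(x)$. $p(z,\lambda)=\det(H_0(z)-\lambda)$, $M^{\mathbf C}_\lambda=\{z\in\mathbf T^d_{\mathbf C}: p(z,\lambda)=0\}$, $M^{\mathbf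 C}_{\lambda,reg}=\{z\in M^{\mathbf C}_\lambda:\nabla_zp(z,\lambda)\ne0\}$, $M^{\mathbf C}_{\lambda,sng}=\{z\in M^{\mathbf C}_\lambda:\nabla_zp(z,\lambda)=0\}$. A trigonometric polynomial is a vector function each component of which is a finite sum $\sum_{|\alpha|\le N}c_\alpha e^{i\alpha\cdot x}$, $\alpha\in\mathbf Z^d$, with constants $c_\alpha$. For a distribution $u$ on $\mathbf T^d$ let $\widehat u(n)=(2\pi)^{-d/2}\int_{\mathbf T^d}e^{-ix\cdot n}u(x)dx$. $\mathcal B^*(\mathbf T^d)$ is the set of $u\in\mathcal S'(\mathbf T^d)$ with $\sup_{R>1}\frac1R\sum_{|n|<R}|\widehat u(n)|^2<\infty$, and $\mathcal B^*_0(\mathbf T^d)$ is the set of $u\in\mathcal B^*(\mathbf T^d)$ with $\lim_{R\to\infty}\frac1R\sum_{|n|<R}|\widehat u(n)|^2=0$ (componentwise for vector-valued $u$). *)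

(* Defs.v *)
From HB Require Import structures.
From mathcomp Require Import all_boot all_order all_algebra.
From mathcomp Require Import sesquilinear spectral generic_quotient.
From mathcomp Require Import all_classical all_reals all_analysis.
From mathcomp Require Import complex.

Set Implicit Arguments.
Unset Strict Implicit.
Unset Printing Implicit Defensive.

Import Order.TTheory GRing.Theory Num.Theory.
Import numFieldNormedType.Exports.

Local Open Scope classical_set_scope.
Local Open Scope ring_scope.
Local Open Scope complex_scope.
Local Open Scope quotient_scope.

(* [R[i]] carries the topology of its modulus; in particular ['rV[R[i]]_d] is
   a normed space over [R[i]], so that ['D_v f z] below is a complex
   directional derivative. *)
HB.instance Definition _ (R : realType) := NormedModule.copy R[i] R[i]^o.

Section Defs.
Variable R : realType.
Local Notation C := R[i].

Section FixedDimension.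
Variable d : nat.
Local Notation Rd := 'rV[R]_d.
Local Notation Cd := 'rV[C]_d.

Definition basis_vec (K : numFieldType) (j : 'I_d) : 'rV[K]_d := delta_mx 0 j.

Definition complexify (x : Rd) : Cd := map_mx (real_complex R) x.

Definition expC (z : C) : C :=
  (expR (complex.Re z))%:C * (cos (complex.Im z) +i* sin (complex.Im z)).

Definition character (a : 'rV[int]_d) (z : Cd) : C :=
  expC ('i * \sum_(j < d) (a 0 j)%:~R * z 0 j).

Definition laurent_trig (F : Cd -> C) : Prop :=
  exists (A : seq 'rV[int]_d) (c : 'rV[int]_d -> C),
    forall z, F z = \sum_(a <- A) c a * character a z.

(* A trigonometric polynomial on [T^d] is the restriction of its extension to
   [T^d_C]. *)
Definition trig_polynomial (m : nat) (f : Rd -> 'cV[C]_m) : Prop :=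
  forall j : 'I_m, exists F : Cd -> C,
    laurent_trig F /\ forall x, f x j 0 = F (complexify x).

Definition lattice_vec (a : 'rV[int]_d) : Cd :=
  \row_(j < d) (2 * pi * (a 0 j)%:~R)%:C.

Definition lattice_rel (z w : Cd) : bool :=
  `[< exists a : 'rV[int]_d, w = z + lattice_vec a >].

Lemma lattice_vecD a b : lattice_vec (a + b) = lattice_vec a + lattice_vec b.
Proof.
by apply/rowP => j; rewrite !mxE rmorphD /= mulrDr -rmorphD.
Qed.

Lemma lattice_vec0 : lattice_vec 0 = 0.
Proof. by apply/rowP => j; rewrite !mxE mulr0. Qed.

Lemma lattice_rel_equiv : equiv_class_of lattice_rel.
Proof.
have tr x y z : lattice_rel x y -> lattice_rel y z -> lattice_rel x z.
  move=> /asboolP[a ->] /asboolP[b ->]; apply/asboolP; exists (a + b).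
  by rewrite lattice_vecD addrA.
have sy x y : lattice_rel x y -> lattice_rel y x.
  move=> /asboolP[a ->]; apply/asboolP; exists (- a).
  by rewrite -addrA -lattice_vecD subrr lattice_vec0 addr0.
split=> [z|x y|y x z]; last exact: tr.
- by apply/asboolP; exists 0; rewrite lattice_vec0 addr0.
- by apply/idP/idP; exact: sy.
Qed.

Canonical lattice_equiv := EquivRelPack lattice_rel_equiv.

(* [C^d / (2 pi Z)^d], with the quotient topology. *)
Definition ctorus := quotient_topology {eq_quot lattice_equiv}.

HB.instance Definition _ := Topological.on ctorus.

Definition ctorus_pi (z : Cd) : ctorus := \pi_{eq_quot lattice_equiv} z.

Definition real_torus : set ctorus := range (ctorus_pi \o complexify).

Definition monomial (a : 'I_d -> nat) (h : Rd) : R :=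
  \prod_(j < d) h 0 j ^+ a j.

(* Sums over multi-indices are taken along the cubes [{0, .., N-1}^d]. *)
Definition real_analytic_at (F : Rd -> R) (x : Rd) : Prop :=
  exists (c : ('I_d -> nat) -> R) (e : R), 0 < e /\
    forall h : Rd, (forall j, `|h 0 j| < e) ->
      cvgn (fun N : nat =>
        \sum_(a : {ffun 'I_d -> 'I_N}) `|c (fun j => a j) * monomial (fun j => a j) h|) /\
      (fun N : nat =>
        \sum_(a : {ffun 'I_d -> 'I_N}) c (fun j => a j) * monomial (fun j => a j) h)
        @ \oo --> F (x + h).

Definition real_analytic_on (U : set Rd) (F : Rd -> Rd) : Prop :=
  forall x, U x -> forall j : 'I_d, real_analytic_at (fun y => F y 0 j) x.

(* Slice charts: [Phi] is a bianalytic map of [U] onto [V], with inverse [Psi],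
   straightening [S] to [R^k x {0}]. *)
Definition analytic_submanifold (k : nat) (S : set Rd) : Prop :=
  forall x, S x ->
    exists (U V : set Rd) (Phi Psi : Rd -> Rd),
      [/\ open U, U x, open V & real_analytic_on U Phi] /\
      [/\ real_analytic_on V Psi,
          forall y, U y -> V (Phi y) /\ Psi (Phi y) = y,
          forall w, V w -> U (Psi w) /\ Phi (Psi w) = w &
          forall y, U y -> (S y <-> forall j : 'I_d, (k <= j)%N -> Phi y 0 j = 0)].

(* The covering [R^d -> T^d] provides the analytic structure of [T^d], so [S]
   is a submanifold of [T^d] when its inverse image in [R^d] is one. *)
Definition torus_analytic_submanifold (k : nat) (S : set ctorus) : Prop :=
  S `<=` real_torus /\
  analytic_submanifold k ((ctorus_pi \o complexify) @^-1` S).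

Section Fermi.
Variable s : nat.
Variable H0 : Cd -> 'M[C]_s.

Definition charpoly_at (l : C) (z : Cd) : C := \det (H0 z - l%:M).

Definition grad_vanishes (F : Cd -> C) (z : Cd) : Prop :=
  forall j : 'I_d, 'D_(basis_vec C j) F z = 0.

Definition fermi (l : C) : set ctorus :=
  ctorus_pi @` [set z | charpoly_at l z = 0].

Definition fermi_reg (l : C) : set ctorus :=
  ctorus_pi @` [set z | charpoly_at l z = 0 /\
                        ~ grad_vanishes (charpoly_at l) z].

Definition fermi_sng (l : C) : set ctorus :=
  ctorus_pi @` [set z | charpoly_at l z = 0 /\
                        grad_vanishes (charpoly_at l) z].

Definition spectrum : set R :=
  [set l | exists x : Rd, eigenvalue (H0 (complexify x)) l%:C].

End Fermi.

Definition discrete_subset (T : topologicalType) (A : set T) : Prop :=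
  A `<=` isolated A.

(* Functions on [T^d] are [(2 pi Z)^d]-periodic functions on [R^d]. *)
Definition periodic (phi : Rd -> C) : Prop :=
  forall (a : 'rV[int]_d) (x : Rd),
    phi (x + \row_(j < d) (2 * pi * (a 0 j)%:~R)) = phi x.

Definition partial (j : 'I_d) (g : Rd -> R) (x : Rd) : R :=
  'D_(basis_vec R j) g x.

Definition iter_partial (r : seq 'I_d) (g : Rd -> R) : Rd -> R :=
  foldr partial g r.

Definition smooth (g : Rd -> R) : Prop :=
  forall r : seq 'I_d,
    continuous (iter_partial r g) /\
    forall (j : 'I_d) (x : Rd), derivable (iter_partial r g) x (basis_vec R j).

Definition test_function (phi : Rd -> C) : Prop :=
  [/\ periodic phi, smooth (fun x => complex.Re (phi x)) & smooth (fun x => complex.Im (phi x))].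

Definition cpartial (r : seq 'I_d) (phi : Rd -> C) (x : Rd) : C :=
  iter_partial r (fun y => complex.Re (phi y)) x +i*
  iter_partial r (fun y => complex.Im (phi y)) x.

Definition functional := (Rd -> C) -> C.

(* The values of a functional outside the test functions are irrelevant.  The
   last clause is continuity for the topology of [C^oo(T^d)]: [u] is bounded by
   a multiple of some [C^N] norm. *)
Definition is_distribution (u : functional) : Prop :=
  (forall (a : C) (phi psi : Rd -> C), test_function phi -> test_function psi ->
     u (fun x => a * phi x + psi x) = a * u phi + u psi) /\
  exists (N : nat) (K : R), forall (phi : Rd -> C) (M : R), test_function phi ->
    (forall (r : seq 'I_d) (x : Rd), (size r <= N)%N ->
       `|cpartial r phi x| <= M%:C) ->
    `|u phi| <= (K * M)%:C.

Definition eq_dist (u v : functional) : Prop :=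
  forall phi, test_function phi -> u phi = v phi.

Definition mul_dist (a : Rd -> C) (u : functional) : functional :=
  fun phi => u (fun x => a x * phi x).

Definition fourier (u : functional) (n : 'rV[int]_d) : C :=
  (Num.sqrt (2 * pi) ^- d)%:C * u (fun x => character (- n) (complexify x)).

Definition sqmod (z : C) : R := complex.Re z ^+ 2 + complex.Im z ^+ 2.

Definition lattice_norm (n : 'rV[int]_d) : R :=
  Num.sqrt (\sum_(j < d) ((n 0 j)%:~R ^+ 2)).

Definition mean_fourier (u : functional) (rho : R) : R :=
  rho^-1 * \sum_(n \in [set n | lattice_norm n < rho]) sqmod (fourier u n).

Definition Bstar (u : functional) : Prop :=
  is_distribution u /\ exists K : R, forall rho, 1 < rho -> mean_fourier u rho <= K.

Definition Bstar0 (u : functional) : Prop :=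
  Bstar u /\ mean_fourier u rho @[rho --> +oo] --> 0.

End FixedDimension.

Fixpoint box_integral (d : nat) : ('rV[R]_d -> R) -> R :=
  match d with
  | 0 => fun F => F 0
  | d'.+1 => fun F =>
      Rintegral lebesgue_measure `[0, 2 * pi]
        (fun t => @box_integral d' (fun y => F (row_mx (t%:M : 'rV_1) y)))
  end.

Definition torus_integral (d : nat) (F : 'rV[R]_d -> C) : C :=
  box_integral (fun x => complex.Re (F x)) +i* box_integral (fun x => complex.Im (F x)).

Definition dist_of_fun (d : nat) (f : 'rV[R]_d -> C) : functional d :=
  fun phi => torus_integral (fun x => f x * phi x).

(* The [j]-th component of [(A(x)) u], for a matrix-valued function [A]. *)
Definition mulmx_dist (d s : nat) (A : 'rV[R]_d -> 'M[C]_s)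
    (u : 'I_s -> functional d) (j : 'I_s) : functional d :=
  fun phi => \sum_(k < s) mul_dist (fun x => A x j k) (u k) phi.

Definition is_trig_polynomial_dist (d s : nat) (u : 'I_s -> functional d) : Prop :=
  exists g : 'rV[R]_d -> 'cV[C]_s,
    trig_polynomial g /\
    forall j, eq_dist (u j) (dist_of_fun (fun x => g x j 0)).

End Defs.

(* Main.v *)
Require Import Defs.
From HB Require Import structures.
From mathcomp Require Import all_boot all_order all_algebra.
From mathcomp Require Import sesquilinear spectral generic_quotient.
From mathcomp Require Import all_classical all_reals all_analysis.
From mathcomp Require Import complex.
From mathcomp Require Import zify ring lra.

Set Implicit Arguments.
Unset Strict Implicit.
Unset Printing Implicit Defensive.

Import Order.TTheory GRing.Theory Num.Theory.
Import numFieldNormedType.Exports.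

Local Open Scope classical_set_scope.
Local Open Scope ring_scope.
Local Open Scope complex_scope.

(** The adjugate of [H0 - l] turns the system into scalar equations
    [p u_i = g_i] with [p = det (H0 - l)] and [g_i] a trigonometric polynomial.

    A functional of B*_0 growth is small on trigonometric polynomials [F] with
    bounded [X ||F||^2 + ||grad F||^2 / X], as [X] tends to infinity
    (Cauchy-Schwarz on the Fourier side).  Testing [p u = g] against functions
    [B p_j q(p)], with [q] a polynomial kernel concentrated near [0] at scale
    [1/X], shows that [g] vanishes at the real points where [p = 0] and
    [grad p <> 0].

    By the assumption on the components of the regular set, a factor of [p] that
    does not divide [g] would have a real regular zero, near which the real zeros
    of [p] project onto an open set; a resultant argument, in polynomials in one
    exponential over the trigonometric polynomials invariant in a generic
    direction, then gives [p | g].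

    Now [v = u - g / p] has B*_0 growth and [p v = 0]; the kernel argument gives
    also [p_j v = 0] for all [j].  The ideal of trigonometric polynomials
    annihilating [v] thus has its zeros in the discrete, hence countable, singular
    set, so it contains a nonzero polynomial in [exp (i z_j)] alone.  If [v] were
    nonzero, some multiple [Q v] would be an eigenvector of multiplication by
    [exp (i z_j)]; its Fourier coefficients would not decay along one of the
    directions [e_j], [- e_j], contradicting the growth condition.  Hence
    [u = g / p] on trigonometric polynomials, and on test functions by density. *)

(** * Complex modulus and exponential *)

(** The growth condition fixes the scale of the test functions: the energy is dual to the weight
    [(X + |n|^2 / X)^-1], and the Fourier coefficients of a B*_0 functional, summed with this
    weight, tend to [0] with [1 / X]. A kernel [q(p)] living on [|p| < 1 / X] has bounded energy
    where [p] can serve as a coordinate, but not near critical points of [p]; the factor [p_j]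
    repairs this, because [p_j q(p)] is a derivative and can be integrated by parts.

    The reality of [p] on the real torus enters through changes of sign. They give the zeros that
    bound the kernel means from below, and the zeros that project onto an open set.

    Discreteness of the singular set is used three times: it excludes [p = 0], it excludes repeated
    factors of [p], whose zeros would give a curve of singular points, and it makes the zeros of the
    annihilating ideal countable.

    Means of trigonometric polynomials are averages over fine grids, exact once the grid is fine
    enough. Lebesgue integrals come in only to translate the equation and to pass to test
    functions. *)

Section Modulus.
Variable R : realType.
Implicit Types (z w : R[i]) (x : R).

(** A real-valued modulus: the norm of [R[i]] takes its values in [R[i]]. *)
Definition cmod z : R := ComplexField.Normc.normc z.

Lemma normcE z : `|z| = (cmod z)%:C.
Proof. by []. Qed.

Lemma cmod_ge0 z : 0 <= cmod z.
Proof. by case: z => a b; exact: sqrtr_ge0. Qed.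

Lemma cmod0 : cmod 0 = 0.
Proof. exact: ComplexField.Normc.normc0. Qed.

Lemma cmod1 : cmod 1 = 1.
Proof. exact: ComplexField.Normc.normc1. Qed.

Lemma cmodM z w : cmod (z * w) = cmod z * cmod w.
Proof. exact: ComplexField.Normc.normcM. Qed.

Lemma cmodX z n : cmod (z ^+ n) = cmod z ^+ n.
Proof. by elim: n => [|n IH]; rewrite ?cmod1 // !exprS cmodM IH. Qed.

Lemma cmodV z : cmod z^-1 = (cmod z)^-1.
Proof. exact: ComplexField.Normc.normcV. Qed.

Lemma cmodD z w : cmod (z + w) <= cmod z + cmod w.
Proof. exact: le_normcD. Qed.

Lemma cmodN z : cmod (- z) = cmod z.
Proof. exact: normcN. Qed.

Lemma cmodB z w : cmod (z - w) <= cmod z + cmod w.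
Proof. by rewrite -(cmodN w) cmodD. Qed.

Lemma cmod_subC z w : cmod (z - w) = cmod (w - z).
Proof. by rewrite -opprB cmodN. Qed.

Lemma cmod_eq0 z : (cmod z == 0) = (z == 0).
Proof.
apply/eqP/eqP => [|->]; last exact: cmod0.
exact: ComplexField.Normc.eq0_normc.
Qed.

Lemma cmod_gt0 z : (0 < cmod z) = (z != 0).
Proof. by rewrite lt_def cmod_ge0 andbT cmod_eq0. Qed.

Lemma sqmodE z : sqmod z = cmod z ^+ 2.
Proof. by case: z => a b; rewrite /cmod/= sqr_sqrtr // addr_ge0 ?sqr_ge0. Qed.

Lemma cmodR x : cmod x%:C = `|x|.
Proof. by rewrite /cmod /= expr0n addr0 sqrtr_sqr. Qed.

Lemma cmodJ z : cmod z^* = cmod z.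
Proof. by case: z => a b; rewrite /cmod /= sqrrN. Qed.

Lemma cmodi : cmod 'i = 1.
Proof. by rewrite /cmod /= expr0n add0r expr1n sqrtr1. Qed.

Lemma cmod_sum (I : Type) (r : seq I) (P : pred I) (F : I -> R[i]) :
  cmod (\sum_(i <- r | P i) F i) <= \sum_(i <- r | P i) cmod (F i).
Proof.
elim/big_rec2: _ => [|i x y _ IH]; first by rewrite cmod0.
by rewrite (le_trans (cmodD _ _)) // lerD2l.
Qed.

Lemma Re_le_cmod z : `|complex.Re z| <= cmod z.
Proof.
case: z => a b; rewrite /cmod /= -sqrtr_sqr ler_sqrt ?lerDl ?sqr_ge0 //.
by rewrite addr_ge0 ?sqr_ge0.
Qed.

Lemma Im_le_cmod z : `|complex.Im z| <= cmod z.
Proof.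
case: z => a b; rewrite /cmod /= -sqrtr_sqr ler_sqrt ?lerDr ?sqr_ge0 //.
by rewrite addr_ge0 ?sqr_ge0.
Qed.

Lemma cmod_le_ReIm z : cmod z <= `|complex.Re z| + `|complex.Im z|.
Proof.
have -> : z = (complex.Re z)%:C + 'i * (complex.Im z)%:C by exact: complexE.
rewrite (le_trans (cmodD _ _)) // cmodM !cmodR cmodi mul1r.
by case: z => a b /=; rewrite !(mul0r, mul1r, subr0, addr0, mulr0, add0r).
Qed.

Lemma lec_cmod z (x : R) : (`|z| <= x%:C) = (cmod z <= x).
Proof. by rewrite normcE lecR. Qed.

Lemma ltc_cmod z (x : R) : (`|z| < x%:C) = (cmod z < x).
Proof. by rewrite normcE ltcR. Qed.

Lemma ReD z w : complex.Re (z + w) = complex.Re z + complex.Re w.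
Proof. by case: z w => [a b] [c d]. Qed.
Lemma ImD z w : complex.Im (z + w) = complex.Im z + complex.Im w.
Proof. by case: z w => [a b] [c d]. Qed.
Lemma ReN z : complex.Re (- z) = - complex.Re z.
Proof. by case: z. Qed.
Lemma ImN z : complex.Im (- z) = - complex.Im z.
Proof. by case: z. Qed.
Lemma ReM z w : complex.Re (z * w) =
  complex.Re z * complex.Re w - complex.Im z * complex.Im w.
Proof. by case: z w => [a b] [c d]. Qed.
Lemma ImM z w : complex.Im (z * w) =
  complex.Re z * complex.Im w + complex.Im z * complex.Re w.
Proof. by case: z w => [a b] [c d]. Qed.
Lemma Re_realM x z : complex.Re (x%:C * z) = x * complex.Re z.
Proof. by rewrite ReM /= mul0r subr0. Qed.
Lemma Im_realM x z : complex.Im (x%:C * z) = x * complex.Im z.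
Proof. by rewrite ImM /= mul0r addr0. Qed.
Lemma Re_sum (I : Type) (r : seq I) (P : pred I) (F : I -> R[i]) :
  complex.Re (\sum_(i <- r | P i) F i) = \sum_(i <- r | P i) complex.Re (F i).
Proof. by elim/big_rec2: _ => [//|i x y _ <-]; rewrite ReD. Qed.
Lemma Im_sum (I : Type) (r : seq I) (P : pred I) (F : I -> R[i]) :
  complex.Im (\sum_(i <- r | P i) F i) = \sum_(i <- r | P i) complex.Im (F i).
Proof. by elim/big_rec2: _ => [//|i x y _ <-]; rewrite ImD. Qed.

Lemma complex_eqP z w :
  complex.Re z = complex.Re w -> complex.Im z = complex.Im w -> z = w.
Proof. by case: z w => [a b] [c d] /= -> ->. Qed.

Lemma conjcM z w : conjc (z * w) = conjc z * conjc w.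
Proof. exact: (rmorphM (@conjc R)). Qed.
Lemma conjcD z w : conjc (z + w) = conjc z + conjc w.
Proof. exact: (rmorphD (@conjc R)). Qed.

Lemma mulJ_cmod z : z * conjc z = (cmod z ^+ 2)%:C.
Proof. by rewrite -sqr_normc normcE rmorphXn. Qed.

End Modulus.

Section Exponential.
Variable R : realType.
Implicit Types (z w : R[i]) (x y : R).

Lemma expC0 : expC 0 = 1 :> R[i].
Proof. by rewrite /expC /= expR0 cos0 sin0 mul1r. Qed.

Lemma expCD z w : expC (z + w) = expC z * expC w.
Proof.
rewrite /expC ReD ImD expRD cosD sinD rmorphM /= mulrACA; congr (_ * _).
by apply: complex_eqP; rewrite /= // addrC.
Qed.

Lemma expC_neq0 z : expC z != 0.
Proof.
have : expC z * expC (- z) = 1 by rewrite -expCD subrr expC0.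
by move/eqP; apply: contraTneq => ->; rewrite mul0r eq_sym oner_eq0.
Qed.

Lemma expCN z : expC (- z) = (expC z)^-1.
Proof.
apply: (mulfI (expC_neq0 z)).
by rewrite -expCD subrr expC0 mulfV // expC_neq0.
Qed.

Lemma expC_sum (I : Type) (r : seq I) (P : pred I) (F : I -> R[i]) :
  expC (\sum_(i <- r | P i) F i) = \prod_(i <- r | P i) expC (F i).
Proof. by elim/big_rec2: _ => [|i x y _ <-]; rewrite ?expC0 ?expCD. Qed.

Lemma expC_nat z n : expC (n%:R * z) = expC z ^+ n.
Proof.
elim: n => [|n IH]; first by rewrite mul0r expC0.
by rewrite exprS -IH -expCD -natr1 mulrDl mul1r addrC.
Qed.

Lemma expC_int z (n : int) : expC (n%:~R * z) = expC z ^ n.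
Proof.
case: n => n; first by rewrite -pmulrn expC_nat.
by rewrite NegzE rmorphN /= mulNr expCN -pmulrn expC_nat -exprnN.
Qed.

Lemma cmod_expC z : cmod (expC z) = expR (complex.Re z).
Proof.
rewrite /expC cmodM cmodR ger0_norm ?expR_ge0 //.
by rewrite /cmod /= cos2Dsin2 sqrtr1 mulr1.
Qed.

Lemma expCi x : expC ('i * x%:C) = cos x +i* sin x.
Proof. by rewrite /expC /= !(mul0r, mul1r, subr0, addr0, mulr0, add0r, oppr0) expR0 mul1r. Qed.

Lemma expCiJ x : (expC ('i * x%:C))^* = expC ('i * (- x)%:C).
Proof. by rewrite !expCi cosN sinN. Qed.

Lemma expC_2pi (n : int) : expC ('i * (2 * pi * n%:~R)%:C) = 1 :> R[i].
Proof.
have -> : 'i * (2 * pi * n%:~R)%:C = n%:~R * ('i * (2 * pi)%:C) :> R[i].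
  by rewrite (rmorphM _ (2 * pi)) /= (rmorph_int (real_complex R)); ring.
rewrite expC_int expCi.
have -> : (2 * pi : R) = pi *+ 2 by rewrite mulr2n; ring.
by rewrite cos2pi sin2pi exp1rz.
Qed.

(** Polar form. The angle is [acos (Re z / |z|)] with the sign of [Im z], and [ln |z|] goes into the
    imaginary part of [w]. *)
Lemma expCi_surj z : z != 0 -> exists w, expC ('i * w) = z.
Proof.
move=> z0; have m0 : 0 < cmod z by rewrite cmod_gt0.
pose c := complex.Re z / cmod z; pose s := complex.Im z / cmod z.
have cs : c ^+ 2 + s ^+ 2 = 1.
  rewrite /c /s !expr_div_n -mulrDl -[_ + _]/(sqmod z) sqmodE divff //.
  by rewrite sqrf_eq0 gt_eqF.
have c1 : -1 <= c <= 1.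
  rewrite -ler_norml -(@ler_pXn2r _ 2) ?nnegrE // ?expr1n real_normK ?num_real //.
  by rewrite -cs lerDl sqr_ge0.
have [t [ct st]] : exists t, cos t = c /\ sin t = s.
  have sE : Num.sqrt (1 - c ^+ 2) = `|s|.
    by rewrite -cs addrC addKr sqrtr_sqr.
  have [s0|s0] := leP 0 s.
    by exists (acos c); rewrite acosK ?in_itv //= sin_acos // sE ger0_norm.
  exists (- acos c); rewrite cosN sinN acosK ?in_itv //= sin_acos // sE.
  by rewrite ltr0_norm // opprK.
exists (t%:C - 'i * (ln (cmod z))%:C).
have -> : 'i * (t%:C - 'i * (ln (cmod z))%:C) =
    'i * t%:C + (ln (cmod z))%:C :> R[i].
  by rewrite mulrBr mulrA -[_ * 'i]/('i ^+ 2) sqr_i mulN1r opprK.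
rewrite expCD expCi ct st [expC _%:C]/expC /= cos0 sin0 lnK ?posrE // mulr1.
apply: complex_eqP; rewrite ?ReM ?ImM /= !(mul0r, mul1r, subr0, addr0, mulr0, add0r, oppr0) divfK ?gt_eqF //.
Qed.

Lemma norm_sin_le x : `|sin x| <= `|x|.
Proof.
wlog x0 : x / 0 <= x => [W|].
  have [/W//|/ltW x0] := leP 0 x.
  by rewrite -normrN -sinN -(normrN x) W // oppr_ge0.
move: x0; rewrite le_eqVlt => /predU1P[<-|x0]; first by rewrite sin0 !normr0.
have [|c _] := @MVT R sin cos 0 x x0 (fun y _ => is_derive_sin y).
  by apply: continuous_subspaceT => y; exact: continuous_sin.
rewrite sin0 !subr0 => ->; rewrite normrM ler_piMl //; exact: cos_max.
Qed.

Lemma cos_sub1_le x : `|cos x - 1| <= x ^+ 2.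
Proof.
have -> : cos x - 1 = - (sin (x / 2) ^+ 2 *+ 2).
  rewrite [in cos _](_ : x = (x / 2) *+ 2); last by rewrite mulr2n; field.
  by rewrite cos_mulr2n cos2sin2 mulrnBl; ring.
rewrite normrN normrMn normrX.
have := norm_sin_le (x / 2).
rewrite -(@ler_pXn2r _ 2) ?nnegrE // !real_normK ?num_real // => H.
have := sqr_ge0 x; move: H; rewrite expr_div_n; set a := (sin _ ^+ 2); lra.
Qed.

Lemma sin_sub_le x : `|sin x - x| <= `|x| ^+ 3.
Proof.
wlog x0 : x / 0 <= x => [W|].
  have [/W//|/ltW x0] := leP 0 x.
  have := W (- x); rewrite oppr_ge0 sinN normrN => /(_ x0).
  by rewrite -opprD normrN.
move: x0; rewrite le_eqVlt => /predU1P[<-|x0].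
  by rewrite sin0 subr0 normr0 expr0n.
have [|c cx] := @MVT R (fun y => sin y - y) (fun y => cos y - 1) 0 x x0.
- by apply: continuous_subspaceT => y; apply: continuousB;
    [exact: continuous_sin | exact: cvg_id].
rewrite sin0 !subr0 => ->; rewrite normrM exprS mulrC ler_wpM2l //.
apply: (le_trans (cos_sub1_le c)); rewrite real_normK ?num_real //.
by move: cx; rewrite in_itv /= => /andP[c0 cx]; rewrite lerXn2r ?nnegrE ?ltW.
Qed.

(** Only [1 + y <= exp y] is used, at [y = x] and at [y = - x]; the latter gives
    [exp x * (1 - x) <= 1]. *)
Lemma expR_sub_le x : `|x| <= 2^-1 -> `|expR x - 1 - x| <= 2 * x ^+ 2.
Proof.
rewrite ler_norml => /andP[x1 x2].
have h1 := expR_ge1Dx x.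
have h2 : expR x * (1 - x) <= 1.
  have := expR_ge1Dx (- x); rewrite expRN => h.
  by rewrite -ler_pdivlMl ?expR_gt0 // mulr1.
rewrite ler_norml; apply/andP; split; have := sqr_ge0 x; nra.
Qed.

(** This second-order remainder is the source of all derivatives of characters below. The constant
    is not sharp: the proof gives [8]. *)
Lemma expC_sub_le z : cmod z <= 2^-1 -> cmod (expC z - 1 - z) <= 20 * cmod z ^+ 2.
Proof.
move=> hz; set m := cmod z in hz *.
set a := complex.Re z; set b := complex.Im z.
have ha : `|a| <= m := Re_le_cmod z.
have hb : `|b| <= m := Im_le_cmod z.
have m0 : 0 <= m := cmod_ge0 z.
have a2 : a ^+ 2 <= m ^+ 2.
  by rewrite -(@real_normK _ a) ?num_real // lerXn2r ?nnegrE.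
have b2 : b ^+ 2 <= m ^+ 2.
  by rewrite -(@real_normK _ b) ?num_real // lerXn2r ?nnegrE.
have he := expR_sub_le (le_trans ha hz).
have hc := cos_sub1_le b.
have hs := sin_sub_le b.
have b3 : `|b| ^+ 3 <= m ^+ 2.
  have h3 : `|b| ^+ 3 <= m ^+ 3 by rewrite lerXn2r ?nnegrE.
  have m2 := sqr_ge0 m.
  by apply: le_trans h3 _; rewrite exprS; nra.
have e2 : 0 <= expR a <= 2.
  rewrite expR_ge0 /=; move: he; rewrite ler_norml => /andP[_ h].
  have : a <= 2^-1 by apply: le_trans (ler_norm _) (le_trans ha hz).
  have : m ^+ 2 <= 4^-1 by nra.
  nra.
apply: (le_trans (cmod_le_ReIm _)).
have -> : complex.Re (expC z - 1 - z) = expR a * (cos b - 1) + (expR a - 1 - a).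
  by rewrite /expC !(ReD, ReN, ReM) /= mul0r subr0; ring.
have -> : complex.Im (expC z - 1 - z) = expR a * (sin b - b) + (expR a - 1) * b.
  by rewrite /expC !(ImD, ImN, ImM) /= mul0r addr0 oppr0 addr0 -/b; ring.
have E1 : `|expR a - 1| <= 2 * m.
  have -> : expR a - 1 = (expR a - 1 - a) + a by ring.
  rewrite (le_trans (ler_normD _ _)) //.
  have : m ^+ 2 <= m / 2 by rewrite expr2; nra.
  lra.
case/andP: e2 => e0 e2.
have N1 : `|expR a * (cos b - 1) + (expR a - 1 - a)| <= 4 * m ^+ 2.
  rewrite (le_trans (ler_normD _ _)) // normrM (ger0_norm e0).
  have : expR a * `|cos b - 1| <= 2 * m ^+ 2.
    by apply: ler_pM => //; apply: le_trans hc b2.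
  lra.
have N2 : `|expR a * (sin b - b) + (expR a - 1) * b| <= 4 * m ^+ 2.
  rewrite (le_trans (ler_normD _ _)) // !normrM (ger0_norm e0).
  have : expR a * `|sin b - b| <= 2 * m ^+ 2.
    by apply: ler_pM => //; apply: le_trans hs b3.
  have : `|expR a - 1| * `|b| <= 2 * m * m by apply: ler_pM.
  lra.
have := sqr_ge0 m; lra.
Qed.

End Exponential.

(** * Trigonometric polynomials *)

Section TrigPolynomials.
Variables (R : realType) (d : nat).
Local Notation C := R[i].
Local Notation Rd := 'rV[R]_d.
Local Notation Cd := 'rV[C]_d.
Local Notation Zd := 'rV[int]_d.
Implicit Types (a b k : Zd) (z w : Cd) (x y : Rd) (F G : Cd -> C).

Lemma complexifyE x j : complexify x 0 j = (x 0 j)%:C.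
Proof. by rewrite mxE. Qed.

Lemma complexifyD x y : complexify (x + y) = complexify x + complexify y.
Proof. by apply/rowP => j; rewrite !mxE rmorphD. Qed.

Lemma complexifyZ (t : R) x : complexify (t *: x) = t%:C *: complexify x.
Proof. by apply/rowP => j; rewrite !mxE rmorphM. Qed.

Lemma complexifyN x : complexify (- x) = - complexify x.
Proof. by apply/rowP => j; rewrite !mxE rmorphN. Qed.

Lemma complexify_basis j : complexify (basis_vec R j : Rd) = basis_vec C j.
Proof. by apply/rowP => i; rewrite !mxE; case: (_ && _). Qed.

Lemma character0 z : character 0 z = 1.
Proof.
by rewrite /character big1 ?mulr0 ?expC0 // => j _; rewrite mxE mul0r.
Qed.

Lemma characterD a b z : character (a + b) z = character a z * character b z.
Proof.
rewrite /character -expCD -mulrDr -big_split /=; congr (expC (_ * _)).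
by apply: eq_bigr => j _; rewrite mxE rmorphD mulrDl.
Qed.

Lemma character_neq0 a z : character a z != 0.
Proof. exact: expC_neq0. Qed.

Lemma characterN a z : character (- a) z = (character a z)^-1.
Proof.
apply: (mulfI (character_neq0 a z)).
by rewrite -characterD subrr character0 mulfV // character_neq0.
Qed.

Lemma characterZ (n : int) a z : character (n *: a) z = character a z ^ n.
Proof.
rewrite /character -expC_int; congr expC.
rewrite mulrCA; congr (_ * _); rewrite mulr_sumr; apply: eq_bigr => j _.
by rewrite mxE rmorphM mulrA.
Qed.

Lemma character_addr a z w : character a (z + w) = character a z * character a w.
Proof.
rewrite /character -expCD -mulrDr -big_split /=; congr (expC (_ * _)).
by apply: eq_bigr => j _; rewrite mxE mulrDr.
Qed.

Lemma character_at0 a : character a (0 : Cd) = 1.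
Proof.
by rewrite /character big1 ?mulr0 ?expC0 // => j _; rewrite mxE mulr0.
Qed.

Lemma characterE a z : character a z = \prod_(j < d) expC ('i * z 0 j) ^ (a 0 j).
Proof.
rewrite /character mulr_sumr expC_sum; apply: eq_bigr => j _.
by rewrite -expC_int; congr expC; ring.
Qed.

Lemma character_complexify a x :
  character a (complexify x) = expC ('i * (\sum_(j < d) (a 0 j)%:~R * x 0 j)%:C).
Proof.
rewrite /character; congr (expC (_ * _)); rewrite rmorph_sum /=.
by apply: eq_bigr => j _; rewrite complexifyE rmorphM /= rmorph_int.
Qed.

Lemma cmod_character a x : cmod (character a (complexify x)) = 1.
Proof. by rewrite character_complexify cmod_expC /= !mul0r mul1r subr0 expR0. Qed.

Lemma characterJ a x :
  (character a (complexify x))^* = character (- a) (complexify x).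
Proof.
rewrite !character_complexify expCiJ; congr (expC (_ * _%:C)).
by rewrite -sumrN; apply: eq_bigr => j _; rewrite mxE rmorphN mulNr.
Qed.

Lemma character_lattice a b : character a (lattice_vec R b) = 1.
Proof.
have -> : lattice_vec R b = complexify (\row_j (2 * pi * (b 0 j)%:~R)).
  by apply/rowP => j; rewrite !mxE.
rewrite character_complexify -[RHS](expC_2pi R (\sum_(j < d) a 0 j * b 0 j)).
congr (expC (_ * _%:C)); rewrite rmorph_sum mulr_sumr.
by apply: eq_bigr => j _; rewrite mxE rmorphM /=; ring.
Qed.

Definition idot a k : int := \sum_(j < d) a 0 j * k 0 j.

Definition cvec k : Cd := map_mx intr k.

Lemma idotDl a b k : idot (a + b) k = idot a k + idot b k.
Proof.
by rewrite /idot -big_split; apply: eq_bigr => j _; rewrite mxE mulrDl.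
Qed.

Lemma idotNl a k : idot (- a) k = - idot a k.
Proof. by rewrite /idot -sumrN; apply: eq_bigr => j _; rewrite mxE mulNr. Qed.

Lemma idotZl (m : int) a k : idot (m *: a) k = m * idot a k.
Proof. by rewrite /idot mulr_sumr; apply: eq_bigr => j _; rewrite mxE mulrA. Qed.

Lemma idot_delta (j : 'I_d) k : idot (delta_mx 0 j) k = k 0 j.
Proof.
rewrite /idot (bigD1 j) //= mxE !eqxx mul1r big1 ?addr0 // => i ij.
by rewrite mxE (negPf ij) andbF mul0r.
Qed.

Lemma idot_deltar (j : 'I_d) a : idot a (delta_mx 0 j) = a 0 j.
Proof.
rewrite /idot (bigD1 j) //= mxE !eqxx mulr1 big1 ?addr0 // => i ij.
by rewrite mxE (negPf ij) andbF mulr0.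
Qed.

Lemma cvec_delta j : cvec (delta_mx 0 j) = basis_vec C j.
Proof. by apply/rowP => i; rewrite !mxE; case: (_ && _). Qed.

Lemma character_cvec a k (s : C) :
  character a (s *: cvec k) = expC ('i * ((idot a k)%:~R * s)).
Proof.
rewrite /character; congr (expC (_ * _)); rewrite rmorph_sum mulr_suml.
by apply: eq_bigr => j _; rewrite !mxE rmorphM /=; ring.
Qed.

(** Along a complex line of integral direction every character is a power of the same exponential.
    This turns trigonometric polynomials into polynomials in one variable. *)
Lemma character_line a k (s : C) z :
  character a (z + s *: cvec k) = expC ('i * s) ^ (idot a k) * character a z.
Proof.
by rewrite character_addr character_cvec mulrC -expC_int; congr (expC _ * _); ring.
Qed.

Definition trig_sum (r : seq (Zd * C)) : Cd -> C :=
  fun z => \sum_(p <- r) p.2 * character p.1 z.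

(** Lists of pairs suit induction, but [laurent_trig] makes the coefficient a function of the
    exponent; hence repeated exponents are merged by adding their coefficients. *)
Lemma laurentP F : laurent_trig F <-> exists r, F = trig_sum r.
Proof.
split=> [[A [c Fc]]|[r ->]].
  exists [seq (a, c a) | a <- A]; apply/funext => z.
  by rewrite Fc /trig_sum big_map.
exists (undup (map fst r)), (fun a => \sum_(p <- r | p.1 == a) p.2) => z.
under eq_bigr => a _ do rewrite mulr_suml big_mkcond.
rewrite exchange_big /= /trig_sum big_seq [RHS]big_seq; apply: eq_bigr => p pr.
rewrite (bigD1_seq p.1) ?undup_uniq ?mem_undup ?map_f //= eqxx big1 ?addr0 //.
by move=> a; rewrite eq_sym => /negPf ->.
Qed.

Lemma laurent_ind (P : (Cd -> C) -> Prop) :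
  P (fun=> 0) ->
  (forall (c : C) a, P (fun z => c * character a z)) ->
  (forall F G, laurent_trig F -> laurent_trig G -> P F -> P G ->
     P (fun z => F z + G z)) ->
  forall F, laurent_trig F -> P F.
Proof.
move=> P0 Pc PD F /laurentP[r ->] {F}; elim: r => [|p r IH].
  by rewrite (_ : trig_sum _ = fun=> 0) //; apply/funext => z; rewrite /trig_sum big_nil.
rewrite (_ : trig_sum _ = fun z => p.2 * character p.1 z + trig_sum r z).
  apply: PD => //; last by apply/laurentP; exists r.
  apply/laurentP; exists [:: p]; apply/funext => z.
  by rewrite /trig_sum big_seq1.
by apply/funext => z; rewrite /trig_sum big_cons.
Qed.

Lemma laurentD F G : laurent_trig F -> laurent_trig G ->
  laurent_trig (fun z => F z + G z).
Proof.
move=> /laurentP[r ->] /laurentP[r' ->]; apply/laurentP; exists (r ++ r').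
by apply/funext => z; rewrite /trig_sum big_cat.
Qed.

Lemma laurent_mono (c : C) a : laurent_trig (fun z => c * character a z).
Proof.
apply/laurentP; exists [:: (a, c)].
by apply/funext => z; rewrite /trig_sum big_seq1.
Qed.

Lemma laurent_character a : laurent_trig (character a : Cd -> C).
Proof.
rewrite (_ : character a = fun z => 1 * character a z); first exact: laurent_mono.
by apply/funext => z; rewrite mul1r.
Qed.

Lemma laurent_cst (c : C) : laurent_trig ((fun=> c) : Cd -> C).
Proof.
rewrite (_ : (fun=> c) = fun z => c * character 0 z); first exact: laurent_mono.
by apply/funext => z; rewrite character0 mulr1.
Qed.

Lemma laurentM F G : laurent_trig F -> laurent_trig G ->
  laurent_trig (fun z => F z * G z).
Proof.
move=> LF LG; move: F LF; apply: laurent_ind => [|c a|F F' _ _ IH IH'].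
- under eq_fun do rewrite mul0r; exact: laurent_cst.
- move: G LG; apply: laurent_ind => [|c' a'|G G' _ _ IH IH'].
  + under eq_fun do rewrite mulr0; exact: laurent_cst.
  + under eq_fun do rewrite mulrACA -characterD; exact: laurent_mono.
  + under eq_fun do rewrite mulrDr; exact: laurentD.
- under eq_fun do rewrite mulrDl; exact: laurentD.
Qed.

Lemma laurentZ (c : C) F : laurent_trig F -> laurent_trig (fun z => c * F z).
Proof. by move=> LF; apply: laurentM => //; exact: laurent_cst. Qed.

Lemma laurentN F : laurent_trig F -> laurent_trig (fun z => - F z).
Proof. by move=> LF; under eq_fun do rewrite -mulN1r; exact: laurentZ. Qed.

Lemma laurentB F G : laurent_trig F -> laurent_trig G ->
  laurent_trig (fun z => F z - G z).
Proof. by move=> LF LG; apply: laurentD => //; exact: laurentN. Qed.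

Lemma laurent_sum (I : Type) (r : seq I) (P : pred I) (F : I -> Cd -> C) :
  (forall i, laurent_trig (F i)) ->
  laurent_trig (fun z => \sum_(i <- r | P i) F i z).
Proof.
move=> LF; elim: r => [|i r IH].
  by under eq_fun do rewrite big_nil; exact: laurent_cst.
under eq_fun do rewrite big_cons; case: (P i) => //; exact: laurentD.
Qed.

Lemma laurent_prod (I : Type) (r : seq I) (P : pred I) (F : I -> Cd -> C) :
  (forall i, laurent_trig (F i)) ->
  laurent_trig (fun z => \prod_(i <- r | P i) F i z).
Proof.
move=> LF; elim: r => [|i r IH].
  by under eq_fun do rewrite big_nil; exact: laurent_cst.
under eq_fun do rewrite big_cons; case: (P i) => //; exact: laurentM.
Qed.

Lemma laurentX F n : laurent_trig F -> laurent_trig (fun z => F z ^+ n).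
Proof.
move=> LF; elim: n => [|n IH]; first exact: laurent_cst.
by under eq_fun do rewrite exprS; exact: laurentM.
Qed.

Lemma laurent_horner (q : {poly C}) F : laurent_trig F ->
  laurent_trig (fun z => q.[F z]).
Proof.
move=> LF; under eq_fun do rewrite horner_coef; apply: laurent_sum => i.
by apply: laurentZ; exact: laurentX.
Qed.

Lemma laurent_shift F w : laurent_trig F -> laurent_trig (fun z => F (z + w)).
Proof.
move: F; apply: laurent_ind => [|c a|F G _ _ IH IH']; last exact: laurentD.
  exact: laurent_cst.
rewrite (_ : (fun z => _) = fun z => (c * character a w) * character a z).
  exact: laurent_mono.
by apply/funext => z; rewrite character_addr; ring.
Qed.

(** Conjugation is not holomorphic, but on real points it negates exponents and conjugates
    coefficients. It thereby keeps [|F|^2] within trigonometric polynomials. *)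
Lemma laurent_conj F : laurent_trig F ->
  exists2 G, laurent_trig G & forall x, G (complexify x) = (F (complexify x))^*.
Proof.
move: F; apply: laurent_ind => [|c a|F G _ _ [F' LF' HF] [G' LG' HG]].
- by exists (fun=> 0); [exact: laurent_cst | move=> x; rewrite conjc0].
- exists (fun z => c^* * character (- a) z); first exact: laurent_mono.
  by move=> x; rewrite conjcM -characterJ.
- exists (fun z => F' z + G' z); first exact: laurentD.
  by move=> x; rewrite conjcD HF HG.
Qed.

Lemma laurent_lattice F z b : laurent_trig F -> F (z + lattice_vec R b) = F z.
Proof.
move: F; apply: laurent_ind => [//|c a|F G _ _ IH IH']; last by rewrite IH IH'.
by rewrite character_addr character_lattice mulr1.
Qed.

Lemma laurent_on_line F k : laurent_trig F -> exists m : nat, forall z,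
  exists q : {poly C}, forall s : C,
    F (z + s *: cvec k) = expC ('i * s) ^- m * q.[expC ('i * s)].
Proof.
move: F; apply: laurent_ind => [|c a|F G _ _ [m Hm] [n Hn]].
- by exists 0%N => z; exists 0 => s; rewrite horner0 mulr0.
- exists `|idot a k|%N => z.
  exists ((c * character a z)%:P * 'X^(`|idot a k + `|idot a k|%:Z|)) => s.
  rewrite character_line hornerM hornerC hornerXn.
  set e := expC _; have e0 : e != 0 := expC_neq0 _.
  have h : (`|(idot a k + `|idot a k|)%R|%N : int) = idot a k + `|idot a k|%N by lia.
  rewrite [X in _ = _ * (_ * X)]exprnP h expfzDr // -[e ^ `|_|%N]exprnP.
  have e4 (t s' x y : C) : s' != 0 -> t * (x * y) = s'^-1 * (t * y * (x * s')) by move=> s0; field.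
  by apply: e4; rewrite expf_neq0.
- exists (m + n)%N => z; have [q Hq] := Hm z; have [r Hr] := Hn z.
  exists (q * 'X^n + r * 'X^m) => s; rewrite Hq Hr hornerD !hornerM !hornerXn.
  set e := expC _; have e0 : e != 0 := expC_neq0 _.
  by rewrite exprD; field; rewrite !expf_neq0.
Qed.

(** Stated over any numeric field, to serve both for complex derivatives of characters and for real
    derivatives along real lines. *)
Lemma quadratic_is_derive (K : numFieldType) (V : normedModType K) (f : V -> K)
    (z v : V) (l B e : K) : 0 < e ->
  (forall h : K, `|h| <= e -> `|f (h *: v + z) - f z - h * l| <= B * `|h| ^+ 2) ->
  is_derive z v f l.
Proof.
move=> e0 H.
have B0 : 0 <= B.
  have := H e; rewrite gtr0_norm // lexx => /(_ isT) /(le_trans (normr_ge0 _)).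
  by rewrite pmulr_lge0 // exprn_gt0.
have cv : (fun h => h^-1 *: ((f \o shift z) (h *: v) - f z)) @ 0^' --> l.
  apply/cvgrPdist_le => t t0; near=> h.
  have h0 : h != 0 by near: h; exact: nbhs_dnbhs_neq.
  have he : `|h| <= e by near: h; apply: dnbhs0_le.
  have ht : `|h| <= t / (B + 1).
    by near: h; apply: dnbhs0_le; rewrite divr_gt0 // ltr_wpDl.
  have -> : l - h^-1 *: ((f \o shift z) (h *: v) - f z) =
      - (h^-1 * (f (h *: v + z) - f z - h * l)).
    by rewrite -[_ *: _]/(_ * _) [in RHS]mulrBr mulKf // opprB.
  rewrite normrN normrM normfV ler_pdivrMl ?normr_gt0 //.
  apply: le_trans (H _ he) _; rewrite expr2 mulrCA ler_wpM2l //.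
  apply: le_trans (ler_wpM2l B0 ht) _.
  by rewrite mulrA ler_pdivrMr ?ltr_wpDl // mulrDr mulr1 mulrC lerDl ltW.
apply: DeriveDef; first by apply/cvg_ex; exists l.
exact: cvg_lim cv.
Unshelve. all: by end_near.
Qed.

Lemma character_is_derive a j z :
  is_derive z (basis_vec C j) (character a : Cd -> C)
    ('i * (a 0 j)%:~R * character a z).
Proof.
set m := cmod ('i * (a 0 j)%:~R : C).
have m0 : 0 <= m := cmod_ge0 _.
(* The radius ensures [|h| m <= 1/2], as the remainder estimate of [expC] requires; [m + 1] replaces
   [m] because [m] may be [0]. *)
apply: (@quadratic_is_derive _ _ _ _ _ _ (20 * m ^+ 2 * cmod (character a z))%:C
  (2 * (m + 1))^-1%:C).
  by rewrite ltcR invr_gt0 mulr_gt0 // ltr_wpDl.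
move=> h; rewrite lec_cmod => hm.
have -> : character a (h *: basis_vec C j + z) - character a z -
    h * ('i * (a 0 j)%:~R * character a z) =
  (expC (h * ('i * (a 0 j)%:~R)) - 1 - h * ('i * (a 0 j)%:~R)) * character a z.
  rewrite addrC -cvec_delta character_addr character_cvec idot_deltar.
  by rewrite (_ : 'i * ((a 0 j)%:~R * h) = h * ('i * (a 0 j)%:~R)); ring.
rewrite normcE -[`|h|]/((cmod h)%:C) -rmorphXn -rmorphM lecR cmodM.
have hm2 : cmod (h * ('i * (a 0 j)%:~R)) <= 2^-1.
  rewrite cmodM -/m; move: hm; rewrite invfM => hm.
  have m1 : 0 < m + 1 by rewrite ltr_wpDl.
  apply: le_trans (ler_wpM2r m0 hm) _.
  by rewrite -mulrA ler_piMr ?invr_ge0 // mulrC ler_pdivrMr // mul1r lerDl.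
apply: le_trans (ler_wpM2r (cmod_ge0 _) (expC_sub_le hm2)) _.
by rewrite cmodM -/m exprMn le_eqVlt; apply/orP; left; apply/eqP; ring.
Qed.

Definition pd j F : Cd -> C := fun z => 'D_(basis_vec C j) F z.

Lemma laurent_derivable F (LF : laurent_trig F) j z : derivable F z (basis_vec C j).
Proof.
move: F LF; apply: laurent_ind => [|c a|F G _ _ IH IH'].
- exact: derivable_cst.
- exact: derivableM (derivable_cst _ _ _) (@ex_derive _ _ _ _ _ _ _ (character_is_derive a j z)).
- exact: derivableD.
Qed.

Lemma pd_cst j (c : C) : pd j ((fun=> c) : Cd -> C) = fun=> 0.
Proof. by apply/funext => z; rewrite /pd derive_cst. Qed.

Lemma pdM j F G : laurent_trig F -> laurent_trig G ->
  pd j (fun z => F z * G z) = fun z => pd j F z * G z + F z * pd j G z.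
Proof.
move=> LF LG; apply/funext => z.
rewrite /pd (deriveM (@laurent_derivable F LF j z) (@laurent_derivable G LG j z)).
by rewrite addrC; congr (_ + _); rewrite /GRing.scale /= mulrC.
Qed.

Lemma pdD j F G : laurent_trig F -> laurent_trig G ->
  pd j (fun z => F z + G z) = fun z => pd j F z + pd j G z.
Proof.
move=> LF LG; apply/funext => z.
exact: (deriveD (@laurent_derivable F LF j z) (@laurent_derivable G LG j z)).
Qed.

Lemma pd_character j a : pd j (character a) = fun z => 'i * (a 0 j)%:~R * character a z.
Proof.
by apply/funext => z; exact: (@derive_val _ _ _ _ _ _ _ (character_is_derive a j z)).
Qed.

Lemma pdZ j (c : C) F : laurent_trig F ->
  pd j (fun z => c * F z) = fun z => c * pd j F z.
Proof.
move=> LF; rewrite pdM //; last exact: laurent_cst.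
by apply/funext => z; rewrite pd_cst mul0r add0r.
Qed.

Lemma pd_mono j (c : C) a : pd j (fun z => c * character a z) =
  fun z => (c * ('i * (a 0 j)%:~R)) * character a z.
Proof.
rewrite pdZ; last exact: laurent_character.
by apply/funext => z; rewrite pd_character mulrA.
Qed.

Lemma laurent_pd j F : laurent_trig F -> laurent_trig (pd j F).
Proof.
move: F; apply: laurent_ind => [|c a|F G LF LG IH IH'].
- rewrite pd_cst; exact: laurent_cst.
- rewrite pd_mono; exact: laurent_mono.
- rewrite pdD //; exact: laurentD.
Qed.

Lemma continuous_expC : continuous (@expC R : C -> C).
Proof.
move=> w.
have H : is_derive (w : C^o) (1 : C^o) (@expC R : C^o -> C) (expC w).
  apply: (@quadratic_is_derive _ _ _ _ _ _ (20 * cmod (expC w))%:C (2^-1)%:C).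
    by rewrite ltcR invr_gt0.
  move=> h; rewrite lec_cmod => hm.
  have -> : expC (h *: (1 : C^o) + w) - expC w - h * expC w =
      (expC h - 1 - h) * expC w.
    by rewrite /GRing.scale /= mulr1 expCD; ring.
  rewrite normcE -[`|h|]/((cmod h)%:C) -rmorphXn -rmorphM lecR cmodM.
  apply: le_trans (ler_wpM2r (cmod_ge0 _) (expC_sub_le hm)) _.
  by rewrite le_eqVlt; apply/orP; left; apply/eqP; ring.
have /derivable1_diffP := @ex_derive _ _ _ _ _ _ _ H.
exact: differentiable_continuous.
Qed.

Lemma character_continuous a : continuous (character a : Cd -> C).
Proof.
move=> z; apply: (@continuous_comp _ _ _
    (fun z : Cd => 'i * \sum_(j < d) (a 0 j)%:~R * z 0 j) (@expC R : C -> C)).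
  2: exact: continuous_expC.
apply: (@continuousM _ _ (cst 'i) _ z); first exact: cst_continuous.
have H (r : seq 'I_d) :
    continuous (fun z : Cd => \sum_(j <- r) (a 0 j)%:~R * z 0 j : C).
  elim: r => [|j r IH] w.
    by under eq_fun do rewrite big_nil; exact: cst_continuous.
  under eq_fun do rewrite big_cons.
  apply: (@continuousD _ _ _ (fun z : Cd => (a 0 j)%:~R * z 0 j : C) _ w _ (IH w)).
  apply: (@continuousM _ _ (cst ((a 0 j)%:~R)) (fun z : Cd => z 0 j) w).
    exact: cst_continuous.
  exact: coord_continuous.
exact: H.
Qed.

Lemma laurent_continuous F : laurent_trig F -> continuous F.
Proof.
move=> LF z; move: F LF; apply: laurent_ind => [|c a|F G _ _ IH IH'].
- exact: (@cst_continuous Cd C 0 z).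
- apply: (@continuousM _ _ (cst c) (character a) z); [exact: cst_continuous | exact: character_continuous].
- exact: (@continuousD _ _ _ F G z IH IH').
Qed.

End TrigPolynomials.

#[global] Opaque pd expC character.

(** * Identity theorem *)

Section Identity.
Variables (R : realType) (d : nat).
Local Notation C := R[i].
Local Notation Rd := 'rV[R]_d.
Local Notation Cd := 'rV[C]_d.
Local Notation Zd := 'rV[int]_d.
Implicit Types (a b k : Zd) (z w : Cd) (x y : Rd) (F G : Cd -> C).

(** Compare imaginary parts: [sin] is injective on [[- pi/2, pi/2]], which contains [[0, 1]]. *)
Lemma expCi_inj_small (s t : R) : 0 <= s <= 1 -> 0 <= t <= 1 ->
  expC ('i * s%:C) = expC ('i * t%:C) -> s = t.
Proof.
move=> /andP[s0 s1] /andP[t0 t1]; rewrite !expCi => -[_ st].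
have p1 : (1 : R) <= pi / 2 := pihalf_ge1 R.
by apply: (@sin_inj R s t) => //; rewrite in_itv /=; apply/andP; split; lra.
Qed.

(** An arc of the unit circle carries [size q] distinct points, one more than the number of roots a
    nonzero [q] may have. *)
Lemma poly_circle_eq0 (q : {poly C}) (e : R) : 0 < e ->
  (forall s : R, 0 < s < e -> q.[expC ('i * s%:C)] = 0) -> q = 0.
Proof.
move=> e0 H; apply/eqP; apply: contraT => q0.
pose f := Num.min e 1; have f0 : 0 < f by rewrite lt_min e0 ltr01.
pose pt (i : nat) : R := f * (i.+1%:R / (size q).+1%:R).
have ptP i : (i < size q)%N -> 0 < pt i < f.
  move=> iq; rewrite /pt mulr_gt0 ?divr_gt0 ?ltr0n //= -[ltRHS]mulr1 ltr_pM2l //.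
  by rewrite ltr_pdivrMr ?ltr0n // mul1r ltr_nat.
have := max_poly_roots (rs := [seq expC ('i * (pt i)%:C) | i <- iota 0 (size q)]) q0.
rewrite size_map size_iota ltnn => W; apply: W.
  rewrite all_map; apply/allP => i; rewrite mem_iota => /andP[_ iq].
  rewrite /= /root H //; have /andP[-> /=] := ptP _ iq.
  by move/lt_le_trans; apply; rewrite ge_min lexx.
rewrite map_inj_in_uniq ?iota_uniq // => i j.
rewrite !mem_iota => /andP[_ iq] /andP[_ jq] /expCi_inj_small W.
have f1 : f <= 1 by rewrite ge_min lexx orbT.
have {W} : pt i = pt j.
  apply: W; [have /andP[] := ptP _ iq|have /andP[] := ptP _ jq] => /ltW -> /ltW h /=;
    exact: le_trans h f1.
move/(mulfI (lt0r_neq0 f0)) => /mulIf W.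
have /eqP := W (invr_neq0 (lt0r_neq0 (ltr0Sn _ _))).
by rewrite eqr_nat eqSS => /eqP.
Qed.

(** The coordinates are released one by one from a small real interval to all of [C]: along a
    coordinate line [F] is, up to a unit, a polynomial in one exponential that vanishes on an
    arc. *)
Lemma laurent_identity F z (e : R) : laurent_trig F -> 0 < e ->
  (forall y, (forall j, `|y 0 j| < e) -> F (z + complexify y) = 0) ->
  forall w, F w = 0.
Proof.
move=> LF e0 H w; rewrite -(subrKC z w); move: (w - z) => {}w.
(* Invariant: the first [n] coordinates of [w] are arbitrary complex numbers, the remaining ones
   real and small. *)
suff S n : (n <= d)%N -> forall w, (forall j : 'I_d, (n <= j)%N ->
    exists2 t : R, w 0 j = t%:C & `|t| < e) -> F (z + w) = 0.
  by apply: (S d) => // j; rewrite leqNgt ltn_ord.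
elim: n => [_ {}w Hw|n IH nd {}w Hw].
  have -> : w = complexify (map_mx (@complex.Re R) w).
    by apply/rowP => j; have [t wt _] := Hw j isT; rewrite !mxE wt.
  by apply: H => j; have [t wt te] := Hw j isT; rewrite mxE wt.
pose j := Ordinal nd.
pose w' := w - w 0 j *: basis_vec C j.
have -> : w = w' + w 0 j *: basis_vec C j by rewrite /w' subrK.
rewrite addrA -cvec_delta.
have [m /(_ (z + w'))[q Hq]] := laurent_on_line (delta_mx 0 j) LF.
rewrite Hq (_ : q = 0) ?horner0 ?mulr0 //.
apply: (poly_circle_eq0 e0) => s /andP[s0 se].
apply: (mulfI (invr_neq0 (expf_neq0 m (expC_neq0 ('i * s%:C))))).
rewrite -Hq mulr0 -addrA; apply: IH; first exact: ltnW.
move=> i ni; rewrite cvec_delta /w'; have [->|ij] := eqVneq i j.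
  by exists s; rewrite ?gtr0_norm // !mxE !eqxx !mulr1 subrr add0r.
have [|t wt te] := Hw i; last first.
  by exists t => //; rewrite !mxE (negPf ij) !mulr0 oppr0 !addr0.
by rewrite ltn_neqAle ni andbT eq_sym; apply: contra ij => /eqP h; apply/eqP/val_inj.
Qed.

Lemma ball_complexify z (e : C) y : 0 < e ->
  (forall j, `|y 0 j| < complex.Re e) -> ball z e (z + complexify y).
Proof.
move=> e0 Hy; split=> // i j; rewrite -ball_normE /= !mxE opprD addrA subrr add0r normrN.
rewrite normcE cmodR (_ : e = (complex.Re e)%:C) ?ltcR ?(ord1 i) //.
by move: e0; rewrite ltcE => /andP[/eqP h _]; apply: complex_eqP.
Qed.

(** Trigonometric polynomials form an integral domain: [F] is nonzero near some point, so [G]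
    vanishes on a real box there and the identity theorem applies. *)
Lemma laurent_mul_eq0 F G : laurent_trig F -> laurent_trig G ->
  (forall z, F z * G z = 0) -> (exists z, F z != 0) -> forall z, G z = 0.
Proof.
move=> LF LG FG [z0 Fz0].
have : \forall z \near z0, F z != 0.
  exact: (cvgr_neq0 _ (@laurent_continuous R d F LF z0) Fz0).
case/nbhs_ballP => e /= e0 He.
have e0' : 0 < complex.Re e by move: e0; rewrite ltcE => /andP[].
apply: (@laurent_identity G z0 (complex.Re e)) => // y Hy.
have /mulfI : F (z0 + complexify y) != 0.
  by apply: He; exact: ball_complexify.
by apply; rewrite FG mulr0.
Qed.

Lemma int_poly_nonroot (q : {poly int}) : q != 0 -> exists n : nat, q.[n%:Z] != 0.
Proof.
move=> q0; apply: contrapT => H.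
have := max_poly_roots (rs := [seq n%:Z | n <- iota 0 (size q)]) q0.
rewrite size_map size_iota ltnn => W.
suff : false by []; apply: W.
  rewrite all_map; apply/allP => n _; rewrite /= /root.
  by apply/negPn/negP => Hn; apply: H; exists n.
by rewrite map_inj_uniq ?iota_uniq // => i j [].
Qed.

(* The direction is a point [(1, N, N^2, ...)] of the moment curve. *)
Lemma separating_direction (j0 : 'I_d) (A : seq Zd) : (j0 : nat) = 0%N ->
  exists k, k 0 j0 = 1 /\
    forall a b, a \in A -> b \in A -> idot a k = idot b k -> a = b.
Proof.
move=> j00.
pose P (c : Zd) : {poly int} := \sum_(j < d) c 0 j *: 'X^j.
have PE c (j : 'I_d) : (P c)`_j = c 0 j.
  rewrite coef_sum (bigD1 j) //= coefZ coefXn eqxx mulr1 big1 ?addr0 // => i ij.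
  rewrite coefZ coefXn (_ : (j : nat) == i = false) ?mulr0 //.
  by apply/negbTE; apply: contra ij => /eqP h; apply/eqP/val_inj.
have P0 c : (P c == 0) = (c == 0).
  apply/eqP/eqP => [h|->].
    by apply/rowP => j; rewrite -PE h coef0 mxE.
  by rewrite /P big1 // => j _; rewrite mxE scale0r.
(* The pairing of [c] with [(1, n, n^2, ...)] is the value of [P c] at [n], so an [n] that is not a
   root of [Q] separates all pairs of exponents at once. *)
pose Q := \prod_(a <- A) \prod_(b <- A | a != b) P (a - b).
have Q0 : Q != 0.
  rewrite prodf_seq_neq0; apply/allP => a _ /=.
  rewrite prodf_seq_neq0; apply/allP => b _ /=.
  by apply/implyP => ab; rewrite P0 subr_eq0.
have [n Hn] := int_poly_nonroot Q0.
exists (\row_j n%:Z ^+ j); split; first by rewrite mxE j00.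
move=> a b aA bA ab; apply: contrapT => /eqP nab.
move: Hn; rewrite /Q horner_prod prodf_seq_neq0 => /allP /(_ a aA) /=.
rewrite horner_prod prodf_seq_neq0 => /allP /(_ b bA); rewrite nab /= => /eqP; apply.
rewrite /P horner_sum; have : idot (a - b) (\row_j n%:Z ^+ j) = 0.
  by rewrite idotDl idotNl ab subrr.
rewrite /idot => h; rewrite -[RHS]h; apply: eq_bigr => j _.
by rewrite hornerZ hornerXn !mxE.
Qed.

Lemma laurent_reduced F : laurent_trig F -> exists A (c : Zd -> C),
  [/\ uniq A, (forall a, a \in A -> c a != 0) &
      F = fun z => \sum_(a <- A) c a * character a z].
Proof.
case=> A [c Fc].
(* The list [A] may repeat an exponent, which then counts with its multiplicity. *)
pose c' a := c a * (count_mem a A)%:R.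
exists [seq a <- undup A | c' a != 0], c'; split.
- by rewrite filter_uniq ?undup_uniq.
- by move=> a; rewrite mem_filter => /andP[].
apply/funext => z; rewrite Fc big_filter.
rewrite -[LHS]big_undup_iterop_count [RHS]big_mkcond.
apply: eq_bigr => a _.
rewrite -[iterop _ _ _ _]/(_ *+ _).
case: ifPn => [_|]; first by rewrite /c' -mulr_natr mulrAC.
by rewrite negbK => /eqP h; rewrite -mulr_natr mulrAC -/(c' a) h mul0r.
Qed.

End Identity.

(** * Trigonometric polynomials invariant along a direction *)

Section InvariantRing.
Variables (R : realType) (d : nat) (k : 'rV[int]_d).
Local Notation C := R[i].
Local Notation Cd := 'rV[C]_d.
Local Notation Zd := 'rV[int]_d.
Implicit Types (a b : Zd) (z w : Cd) (F G : Cd -> C).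

(** The coefficients of the one-variable description: functions constant along the complex direction
    [k], in which only one exponential is left to vary. *)
Definition laurent_inv : {pred (Cd -> C)} :=
  fun F => `[< laurent_trig F /\ forall z s, F (z + s *: cvec R k) = F z >].

Lemma laurent_invP F : reflect
  (laurent_trig F /\ forall z s, F (z + s *: cvec R k) = F z) (F \in laurent_inv).
Proof. exact: asboolP. Qed.

Fact laurent_inv_subring : subring_closed laurent_inv.
Proof.
split=> [|F G /laurent_invP[LF IF] /laurent_invP[LG IG]
         |F G /laurent_invP[LF IF] /laurent_invP[LG IG]]; apply/laurent_invP.
- by split=> //; exact: laurent_cst.
- split; first exact: laurentB.
  by move=> z s; rewrite -[LHS]/(F _ - G _) IF IG.
- split; first exact: laurentM.
  by move=> z s; rewrite -[LHS]/(F _ * G _) IF IG.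
Qed.
HB.instance Definition _ :=
  GRing.isSubringClosed.Build (Cd -> C) laurent_inv laurent_inv_subring.

Record inv_ring := InvRing { inv_fun : Cd -> C; _ : inv_fun \in laurent_inv }.
HB.instance Definition _ := [isSub for inv_fun].
HB.instance Definition _ := [Choice of inv_ring by <:].
HB.instance Definition _ := [SubChoice_isSubComNzRing of inv_ring by <:].

Implicit Types f g h : inv_ring.

Lemma inv_ring_laurent f : laurent_trig (inv_fun f).
Proof. by case: f => F /= /laurent_invP[]. Qed.

Lemma inv_ring_inv f z s : inv_fun f (z + s *: cvec R k) = inv_fun f z.
Proof. by case: f => F /= /laurent_invP[]. Qed.

Lemma inv_ringP f g : (forall z, inv_fun f z = inv_fun g z) -> f = g.
Proof. by move=> H; apply: val_inj; apply/funext => z; exact: H. Qed.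

Lemma inv_ringM f g z : inv_fun (f * g) z = inv_fun f z * inv_fun g z.
Proof. by []. Qed.
Fact inv_ring_idomain f g : f * g = 0 -> (f == 0) || (g == 0).
Proof.
move=> fg; have [//|f0 /=] := eqVneq f 0.
have Ex : exists z, inv_fun f z != 0.
  apply: contrapT => H; move/eqP: f0; apply; apply: inv_ringP => z.
  by apply: contrapT => Hz; apply: H; exists z; apply/eqP.
apply/eqP/inv_ringP => z.
apply: (laurent_mul_eq0 (inv_ring_laurent f) (inv_ring_laurent g) _ Ex) => w.
by rewrite -inv_ringM fg.
Qed.

(** Units and inverses are obtained by choice. They complete the structure of integral domain on
    which gcds and pseudo-division of polynomials over [inv_ring] rest. *)
Definition inv_unit : pred inv_ring := fun f => `[< exists g, g * f = 1 >].
Definition inv_inv f : inv_ring :=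
  if pselect (exists g, g * f = 1) is left H then sval (cid H) else f.

Fact inv_ring_mulVr : {in inv_unit, left_inverse 1 inv_inv *%R}.
Proof.
move=> f /asboolP H; rewrite /inv_inv; case: pselect => // H'.
exact: (svalP (cid H')).
Qed.
Fact inv_ring_unitP f g : g * f = 1 -> inv_unit f.
Proof. by move=> fg; apply/asboolP; exists g. Qed.
Fact inv_ring_invr_out : {in [predC inv_unit], inv_inv =1 id}.
Proof. by move=> f /asboolP H; rewrite /inv_inv; case: pselect. Qed.
HB.instance Definition _ := GRing.ComNzRing_hasMulInverse.Build inv_ring
  inv_ring_mulVr inv_ring_unitP inv_ring_invr_out.
HB.instance Definition _ := GRing.ComUnitRing_isIntegral.Build inv_ring inv_ring_idomain.

Definition ev z (f : inv_ring) : C := inv_fun f z.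
Fact ev_additive z : additive (ev z). Proof. by []. Qed.
Fact ev_multiplicative z : multiplicative (ev z). Proof. by []. Qed.
HB.instance Definition _ z := GRing.isAdditive.Build inv_ring C (ev z) (ev_additive z).
HB.instance Definition _ z :=
  GRing.isMultiplicative.Build inv_ring C (ev z) (ev_multiplicative z).

Lemma evM z f g : ev z (f * g) = ev z f * ev z g. Proof. by []. Qed.

Lemma ev_line f z s : ev (z + s *: cvec R k) f = ev z f.
Proof. exact: inv_ring_inv. Qed.

Lemma inv_ring_neq0 f : f != 0 -> exists z, ev z f != 0.
Proof.
move=> f0; apply: contrapT => H; move/eqP: f0; apply; apply: inv_ringP => z.
by apply: contrapT => Hz; apply: H; exists z; apply/eqP.
Qed.

Variable j0 : 'I_d.
Hypothesis kj0 : k 0 j0 = 1.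

(** The variable of the one-variable description. As [k] has entry [1] at [j0], it is multiplied by
    [expC ('i * s)] along [s k], and so takes every nonzero complex value on each fibre. *)
Definition tvar z : C := character (delta_mx 0 j0) z.

Lemma tvar_line z s : tvar (z + s *: cvec R k) = expC ('i * s) * tvar z.
Proof. by rewrite /tvar character_line idot_delta kj0 expr1z. Qed.

Lemma tvar_neq0 z : tvar z != 0.
Proof. exact: character_neq0. Qed.

Lemma tvar_onto z (c : C) : c != 0 -> exists s, tvar (z + s *: cvec R k) = c.
Proof.
move=> c0; have [|s Hs] := @expCi_surj R (c / tvar z).
  by rewrite mulf_neq0 // invr_eq0 tvar_neq0.
by exists s; rewrite tvar_line Hs divfK // tvar_neq0.
Qed.

(** Along the fibre through [z] the coefficients are frozen, and [P] becomes an ordinary complex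
    polynomial evaluated at the values of [tvar]. *)
Definition peval (P : {poly inv_ring}) z : C := (map_poly (ev z) P).[tvar z].

Lemma pevalD P Q z : peval (P + Q) z = peval P z + peval Q z.
Proof. by rewrite /peval rmorphD hornerD. Qed.
Lemma pevalM P Q z : peval (P * Q) z = peval P z * peval Q z.
Proof. by rewrite /peval rmorphM hornerM. Qed.
Lemma peval0 z : peval 0 z = 0.
Proof. by rewrite /peval rmorph0 horner0. Qed.
Lemma pevalC f z : peval f%:P z = ev z f.
Proof. by rewrite /peval map_polyC hornerC. Qed.
Lemma pevalXn n z : peval 'X^n z = tvar z ^+ n.
Proof. by rewrite /peval map_polyXn hornerXn. Qed.
Lemma peval_sum (I : Type) (r : seq I) (P : pred I) (Q : I -> {poly inv_ring}) z :
  peval (\sum_(i <- r | P i) Q i) z = \sum_(i <- r | P i) peval (Q i) z.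
Proof. by elim/big_rec2: _ => [|i x y _ <-]; rewrite ?peval0 ?pevalD. Qed.

Lemma map_ev_line P z s : map_poly (ev (z + s *: cvec R k)) P = map_poly (ev z) P.
Proof. by apply/polyP => i; rewrite !coef_map /= ev_line. Qed.

Lemma peval_line P z s : peval P (z + s *: cvec R k) =
  (map_poly (ev z) P).[expC ('i * s) * tvar z].
Proof. by rewrite /peval map_ev_line tvar_line. Qed.

Lemma laurent_peval P : laurent_trig (peval P).
Proof.
elim/poly_ind: P => [|P f IH].
  rewrite (_ : peval 0 = (fun=> 0)); first exact: laurent_cst.
  by apply/funext => z; rewrite peval0.
rewrite (_ : peval _ = fun z => peval P z * tvar z + ev z f).
  apply: laurentD; last exact: inv_ring_laurent.
  by apply: laurentM => //; exact: laurent_character.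
by apply/funext => z; rewrite pevalD pevalM pevalC -['X]expr1 pevalXn expr1.
Qed.

Lemma peval_eq0 P : (forall z, peval P z = 0) -> P = 0.
Proof.
move=> H; apply/polyP => n; rewrite coef0; apply: inv_ringP => z.
have -> : inv_fun P`_n z = (map_poly (ev z) P)`_n by rewrite coef_map.
suff -> : map_poly (ev z) P = 0 by rewrite coef0.
(* Rescaling by the nonzero number [tvar z] moves the values of [tvar] on the fibre to an arc of the
   unit circle. *)
have : (map_poly (ev z) P) \Po (tvar z *: 'X) = 0.
  apply: (poly_circle_eq0 (@ltr01 R)) => s _.
  by rewrite horner_comp hornerZ hornerX mulrC -peval_line H.
move/eqP; rewrite comp_poly_eq0 ?size_scale ?size_polyX ?tvar_neq0 //.
by move/eqP.
Qed.

Fact mono_inv (c : C) a : idot a k = 0 ->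
  (fun z => c * character a z) \in laurent_inv.
Proof.
move=> ak; apply/laurent_invP; split; first exact: laurent_mono.
by move=> z s; rewrite character_line ak expr0z mul1r.
Qed.

(** Projection along the [j0]-th basis vector onto the exponents orthogonal to [k]. A character is
    then an invariant one times a power of [tvar]. *)
Definition kproj a : Zd := a - idot a k *: delta_mx 0 j0.

Lemma idot_kproj a : idot (kproj a) k = 0.
Proof. by rewrite idotDl idotNl idotZl idot_delta kj0 mulr1 subrr. Qed.

Definition kmono (c : C) a : inv_ring := InvRing (mono_inv c (idot_kproj a)).

Lemma kmonoE c a z : ev z (kmono c a) = c * character (kproj a) z.
Proof. by []. Qed.

Lemma character_tvar (n : int) z : character (n *: delta_mx 0 j0) z = tvar z ^ n.
Proof. exact: characterZ. Qed.

Lemma character_kproj a z : character a z = character (kproj a) z * tvar z ^ (idot a k).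
Proof.
by rewrite -character_tvar -characterD /kproj subrK.
Qed.

(** Multiplication by a power of [tvar], a unit, clears the negative powers. *)
Lemma laurent_peval_rep F : laurent_trig F -> exists (P : {poly inv_ring}) (m : nat),
  forall z, peval P z = tvar z ^+ m * F z.
Proof.
move: F; apply: laurent_ind => [|c a|F G _ _ [P [m Hm]] [Q [n Hn]]].
- by exists 0, 0%N => z; rewrite peval0 mulr0.
- exists ((kmono c a)%:P * 'X^(`|idot a k + `|idot a k|%:Z|)), `|idot a k|%N => z.
  rewrite pevalM pevalC pevalXn kmonoE [character a z]character_kproj.
  have e0 := tvar_neq0 z.
  have h : (`|(idot a k + `|idot a k|)%R|%N : int) = idot a k + `|idot a k|%N by lia.
  rewrite [X in _ * X = _]exprnP h expfzDr // -[_ ^ `|_|%N]exprnP.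
  have e4 (t s x y : C) : t * x * (y * s) = s * (t * (x * y)) by ring.
  exact: e4.
- exists (P * 'X^n + Q * 'X^m), (m + n)%N => z.
  by rewrite pevalD !pevalM !pevalXn Hm Hn exprD; ring.
Qed.

End InvariantRing.

(** * Division and Gauss' lemma *)

Section OneVariable.
Variable R : realType.
Local Notation C := R[i].
Implicit Types (p q r e : {poly C}) (c : C).

Lemma seq_argmax (T : eqType) (f : T -> int) (s : seq T) : s != [::] ->
  exists2 a, a \in s & forall b, b \in s -> f b <= f a.
Proof.
elim: s => // x [|y s] IH _.
  by exists x; rewrite ?mem_head // => b; rewrite inE => /eqP ->.
have [a ais Ha] := IH isT; have [fxa|fax] := lerP (f x) (f a).
  exists a; first by rewrite inE ais orbT.
  by move=> b; rewrite inE => /predU1P[->//|/Ha].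
exists x; first exact: mem_head.
move=> b; rewrite inE => /predU1P[->//|/Ha h].
exact: le_trans h (ltW fax).
Qed.

(** Boundedness of [r / e] along some points that tend to [c] and differ from [c]. Asking for no
    more keeps the condition stable when a common root is cancelled. *)
Definition dominated_at r e c := exists K : R, forall t : R, 0 < t ->
  exists c', [/\ c' != c, cmod (c' - c) < t & cmod r.[c'] <= K * cmod e.[c']].

Lemma horner_continuous (q : {poly C}) : continuous (fun c : C => q.[c]).
Proof.
elim/poly_ind: q => [|q c IH] w.
  by under eq_fun do rewrite horner0; exact: cst_continuous.
under eq_fun do rewrite hornerMXaddC.
apply: (@continuousD _ _ _ (fun x : C => q.[x] * x) (cst c) w); last exact: cst_continuous.
by apply: (@continuousM _ _ (fun x : C => q.[x]) id w (IH w)); exact: cvg_id.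
Qed.

Lemma horner_near q c (t : R) : 0 < t ->
  exists2 u : R, 0 < u & forall c', cmod (c' - c) < u -> cmod (q.[c'] - q.[c]) < t.
Proof.
move=> t0; have /cvgrPdist_lt /(_ t%:C) := @horner_continuous q c.
rewrite ltcR => /(_ t0) /nbhs_ballP[u /= u0 Hu].
have uE : u = (complex.Re u)%:C.
  by move: u0; rewrite ltcE => /andP[/eqP h _]; apply: complex_eqP.
exists (complex.Re u); first by rewrite -ltcR -uE.
move=> c' Hc; have : ball c u c'.
  by rewrite -ball_normE /= uE ltc_cmod cmod_subC.
by move/Hu; rewrite /= ltc_cmod cmod_subC.
Qed.

Lemma dominated_root r e c : dominated_at r e c -> root e c -> root r c.
Proof.
move=> [K HK] /rootP ec; rewrite /root; apply: contraT => rc.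
have m0 : 0 < cmod r.[c] / 2 by rewrite divr_gt0 // cmod_gt0.
pose t2 := cmod r.[c] / 2 / (`|K| + 1).
have t20 : 0 < t2 by rewrite divr_gt0 // ltr_wpDl.
have [u1 u10 H1] := horner_near r c m0; have [u2 u20 H2] := horner_near e c t20.
have [|c' [_ Hc He]] := HK (Num.min u1 u2); first by rewrite lt_min u10.
move: Hc; rewrite lt_min => /andP[/H1 h1 /H2]; rewrite ec subr0 => h2.
have h3 : cmod r.[c] <= cmod (r.[c'] - r.[c]) + cmod r.[c'].
  by rewrite cmod_subC -{1}(subrK r.[c'] r.[c]) cmodD.
have h4 : K * cmod e.[c'] <= `|K| * t2.
  apply: le_trans (ler_wpM2r (cmod_ge0 _) (ler_norm K)) _.
  by apply: ler_wpM2l => //; exact: ltW.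
have h5 : `|K| * t2 <= cmod r.[c] / 2.
  rewrite /t2 mulrA ler_pdivrMr ?ltr_wpDl // mulrC ler_wpM2l ?lerDl //.
  exact: ltW.
have : cmod r.[c] < cmod r.[c] by lra.
by rewrite ltxx.
Qed.

(** Induction on the size of [e]. A root of [e] is a root of [r] by domination; after cancelling it
    the quotients still satisfy the hypothesis, since domination is tested off that root. *)
Lemma dominated_dvdp n r e : (size e <= n)%N -> e != 0 ->
  (forall c, root e c -> dominated_at r e c) -> e %| r.
Proof.
elim: n r e => [|n IH] r e.
  by rewrite leqn0 size_poly_eq0 => ->.
move=> en e0 H; have [s1|s1] := eqVneq (size e) 1%N.
  have : e %= 1 by rewrite -size_poly_eq1 s1.
  by move/eqp_dvdl => ->; exact: dvd1p.
have [c ec] := closed_rootP e s1.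
have rc := dominated_root (H c ec) ec.
have [e1 E1] := factor_theorem _ _ ec; have [r1 R1] := factor_theorem _ _ rc.
rewrite {1}E1 R1.
have e10 : e1 != 0 by apply: contraNneq e0 => h; rewrite E1 h mul0r.
apply: dvdp_mul => //; apply: IH => //.
  by move: en; rewrite E1 size_Mmonic ?monicXsubC // size_XsubC addn2.
move=> c2 ec2; have [K HK] : dominated_at r e c2.
  by apply: H; rewrite E1 rootM ec2.
exists K => t t0.
(* Staying closer to [c2] than [c] is keeps [c'] away from [c], so that the factor ['X - c] can be
   cancelled in the inequality. *)
pose u := if c2 == c then t else Num.min t (cmod (c2 - c)).
have u0 : 0 < u.
  by rewrite /u; case: eqP => // /eqP h; rewrite lt_min t0 cmod_gt0 subr_eq0.
have [c' [n2 d2]] := HK u u0.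
have cc : c' != c.
  apply: contraTneq d2 => c'c; rewrite /u.
  have [h|h] := eqVneq c2 c; first by rewrite h c'c eqxx in n2.
  by rewrite c'c lt_min cmod_subC ltxx andbF.
rewrite E1 R1 !hornerM !cmodM mulrA ler_pM2r.
  move=> h; exists c'; split=> //; apply: lt_le_trans d2 _.
  by rewrite /u; case: eqP => // _; rewrite ge_min lexx.
by rewrite cmod_gt0 hornerXsubC subr_eq0.
Qed.

Lemma root_bound p c : p \is monic -> root p c ->
  cmod c <= 1 + \sum_(i < size p) cmod p`_i.
Proof.
move=> mp /rootP pc; have [c1|c1] := lerP (cmod c) 1.
  by apply: le_trans c1 _; rewrite lerDl sumr_ge0 // => i _; exact: cmod_ge0.
have sp : (0 < size p)%N by rewrite size_poly_gt0 monic_neq0.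
case sn : (size p) sp => [//|n] _.
have c0 : 0 < cmod c by apply: lt_trans c1.
move: pc; rewrite horner_coef sn big_ord_recr /= (_ : p`_n = 1); last first.
  by move/monicP: mp; rewrite lead_coefE sn.
rewrite mul1r => /eqP; rewrite addrC addr_eq0 => /eqP h.
have h2 : cmod c ^+ n <= (\sum_(i < n) cmod p`_i) * cmod c ^+ n.-1.
  rewrite -cmodX h cmodN; apply: le_trans (cmod_sum _ _ _) _.
  rewrite mulr_suml; apply: ler_sum => i _; rewrite cmodM cmodX.
  apply: ler_wpM2l; first exact: cmod_ge0.
  by rewrite ler_weXn2l ?(ltW c1) // -ltnS prednK ?(leq_ltn_trans _ (ltn_ord i)).
case: n sn h h2 => [|n] sn h h2.
  by move: h; rewrite expr0 big_ord0 oppr0 => /eqP; rewrite oner_eq0.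
rewrite big_ord_recr /=; move: h2; rewrite exprS ler_pM2r ?exprn_gt0 // => h2.
have := cmod_ge0 p`_n.+1; lra.
Qed.

Lemma prod_XsubC_coef (M : R) (rs : seq C) i :
  (forall c, c \in rs -> cmod c <= M) -> 0 <= M ->
  cmod (\prod_(c <- rs) ('X - c%:P))`_i <= (1 + M) ^+ size rs.
Proof.
move=> + M0; elim: rs i => [|c rs IH] i H.
  by rewrite big_nil coef1 /= expr0; case: (i == 0)%N; rewrite ?cmod1 // cmod0 ler01.
rewrite big_cons mulrBl coefB coefXM coefCM exprS mulrDl mul1r.
have {}IH j : cmod (\prod_(c <- rs) ('X - c%:P))`_j <= (1 + M) ^+ size rs.
  by apply: IH => c' c's; apply: H; rewrite inE c's orbT.
apply: le_trans (cmodB _ _) _; apply: lerD.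
  by case: eqP => // _; rewrite cmod0 exprn_ge0 // addr_ge0.
by rewrite cmodM; apply: ler_pM; rewrite ?cmod_ge0 ?IH // H // mem_head.
Qed.

(** The roots of [q] are among those of [p], hence bounded, and the coefficients of [q] over its
    leading one are symmetric functions of them. The bound depends continuously on the coefficients
    of [p], and on nothing else. *)
Lemma monic_divisor_coef p q i : p \is monic -> q %| p ->
  cmod q`_i <= cmod (lead_coef q) * (2 + \sum_(j < size p) cmod p`_j) ^+ size p.
Proof.
move=> mp qp; have p0 := monic_neq0 mp.
set M := 1 + \sum_(j < size p) cmod p`_j.
have M0 : 0 <= M by rewrite addr_ge0 // sumr_ge0 // => j _; exact: cmod_ge0.
have [rs qE] := closed_field_poly_normal q.
have q0 : q != 0 by apply: contraTneq qp => ->; rewrite dvd0p.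
rewrite {1}qE coefZ cmodM; apply: ler_wpM2l; first exact: cmod_ge0.
have -> : 2 + \sum_(j < size p) cmod p`_j = 1 + M by rewrite /M; lra.
apply: (le_trans (prod_XsubC_coef (M := M) (rs := rs) i _ _)) => //.
  move=> c crs; apply: root_bound => //; apply: (root_dvdp qp).
  by rewrite qE rootZ ?lead_coef_eq0 // root_prod_XsubC.
apply: ler_weXn2l; first by rewrite lerDl.
have := dvdp_leq p0 qp; rewrite {1}qE size_scale ?lead_coef_eq0 //.
by rewrite size_prod_XsubC; exact: ltnW.
Qed.

End OneVariable.

(** * Division of trigonometric polynomials *)

Section Divisibility.
Variables (R : realType) (d : nat).
Local Notation C := R[i].
Local Notation Rd := 'rV[R]_d.
Local Notation Cd := 'rV[C]_d.
Local Notation Zd := 'rV[int]_d.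
Implicit Types (k : Zd) (z w : Cd) (F G : Cd -> C).

Definition laurent_unit U := laurent_trig U /\
  exists2 V : Cd -> C, laurent_trig V & forall z, U z * V z = 1.

(** When [k] separates the exponents, each power of [tvar] has a single monomial as its coefficient,
    and monomials are units. Dividing by the top one makes [P] monic; the bottom one makes its
    constant coefficient vanish nowhere, so that all fibre roots are nonzero, that is, values of
    [tvar]. *)
Lemma laurent_monic_in k (j0 : 'I_d) (kj0 : k 0 j0 = 1) (A : seq Zd) (c : Zd -> C) :
  uniq A -> A != [::] -> (forall a, a \in A -> c a != 0) ->
  (forall a b, a \in A -> b \in A -> idot a k = idot b k -> a = b) ->
  exists (P : {poly inv_ring R k}) (U : Cd -> C),
    [/\ P \is monic, laurent_unit U, forall z, ev z P`_0 != 0 &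
     forall z, \sum_(a <- A) c a * character a z = U z * peval j0 P z].
Proof.
move=> uA A0 c0 sep.
have [a1 a1A max1] := seq_argmax (fun a => idot a k) A0.
have [a0 a0A max0] := seq_argmax (fun a => - idot a k) A0.
set n0 := idot a0 k; pose dg a := `|idot a k - n0|%N.
have dgE a : a \in A -> (dg a : int) = idot a k - n0.
  by move=> aA; have := max0 a aA; rewrite /dg /n0; lia.
have dg_inj a b : a \in A -> b \in A -> dg a = dg b -> a = b.
  move=> aA bA ab; apply: sep => //.
  by have := dgE a aA; have := dgE b bA; rewrite ab => -> /addIr.
have dg1 a : a \in A -> (dg a <= dg a1)%N.
  move=> aA; have := max1 a aA; have := dgE a aA; have := dgE a1 a1A; lia.
pose m a := kmono kj0 (c a / c a1) (a - a1).
pose P := \sum_(a <- A) m a *: 'X^(dg a).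
have PE b : b \in A -> P`_(dg b) = m b.
  move=> bA; rewrite coef_sum (bigD1_seq b) //= coefZ coefXn eqxx mulr1.
  rewrite big_seq_cond big1 ?addr0 // => a /andP[aA ab]; rewrite coefZ coefXn.
  by case: eqP => [h|_]; rewrite ?mulr0 //; rewrite (dg_inj b a) ?eqxx in ab.
have m1 : m a1 = 1.
  apply: inv_ringP => z; rewrite -[LHS]/(ev z _) kmonoE divff ?c0 // subrr.
  by rewrite /kproj /idot big1 ?scale0r ?subr0 ?character0 ?mulr1 // => j _; rewrite mxE mul0r.
have sP : (size P <= (dg a1).+1)%N.
  apply/leq_sizeP => j jn; rewrite coef_sum big_seq big1 // => a aA.
  rewrite coefZ coefXn (_ : j == dg a = false) ?mulr0 //.
  by apply/negbTE; rewrite neq_ltn (leq_ltn_trans (dg1 a aA) jn) orbT.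
have mP : P \is monic.
  rewrite monicE lead_coefE (_ : (size P).-1 = dg a1) ?PE ?m1 //.
  have : (dg a1 < size P)%N.
    by rewrite ltnNge; apply/negP => /leq_sizeP /(_ _ (leqnn _)) /eqP; rewrite PE // m1 oner_eq0.
  move=> h; have -> // : size P = (dg a1).+1.
  by apply/eqP; rewrite eqn_leq sP h.
(* The exponent of the unit that is divided out: the invariant part of the top exponent plus the
   lowest power of [tvar]. *)
pose b1 := kproj k j0 a1 + n0 *: delta_mx 0 j0.
exists P, (fun z => c a1 * character b1 z); split=> //.
- split; first exact: laurent_mono.
  exists (fun z => (c a1)^-1 * character (- b1) z); first exact: laurent_mono.
  by move=> z; rewrite mulrACA divff ?c0 // mul1r -characterD subrr character0.
- move=> z; have : dg a0 = 0%N by rewrite /dg subrr.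
  move=> <-; rewrite PE // kmonoE mulf_neq0 ?character_neq0 //.
  by rewrite mulf_neq0 ?invr_eq0 ?c0.
move=> z; rewrite peval_sum mulr_sumr big_seq [RHS]big_seq; apply: eq_bigr => a aA.
rewrite -mul_polyC pevalM pevalC pevalXn kmonoE (character_kproj k j0 a).
rewrite /b1 characterD (character_tvar j0).
have -> : idot a k = n0 + (dg a : int) by rewrite dgE //; lia.
rewrite expfzDr ?tvar_neq0 // -exprnP.
have -> : kproj k j0 a = kproj k j0 a1 + kproj k j0 (a - a1).
  by rewrite /kproj idotDl idotNl; apply/rowP => i; rewrite !mxE; ring.
rewrite characterD.
have e (s t u v w y : C) : s != 0 ->
    t * (u * w * (v * y)) = s * (u * v) * (t / s * w * y) by move=> s0; field.
by apply: e; exact: c0.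
Qed.

Lemma laurent_monic (j0 : 'I_d) F : (j0 : nat) = 0%N -> laurent_trig F ->
  (exists z, F z != 0) ->
  exists k, k 0 j0 = 1 /\ exists (P : {poly inv_ring R k}) (U : Cd -> C),
    [/\ P \is monic, laurent_unit U, forall z, ev z P`_0 != 0 &
     forall z, F z = U z * peval j0 P z].
Proof.
move=> j00 LF [z0 Fz0]; have [A [c [uA cA FE]]] := laurent_reduced LF.
have [k [k1 sep]] := separating_direction A j00.
exists k; split=> //; move: Fz0; rewrite FE => Fz0; apply: laurent_monic_in => //.
by apply: contraNneq Fz0 => ->; rewrite big_nil.
Qed.

Lemma real_complex_continuous : continuous (real_complex R : R -> C).
Proof.
move=> x; apply/cvgrPdist_lt => t t0.
have t0' : 0 < complex.Re t by move: t0; rewrite ltcE => /andP[].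
have tE : t = (complex.Re t)%:C.
  by move: t0; rewrite ltcE => /andP[/eqP h _]; apply: complex_eqP.
near=> y; rewrite tE -rmorphB ltc_cmod cmodR.
by near: y; apply: cvgr_dist_lt.
Unshelve. all: by end_near.
Qed.

Lemma complex_line_continuous z w : continuous (fun h : R => z + h%:C *: w).
Proof.
move=> h; apply: (@continuousD _ _ _ (cst z) (fun h : R => h%:C *: w)).
  exact: cst_continuous.
apply: (@continuous_comp _ _ _ (real_complex R) (fun c : C => c *: w)).
  exact: real_complex_continuous.
exact: scalel_continuous.
Qed.

Lemma cmod_continuous : continuous (@cmod R : C -> R).
Proof.
move=> x A /nbhs_ballP[t /= t0 Ht]; apply/nbhs_ballP.
exists t%:C; first by rewrite /= ltcR.
move=> y; rewrite -ball_normE /= ltc_cmod => xy; apply: Ht.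
rewrite -ball_normE /=; apply: le_lt_trans xy.
rewrite ler_norml; have := cmodD (x - y) y; have := cmodD (y - x) x.
by rewrite !subrK (cmod_subC y); lra.
Qed.

Lemma cmod_laurent_continuous F : laurent_trig F -> continuous (fun z => cmod (F z)).
Proof.
move=> LF z; apply: (@continuous_comp _ _ _ F (@cmod R)).
  exact: laurent_continuous.
exact: cmod_continuous.
Qed.

Lemma expCi_near (t : R) : 0 < t -> exists2 u : R, 0 < u <= 1 &
  forall h : R, `|h| < u -> cmod (expC ('i * h%:C) - 1) < t.
Proof.
move=> t0; exists (Num.min (t / 12) (2^-1)).
  by rewrite lt_min ge_min divr_gt0 //= invr_gt0 ltr0n /= orbC invf_le1 // ler1n.
move=> h; rewrite lt_min => /andP[h1 h2].
have cm : cmod ('i * h%:C) = `|h| by rewrite cmodM cmodi cmodR mul1r.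
have := @expC_sub_le R ('i * h%:C); rewrite cm => /(_ (ltW h2)) H.
have -> : expC ('i * h%:C) - 1 = (expC ('i * h%:C) - 1 - 'i * h%:C) + 'i * h%:C.
  by rewrite subrK.
apply: le_lt_trans (cmodD _ _) _; rewrite cm.
have h0 := normr_ge0 h; nra.
Qed.

(** Divide with remainder by the monic polynomial of [e]. On each fibre the remainder is still
    dominated by [e], hence divisible by it, hence zero because its degree is smaller. *)
Lemma laurent_dvd (j0 : 'I_d) (e a : Cd -> C) (B : Cd -> R) : (j0 : nat) = 0%N ->
  laurent_trig e -> laurent_trig a -> (exists z, e z != 0) -> continuous B ->
  (forall z, cmod (a z) <= B z * cmod (e z)) ->
  exists2 q, laurent_trig q & forall z, a z = q z * e z.
Proof.
move=> j00 Le La e0 cB aB.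
have [k [k1 [E [U [mE [LU [V LV UV]] E0 EE]]]]] := laurent_monic j00 Le e0.
have [A [m AE]] := laurent_peval_rep k1 La.
pose Q := Pdiv.Ring.rdivp A E; pose Rm := Pdiv.Ring.rmodp A E.
have AQ : A = Q * E + Rm := Pdiv.RingMonic.rdivp_eq mE A.
suff Rm0 : Rm = 0.
  exists (fun z => character (- (m%:Z *: delta_mx 0 j0)) z * (peval j0 Q z * V z)).
    apply: laurentM; first exact: laurent_character.
    by apply: laurentM => //; exact: laurent_peval.
  move=> z; rewrite EE characterN (character_tvar j0) -exprnP.
  apply: (mulfI (expf_neq0 m (tvar_neq0 j0 z))); rewrite -AE AQ Rm0 addr0 pevalM.
  have -> : peval j0 Q z * peval j0 E z = peval j0 Q z * peval j0 E z * (U z * V z).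
    by rewrite UV mulr1.
  by field; rewrite expf_neq0 // tvar_neq0.
have dom z : exists2 B' : Cd -> R, continuous B' &
    forall z, cmod (peval j0 Rm z) <= B' z * cmod (peval j0 E z).
  exists (fun z => cmod (tvar j0 z ^+ m) * B z * cmod (U z) + cmod (peval j0 Q z)).
    move=> w; apply: (@continuousD _ _ _ (fun z => cmod (tvar j0 z ^+ m) * B z * cmod (U z))).
      apply: (@continuousM _ _ (fun z => cmod (tvar j0 z ^+ m) * B z)).
        apply: (@continuousM _ _ (fun z => cmod (tvar j0 z ^+ m))); last exact: cB.
        by apply: cmod_laurent_continuous; apply: laurentX; exact: laurent_character.
      exact: cmod_laurent_continuous.
    by apply: cmod_laurent_continuous; exact: laurent_peval.
  move=> {}z; have -> : peval j0 Rm z = tvar j0 z ^+ m * a z - peval j0 Q z * peval j0 E z.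
    by rewrite -AE AQ pevalD pevalM addrC addKr.
  apply: le_trans (cmodB _ _) _; rewrite !cmodM mulrDl lerD2r -!mulrA.
  apply: ler_wpM2l; first exact: cmod_ge0.
  by have := aB z; rewrite EE cmodM.
suff H z : map_poly (ev z) Rm = 0.
  by apply: (peval_eq0 k1) => z; rewrite /peval H horner0.
have mEz : map_poly (ev z) E \is monic by exact: monic_map.
apply/eqP; apply: contraT => Rz.
have := Pdiv.Ring.ltn_rmodpN0 A (monic_neq0 mE); rewrite ltnNge.
have -> // : (size E <= size Rm)%N.
have sE : size (map_poly (ev z) E) = size E.
  by rewrite size_map_poly_id0 // (monicP mE) rmorph1 oner_neq0.
rewrite -sE; apply: leq_trans (dvdp_leq Rz _) (size_poly _ _).
apply: (dominated_dvdp (leqnn _) (monic_neq0 mEz)) => c /rootP rc.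
(* Being nonzero, the root [c] is the value of [tvar] at some point of the fibre. Rotating it by
   small real angles [h] gives the points [c'] required by [dominated_at], and there the bound [B']
   is nearly its value at [h = 0]. *)
have c0 : c != 0.
  apply: contraTneq (E0 z) => h; move: rc; rewrite h horner_coef0 coef_map /= => ->.
  by rewrite eqxx.
have [s0 Hs0] := tvar_onto k1 z c0.
have [B' cB' HB'] := dom z.
pose z1 := z + s0 *: cvec R k.
have cl : continuous (fun h : R => B' (z1 + h%:C *: cvec R k)).
  move=> h; apply: (@continuous_comp _ _ _ (fun h : R => z1 + h%:C *: cvec R k) B').
    exact: complex_line_continuous.
  exact: cB'.
have := cl 0 => /cvgrPdist_lt /(_ 1 ltr01) /nbhs_ballP[u1 /= u10 Hu1].
exists (B' z1 + 1) => t t0.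
have tc : 0 < t / cmod c by rewrite divr_gt0 // cmod_gt0.
have [u2 /andP[u20 u21] Hu2] := expCi_near tc.
pose h := Num.min u1 u2 / 2.
have u0 : 0 < Num.min u1 u2 by rewrite lt_min u10.
have h0 : 0 < h by rewrite divr_gt0.
have hu : h < Num.min u1 u2 by rewrite /h; lra.
have hu1 : h < u1 by apply: lt_le_trans hu _; rewrite ge_min lexx.
have hu2 : h < u2 by apply: lt_le_trans hu _; rewrite ge_min lexx orbT.
have cE : expC ('i * (s0 + h%:C)) * tvar j0 z = expC ('i * h%:C) * c.
  by rewrite -Hs0 (tvar_line k1) mulrDr expCD; ring.
exists (expC ('i * h%:C) * c); split.
- rewrite -subr_eq0 -[X in _ - X]mul1r -mulrBl mulf_neq0 // subr_eq0.
  apply/eqP => H1.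
  have : expC ('i * h%:C) = expC ('i * 0%:C) by rewrite H1 mulr0 expC0.
  move/expCi_inj_small; rewrite lexx ler01 (ltW h0) (ltW (lt_le_trans hu2 u21)).
  by move=> /(_ isT isT) h00; rewrite h00 ltxx in h0.
- rewrite -[X in _ - X]mul1r -mulrBl cmodM -ltr_pdivlMr ?cmod_gt0 //.
  by apply: Hu2; rewrite gtr0_norm.
rewrite -cE -!(peval_line k1) scalerDl addrA -/z1.
apply: le_trans (HB' _) _; apply: ler_wpM2r; first exact: cmod_ge0.
have := Hu1 h; rewrite /ball /= sub0r normrN gtr0_norm // scale0r addr0 => /(_ hu1).
by rewrite ltr_norml => /andP[]; lra.
Qed.

(** The quotient is again constant along [k], because its variation multiplied by [e] is zero. *)
Lemma inv_ring_dvd k (j0 : 'I_d) (e a : inv_ring R k) (B : Cd -> R) :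
  (j0 : nat) = 0%N -> e != 0 -> continuous B ->
  (forall z, cmod (ev z a) <= B z * cmod (ev z e)) ->
  exists q, a = q * e.
Proof.
move=> j00 e0 cB aB; have ez := inv_ring_neq0 e0.
have [q Lq aq] := laurent_dvd j00 (inv_ring_laurent e) (inv_ring_laurent a) ez cB aB.
have qi : q \in laurent_inv k.
  apply/laurent_invP; split=> // z s; apply/eqP; rewrite -subr_eq0; apply/eqP.
  apply: (@laurent_mul_eq0 _ _ (inv_fun e) (fun z => q (z + s *: cvec R k) - q z)) => //.
  - exact: inv_ring_laurent.
  - by apply: laurentB => //; exact: laurent_shift.
  - move=> w; rewrite mulrBr [X in _ - X]mulrC -aq.
    by rewrite -(inv_ring_inv e w s) mulrC -aq inv_ring_inv subrr.
by exists (InvRing qi); apply: inv_ringP => z; rewrite aq.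
Qed.

(** The zeros of a nonzero [c] contain no real box, so a weak inequality between continuous
    functions extends across them. *)
Lemma inv_ring_dense k (c : inv_ring R k) (f g : Cd -> R) : c != 0 ->
  continuous f -> continuous g ->
  (forall z, ev z c != 0 -> f z <= g z) -> forall z, f z <= g z.
Proof.
move=> c0 cf cg H z; rewrite leNgt; apply/negP => gf.
have : \forall w \near z, 0 < (f \- g) w.
  by apply: (@cvgr_gt _ _ _ _ _ _ (continuousB (cf z) (cg z))); rewrite subr_gt0.
case/nbhs_ballP => t /= t0 Ht.
have tE : t = (complex.Re t)%:C.
  by move: t0; rewrite ltcE => /andP[/eqP h _]; apply: complex_eqP.
move/eqP: c0; apply; apply: inv_ringP => w.
apply: (@laurent_identity _ _ _ z (complex.Re t)); first exact: inv_ring_laurent.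
  by rewrite -ltcR -tE.
move=> y Hy; apply: contrapT => /eqP h.
have := Ht (z + complexify y) (ball_complexify _ t0 Hy).
by rewrite /= subr_gt0 ltNge H.
Qed.

(* Gauss' lemma for monic polynomials: the coefficients of [D], divided by its
   leading coefficient, are bounded, since the roots of [P] are. *)
Lemma inv_ring_gauss k (j0 : 'I_d) (P E D : {poly inv_ring R k}) (c : inv_ring R k) :
  (j0 : nat) = 0%N -> P \is monic -> c != 0 -> c *: P = E * D ->
  exists D', D' \is monic /\ D = lead_coef D *: D'.
Proof.
move=> j00 mP c0 PED.
have D0 : D != 0.
  apply: contraNneq c0 => h; move: PED; rewrite h mulr0 => /eqP.
  by rewrite scale_poly_eq0 (negPf (monic_neq0 mP)) orbF.
have l0 : lead_coef D != 0 by rewrite lead_coef_eq0.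
pose B z := (2 + \sum_(j < size P) cmod (ev z P`_j)) ^+ size P.
have cB : continuous B.
  move=> z; apply: (@continuous_comp _ _ _
    (fun z => 2 + \sum_(j < size P) cmod (ev z P`_j)) (fun x : R => x ^+ size P)).
    apply: (@continuousD _ _ _ (cst (2 : R))); first exact: cst_continuous.
    apply: (@continuous_big _ _ _ _ _ (@add_continuous R)) => i _.
    exact: cmod_laurent_continuous (inv_ring_laurent _).
  exact: exprn_continuous.
have H i z : cmod (ev z D`_i) <= B z * cmod (ev z (lead_coef D)).
  move: z; apply: (inv_ring_dense c0).
  - exact: cmod_laurent_continuous (inv_ring_laurent _).
  - move=> z; apply: (@continuousM _ _ B); first exact: cB.
    exact: cmod_laurent_continuous (inv_ring_laurent _) z.
  move=> z cz.
  have dz : map_poly (ev z) D %| map_poly (ev z) P.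
    have : map_poly (ev z) (c *: P) = ev z c *: map_poly (ev z) P by rewrite linearZ.
    rewrite PED rmorphM => h.
    by rewrite -(dvdpZr _ _ cz) -h dvdp_mull.
  have lz : ev z (lead_coef D) != 0.
    have : c * lead_coef P = lead_coef E * lead_coef D by rewrite -lead_coefM -PED lead_coefZ.
    rewrite (monicP mP) mulr1 => h; apply: contraNneq cz => h2.
    by rewrite h -[ev z _]/(ev z (lead_coef E) * ev z (lead_coef D)) h2 mulr0.
  have := monic_divisor_coef i (monic_map (ev z) mP) dz.
  rewrite coef_map lead_coef_map_eq // mulrC size_map_poly_id0; last first.
    by rewrite (monicP mP) rmorph1 oner_neq0.
  by under eq_bigr do rewrite coef_map.
have /boolp.choice[q Hq] : forall i, exists q : inv_ring R k, D`_i = q * lead_coef D.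
  by move=> i; exact: inv_ring_dvd j00 l0 cB (H i).
exists (\poly_(i < size D) q i).
have DE : D = lead_coef D *: \poly_(i < size D) q i.
  apply/polyP => i; rewrite coefZ coef_poly; case: ltnP => iD; first by rewrite mulrC -Hq.
  by rewrite mulr0 nth_default.
split=> //; rewrite monicE; apply/eqP; apply: (mulfI l0).
by rewrite -lead_coefZ -DE mulr1.
Qed.

End Divisibility.

(** * Zeros of trigonometric polynomials *)

Section Torus.
Variables (R : realType) (d : nat).
Local Notation C := R[i].
Local Notation Rd := 'rV[R]_d.
Local Notation Cd := 'rV[C]_d.
Local Notation Zd := 'rV[int]_d.
Implicit Types (k : Zd) (z w : Cd) (F G : Cd -> C).

Lemma ctorus_pi_eq z w : ctorus_pi z = ctorus_pi w -> exists a : Zd, w = z + lattice_vec R a.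
Proof. by move/eqmodP => /asboolP. Qed.

Lemma laurent_ctorus F z w : laurent_trig F -> ctorus_pi z = ctorus_pi w -> F z = F w.
Proof. by move=> LF /ctorus_pi_eq[a ->]; rewrite laurent_lattice. Qed.

Lemma ctorus_pi_surj (t : ctorus R d) : exists z, ctorus_pi z = t.
Proof. by exists (repr t); exact: reprK. Qed.

Definition qpoint (q : 'rV[rat * rat]_d) : Cd :=
  \row_j ((ratr (q 0 j).1 : R) +i* (ratr (q 0 j).2 : R)).

Lemma qpoint_dense z (n : nat) : exists q, ball (qpoint q) ((n.+1%:R)^-1)%:C z.
Proof.
have : 0 < ((n.+1%:R)^-1 : R) by rewrite invr_gt0.
set m := (n.+1%:R)^-1 => n0.
have /boolp.choice[f Hf] : forall x : R, exists q : rat, `|ratr q - x| < m / 2.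
  move=> x; have [|q] := @rat_in_itvoo R (x - m / 2) (x + m / 2).
    lra.
  by rewrite in_itv /= => /andP[h1 h2]; exists q; rewrite ltr_norml; lra.
exists (\row_j (f (complex.Re (z 0 j)), f (complex.Im (z 0 j)))).
split=> [|i j]; first by rewrite ltcR.
rewrite -ball_normE /= !mxE /= (ord1 i) ltc_cmod.
apply: le_lt_trans (cmod_le_ReIm _) _; rewrite ReD ImD ReN ImN /=.
have := Hf (complex.Re (z 0 j)); have := Hf (complex.Im (z 0 j)); lra.
Qed.

(** Each point of [A] is isolated by the image of a small ball with rational centre and radius
    [1 / (n + 1)], and such a ball determines the point. *)
Lemma discrete_countable (A : set (ctorus R d)) : discrete_subset A -> countable A.
Proof.
move=> dA.
have /boolp.choice[f Hf] : forall t, exists p : 'rV[rat * rat]_d * nat, A t ->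
    (exists2 w, ball (qpoint p.1) ((p.2.+1%:R)^-1)%:C w & ctorus_pi w = t) /\
    forall w, ball (qpoint p.1) ((p.2.+1%:R)^-1)%:C w -> A (ctorus_pi w) ->
      ctorus_pi w = t.
  move=> t; have [At|nAt] := pselect (A t); last by exists (0, 0%N).
  have [_ [V]] := dA t At; rewrite nbhsE => -[U [oU Ut] UV] VA.
  have [z zt] := ctorus_pi_surj t.
  have : nbhs z (@ctorus_pi R d @^-1` U).
    apply: open_nbhs_nbhs; split; last by rewrite /= zt.
    exact: oU.
  case/nbhs_ballP => e /= e0 He.
  have e0' : 0 < complex.Re e by move: e0; rewrite ltcE => /andP[].
  have eE : e = (complex.Re e)%:C.
    by move: e0; rewrite ltcE => /andP[/eqP h _]; apply: complex_eqP.
  (* With this [n], two radii [1 / (n + 1)] fit into [e]: a ball of that radius that contains [z]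
     lies within [e] of [z]. *)
  pose n := Num.truncn (2 / complex.Re e).
  have nE : (n.+1%:R)^-1 < complex.Re e / 2.
    rewrite -[ltRHS]invrK ltf_pV2 ?posrE ?invr_gt0 ?divr_gt0 // invf_div.
    by apply: truncnS_gt.
  have [q Hq] := qpoint_dense z n.
  exists (q, n) => _; split; first by exists z.
  move=> w Hw Aw; suff : [set t] (ctorus_pi w) by [].
  rewrite -VA; split=> //; apply: UV; apply: (He w); rewrite eE.
  apply: (@le_ball _ _ _ ((n.+1%:R)^-1 + (n.+1%:R)^-1)%:C).
    by rewrite lecR; move: nE; set m := (n.+1%:R)^-1; lra.
  rewrite rmorphD; apply: ball_triangle Hw; exact: ball_sym.
apply/countable_injP; exists (pickle \o f) => t t'; rewrite !inE => At At' /= ff.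
have {}ff : f t = f t' by apply: (pcan_inj pickleK).
have [[w Hw wt] _] := Hf t At; have [_ H'] := Hf t' At'.
by rewrite -wt; apply: H'; rewrite -?ff ?wt.
Qed.

(** An injective curve is uncountable, as an interval of positive length is; discrete sets are
    countable. *)
Lemma discrete_no_curve (A : set (ctorus R d)) (f : R -> ctorus R d) (e : R) :
  discrete_subset A -> 0 < e -> (forall s, 0 < s < e -> A (f s)) ->
  (forall s t, 0 < s < e -> 0 < t < e -> f s = f t -> s = t) -> False.
Proof.
move=> /discrete_countable /countable_injP[g gi] e0 Af fi.
have cI : countable (`]0, e[ : set R).
  apply/countable_injP; exists (g \o f) => s t; rewrite !inE /= !in_itv /= => se te /gi fst.
  by apply: fi => //; apply: fst; rewrite inE; exact: Af.
have := countable_lebesgue_measure0 cI; rewrite lebesgue_measure_itv /= lte_fin e0.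
by rewrite sube0 => /eqP; rewrite eqe gt_eqF.
Qed.

(** Moving the base point in the direction [j1] and solving [E = 0] on each fibre gives a curve of
    zeros, which a discrete set cannot contain. The nonzero leading coefficient preserves the degree
    on the fibre, and the nonzero constant coefficient makes the root a value of [tvar]. This
    requires a second direction, hence dimension at least two. *)
Lemma poly_zero_curve k (j0 j1 : 'I_d) (E : {poly inv_ring R k}) z0 (e : R)
    (A : set (ctorus R d)) :
  k 0 j0 = 1 -> j1 != j0 -> 0 < e -> (1 < size E)%N -> discrete_subset A ->
  (forall s : R, 0 < s < e -> ev (z0 + s%:C *: basis_vec C j1) (lead_coef E) != 0 /\
     ev (z0 + s%:C *: basis_vec C j1) E`_0 != 0) ->
  exists (s : R) (t : C), let z := z0 + s%:C *: basis_vec C j1 + t *: cvec R k in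
    [/\ 0 < s < e, peval j0 E z = 0 & ~ A (ctorus_pi z)].
Proof.
move=> k1 j10 e0 sE dA HE.
pose Z s := z0 + s%:C *: basis_vec C j1.
have /boolp.choice[tau Htau] : forall s : R, exists t : C, 0 < s < e ->
    peval j0 E (Z s + t *: cvec R k) = 0.
  move=> s; have [se|nse] := boolP (0 < s < e); last by exists 0.
  have [lE E0] := HE s se.
  have sz : size (map_poly (ev (Z s)) E) != 1%N.
    by rewrite size_map_poly_id0 // neq_ltn sE orbT.
  have [c /rootP Hc] := closed_rootP _ sz.
  have c0 : c != 0.
    apply: contraNneq E0 => h; move: Hc; rewrite h horner_coef0 coef_map /= => ->.
    by [].
  have [t Ht] := tvar_onto k1 (Z s) c0.
  by exists t => _; rewrite /peval map_ev_line Ht.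
apply: contrapT => H.
pose f := Num.min e 1.
have fP s : 0 < s < f -> (0 < s < e) /\ 0 <= s <= 1.
  by rewrite lt_min => /andP[s0 /andP[se s1]]; rewrite s0 se (ltW s0) (ltW s1).
apply: (@discrete_no_curve A (fun s => ctorus_pi (Z s + tau s *: cvec R k)) f dA).
- by rewrite lt_min e0 ltr01.
- move=> s /fP[se _]; apply: contrapT => nA; apply: H; exists s, (tau s).
  by split=> //; exact: Htau.
move=> s t /fP[se s1] /fP[te t1] st.
(* This exponent is orthogonal to [k], so its character ignores the displacement [tau] along the
   fibre and reads off [expC ('i * s)]. It tells the points of the curve apart. *)
pose b : Zd := delta_mx 0 j1 - k 0 j1 *: delta_mx 0 j0.
have bk : idot b k = 0.
  by rewrite idotDl idotNl idotZl !idot_delta k1 mulr1 subrr.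
have bE u : character b (Z u + tau u *: cvec R k) = expC ('i * u%:C) * character b z0.
  rewrite character_line bk expr0z mul1r /Z -cvec_delta character_line idot_deltar.
  by rewrite /b !mxE !eqxx (negPf j10) !mulr0 subr0 expr1z.
apply: expCi_inj_small => //; apply: (mulIf (character_neq0 b z0)).
by rewrite -!bE; apply: laurent_ctorus st; exact: laurent_character.
Qed.

End Torus.

(** * Zeros of a family of increasing functions *)

Section PlaneZeros.
Variable R : realType.

Lemma IVT0 (f : R -> R) (a b : R) : a <= b -> continuous f ->
  f a * f b <= 0 -> exists2 c, a <= c <= b & f c = 0.
Proof.
move=> ab cf fab; have [c cab fc] : exists2 c, c \in `[a, b] & f c = 0.
  apply: IVT => //; first exact: continuous_subspaceT.
  by rewrite ge_min le_max; case: (lerP (f a) 0) => h1; case: (lerP (f b) 0) => h2 //=;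
    rewrite ?(ltW h1) ?(ltW h2) ?orbT //; nra.
by exists c => //; move: cab; rewrite in_itv.
Qed.

(** For each [y] there is a single zero [x(y)]. It is not constant, since [F] does not vanish
    identically above [x(0)]. For [x] strictly between two of its values, [F x] changes sign in
    [y]. *)
Lemma plane_zeros (F : R -> R -> R) (r b : R) : 0 < r -> 0 < b ->
  (forall y, 0 <= y <= b -> forall x x', - r <= x -> x < x' -> x' <= r -> F x y < F x' y) ->
  (forall y, continuous (F ^~ y)) -> (forall x, continuous (F x)) ->
  (forall y, 0 <= y <= b -> F (- r) y < 0 < F r y) ->
  (forall x, - r <= x <= r -> exists2 y, 0 <= y <= b & F x y != 0) ->
  exists l u, [/\ - r <= l, l < u, u <= r &
    forall x, l < x < u -> exists2 y, 0 <= y <= b & F x y = 0].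
Proof.
move=> r0 b0 inc cx cy Fr nz.
have rr : - r <= r by lra.
have root y : 0 <= y <= b -> exists2 c, - r < c < r & F c y = 0.
  move=> yb; have /andP[h1 h2] := Fr y yb.
  have [|c /andP[c1 c2] Fc] := IVT0 rr (cx y).
    by rewrite nmulr_rle0 ?ltW.
  exists c => //; rewrite !lt_neqAle c1 c2 !andbT.
  by apply/andP; split; apply/negP => /eqP hc; move: Fc; [rewrite -hc | rewrite hc];
    move=> h; move: h1 h2; rewrite h ltxx.
have zb : (0 : R) <= 0 <= b by rewrite lexx ltW.
have [a0 /andP[a1 a2] Fa] := root 0 zb.
have [|y1 yb Fy] := nz a0; first by rewrite !ltW.
have [c /andP[c1 c2] Fc] := root y1 yb.
have y10 : 0 <= y1 by case/andP: yb.
have key x : - r <= x <= r -> F x 0 * F x y1 <= 0 -> exists2 y, 0 <= y <= b & F x y = 0.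
  move=> _ /(IVT0 y10 (cy x))[y /andP[h1 h2] Fxy]; exists y => //.
  by rewrite h1 (le_trans h2) //; case/andP: yb.
have [ca|ac] : c < a0 \/ a0 < c.
  by case: (ltgtP c a0) => [||h]; [left|right|move: Fy; rewrite -h Fc eqxx].
- exists c, a0; split; [exact: ltW|exact: ca|exact: ltW|] => x /andP[x1 x2].
  apply: key; first by apply/andP; split; lra.
  have : F x 0 < F a0 0 by apply: inc => //; lra.
  have : F c y1 < F x y1 by apply: inc => //; lra.
  rewrite Fa Fc => h1 h2; nra.
- exists a0, c; split; [exact: ltW|exact: ac|exact: ltW|] => x /andP[x1 x2].
  apply: key; first by apply/andP; split; lra.
  have : F a0 0 < F x 0 by apply: inc => //; lra.
  have : F x y1 < F c y1 by apply: inc => //; lra.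
  rewrite Fa Fc => h1 h2; nra.
Qed.

End PlaneZeros.

(** * Real zeros near a regular point *)

Section RealZeros.
Variables (R : realType) (d : nat).
Local Notation C := R[i].
Local Notation Rd := 'rV[R]_d.
Local Notation Cd := 'rV[C]_d.
Local Notation Zd := 'rV[int]_d.
Implicit Types (a k : Zd) (z w : Cd) (x y : Rd) (F G : Cd -> C).

Lemma character_line_quadratic a j w (h : R) (m := cmod ('i * (a 0 j)%:~R : C)) :
  `|h| <= (2 * (m + 1))^-1 ->
  cmod (character a (w + h%:C *: basis_vec C j) - character a w -
        h%:C * ('i * (a 0 j)%:~R * character a w)) <=
  20 * m ^+ 2 * `|h| ^+ 2 * cmod (character a w).
Proof.
move=> hm; have m0 : 0 <= m := cmod_ge0 _.
have -> : character a (w + h%:C *: basis_vec C j) - character a w -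
    h%:C * ('i * (a 0 j)%:~R * character a w) =
    (expC (h%:C * ('i * (a 0 j)%:~R)) - 1 - h%:C * ('i * (a 0 j)%:~R)) * character a w.
  rewrite character_addr -cvec_delta character_cvec idot_deltar.
  by rewrite (_ : 'i * ((a 0 j)%:~R * h%:C) = h%:C * ('i * (a 0 j)%:~R)); ring.
have hm2 : cmod (h%:C * ('i * (a 0 j)%:~R)) <= 2^-1.
  rewrite cmodM cmodR -/m; move: hm; rewrite invfM => hm.
  have m1 : 0 < m + 1 by rewrite ltr_wpDl.
  apply: le_trans (ler_wpM2r m0 hm) _.
  by rewrite -mulrA ler_piMr ?invr_ge0 // mulrC ler_pdivrMr // mul1r lerDl.
rewrite cmodM; apply: ler_wpM2r; first exact: cmod_ge0.
apply: le_trans (expC_sub_le hm2) _.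
by rewrite cmodM cmodR -/m exprMn le_eqVlt; apply/orP; left; apply/eqP; ring.
Qed.

Lemma laurent_Re_is_derive F z j (t : R) : laurent_trig F ->
  is_derive t (1 : R) (fun t : R => complex.Re (F (z + t%:C *: basis_vec C j)))
    (complex.Re (pd j F (z + t%:C *: basis_vec C j))).
Proof.
move: F; apply: laurent_ind => [|c a|F G LF LG IH IH'].
- by rewrite pd_cst; exact: is_derive_cst.
- rewrite pd_mono.
  apply: (@quadratic_is_derive R R _ _ _ _
    (20 * cmod ('i * (a 0 j)%:~R : C) ^+ 2 * cmod (c * character a (z + t%:C *: basis_vec C j)))
    (2 * (cmod ('i * (a 0 j)%:~R : C) + 1))^-1).
    by rewrite invr_gt0 mulr_gt0 // ltr_wpDl ?cmod_ge0.
  move=> h hm.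
  have -> : z + (h *: (1 : R) + t)%:C *: basis_vec C j =
      z + t%:C *: basis_vec C j + h%:C *: basis_vec C j.
    by rewrite -[h *: _]/(h * 1) mulr1 rmorphD scalerDl [X in z + X]addrC addrA.
  move: (z + t%:C *: basis_vec C j) => w.
  have := character_line_quadratic w hm; move: (character a w) (character a _) => A B.
  move/(ler_wpM2l (cmod_ge0 c)); rewrite -cmodM => H.
  apply: le_trans (le_trans _ H) _.
    apply: le_trans (Re_le_cmod _); rewrite mulrBr mulrBr !ReD !ReN.
    rewrite (_ : complex.Re (c * (h%:C * _)) = h * complex.Re (c * ('i * (a 0 j)%:~R) * A)) //.
    rewrite (_ : c * (h%:C * _) = h%:C * (c * ('i * (a 0 j)%:~R) * A)); last by ring.
    exact: Re_realM.
  by rewrite cmodM le_eqVlt; apply/orP; left; apply/eqP; ring.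
rewrite pdD //; under eq_fun do rewrite ReD; rewrite ReD.
exact: (@is_deriveD _ _ _ (fun t : R => complex.Re (F (z + t%:C *: basis_vec C j)))
  (fun t : R => complex.Re (G (z + t%:C *: basis_vec C j))) t 1 _ _ IH IH').
Qed.

Lemma Re_continuous : continuous (@complex.Re R : C -> R).
Proof.
move=> x A /nbhs_ballP[t /= t0 Ht]; apply/nbhs_ballP.
exists t%:C; first by rewrite /= ltcR.
move=> y; rewrite -ball_normE /= ltc_cmod => xy; apply: Ht.
by rewrite -ball_normE /=; apply: le_lt_trans xy; rewrite -ReN -ReD Re_le_cmod.
Qed.

Lemma laurent_Re_line_continuous F z w : laurent_trig F ->
  continuous (fun t : R => complex.Re (F (z + t%:C *: w))).
Proof.
move=> LF t; apply: (@continuous_comp _ _ _ (fun t : R => z + t%:C *: w)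
    (fun z => complex.Re (F z))); first exact: complex_line_continuous.
apply: (@continuous_comp _ _ _ F (@complex.Re R)); first exact: laurent_continuous.
exact: Re_continuous.
Qed.

Lemma laurent_Re_near F z (e : R) : laurent_trig F -> 0 < e ->
  exists2 r : R, 0 < r & forall y, (forall i, `|y 0 i| < r) ->
    `|complex.Re (F (z + complexify y)) - complex.Re (F z)| < e.
Proof.
move=> LF e0.
have : continuous (fun z => complex.Re (F z)).
  move=> w; apply: (@continuous_comp _ _ _ F (@complex.Re R)).
    exact: laurent_continuous.
  exact: Re_continuous.
move/(_ z)/cvgrPdist_lt/(_ e e0)/nbhs_ballP => [t /= t0 Ht].
exists (complex.Re t); first by move: t0; rewrite ltcE => /andP[].
move=> y Hy; rewrite distrC; apply: Ht; exact: ball_complexify.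
Qed.

(** On the box the derivative differs from its positive value at [x0] by less than that value, so it
    stays positive; then the mean value theorem applies. *)
Lemma laurent_Re_increasing F j x0 (r : R) : laurent_trig F ->
  0 < complex.Re (pd j F (complexify x0)) ->
  (forall y, (forall i, `|y 0 i| < r) ->
    `|complex.Re (pd j F (complexify x0 + complexify y)) -
      complex.Re (pd j F (complexify x0))| < complex.Re (pd j F (complexify x0))) ->
  forall x (t1 t2 : R), (forall i, i != j -> `|x 0 i - x0 0 i| < r) ->
    (forall t, t1 <= t <= t2 -> `|x 0 j + t - x0 0 j| < r) -> t1 < t2 ->
    complex.Re (F (complexify x + t1%:C *: basis_vec C j)) <
    complex.Re (F (complexify x + t2%:C *: basis_vec C j)).
Proof.
move=> LF Fj H1 x t1 t2 Hx Ht t12.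
pose f t := complex.Re (F (complexify x + t%:C *: basis_vec C j)).
pose df t := complex.Re (pd j F (complexify x + t%:C *: basis_vec C j)).
suff : f t1 < f t2 by [].
have [||c ct E] := @MVT R f df t1 t2 t12.
- by move=> t _; exact: laurent_Re_is_derive.
- by apply: continuous_subspaceT; exact: laurent_Re_line_continuous.
rewrite -subr_gt0 E; apply: mulr_gt0; last by rewrite subr_gt0.
move: ct; rewrite in_itv /= => /andP[c1 c2].
have W := H1 (x + c *: basis_vec R j - x0).
have E2 : complexify x0 + complexify (x + c *: basis_vec R j - x0) =
    complexify x + c%:C *: basis_vec C j.
  by rewrite -complexifyD subrKC complexifyD complexifyZ complexify_basis.
rewrite E2 in W.
have : `|df c - complex.Re (pd j F (complexify x0))| < complex.Re (pd j F (complexify x0)).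
  apply: W => i; rewrite !mxE eqxx /=; have [->|ij] := eqVneq i j.
    by rewrite mulr1; apply: Ht; rewrite !ltW.
  by rewrite mulr0 addr0; exact: Hx.
set v := complex.Re (pd j F (complexify x0)); move: (df c) v => u v.
by rewrite ltr_norml => /andP[h _]; rewrite -(ltrD2r (- v)) add0r.
Qed.

(* If the line through a zero in the direction [k] does not stay in the zero
   set, then by monotonicity in [x_j] the zeros near it project along [k] onto
   an open set. *)
Lemma inv_ring_zeros_near (p : Cd -> C) k (h : inv_ring R k) x0 (r0 : R) :
  laurent_trig p -> 0 < r0 ->
  (forall x, complex.Im (p (complexify x)) = 0) ->
  (exists j, complex.Re (pd j p (complexify x0)) != 0) ->
  p (complexify x0) = 0 ->
  (forall z (b : R), 0 < b -> exists2 t : R, 0 <= t <= b & p (z + t%:C *: cvec R k) != 0) ->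
  (forall x, (forall i, `|x 0 i - x0 0 i| < r0) -> p (complexify x) = 0 ->
     ev (complexify x) h = 0) ->
  h = 0.
Proof.
move=> Lp r00 Imp; wlog [j pj] : p Lp Imp / exists j, 0 < complex.Re (pd j p (complexify x0)).
  move=> W [j pj] p0 nz H.
  have [s0|s0|s0] := ltgtP (complex.Re (pd j p (complexify x0))) 0.
  - have Np : pd j (fun z => - p z) = fun z => - pd j p z.
      by under eq_fun do rewrite -mulN1r; rewrite pdZ //; apply/funext => z; rewrite mulN1r.
    apply: (W (fun z => - p z)); rewrite ?p0 ?oppr0 //.
    + exact: laurentN.
    + by move=> x; rewrite ImN Imp oppr0.
    + by exists j; rewrite Np ReN oppr_gt0.
    + by exists j; rewrite Np ReN oppr_eq0.
    + by move=> z b b0; have [t tb pt] := nz z b b0; exists t; rewrite ?oppr_eq0.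
    + by move=> x Hx /eqP; rewrite oppr_eq0 => /eqP; exact: H.
  - by apply: (W p) => //; exists j.
  - by rewrite s0 eqxx in pj.
move=> _ p0 nz H.
have Lpj : laurent_trig (pd j p) by exact: laurent_pd.
have [r1 r10 H1] := laurent_Re_near (complexify x0) Lpj pj.
(* A positive bound for all entries of [k]: with [b = s / kn], moving by [t k] for [0 <= t <= b]
   changes each coordinate by at most [s]. *)
pose kn := 1 + \sum_i `|(k 0 i)%:~R : R|.
have kn1 : 1 <= kn by rewrite lerDl sumr_ge0.
have kni i : `|(k 0 i)%:~R : R| <= kn.
  by rewrite /kn (bigD1 i) //= addrCA lerDl addr_ge0 // sumr_ge0.
pose r := Num.min r0 r1 / 4.
have rp : 0 < r by rewrite divr_gt0 // lt_min r00.
have r4 : 4 * r = Num.min r0 r1 by rewrite /r; field.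
have r40 : 4 * r <= r0 by rewrite r4 ge_min lexx.
have r41 : 4 * r <= r1 by rewrite r4 ge_min lexx orbT.
clearbody r.
have grow := laurent_Re_increasing Lp pj H1.
have Hm : complex.Re (p (complexify x0 + (- r)%:C *: basis_vec C j)) < 0 <
          complex.Re (p (complexify x0 + r%:C *: basis_vec C j)).
  have E0 : 0 = complex.Re (p (complexify x0 + 0%:C *: basis_vec C j)).
    by rewrite scale0r addr0 p0.
  have Hx i : i != j -> `|x0 0 i - x0 0 i| < r1 by rewrite subrr normr0.
  apply/andP; split; rewrite [X in X < _]E0 || rewrite [X in _ < X]E0; apply: grow => //; rewrite ?oppr_lt0 //;
    move=> t /andP[t1 t2]; rewrite addrAC subrr add0r ltr_norml; clear -t1 t2 rp r41; lra.
case/andP: Hm => Hm1 Hm2.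
have [|s1 s10 Hs1] := laurent_Re_near (complexify x0 + (- r)%:C *: basis_vec C j) Lp (e := - complex.Re (p (complexify x0 + (- r)%:C *: basis_vec C j))).
  by rewrite oppr_gt0.
have [s2 s20 Hs2] := laurent_Re_near (complexify x0 + r%:C *: basis_vec C j) Lp Hm2.
pose s := Num.min r (Num.min s1 s2) / 2.
have sp : 0 < s by rewrite divr_gt0 // !lt_min rp s10 s20.
have s2m : 2 * s = Num.min r (Num.min s1 s2) by rewrite /s; field.
have sr : 2 * s <= r by rewrite s2m ge_min lexx.
have sr1 : 2 * s <= r1 by clear -sr r41 rp; lra.
have ss1 : 2 * s <= s1 by rewrite s2m !ge_min lexx orbT.
have ss2 : 2 * s <= s2 by rewrite s2m !ge_min lexx !orbT.
apply: inv_ringP => w.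
apply: (@laurent_identity _ _ _ (complexify x0) s (inv_ring_laurent h) sp) => y Hy.
pose x := x0 + y.
have xE : complexify x0 + complexify y = complexify x by rewrite complexifyD.
rewrite xE.
pose kR : Rd := map_mx intr k.
have kE (t : R) : t%:C *: cvec R k = complexify (t *: kR).
  by apply/rowP => i; rewrite !mxE rmorphM /= rmorph_int.
pose b := s / kn.
have bp : 0 < b by rewrite divr_gt0 // (lt_le_trans ltr01).
have kb (t : R) i : 0 <= t <= b -> `|(t *: kR) 0 i| <= s.
  move=> /andP[t0 tb]; rewrite !mxE normrM ger0_norm //.
  apply: le_trans (ler_pM t0 (normr_ge0 _) tb (kni i)) _.
  by rewrite /b divfK // gt_eqF // (lt_le_trans ltr01).
pose X (t : R) := x + t *: kR.
have XE t : complexify (X t) = complexify x + t%:C *: cvec R k.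
  by rewrite complexifyD kE.
have X0 (t : R) i : 0 <= t <= b -> `|X t 0 i - x0 0 i| < 2 * s.
  move=> tb; have h1 := kb t i tb; have h2 := Hy i.
  have -> : X t 0 i - x0 0 i = y 0 i + (t *: kR) 0 i by rewrite !mxE; ring.
  by apply: le_lt_trans (ler_normD _ _) _; rewrite mulr_natl mulr2n ltr_leD.
(* The real part of [p] on the plane through [x] spanned by [e_j], where it increases in [a], and by
   [k], where the assumption on lines keeps it from vanishing identically in [t]. *)
pose F (a t : R) := complex.Re (p (complexify (X t) + a%:C *: basis_vec C j)).
have [l [u [rl lu ur Hlu]]] : exists l u : R, [/\ - r <= l, l < u, u <= r &
    forall a : R, l < a < u -> exists2 t : R, 0 <= t <= b & F a t = 0].
  apply: (plane_zeros rp bp) => [t tb a a' ra aa ar|t|a|t tb|a /andP[ra ar]].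
  - apply: grow => // [i _|q /andP[q1 q2]].
      exact: lt_le_trans (X0 t i tb) sr1.
    have := X0 t j tb; rewrite !ltr_norml => /andP[h1 h2].
    move: ra ar q1 q2 h1 h2 sr r41 rp; clear; lra.
  - exact: laurent_Re_line_continuous.
  - rewrite /F; under eq_fun do rewrite XE addrAC; exact: laurent_Re_line_continuous.
  - have E (a : R) : complexify (X t) + a%:C *: basis_vec C j =
        complexify x0 + a%:C *: basis_vec C j + complexify (X t - x0).
      by rewrite addrAC -complexifyD subrKC.
    have XB i : `|(X t - x0) 0 i| < 2 * s by have := X0 t i tb; rewrite !mxE.
    rewrite /F !E; apply/andP; split.
      have := Hs1 (X t - x0); set v := complex.Re _; set v' := complex.Re _.
      rewrite ltr_norml => W; have /andP[_] := W (fun i => lt_le_trans (XB i) ss1).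
      by rewrite ltrBlDr addNr.
    have := Hs2 (X t - x0); set v := complex.Re _; set v' := complex.Re _.
    rewrite ltr_norml => W; have /andP[+ _] := W (fun i => lt_le_trans (XB i) ss2).
    by rewrite ltrBrDr addNr.
  - have [t tb pt] := nz (complexify x + a%:C *: basis_vec C j) b bp.
    exists t => //; rewrite /F XE addrAC; apply: contraNneq pt => h0.
    apply/eqP/complex_eqP => //.
    by rewrite kE -complexify_basis -complexifyZ -!complexifyD Imp.
(* Since [h] is constant along [k], it vanishes at [x + a e_j] for all [a] in an interval. Being a
   polynomial in one exponential along this line, up to a unit, it also vanishes at [x]. *)
have Lh := inv_ring_laurent h.
have [m /(_ (complexify x + l%:C *: basis_vec C j))[q Hq]] := laurent_on_line (delta_mx 0 j) Lh.
rewrite cvec_delta in Hq.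
have q0 : q = 0.
  apply: (poly_circle_eq0 (e := u - l)); first by rewrite subr_gt0.
  move=> t /andP[t0 tul].
  apply: (mulfI (invr_neq0 (expf_neq0 m (expC_neq0 ('i * t%:C))))).
  rewrite -Hq mulr0 -addrA -scalerDl -rmorphD.
  have [|y1 yb Fy] := Hlu (l + t); first by rewrite ltrDl t0 -ltrBrDl.
  rewrite -(inv_ring_inv h _ y1%:C) addrAC -XE -complexify_basis -complexifyZ -complexifyD.
  apply: H; last first.
    apply: complex_eqP; last by rewrite Imp.
    by rewrite complexifyD complexifyZ complexify_basis.
  move=> i; have := X0 y1 i yb; have -> : (X y1 + (l + t) *: basis_vec R j) 0 i - x0 0 i =
    (X y1 0 i - x0 0 i) + (l + t) * basis_vec R j 0 i by rewrite !mxE; ring.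
  have : `|(l + t) * basis_vec R j 0 i| <= r.
    rewrite mxE eqxx /=; case: (i == j); last by rewrite mulr0 normr0 ltW.
    rewrite mulr1 ler_norml; move: rl ur t0 tul; clear => rl ur t0 tul; apply/andP; split; lra.
  set v1 := _ * _; set v2 := _ - _ => h1 h2.
  apply: le_lt_trans (ler_normD _ _) _; move: h1 h2 sr r40 rp; clear; lra.
have := Hq (- l%:C); rewrite scaleNr addrK q0 horner0 mulr0; exact.
Qed.

End RealZeros.

(** * Divisibility by [p] *)

Section FermiDivides.
Variables (R : realType) (d : nat).
Local Notation C := R[i].
Local Notation Rd := 'rV[R]_d.
Local Notation Cd := 'rV[C]_d.
Local Notation Zd := 'rV[int]_d.
Implicit Types (k : Zd) (z w : Cd) (x y : Rd) (F G : Cd -> C).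

Lemma laurent_neq0_near F z : laurent_trig F -> F z != 0 ->
  exists2 r : R, 0 < r & forall y, (forall i, `|y 0 i| < r) -> F (z + complexify y) != 0.
Proof.
move=> LF Fz.
have : \forall w \near z, F w != 0 by exact: (cvgr_neq0 _ (@laurent_continuous R d F LF z) Fz).
case/nbhs_ballP => e /= e0 He; exists (complex.Re e).
  by move: e0; rewrite ltcE => /andP[].
by move=> y Hy; apply: He; exact: ball_complexify.
Qed.

Lemma poly_line_eq0 (q : {poly C}) (c : C) (b : R) : 0 < b -> c != 0 ->
  (forall t : R, 0 < t < b -> q.[expC ('i * t%:C) * c] = 0) -> q = 0.
Proof.
move=> b0 c0 H.
have : q \Po (c *: 'X) = 0.
  apply: (poly_circle_eq0 b0) => t tb.
  by rewrite horner_comp hornerZ hornerX mulrC H.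
move/eqP; rewrite comp_poly_eq0 ?size_scale ?size_polyX //.
by move/eqP.
Qed.

(** The real part of [- i F] is the imaginary part of [F], which is constant along real lines. *)
Lemma laurent_real_pd F j x : laurent_trig F ->
  (forall y, complex.Im (F (complexify y)) = 0) -> complex.Im (pd j F (complexify x)) = 0.
Proof.
move=> LF H.
have LG : laurent_trig (fun z => - 'i * F z) by exact: laurentZ.
have D := laurent_Re_is_derive (complexify x) j 0 LG.
have E0 : (fun t : R => complex.Re (- 'i * F (complexify x + t%:C *: basis_vec C j))) = cst 0.
  apply/funext => t; rewrite -complexify_basis -complexifyZ -complexifyD.
  by rewrite ReM /= H !(mulr0, oppr0, mul0r, subr0).
rewrite E0 in D; have := @derive_val _ _ _ _ _ _ _ D.
rewrite derive_cst pdZ // scale0r addr0 ReM /= oppr0 mul0r sub0r mulN1r opprK.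
by move=> <-.
Qed.

(** For the characteristic polynomial, this and [sng_set] unfold to [fermi_reg] and [fermi_sng]. *)
Definition reg_set F : set (ctorus R d) :=
  @ctorus_pi R d @` [set z | F z = 0 /\ ~ grad_vanishes F z].
Definition sng_set F : set (ctorus R d) :=
  @ctorus_pi R d @` [set z | F z = 0 /\ grad_vanishes F z].

Lemma closed_ctorus_zeros F : laurent_trig F ->
  closed [set t : ctorus R d | exists2 w, ctorus_pi w = t & F w = 0].
Proof.
move=> LF; rewrite -openC; set A := [set t | _].
suff : open (@ctorus_pi R d @^-1` (~` A)) by [].
have -> : @ctorus_pi R d @^-1` (~` A) = [set w | F w != 0].
  apply/seteqP; split=> w /=.
    by move=> nA; apply/eqP => Fw; apply: nA; exists w.
  by move=> Fw [w' /(laurent_ctorus LF) ->] /eqP; rewrite (negPf Fw).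
rewrite openE => w Fw.
exact: (cvgr_neq0 _ (laurent_continuous LF (x:=w)) Fw).
Qed.

Lemma grad_vanishesE F z : grad_vanishes F z <-> forall j, pd j F z = 0.
Proof. by []. Qed.

Lemma grad_vanishes_mul F G z : laurent_trig F -> laurent_trig G ->
  F z = 0 -> G z = 0 -> grad_vanishes (fun z => F z * G z) z.
Proof.
by move=> LF LG Fz Gz; apply/grad_vanishesE => j; rewrite pdM // Fz Gz mul0r mulr0 addr0.
Qed.

Lemma grad_vanishes_mull F G z : laurent_trig F -> laurent_trig G ->
  G z = 0 -> grad_vanishes G z -> grad_vanishes (fun z => F z * G z) z.
Proof.
move=> LF LG Gz dG; apply/grad_vanishesE => j; rewrite pdM // Gz mulr0 add0r.
by have /grad_vanishesE -> := dG; rewrite mulr0.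
Qed.

(** For [F = 0] every point is singular, and an arc of a coordinate circle would be a curve in a
    discrete set. *)
Lemma sng_discrete_neq0 (F : Cd -> C) (j1 : 'I_d) :
  discrete_subset (sng_set F) -> exists z, F z != 0.
Proof.
move=> dF; apply: contrapT => H.
have F0 : F = fun=> 0.
  by apply/funext => z; apply: contrapT => Fz; apply: H; exists z; apply/eqP.
apply: (@discrete_no_curve R d _ (fun s => ctorus_pi (s%:C *: basis_vec C j1)) 1 dF) => //.
  move=> s _; exists (s%:C *: basis_vec C j1) => //; split; first by rewrite F0.
  by apply/grad_vanishesE => j; rewrite F0 pd_cst.
move=> s t /andP[s0 s1] /andP[t0 t1] st.
apply: expCi_inj_small; rewrite ?(ltW s0) ?(ltW s1) ?(ltW t0) ?(ltW t1) //.
have := laurent_ctorus (laurent_character R (delta_mx 0 j1)) st.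
by rewrite -cvec_delta !character_cvec idot_deltar mxE !eqxx !mul1r.
Qed.

(** If [u] and [v] had a common factor [D] of positive degree, [D^2] would divide [P] and every zero
    of [D] off the exceptional set would be singular for [F]; but the zeros of [D] leave any
    discrete set. *)
Lemma sng_discrete_squarefree k (j0 j1 : 'I_d) (P : {poly inv_ring R k}) F U :
  k 0 j0 = 1 -> j1 != j0 -> P \is monic -> laurent_trig U ->
  (forall z, ev z P`_0 != 0) -> (forall z, F z = U z * peval j0 P z) ->
  discrete_subset (sng_set F) -> forall u v : {poly inv_ring R k}, u * v %| P -> coprimep u v.
Proof.
move=> k1 j10 mP LU P0 FE dF u v uvP.
apply: contraT => ncop; set D := gcdp u v.
have DP : D * D %| P.
  by apply: dvdp_trans uvP; rewrite dvdp_mul ?dvdp_gcdl ?dvdp_gcdr.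
(* Over a domain divisibility holds only up to a nonzero constant [c], so the curve of zeros is
   taken from where [c] does not vanish. *)
have /Pdiv.WeakIdomain.dvdpP[[c B] /= c0 PE] := DP.
have D0 : D != 0.
  apply: contraNneq c0 => h; move: PE; rewrite h mul0r mulr0 => /eqP.
  by rewrite scale_poly_eq0 (negPf (monic_neq0 mP)) orbF.
have sD : (1 < size D)%N.
  move: ncop; rewrite coprimep_def -/D neq_ltn; case/orP => //.
  by rewrite ltnS leqn0 size_poly_eq0 (negPf D0).
have [z0 cz0] := inv_ring_neq0 c0.
have [r r0 Hr] := laurent_neq0_near (inv_ring_laurent c) cz0.
have cE : c = lead_coef B * (lead_coef D * lead_coef D).
  by rewrite -!lead_coefM -PE lead_coefZ (monicP mP) mulr1.
have c0E : c * P`_0 = B`_0 * (D`_0 * D`_0).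
  by have := congr1 (fun q : {poly _} => q`_0) PE; rewrite coefZ !coef0M.
have cs (s : R) : 0 < s < r -> ev (z0 + s%:C *: basis_vec C j1) c != 0.
  move=> /andP[s0 sr]; rewrite -complexify_basis -complexifyZ; apply: Hr => i.
  rewrite !mxE; case: (_ && _); rewrite ?mulr1 ?mulr0 ?normr0 //.
  by rewrite gtr0_norm.
have [|s [t [st Dz nA]]] := @poly_zero_curve R d k j0 j1 D z0 r _ k1 j10 r0 sD dF.
  move=> s /cs h; split.
    by apply: contraNneq h => lD; rewrite cE !evM lD mulr0 mulr0.
  have : ev (z0 + s%:C *: basis_vec C j1) (c * P`_0) != 0.
    by rewrite evM mulf_neq0.
  by rewrite c0E; apply: contraNneq => lD; rewrite !evM lD mulr0 mulr0.
exfalso; apply: nA.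
set z := z0 + _ + _ in Dz *; exists z => //.
have cz : ev z c != 0 by rewrite ev_line; exact: cs.
have Pz : peval j0 P z = 0.
  apply: (mulfI cz); rewrite mulr0 -(pevalC j0) -pevalM mul_polyC PE !pevalM Dz.
  by rewrite mulr0 mulr0.
split; first by rewrite FE Pz mulr0.
have -> : F = fun z => U z * peval j0 P z by apply/funext => w; rewrite FE.
apply: grad_vanishes_mull => //; first exact: laurent_peval.
have Lc := inv_ring_laurent c; have LP := laurent_peval j0 P.
have LD := laurent_peval j0 D; have LB := laurent_peval j0 B.
have : grad_vanishes (fun z => ev z c * peval j0 P z) z.
  have -> : (fun z => ev z c * peval j0 P z) =
      fun z => peval j0 B z * (peval j0 D z * peval j0 D z).
    by apply/funext => w; rewrite -(pevalC j0) -!pevalM mul_polyC PE.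
  apply: grad_vanishes_mull => //; first exact: laurentM.
    by rewrite Dz mulr0.
  exact: grad_vanishes_mul.
move/grad_vanishesE => H; apply/grad_vanishesE => j.
have := H j; rewrite pdM // Pz mulr0 add0r => /eqP.
by rewrite mulf_eq0 (negPf cz) /= => /eqP.
Qed.

Lemma size_le1 (a b : nat) : (0 < a)%N -> (0 < b)%N -> ((a + b).-1 <= b)%N -> (a <= 1)%N.
Proof. lia. Qed.

(* [P = D' E] where [P] is [p] as a polynomial in one exponential and [D'] its
   gcd with [g].  A regular zero of [E] has a real point in its component, as
   [E = 0] and [D' = 0] are disjoint and closed there; near it all real zeros of
   [p] are zeros of both [E] and [g], so that their resultant vanishes. *)
Lemma fermi_divides (j0 j1 : 'I_d) (p g : Cd -> C) :
  (j0 : nat) = 0%N -> j1 != j0 -> laurent_trig p ->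
  (forall x, complex.Im (p (complexify x)) = 0) ->
  discrete_subset (sng_set p) ->
  (forall t, reg_set p t -> exists x,
     connected_component (reg_set p) t (ctorus_pi (complexify x))) ->
  laurent_trig g ->
  (forall x, p (complexify x) = 0 -> ~ grad_vanishes p (complexify x) ->
     g (complexify x) = 0) ->
  exists2 q, laurent_trig q & forall z, g z = q z * p z.
Proof.
move=> j00 j10 Lp Imp dS comp Lg gz.
have pn := sng_discrete_neq0 j1 dS.
have [k [k1 [P [U [mP [LU [V LV UV]] P0 PE]]]]] := laurent_monic j00 Lp pn.
have sq := sng_discrete_squarefree k1 j10 mP LU P0 PE dS.
have [G [m GE]] := laurent_peval_rep k1 Lg.
have Pn0 := monic_neq0 mP.
set D := gcdp P G.
have /Pdiv.WeakIdomain.dvdpP[[c E0] /= c0 PED] : D %| P by exact: dvdp_gcdl.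
(* The gcd is only defined up to constants of the domain. Gauss' lemma provides a monic associate,
   by which exact division is possible. *)
have [D' [mD' DD']] := inv_ring_gauss j00 mP c0 PED.
have D0 : D != 0 by rewrite gcdp_eq0 (negPf Pn0).
have DeD' : D %= D' by rewrite DD' eqp_scale // lead_coef_eq0.
have /(Pdiv.IdomainMonic.dvdpP mD')[E PE'] : D' %| P.
  by rewrite -(eqp_dvdl _ DeD') dvdp_gcdl.
have /(Pdiv.IdomainMonic.dvdpP mD')[Q GE'] : D' %| G.
  by rewrite -(eqp_dvdl _ DeD') dvdp_gcdr.
have mE : E \is monic.
  by move: mP; rewrite PE' !monicE lead_coefM (monicP mD') mulr1.
have [E1|sE] := eqVneq (size E) 1%N.
  have {}E1 : E = 1.
    have [e _ Ee] := size_poly1P _ (introT eqP E1).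
    by move: mE; rewrite Ee monicE lead_coefC => /eqP ->; exact: polyC1.
  exists (fun z => character (- (m%:Z *: delta_mx 0 j0)) z * (peval j0 Q z * V z)).
    apply: laurentM; first exact: laurent_character.
    by apply: laurentM => //; exact: laurent_peval.
  move=> z; rewrite PE characterN characterZ -exprnP.
  apply: (mulfI (expf_neq0 m (tvar_neq0 j0 z))); rewrite -GE GE' pevalM.
  rewrite PE' E1 mul1r.
  have -> : peval j0 Q z * peval j0 D' z = peval j0 Q z * peval j0 D' z * (U z * V z).
    by rewrite UV mulr1.
  by field; rewrite expf_neq0 // tvar_neq0.
have {}sE : (1 < size E)%N.
  by move: sE; rewrite neq_ltn; case/orP => //; rewrite ltnS leqn0 size_poly_eq0 (negPf (monic_neq0 mE)).
(* A common factor [f] of [E] and [G] is coprime to [D'], as [P = E D'] has no repeated factor. Then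
   [f D'] divides both [P] and [G], hence their gcd, and [f] is constant. *)
have cop : coprimep E G.
  apply/coprimepP => f fE fG.
  have cfD : coprimep f D'.
    by apply: sq; rewrite PE' dvdp_mul.
  have fP : f * D' %| P by rewrite PE' dvdp_mul.
  have dG : D' %| G by rewrite GE' dvdp_mull.
  have fDG : f * D' %| G by rewrite Gauss_dvdp // fG dG.
  have : f * D' %| D by rewrite dvdp_gcd fP fDG.
  rewrite (eqp_dvdr _ DeD').
  move/(dvdp_leq (monic_neq0 mD')).
  have f0 : f != 0 by apply: contraTneq fE => ->; rewrite dvd0p monic_neq0.
  rewrite (size_mul f0 (monic_neq0 mD')).
  have sf : (0 < size f)%N by rewrite size_poly_gt0.
  have sD' : (0 < size D')%N by rewrite size_poly_gt0 monic_neq0.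
  by move/(size_le1 sf sD') => f1; rewrite -size_poly_eq1 eqn_leq sf f1.
(* In the role of the resultant: a nonzero [h], constant along [k], in the ideal generated by [E]
   and [G]. *)
have /Bezout_coprimepP[[u v] /=] := cop.
rewrite -size_poly_eq1 => /size_poly1P[h h0 hE].
exfalso; move/eqP: h0; apply.
have E00 z : ev z E`_0 != 0.
  have := P0 z; rewrite PE' coef0M evM; apply: contraNneq => ->.
  by rewrite mul0r.
(* The zeros of [E] are not all in the discrete singular set, so one of them is a regular zero of
   [p]. *)
have [|s [t [_ Ez nS]]] := @poly_zero_curve R d k j0 j1 E 0 1 _ k1 j10 (@ltr01 R) sE dS.
  by move=> s _; split=> //; rewrite (monicP mE) rmorph1 oner_neq0.
set z := 0 + _ + _ in Ez nS.
have pz : p z = 0 by rewrite PE PE' pevalM Ez mul0r mulr0.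
have rz : reg_set p (ctorus_pi z).
  exists z => //; split=> // gv; apply: nS; by exists z.
have [x0 Yx0] := comp _ rz.
pose A (B : {poly inv_ring R k}) : set (ctorus R d) :=
  [set t | exists2 w, ctorus_pi w = t & peval j0 B w = 0].
have AE B w : A B (ctorus_pi w) -> peval j0 B w = 0.
  by case=> w' ww' <-; exact: laurent_ctorus (laurent_peval j0 B) (esym ww').
have clA B : closed (A B) by exact: closed_ctorus_zeros (laurent_peval j0 B).
have regE w : reg_set p (ctorus_pi w) -> p w = 0 /\ ~ grad_vanishes p w.
  case=> w' [pw' gw'] ww'; split; first by rewrite -(laurent_ctorus Lp ww').
  move=> gw; apply: gw'; apply/grad_vanishesE => j.
  by rewrite (laurent_ctorus (laurent_pd j Lp) ww'); move/grad_vanishesE: gw.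
have AED w : reg_set p (ctorus_pi w) -> ~ (peval j0 E w = 0 /\ peval j0 D' w = 0).
  move=> /regE[_ gw] [Ew Dw]; apply: gw.
  have -> : p = fun z => U z * (peval j0 E z * peval j0 D' z).
    by apply/funext => w'; rewrite PE PE' pevalM.
  have LE := laurent_peval j0 E; have LD := laurent_peval j0 D'.
  apply: grad_vanishes_mull => //; first exact: laurentM.
    by rewrite Ew mul0r.
  exact: grad_vanishes_mul.
set Y := connected_component (reg_set p) (ctorus_pi z) in Yx0.
have YS : Y `<=` reg_set p by exact: connected_component_sub.
have YE : Y `&` A E = Y.
  apply: (@component_connected _ (reg_set p) (ctorus_pi z)).
  - exists (ctorus_pi z); split; last by exists z.
    exact: connected_component_refl.
  - exists (~` A D'); first by rewrite openC.
    apply/seteqP; split=> t' [Yt At]; split=> //.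
      have [w wt] := ctorus_pi_surj t'; rewrite -wt in Yt At *.
      by move=> /AE Dw; apply: (AED w (YS _ Yt)); split=> //; exact: AE.
    have [w wt] := ctorus_pi_surj t'; rewrite -wt in Yt At *; exists w => //.
    have [pw _] := regE w (YS _ Yt).
    move: pw; rewrite PE PE' pevalM => /eqP; rewrite !mulf_eq0.
    have /negPf -> /= : U w != 0.
      by have := UV w; apply: contra_eqN => /eqP ->; rewrite mul0r eq_sym oner_eq0.
    case/orP => /eqP // Dw; exfalso; apply: At; by exists w.
  - by exists (A E).
have Ex0 : peval j0 E (complexify x0) = 0.
  by apply: AE; have : Y (ctorus_pi (complexify x0)) by []; rewrite -YE => -[].
have [px0 gx0] := regE _ (YS _ Yx0).
have Dx0 : peval j0 D' (complexify x0) != 0.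
  by apply/eqP => Dx0; apply: (AED _ (YS _ Yx0)).
have [j pj] : exists j, pd j p (complexify x0) != 0.
  apply: contrapT => H; apply: gx0; apply/grad_vanishesE => j.
  by apply: contrapT => Hj; apply: H; exists j; apply/eqP.
have [r1 r10 H1] := laurent_neq0_near (laurent_peval j0 D') Dx0.
have [r2 r20 H2] := laurent_neq0_near (laurent_pd j Lp) pj.
apply: (@inv_ring_zeros_near R d p k h x0 (Num.min r1 r2)) => //.
- by rewrite lt_min r10.
- exists j; apply: contraNneq pj => pj0; apply/eqP/complex_eqP => //.
  exact: laurent_real_pd.
(* The fibre polynomial of [P] is monic, hence nonzero, and cannot vanish on an arc. *)
- move=> w b b0; apply: contrapT => H.
  have : map_poly (ev w) P = 0.
    apply: (poly_line_eq0 b0 (tvar_neq0 j0 w)) => t0 /andP[t1 t2].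
    rewrite -(peval_line k1); apply: contrapT => Ht; apply: H; exists t0.
      by rewrite !ltW.
    rewrite PE; apply: mulf_neq0; last exact/eqP.
    by have := UV (w + t0%:C *: cvec R k); apply: contra_eqN => /eqP ->;
      rewrite mul0r eq_sym oner_eq0.
  by apply/eqP; rewrite monic_neq0 // monic_map.
move=> x Hx px.
have xE : complexify x = complexify x0 + complexify (x - x0) by rewrite -complexifyD subrKC.
have Hx1 i : `|(x - x0) 0 i| < r1.
  by have := Hx i; rewrite !mxE lt_min => /andP[].
have Hx2 i : `|(x - x0) 0 i| < r2.
  by have := Hx i; rewrite !mxE lt_min => /andP[].
have Ex : peval j0 E (complexify x) = 0.
  have /negPf Dx : peval j0 D' (complexify x) != 0 by rewrite xE; exact: H1.
  move: px; rewrite PE PE' pevalM => /eqP; rewrite !mulf_eq0 Dx orbF.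
  have /negPf -> /= : U (complexify x) != 0.
    by have := UV (complexify x); apply: contra_eqN => /eqP ->; rewrite mul0r eq_sym oner_eq0.
  by move/eqP.
have gx : g (complexify x) = 0.
  apply: (gz x px) => /grad_vanishesE gx.
  by have := H2 (x - x0) Hx2; rewrite -xE gx eqxx.
have Gx : peval j0 G (complexify x) = 0 by rewrite GE gx mulr0.
by rewrite -(pevalC j0) -hE pevalD !pevalM Ex Gx !mulr0 addr0.
Qed.

End FermiDivides.

(** * Ideals of trigonometric polynomials *)

Section Ideals.
Variables (R : realType) (d : nat).
Local Notation C := R[i].
Local Notation Cd := 'rV[C]_d.
Local Notation Zd := 'rV[int]_d.
Implicit Types (a b k : Zd) (z w : Cd) (F G H : Cd -> C) (J : (Cd -> C) -> Prop).

Definition laurent_ideal J := [/\ J (fun=> 0),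
  forall F G, J F -> J G -> J (fun z => F z + G z) &
  forall H F, laurent_trig H -> J F -> J (fun z => H z * F z)].

Lemma laurent_tvar j : laurent_trig (@tvar R d j).
Proof. exact: laurent_character. Qed.

Lemma ideal_sum J (I : Type) (r : seq I) (P : pred I) (F : I -> Cd -> C) :
  laurent_ideal J -> (forall i, P i -> J (F i)) ->
  J (fun z => \sum_(i <- r | P i) F i z).
Proof.
move=> [J0 JD _] JF; elim: r => [|i r IH]; first by under eq_fun do rewrite big_nil.
under eq_fun do rewrite big_cons; case Pi: (P i) => //.
by apply: JD => //; exact: JF.
Qed.

(** Exponents in the cube [[-N, N]^d], indexed by a finite type: for each [N] the coefficients live
    in a space of finite dimension. *)
Definition box_index N (f : {ffun 'I_d -> 'I_(N.*2.+1)}) : Zd :=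
  \row_j ((f j : nat)%:Z - N%:Z).

Lemma box_index_inj N : injective (@box_index N).
Proof.
move=> f g /rowP fg; apply/ffunP => j; apply/val_inj.
by have := fg j; rewrite !mxE => /addIr [].
Qed.

Lemma laurent_box F : laurent_trig F ->
  exists (N : nat) (c : {ffun 'I_d -> 'I_(N.*2.+1)} -> C),
    F = fun z => \sum_f c f * character (box_index f) z.
Proof.
case/laurent_reduced => A [c [uA _ FE]].
have [N HN] : exists N : nat, forall (a : Zd) (j : 'I_d), a \in A -> (`|a ord0 j|%N <= N)%N.
  exists (\sum_(a <- A) \sum_(j < d) `|a ord0 j|%N)%N => a j aA.
  rewrite (bigD1_seq a) //= (bigD1 j) //= -addnA; exact: leq_addr.
have AE : perm_eq A [seq box_index f | f <- enum {ffun 'I_d -> 'I_(N.*2.+1)} & box_index f \in A].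
  apply: uniq_perm => //.
    by rewrite (map_inj_uniq (@box_index_inj N)) filter_uniq ?enum_uniq.
  move=> a; apply/idP/mapP => [aA|[f]]; last by rewrite mem_filter => /andP[fA _] ->.
  pose f : {ffun 'I_d -> 'I_(N.*2.+1)} := [ffun j => inord `|(a ord0 j + N%:Z)%R|%N].
  have fE : a = box_index f.
    apply/rowP => j; have := HN a j aA; rewrite mxE ffunE; move: (a ord0 j) => x Hx.
    by rewrite inordK; lia.
  by exists f => //; rewrite mem_filter mem_enum -fE aA.
exists N, (fun f => if box_index f \in A then c (box_index f) else 0).
rewrite FE; apply/funext => z; rewrite (perm_big _ AE) big_map big_filter.
rewrite big_enum_cond big_mkcond; apply: eq_bigr => f _ /=.
by case: ifP => //; rewrite mul0r.
Qed.

(* More inverses than the dimension of the space containing them: a linear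
   relation between them gives the polynomial. *)
Lemma ideal_polynomial J W (S : set R) (c : R -> C) : laurent_ideal J ->
  laurent_trig W -> ~ countable S -> {in S &, injective c} ->
  (forall s, S s -> exists2 h, laurent_trig h & J (fun z => (W z - c s) * h z - 1)) ->
  exists2 r : {poly C}, r != 0 & J (fun z => r.[W z]).
Proof.
move=> IJ LW uS ci Hh; have [J0 JD JM] := IJ.
pose SN N : set R := [set s | S s /\ exists b : {ffun 'I_d -> 'I_(N.*2.+1)} -> C,
  J (fun z => (W z - c s) * (\sum_f b f * character (box_index f) z) - 1)].
(* There are countably many cubes and uncountably many parameters, so the inverses for uncountably
   many [s] have their exponents in a common cube. *)
have [N HN] : exists N, ~ countable (SN N).
  apply: contrapT => H; apply: uS.
  apply: (sub_countable (B := \bigcup_N SN N)).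
    apply: subset_card_le => s Ss; have [h Lh Jh] := Hh s Ss.
    by have [N [b hE]] := laurent_box Lh; exists N => //; split=> //; exists b; move: Jh; rewrite hE.
  by apply: bigcup_countable => // N _; apply: contrapT => HN; apply: H; exists N.
have iS : infinite_set (SN N).
  by move=> fS; apply: HN; exact: finite_set_countable.
pose T := {ffun 'I_d -> 'I_(N.*2.+1)}; pose n := #|T|.
have [s [si sS]] : exists s : 'I_n.+1 -> R, injective s /\ forall i, SN N (s i).
  have [B BS Bn] := infinite_set_fset n.+1 iS.
  have iB (i : 'I_n.+1) : (i < size (finmap.enum_fset B))%N by exact: leq_trans (ltn_ord i) Bn.
  exists (fun i : 'I_n.+1 => nth 0 (finmap.enum_fset B) i); split=> [i l /eqP|i].
    by rewrite nth_uniq ?finmap.fset_uniq // => /eqP /val_inj.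
  apply: BS => /=; exact: (mem_nth 0 (iB i)).
have /boolp.choice[b Hb] : forall i, exists b : T -> C,
    J (fun z => (W z - c (s i)) * (\sum_f b f * character (box_index f) z) - 1).
  by move=> i; have [_] := sS i.
pose M : 'M[C]_(n.+1, n) := \matrix_(i, j) b i (enum_val j).
have [v vM v0] : exists2 v : 'rV[C]_n.+1, v *m M = 0 & v != 0.
  have : ~~ row_free M by rewrite /row_free neq_ltn (leq_ltn_trans (rank_leq_col _)).
  rewrite -kermx_eq0 => /rowV0Pn[v vk v0]; exists v => //.
  exact/sub_kermxP.
pose q i : {poly C} := \prod_(l | l != i) ('X - (c (s l))%:P).
(* Nonzero because, at [c (s i)] with [v 0 i] nonzero, the term of index [i] is the only one that
   survives. *)
exists (\sum_i v 0 i *: q i).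
  have [i vi] : exists i, v 0 i != 0.
    apply: contrapT => H; move/eqP: v0; apply; apply/rowP => i; rewrite mxE.
    by apply: contrapT => Hi; apply: H; exists i; apply/eqP.
  apply: contraNneq vi => h; have := congr1 (fun r : {poly C} => r.[c (s i)]) h.
  rewrite horner0 horner_sum (bigD1 i) //= big1 ?addr0 => [|l li].
    rewrite hornerZ horner_prod => /eqP; rewrite mulf_eq0 => /orP[//|].
    move/prodf_eq0 => [l li]; rewrite hornerXsubC subr_eq0 => /eqP cil.
    have /si h2 : s i = s l by apply: ci; rewrite ?inE //; [have [] := sS i|have [] := sS l].
    by rewrite h2 eqxx in li.
  rewrite hornerZ horner_prod (bigD1 i) 1?eq_sym //= hornerXsubC subrr.
  by rewrite mul0r mulr0.
(* Modulo [J] the inverse [h_i] satisfies [Q(W) h_i = q_i(W)], hence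
   [sum v_i q_i(W) = Q(W) sum v_i h_i = 0]. The identity below writes this as an explicit
   combination of elements of [J]. *)
pose Q : {poly C} := \prod_l ('X - (c (s l))%:P).
have QE i : Q = ('X - (c (s i))%:P) * q i by rewrite /Q (bigD1 i).
pose hh i z := \sum_(f : T) b i f * character (box_index f) z.
have hh0 z : \sum_i v 0 i * hh i z = 0.
  under eq_bigr do rewrite mulr_sumr; rewrite exchange_big big1 // => f _ /=.
  have := congr1 (fun A : 'rV[C]_n => A 0 (enum_rank f)) vM; rewrite !mxE => h.
  transitivity ((\sum_i v 0 i * M i (enum_rank f)) * character (box_index f) z); last by rewrite h mul0r.
  rewrite mulr_suml; by apply: eq_bigr => i _; rewrite !mxE enum_rankK mulrA.
have -> : (fun z => (\sum_i v 0 i *: q i).[W z]) = fun z =>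
    \sum_i (- v 0 i * (q i).[W z]) * ((W z - c (s i)) * hh i z - 1).
  apply/funext => z; rewrite horner_sum.
  transitivity (\sum_i v 0 i * (q i).[W z] - Q.[W z] * \sum_i v 0 i * hh i z).
    by rewrite hh0 mulr0 subr0; apply: eq_bigr => i _; rewrite hornerZ.
  rewrite mulr_sumr -sumrB; apply: eq_bigr => i _.
  by rewrite (QE i) hornerM hornerXsubC; ring.
apply: (ideal_sum _ IJ) => i _; apply: JM; last exact: Hb.
by apply: laurentZ; exact: laurent_horner.
Qed.

Definition ideal_add J G : (Cd -> C) -> Prop := fun F =>
  exists F1 H1, [/\ J F1, laurent_trig H1 & F = fun z => F1 z + H1 z * G z].

Lemma ideal_add_ideal J G : laurent_ideal J -> laurent_ideal (ideal_add J G).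
Proof.
move=> [J0 JD JM]; split.
- exists (fun=> 0), (fun=> 0); split=> //; first exact: laurent_cst.
  by apply/funext => z; rewrite mul0r addr0.
- move=> F F' [F1 [H1 [JF1 LH1 ->]]] [F2 [H2 [JF2 LH2 ->]]].
  exists (fun z => F1 z + F2 z), (fun z => H1 z + H2 z); split; [exact: JD|exact: laurentD|].
  by apply/funext => z; ring.
- move=> H F LH [F1 [H1 [JF1 LH1 ->]]].
  exists (fun z => H z * F1 z), (fun z => H z * H1 z); split; [exact: JM|exact: laurentM|].
  by apply/funext => z; ring.
Qed.

Lemma ideal_add_sub J G F : J F -> ideal_add J G F.
Proof.
move=> JF; exists F, (fun=> 0); split=> //; first exact: laurent_cst.
by apply/funext => z; rewrite mul0r addr0.
Qed.

Lemma ideal_add_gen J G : laurent_ideal J -> ideal_add J G G.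
Proof.
move=> [J0 _ _]; exists (fun=> 0), (fun=> 1); split=> //; first exact: laurent_cst.
by apply/funext => z; rewrite add0r mul1r.
Qed.

Lemma ideal_add_inverse J W (c : C) : laurent_ideal J -> laurent_trig W ->
  ideal_add J (fun z => W z - c) (fun=> 1) ->
  exists2 h, laurent_trig h & J (fun z => (W z - c) * h z - 1).
Proof.
move=> [J0 JD JM] LW [F1 [H1 [JF1 LH1 E]]]; exists H1 => //.
have -> : (fun z => (W z - c) * H1 z - 1) = fun z => (-1) * F1 z.
  apply/funext => z; have := congr1 (fun F => F z) E => /= e.
  by rewrite -(addKr (H1 z * (W z - c)) (F1 z)) [_ + F1 z]addrC -e; ring.
by apply: JM => //; exact: laurent_cst.
Qed.

Lemma unit_interval_uncountable : ~ countable (`]0, 1[ : set R).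
Proof.
move=> cI; have := countable_lebesgue_measure0 cI; rewrite lebesgue_measure_itv /=.
by rewrite lte_fin ltr01 sube0 => /eqP; rewrite eqe oner_eq0.
Qed.

Lemma circle_inj : {in (`]0, 1[%classic : set R) &, injective (fun s : R => expC ('i * s%:C))}.
Proof.
move=> s t; rewrite !inE /= !in_itv /= => /andP[s0 s1] /andP[t0 t1].
by apply: expCi_inj_small; rewrite !ltW.
Qed.

(** Otherwise all [W - c] are invertible modulo [J], for uncountably many [c], so [J] contains a
    nonzero polynomial in [W]. Cancelling its linear factors puts [1] in [J]. This is the proof of
    the Nullstellensatz over an uncountable field. *)
Lemma ideal_extend J W : laurent_ideal J -> laurent_trig W -> ~ J (fun=> 1) ->
  exists c, ~ ideal_add J (fun z => W z - c) (fun=> 1).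
Proof.
move=> IJ LW J1; have [J0 JD JM] := IJ; apply: contrapT => H.
have {}H c : exists2 h, laurent_trig h & J (fun z => (W z - c) * h z - 1).
  by apply: ideal_add_inverse => //; apply: contrapT => Hc; apply: H; exists c.
have [r r0 Jr] := ideal_polynomial IJ LW unit_interval_uncountable circle_inj (fun s _ => H _).
have [rs rE] := closed_field_poly_normal r.
have {}Jr : J (fun z => \prod_(c <- rs) (W z - c)).
  have -> : (fun z => \prod_(c <- rs) (W z - c)) = fun z => (lead_coef r)^-1 * r.[W z].
    apply/funext => z; rewrite {2}rE hornerZ mulKf ?lead_coef_eq0 // horner_prod.
    by apply: eq_bigr => c _; rewrite hornerXsubC.
  by apply: JM => //; exact: laurent_cst.
apply: J1; elim: rs Jr {rE} => [|c rs IH]; first by under eq_fun do rewrite big_nil.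
under eq_fun do rewrite big_cons; move=> Jc; apply: IH.
have [h Lh Jh] := H c.
have LP : laurent_trig (fun z => \prod_(c <- rs) (W z - c)).
  by apply: laurent_prod => c'; apply: laurentB => //; exact: laurent_cst.
have -> : (fun z => \prod_(c <- rs) (W z - c)) = fun z =>
    h z * ((W z - c) * \prod_(c <- rs) (W z - c)) +
    (- \prod_(c <- rs) (W z - c)) * ((W z - c) * h z - 1).
  by apply/funext => z; ring.
by apply: JD; apply: JM => //; exact: laurentN.
Qed.

Lemma ideal_extend_vars J (js : seq 'I_d) : laurent_ideal J -> ~ J (fun=> 1) ->
  exists J' : (Cd -> C) -> Prop, [/\ laurent_ideal J', ~ J' (fun=> 1),
    forall F, J F -> J' F & forall j, j \in js -> exists c, J' (fun z => tvar j z - c)].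
Proof.
elim: js J => [|j js IH] J IJ J1; first by exists J; split.
have [c Hc] := ideal_extend IJ (laurent_tvar j) J1.
have [J' [IJ' J'1 JJ' H]] := IH _ (ideal_add_ideal _ IJ) Hc.
exists J'; split=> // [F JF|l]; first by apply: JJ'; exact: ideal_add_sub.
rewrite inE => /predU1P[->|/H //]; exists c.
by apply: JJ'; exact: ideal_add_gen.
Qed.

(** Weak Nullstellensatz. Adjoin some [tvar j - c j] for every [j] without reaching [1]. The [c j]
    are nonzero because [tvar j] is a unit, so they are the exponentials of a point [z], and every
    [F] is congruent to [F z]. *)
Lemma ideal_zero J : laurent_ideal J -> ~ J (fun=> 1) ->
  exists z, forall F, laurent_trig F -> J F -> F z = 0.
Proof.
move=> IJ J1.
have [J' [IJ' J'1 JJ' H]] := ideal_extend_vars (enum 'I_d) IJ J1.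
have [J0 JD JM] := IJ'.
have /boolp.choice[c Hc] : forall j, exists c, J' (fun z => tvar j z - c).
  by move=> j; apply: H; rewrite mem_enum.
have c0 j : c j != 0.
  apply/eqP => cj; apply: J'1.
  have -> : (fun=> 1) = fun z => character (- delta_mx 0 j) z * (tvar j z - c j) :> C.
    by apply/funext => z; rewrite cj subr0 characterN mulVf // character_neq0.
  by apply: JM => //; exact: laurent_character.
have /boolp.choice[t Ht] : forall j, exists t, expC ('i * t) = c j.
  by move=> j; exact: expCi_surj.
pose z := \row_j t j : Cd; exists z.
have Jd j : J' (fun w => character (delta_mx 0 j) w - character (delta_mx 0 j) z).
  have -> : character (delta_mx 0 j) z = c j; last exact: Hc.
  have := character_cvec (delta_mx 0 j) (delta_mx 0 j : Zd) (t j).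
  rewrite idot_delta mxE !eqxx mul1r Ht => <-.
  rewrite !characterE; apply: eq_bigr => i _; rewrite cvec_delta !mxE eqxx /=.
  have [->|ij] := eqVneq i j; first by rewrite mulr1.
  by rewrite !mulr0n !expr0z.
have JDa a b : J' (fun w => character a w - character a z) ->
    J' (fun w => character b w - character b z) ->
    J' (fun w => character (a + b) w - character (a + b) z).
  move=> Ja Jb.
  have -> : (fun w => character (a + b) w - character (a + b) z) = fun w =>
      character a w * (character b w - character b z) +
      character b z * (character a w - character a z).
    by apply/funext => w; rewrite !characterD; ring.
  apply: JD; first by apply: JM => //; exact: laurent_character.
  by apply: JM => //; exact: laurent_cst.
have JNa a : J' (fun w => character a w - character a z) ->
    J' (fun w => character (- a) w - character (- a) z).
  move=> Ja.
  have -> : (fun w => character (- a) w - character (- a) z) = fun w =>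
      (- character (- a) z * character (- a) w) * (character a w - character a z).
    apply/funext => w; rewrite !characterN.
    by field; rewrite !character_neq0.
  by apply: JM => //; exact: laurent_mono.
have J0a : J' (fun w => character 0 w - character 0 z).
  by under eq_fun do rewrite !character0 subrr.
have Jall a : J' (fun w => character a w - character a z).
  (* Congruence of a character to its value at [z] passes to sums and opposites of exponents, so it
     follows from the basis exponents. *)
  have -> : a = \sum_(j < d) a 0 j *: delta_mx 0 j.
    by rewrite [LHS]row_sum_delta.
  elim/big_rec: _ => // j b _ Jb; apply: (JDa) => //.
  have JN (n : nat) : J' (fun w => character (n%:Z *: delta_mx 0 j) w -
      character (n%:Z *: delta_mx 0 j) z).
    elim: n => [|n IH]; first by rewrite scale0r.
    by rewrite intS scalerDl scale1r; exact: (JDa).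
  case: (a 0 j) => n; first exact: JN.
  by rewrite NegzE scaleNr; apply: (JNa); exact: JN.
have JF F : laurent_trig F -> J' (fun w => F w - F z).
  move: F; apply: laurent_ind => [|b a|F G _ _ IH IH'].
  - by under eq_fun do rewrite subrr.
  - under eq_fun do rewrite -mulrBr; apply: (JM) => //; exact: laurent_cst.
  - have -> : (fun w => F w + G w - (F z + G z)) = fun w => (F w - F z) + (G w - G z).
      by apply/funext => w; ring.
    exact: JD.
move=> F LF /JJ' JFw; apply: contrapT => /eqP Fz; apply: J'1.
have -> : (fun=> 1) = fun w => (F z)^-1 * (F w + (-1) * (F w - F z)) :> C.
  by apply/funext => w; field.
apply: (JM); first exact: laurent_cst.
apply: (JD) => //; apply: (JM); [exact: laurent_cst|exact: JF].
Qed.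

(* Uncountably many values [c] on the unit circle are not coordinates of zeros,
   and for each of them [tvar j - c] is invertible modulo [J]. *)
Lemma ideal_discrete_zeros J (A : set (ctorus R d)) j : laurent_ideal J ->
  discrete_subset A ->
  (forall z, (forall F, laurent_trig F -> J F -> F z = 0) -> A (ctorus_pi z)) ->
  exists2 r : {poly C}, r != 0 & J (fun z => r.[tvar j z]).
Proof.
move=> IJ /discrete_countable cA HA; apply: contrapT => Hr.
pose c (s : R) := expC ('i * s%:C) : C.
pose S : set R := [set s | `]0, 1[%classic s /\
  exists2 h, laurent_trig h & J (fun z => (tvar j z - c s) * h z - 1)].
have cS : countable S.
  apply: contrapT => uS; apply: Hr; apply: (ideal_polynomial IJ (laurent_tvar j) uS (c := c)).
    by move=> s t; rewrite !inE => -[Ss _] [St _]; apply: circle_inj; rewrite inE.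
  by move=> s [].
pose S' : set R := `]0, 1[%classic `\` S.
have cS' : countable S'.
  have /boolp.choice[z Hz] : forall s, exists z : Cd, S' s ->
      A (ctorus_pi z) /\ tvar j z = c s.
    move=> s; have [Ss|nS] := pselect (S' s); last by exists 0.
    have [z Hz] : exists z, forall F, laurent_trig F ->
        ideal_add J (fun z => tvar j z - c s) F -> F z = 0.
      apply: ideal_zero; first exact: ideal_add_ideal.
      move=> H1; have [sI nSs] := Ss; apply: nSs; split=> //.
      by apply: ideal_add_inverse => //; exact: laurent_tvar.
    exists z => _; split.
      by apply: HA => F LF JF; apply: Hz => //; exact: ideal_add_sub.
    apply/eqP; rewrite -subr_eq0; apply/eqP; apply: (Hz (fun z => tvar j z - c s)).
      by apply: laurentB; [exact: laurent_tvar|exact: laurent_cst].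
    exact: ideal_add_gen.
  move/countable_injP: cA => [g gi]; apply/countable_injP.
  exists (fun s => g (ctorus_pi (z s))) => s t; rewrite !inE => Ss St.
  have [As ws] := Hz s Ss; have [At wt] := Hz t St.
  move/gi; rewrite !inE => /(_ As At) st.
  apply: circle_inj; rewrite ?inE; [by case: Ss|by case: St|].
  rewrite -/(c s) -/(c t) -ws -wt.
  exact: laurent_ctorus (laurent_tvar j) st.
apply: unit_interval_uncountable.
apply: (sub_countable (B := S `|` S')); last first.
  by rewrite -bigcup2E; apply: bigcup_countable => // -[|[|i]] _ //=; exact: countable0.
apply: subset_card_le => s sI; have [Ss|nS] := pselect (S s); [by left|by right].
Qed.

(** Strip the linear factors of [r] one at a time. As long as the current factor does not annihilate
    the functional, it is absorbed into the multiplier; this must stop before the functional becomes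
    zero. *)
Lemma eigenfunctional (v : (Cd -> C) -> C) j (r : {poly C}) (phi : Cd -> C) : r != 0 ->
  laurent_trig phi -> v phi != 0 ->
  (forall (a : C) F, laurent_trig F -> v (fun z => a * F z) = a * v F) ->
  (forall F, laurent_trig F -> v (fun z => r.[tvar j z] * F z) = 0) ->
  exists Q c, [/\ laurent_trig Q, v Q != 0 &
    forall F, laurent_trig F -> v (fun z => (tvar j z - c) * (Q z * F z)) = 0].
Proof.
move=> r0 Lphi vphi vZ vr; have [rs rE] := closed_field_poly_normal r.
have : forall F, laurent_trig F -> v (fun z => \prod_(c <- rs) (tvar j z - c) * (phi z * F z)) = 0.
  move=> F LF; have LpF : laurent_trig (fun z => phi z * F z) by exact: laurentM.
  have := vr (fun z => (lead_coef r)^-1 * (phi z * F z)) (laurentZ _ LpF).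
  congr (v _ = 0); apply/funext => z; rewrite {1}rE hornerZ horner_prod.
  rewrite (eq_bigr (fun c => tvar j z - c)); last by move=> c _; rewrite hornerXsubC.
  by field; rewrite lead_coef_eq0.
elim: rs phi Lphi vphi {rE} => [|c rs IH] phi Lphi vphi H.
  have := H (fun=> 1) (laurent_cst d 1).
  rewrite (_ : (fun z => _) = phi) => [h|]; first by rewrite h eqxx in vphi.
  by apply/funext => z; rewrite big_nil mul1r mulr1.
have [H1|] := pselect (forall F, laurent_trig F -> v (fun z => (tvar j z - c) * (phi z * F z)) = 0).
  by exists phi, c.
move/existsNP => [F /not_implyP[LF /eqP vF]].
apply: (IH (fun z => (tvar j z - c) * (phi z * F z))) => //.
  apply: laurentM; last exact: laurentM.
  by apply: laurentB; [exact: laurent_tvar|exact: laurent_cst].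
move=> G LG; have := H (fun z => F z * G z) (laurentM LF LG).
by congr (v _ = 0); apply/funext => z; rewrite big_cons; ring.
Qed.

End Ideals.

(** * Means over the real torus *)

Section Mean.
Variables (R : realType) (d : nat).
Local Notation C := R[i].
Local Notation Rd := 'rV[R]_d.
Local Notation Cd := 'rV[C]_d.
Local Notation Zd := 'rV[int]_d.
Implicit Types (a b : Zd) (x y : Rd) (F : Cd -> C) (G H : Rd -> C) (M : nat).

Definition grid_point M (k : {ffun 'I_d -> 'I_M}) : Rd :=
  \row_j (2 * pi * (k j)%:R / M%:R).

Definition avg M y G : C :=
  (M%:R ^- d) * \sum_(k : {ffun 'I_d -> 'I_M}) G (y + grid_point k).

(** Grid averages of a trigonometric polynomial are eventually constant, so its mean is an exact
    value of them. The threshold is uniform in the base point [y], which can be placed where a bound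
    needs it. *)
Definition is_mean G (m : C) :=
  exists M0, forall M y, (M0 < M)%N -> avg M y G = m.

Definition mean G : C := xget 0 (is_mean G).

Definition real_trig G := exists2 F, laurent_trig F & forall x, G x = F (complexify x).

Lemma is_mean_unique G m n : is_mean G m -> is_mean G n -> m = n.
Proof.
move=> [M0 HM] [N0 HN]; rewrite -(HM (maxn M0 N0).+1 0) ?ltnS ?leq_maxl //.
by rewrite HN // ltnS leq_maxr.
Qed.

Lemma meanE G m : is_mean G m -> mean G = m.
Proof. by move=> Gm; apply: is_mean_unique (Gm); exact: xgetPex (ex_intro _ m Gm). Qed.

Lemma avgD M y G H : avg M y (fun x => G x + H x) = avg M y G + avg M y H.
Proof. by rewrite /avg big_split mulrDr. Qed.

Lemma avgZ M y (c : C) G : avg M y (fun x => c * G x) = c * avg M y G.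
Proof. by rewrite /avg -mulr_sumr mulrCA. Qed.

Lemma avg_cst M y (c : C) : (0 < M)%N -> avg M y (fun=> c) = c.
Proof.
move=> M0; rewrite /avg sumr_const card_ffun !card_ord -[c *+ _]mulr_natl natrX mulKf //.
by rewrite expf_neq0 // pnatr_eq0 -lt0n.
Qed.

Lemma Re_avg M y G :
  complex.Re (avg M y G) = M%:R ^- d * \sum_(k : {ffun 'I_d -> 'I_M}) complex.Re (G (y + grid_point k)).
Proof.
rewrite /avg (_ : (M%:R ^- d : C) = (M%:R ^- d : R)%:C); last first.
  by rewrite fmorphV rmorphXn /= rmorph_nat.
by rewrite Re_realM Re_sum.
Qed.

Lemma Re_avg_le M y G H : (forall x, complex.Re (G x) <= complex.Re (H x)) ->
  complex.Re (avg M y G) <= complex.Re (avg M y H).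
Proof.
move=> GH; rewrite !Re_avg ler_wpM2l ?invr_ge0 ?exprn_ge0 //.
by apply: ler_sum => k _.
Qed.

Lemma cmod_avg_le M y G (B : R) : (0 < M)%N -> (forall x, cmod (G x) <= B) ->
  cmod (avg M y G) <= B.
Proof.
move=> M0 GB; rewrite /avg cmodM cmodV cmodX.
have -> : cmod (M%:R : C) = M%:R by rewrite -(rmorph_nat (real_complex R)) cmodR ger0_norm.
have MM : 0 < M%:R ^+ d :> R by rewrite exprn_gt0 // ltr0n.
rewrite -ler_pdivlMl ?invr_gt0 // invrK.
apply: (le_trans (cmod_sum _ _ _)).
apply: (le_trans (ler_sum _ (fun k _ => GB _))).
by rewrite sumr_const card_ffun !card_ord -[B *+ _]mulr_natl natrX.
Qed.

Lemma is_meanD G H m n : is_mean G m -> is_mean H n -> is_mean (fun x => G x + H x) (m + n).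
Proof.
move=> [M0 HM] [N0 HN]; exists (maxn M0 N0) => M y; rewrite gtn_max => /andP[hM hN].
by rewrite avgD HM // HN.
Qed.

Lemma is_meanZ (c : C) G m : is_mean G m -> is_mean (fun x => c * G x) (c * m).
Proof. by move=> [M0 HM]; exists M0 => M y hM; rewrite avgZ HM. Qed.

Lemma is_mean_cst (c : C) : is_mean (fun=> c) c.
Proof. by exists 0%N => M y hM; exact: avg_cst. Qed.

Lemma expCi_neq1 (t : R) : 0 < t < pi -> expC ('i * (t *+ 2)%:C) != 1.
Proof.
move=> /andP[t0 tpi]; rewrite expCi; apply/negP => /eqP [].
rewrite cos_mulr2n => ct _; have : 0 < sin t by apply: sin_gt0_pi; rewrite t0.
suff -> : sin t = 0 by rewrite ltxx.
by apply/eqP; rewrite -sqrf_eq0 sin2cos2; apply/eqP; lra.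
Qed.

Lemma root_neq1 M (n : int) : n != 0 -> (`|n|%N < M)%N ->
  expC ('i * (2 * pi / M%:R)%:C) ^ n != 1 :> C.
Proof.
move=> n0 nM.
have pos (k : nat) : (0 < k < M)%N -> expC ('i * (2 * pi / M%:R)%:C) ^+ k != 1 :> C.
  move=> /andP[k0 kM].
  rewrite -expC_nat (_ : k%:R * _ = 'i * ((pi * k%:R / M%:R) *+ 2)%:C).
    have M0 : 0 < M%:R :> R by rewrite ltr0n (leq_ltn_trans _ kM).
    apply: expCi_neq1; rewrite divr_gt0 // ?mulr_gt0 ?pi_gt0 ?ltr0n //=.
    by rewrite ltr_pdivrMr // ltr_pM2l ?pi_gt0 // ltr_nat.
  rewrite mulrCA; congr (_ * _); rewrite -(rmorph_nat (real_complex R)) -rmorphM /=; congr _%:C.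
  rewrite -mulr_natr; ring.
case: n n0 nM => n n0 nM; first by apply: pos; rewrite nM andbT lt0n.
by rewrite NegzE -exprnN invr_eq1; apply: pos; rewrite /= nM.
Qed.

Lemma character_grid M a (k : {ffun 'I_d -> 'I_M}) :
  character a (complexify (grid_point k)) =
  \prod_j (expC ('i * (2 * pi / M%:R)%:C) ^ (a 0 j)) ^+ (k j).
Proof.
rewrite characterE; apply: eq_bigr => j _; rewrite complexifyE mxE.
rewrite (_ : 'i * _ = (k j)%:R * ('i * (2 * pi / M%:R)%:C)).
  by rewrite expC_nat !exprnP exprzAC.
rewrite mulrCA -(rmorph_nat (real_complex R)) -rmorphM /=; congr (_ * _%:C); ring.
Qed.

(** Once [M] exceeds the entries of [a], some nonzero entry gives a nontrivial [M]-th root of unity,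
    whose geometric sum vanishes. *)
Lemma is_mean_character a : is_mean (fun x => character a (complexify x)) (a == 0)%:R.
Proof.
exists (\sum_j `|a ord0 j|%N)%N => M y hM.
have aM j : (`|a ord0 j|%N < M)%N.
  by apply: leq_ltn_trans hM; rewrite (bigD1 j) //= leq_addr.
case: eqVneq => [->|a0].
  by under [X in avg _ _ X]eq_fun do rewrite character0; apply: avg_cst; case: M hM {aM}.
have [j aj] : exists j, a 0 j != 0.
  apply: contrapT => h; move/eqP: a0; apply; apply/rowP => j; rewrite mxE.
  by apply: contrapT => aj; apply: h; exists j; apply/eqP.
rewrite /avg; under eq_bigr do rewrite complexifyD character_addr character_grid.
rewrite -mulr_sumr; pose om j : C := expC ('i * (2 * pi / M%:R)%:C) ^ (a 0 j).
suff -> : \sum_(k : {ffun 'I_d -> 'I_M}) \prod_i om i ^+ k i = 0 by rewrite !mulr0.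
rewrite -(bigA_distr_bigA (fun i (t : 'I_M) => om i ^+ t)) (bigD1 j) //=.
suff -> : \sum_(t < M) om j ^+ t = 0 by rewrite mul0r.
have := subrX1 (om j) M; rewrite (_ : om j ^+ M = 1).
  move/esym/eqP; rewrite subrr mulf_eq0 subr_eq0 (negPf (root_neq1 aj (aM j))) /= => /eqP.
  by [].
rewrite /om exprnP exprzAC -exprnP -expC_nat mulrCA -(rmorph_nat (real_complex R)) -rmorphM /=.
rewrite (_ : M%:R * (2 * pi / M%:R) = 2 * pi * (1 : int)%:~R :> R).
  by rewrite expC_2pi exp1rz.
by rewrite mulr1 mulrC divfK // pnatr_eq0; case: M hM {aM om}.
Qed.

Lemma real_trig_is_mean G : real_trig G -> exists m, is_mean G m.
Proof.
move=> [F LF /funext ->]; elim/laurent_ind: F / LF => [|c a|F F' _ _ [m Fm] [n Fn]].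
- by exists 0; exact: is_mean_cst.
- by exists (c * (a == 0)%:R); apply: is_meanZ; exact: is_mean_character.
- by exists (m + n); exact: is_meanD.
Qed.

Lemma meanP G : real_trig G -> is_mean G (mean G).
Proof. by case/real_trig_is_mean => m Gm; rewrite (meanE Gm). Qed.

Lemma meanD G H : real_trig G -> real_trig H -> mean (fun x => G x + H x) = mean G + mean H.
Proof. by move=> tG tH; apply: meanE; apply: is_meanD; exact: meanP. Qed.

Lemma meanZ (c : C) G : real_trig G -> mean (fun x => c * G x) = c * mean G.
Proof. by move=> tG; apply: meanE; apply: is_meanZ; exact: meanP. Qed.

Lemma mean_cst (c : C) : mean (fun=> c) = c.
Proof. exact/meanE/is_mean_cst. Qed.

Lemma mean_character a : mean (fun x => character a (complexify x)) = (a == 0)%:R.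
Proof. exact/meanE/is_mean_character. Qed.

Lemma real_trig_laurent F : laurent_trig F -> real_trig (fun x => F (complexify x)).
Proof. by move=> LF; exists F. Qed.

Lemma real_trigD G H : real_trig G -> real_trig H -> real_trig (fun x => G x + H x).
Proof.
move=> [F LF FE] [F' LF' FE']; exists (fun z => F z + F' z); first exact: laurentD.
by move=> x; rewrite FE FE'.
Qed.

Lemma real_trigM G H : real_trig G -> real_trig H -> real_trig (fun x => G x * H x).
Proof.
move=> [F LF FE] [F' LF' FE']; exists (fun z => F z * F' z); first exact: laurentM.
by move=> x; rewrite FE FE'.
Qed.

Lemma real_trigJ G : real_trig G -> real_trig (fun x => conjc (G x)).
Proof.
move=> [F LF FE]; have [F' LF' FE'] := laurent_conj LF.
by exists F' => // x; rewrite FE FE'.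
Qed.

Lemma real_trig_cst (c : C) : real_trig (fun=> c).
Proof. by exists (fun=> c) => //; exact: laurent_cst. Qed.

Lemma real_trig_sum (I : Type) (r : seq I) (P : pred I) (G : I -> Rd -> C) :
  (forall i, real_trig (G i)) -> real_trig (fun x => \sum_(i <- r | P i) G i x).
Proof.
move=> tG; elim: r => [|i r IH].
  by under eq_fun do rewrite big_nil; exact: real_trig_cst.
by under eq_fun do rewrite big_cons; case: (P i) => //; exact: real_trigD.
Qed.

Lemma mean_sum (I : Type) (r : seq I) (P : pred I) (G : I -> Rd -> C) :
  (forall i, real_trig (G i)) ->
  mean (fun x => \sum_(i <- r | P i) G i x) = \sum_(i <- r | P i) mean (G i).
Proof.
move=> tG; elim: r => [|i r IH].
  by rewrite big_nil -[RHS](mean_cst 0); congr mean; apply/funext => x; rewrite big_nil.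
rewrite big_cons -IH; case Pi : (P i); last first.
  by congr mean; apply/funext => x; rewrite big_cons Pi.
rewrite -meanD //; last exact: real_trig_sum.
by congr mean; apply/funext => x; rewrite big_cons Pi.
Qed.

Lemma Re_mean_le G H : real_trig G -> real_trig H ->
  (forall x, complex.Re (G x) <= complex.Re (H x)) -> complex.Re (mean G) <= complex.Re (mean H).
Proof.
move=> /meanP[M HM] /meanP[N HN] GH.
rewrite -(HM (maxn M N).+1 0) ?ltnS ?leq_maxl // -(HN (maxn M N).+1 0) ?ltnS ?leq_maxr //.
exact: Re_avg_le.
Qed.

Lemma cmod_mean_le G (B : R) : real_trig G -> (forall x, cmod (G x) <= B) -> cmod (mean G) <= B.
Proof. by move=> /meanP[M HM] GB; rewrite -(HM M.+1 0) //; exact: cmod_avg_le. Qed.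

(** Differentiation kills the constant term. Applied to products, this is integration by parts on
    the torus. *)
Lemma mean_pd j F : laurent_trig F -> mean (fun x => pd j F (complexify x)) = 0.
Proof.
move: F; apply: laurent_ind => [|c a|F F' LF LF' h h'].
- by rewrite pd_cst mean_cst.
- rewrite pd_mono meanZ; last by apply: real_trig_laurent; exact: laurent_character.
  rewrite mean_character; case: eqVneq => [->|_]; last by rewrite mulr0.
  by rewrite mxE mulr0 mulr0 mul0r.
- have t (G : Cd -> C) : laurent_trig G -> real_trig (fun x => pd j G (complexify x)).
    by move=> LG; exact/real_trig_laurent/laurent_pd.
  have -> : pd j (fun z => F z + F' z) = fun z => pd j F z + pd j F' z by exact: pdD.
  exact: etrans (meanD (t _ LF) (t _ LF')) (etrans (congr2 +%R h h') (addr0 0)).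
Qed.

Lemma laurent_bounded F : laurent_trig F -> exists2 B : R, 0 <= B & forall x, cmod (F (complexify x)) <= B.
Proof.
move: F; apply: laurent_ind => [|c a|F F' LF LF' [B B0 h] [B' B'0 h']].
- by exists 0 => // x; rewrite cmod0.
- by exists (cmod c); [exact: cmod_ge0|move=> x; rewrite cmodM cmod_character mulr1].
- exists (B + B'); first exact: addr_ge0.
  by move=> x; apply: (le_trans (cmodD _ _)); exact: lerD.
Qed.

Lemma conjc_sum (I : Type) (r : seq I) (P : pred I) (f : I -> C) :
  conjc (\sum_(i <- r | P i) f i) = \sum_(i <- r | P i) conjc (f i).
Proof.
apply: (big_morph (@conjc R)) => [z w|]; first exact: conjcD.
by apply: complex_eqP => /=; rewrite ?oppr0.
Qed.

(** The squared [L^2] norm on the real torus for the normalised measure. *)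
Definition msq F : R := complex.Re (mean (fun x => F (complexify x) * conjc (F (complexify x)))).

Lemma parseval (A : seq Zd) (c : Zd -> C) : uniq A ->
  msq (fun z => \sum_(a <- A) c a * character a z) = \sum_(a <- A) cmod (c a) ^+ 2.
Proof.
move=> uA; rewrite /msq.
have -> : (fun x => (\sum_(a <- A) c a * character a (complexify x)) *
   conjc (\sum_(a <- A) c a * character a (complexify x))) = fun x =>
   \sum_(a <- A) \sum_(b <- A) (c a * conjc (c b)) * character (a - b) (complexify x).
  apply/funext => x; rewrite mulr_suml; apply: eq_bigr => a _.
  rewrite conjc_sum mulr_sumr; apply: eq_bigr => b _.
  by rewrite conjcM characterJ characterD; ring.
have tc a (t : C) : real_trig (fun x => t * character a (complexify x)).
  by apply: (@real_trig_laurent (fun z => t * character a z)); exact: laurent_mono.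
rewrite mean_sum; last by move=> a; apply: real_trig_sum => b; exact: tc.
rewrite Re_sum; rewrite big_seq [RHS]big_seq; apply: eq_bigr => a aA.
rewrite mean_sum; last by move=> b; exact: tc.
rewrite (bigD1_seq a) //= big1 ?addr0 => [|b ba].
  rewrite meanZ; last by apply: real_trig_laurent; exact: laurent_character.
  by rewrite mean_character subrr eqxx mulr1 mulJ_cmod.
rewrite meanZ; last by apply: real_trig_laurent; exact: laurent_character.
by rewrite mean_character subr_eq0 eq_sym (negPf ba) mulr0.
Qed.

End Mean.

(** * Polynomial kernels *)

Section Kernels.
Variable R : realType.
Implicit Types (q : {poly R}) (t X c : R).

Lemma poly_antiderivative q : exists K : {poly R}, K^`() = q /\ K.[0] = 0.
Proof.
exists (\poly_(i < (size q).+1) (q`_i.-1 / i%:R)); split; last by rewrite horner_coef0 coef_poly /= invr0 mulr0.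
apply/polyP => i; rewrite coef_deriv coef_poly ltnS; case: ltnP => iq.
  by rewrite -[_ *+ i.+1]mulr_natr divfK ?pnatr_eq0.
by rewrite mul0rn nth_default.
Qed.

Lemma sq_le1 t : `|t| <= 1 -> t ^+ 2 <= 1.
Proof. by move=> t1; rewrite -real_normK ?num_real // exprn_ile1. Qed.

(** Comparison with [- (2 c / X) / (1 + X s)], whose derivative [2 c / (1 + X s)^2] dominates [q]
    because [(1 + X s)^2 <= 2 (1 + X^2 s^2)]. It does the work of an arctangent. *)
Lemma antiderivative_bound_ge0 (q K : {poly R}) X c : 0 < X -> 0 <= c ->
  K^`() = q -> K.[0] = 0 ->
  (forall t, 0 <= t <= 1 -> 0 <= q.[t] <= c / (1 + X ^+ 2 * t ^+ 2)) ->
  forall t, 0 <= t <= 1 -> 0 <= K.[t] <= 2 * c / X.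
Proof.
move=> X0 c0 Kq K0 hq t /andP[t0 t1]; apply/andP; split.
  rewrite -K0; apply: (@ger0_derive1_ndecr R (horner K) 0 1 _ _ _ 0 t (lexx 0) t0 t1).
  - by move=> x _; case: (is_derive_poly K x).
  - move=> x; rewrite in_itv /= => /andP[x0 x1]; have h := is_derive_poly K x; rewrite derive1E derive_val Kq.
    by have /andP[] := hq x (introT andP (conj (ltW x0) (ltW x1))).
  - by apply: derivable_within_continuous => x _; by case: (is_derive_poly K x).
pose L (s : R) : R := - (2 * c / X) * (1 + X * s)^-1 - K.[s].
have pos (s : R) : 0 <= s -> 0 < 1 + X * s by move=> s0; rewrite ltr_wpDr ?mulr_ge0 // ltW.
have dL (s : R) : 0 <= s -> is_derive s (1 : R) L (2 * c / (1 + X * s) ^+ 2 - q.[s]).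
  move=> s0; have P0 := lt0r_neq0 (pos s s0).
  have dV : is_derive s (1 : R) (fun s : R => (1 + X * s)^-1) (- X / (1 + X * s) ^+ 2).
    have d1 : is_derive s (1 : R) (fun s : R => 1 + X * s) X.
      have := is_derive_poly (X *: 'X + 1%:P) s.
      rewrite derivD derivZ derivX derivC addr0 hornerZ hornerC mulr1.
      rewrite (_ : horner _ = fun s : R => 1 + X * s) //.
      by apply/funext => r; rewrite hornerD hornerZ hornerX hornerC addrC.
    have := @is_deriveV R (fun s : R => 1 + X * s) s X 1 P0 d1; move=> h; apply: is_derive_eq h _.
    by rewrite -[LHS]/(- (1 + X * s) ^- 2 * X) !mulNr (mulrC X (_ ^- 2)).
  have := is_deriveB (is_deriveZ (- (2 * c / X)) dV) (is_derive_poly K s).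
  move=> h; apply: is_derive_eq h _; rewrite Kq.
  rewrite -[_ *: _]/(- (2 * c / X) * (- X / (1 + X * s) ^+ 2)); field.
  by rewrite P0 gt_eqF.
have : L 0 <= L t.
  apply: (@ger0_derive1_ndecr R L 0 1 _ _ _ 0 t (lexx 0) t0 t1).
  - by move=> x; rewrite in_itv /= => /andP[x0 x1]; have [] := dL x (ltW x0).
  - move=> x; rewrite in_itv /= => /andP[x0 x1].
    have h := dL x (ltW x0); rewrite derive1E derive_val subr_ge0.
    have /andP[_ hx] := hq x (introT andP (conj (ltW x0) (ltW x1))).
    apply: (le_trans hx); rewrite ler_pdivrMr; last by rewrite ltr_wpDr // mulr_ge0 // sqr_ge0.
    rewrite mulrAC ler_pdivlMr ?exprn_gt0 ?pos //; last by rewrite ltW.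
    by have := mulr_ge0 c0 (sqr_ge0 (1 - X * x)); rewrite !expr2; lra.
  - by apply: derivable_within_continuous => x; rewrite in_itv /= => /andP[x0 _]; have [] := dL x x0.
rewrite /L K0 mulr0 addr0 invr1 mulr1 subr0 => hL.
have : 0 <= 2 * c / X * (1 + X * t)^-1.
  by rewrite mulr_ge0 ?divr_ge0 ?invr_ge0 ?mulr_ge0 // ltW // pos.
by move: hL; rewrite mulNr; lra.
Qed.

Lemma antiderivative_bound (q K : {poly R}) X c : 0 < X -> 0 <= c ->
  K^`() = q -> K.[0] = 0 ->
  (forall t, `|t| <= 1 -> 0 <= q.[t] <= c / (1 + X ^+ 2 * t ^+ 2)) ->
  forall t, `|t| <= 1 -> `|K.[t]| <= 2 * c / X.
Proof.
move=> X0 c0 Kq K0 hq t t1; have [t0|t0] := leP 0 t.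
  have /andP[h1 h2] : 0 <= K.[t] <= 2 * c / X.
    apply: (antiderivative_bound_ge0 X0 c0 Kq K0); last by rewrite t0 -(ger0_norm t0).
    by move=> s /andP[s0 s1]; apply: hq; rewrite ger0_norm.
  by rewrite ger0_norm.
have /andP[h1 h2] : 0 <= (- (K \Po (- 'X))).[- t] <= 2 * c / X.
  apply: (antiderivative_bound_ge0 (q := q \Po (- 'X)) X0 c0).
  - by rewrite derivN deriv_comp Kq derivN derivX mulrN1 opprK.
  - by rewrite hornerN horner_comp !hornerE oppr0 K0 oppr0.
  - move=> s /andP[s0 s1]; rewrite horner_comp hornerN hornerX -(sqrrN s); apply: hq.
    by rewrite normrN ger0_norm.
  - by rewrite oppr_ge0 ltW //= -(ltr0_norm t0).
by move: h1 h2; rewrite hornerN horner_comp !hornerE opprK oppr_ge0 => h1; rewrite ler0_norm.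
Qed.

(** Multiply by [(1 + t^2)^n], which is at least [1 + n t^2] by Bernoulli, and use
    [(1 - t^2) (1 + t^2) <= 1]. *)
Lemma bernoulli_sq_le t n : `|t| <= 1 -> (1 - t ^+ 2) ^+ n <= (1 + n%:R * t ^+ 2)^-1.
Proof.
move=> t1; have t2 : t ^+ 2 <= 1 by exact: sq_le1.
have p0 : 0 < 1 + n%:R * t ^+ 2 by rewrite ltr_wpDr // mulr_ge0 // sqr_ge0.
rewrite -[leLHS](mulfK (lt0r_neq0 p0)) ler_pdivrMr // mulVf ?lt0r_neq0 //.
apply: (@le_trans _ _ ((1 - t ^+ 2) ^+ n * (1 + t ^+ 2) ^+ n)).
  rewrite ler_wpM2l ?exprn_ge0 ?subr_ge0 //.
  elim: n {p0} => [|n IH]; first by rewrite mul0r addr0 expr0.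
  have s0 := sqr_ge0 t; have n0 : 0 <= n%:R :> R by [].
  rewrite [leRHS]exprS; apply: (@le_trans _ _ ((1 + t ^+ 2) * (1 + n%:R * t ^+ 2))).
    rewrite -natr1; have : 0 <= t ^+ 2 * (n%:R * t ^+ 2) by rewrite mulr_ge0 // mulr_ge0.
    by move: (t ^+ 2) => s; nra.
  by rewrite ler_wpM2l // addr_ge0.
rewrite -exprMn -subr_sqr expr1n exprn_ile1 //.
  by rewrite subr_ge0 exprn_ile1 // sqr_ge0.
by rewrite gerBl exprn_ge0 // sqr_ge0.
Qed.

(** Pointwise bounds under which [X q^2] and [q'^2 / X] have integrals over [[-1, 1]] bounded
    independently of [X]. The constant is the square of the [6] that arises for the derivative of
    [peak]. *)
Definition kernel_bounded (X : R) q := forall t, `|t| <= 1 ->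
  q.[t] ^+ 2 <= 36 / (1 + X ^+ 2 * t ^+ 2) /\
  q^`().[t] ^+ 2 <= 36 * X ^+ 2 / (1 + X ^+ 2 * t ^+ 2).

(* [bump n] is [1] at [0], and [peak n] is [t] times a function of size [n] on an
   interval of length [1 / n]: both are kernels of scale [X = n]. *)
Definition bump (n : nat) : {poly R} := (1 - 'X^2) ^+ (n ^ 2).+1.

Lemma horner_1subX2 n t : ((1 - 'X^2) ^+ n : {poly R}).[t] = (1 - t ^+ 2) ^+ n.
Proof. by rewrite horner_exp !hornerE. Qed.

Lemma deriv_1subX2 n : ((1 - 'X^2) ^+ n.+1 : {poly R})^`() = - (2 * n.+1%:R)%:P * 'X * (1 - 'X^2) ^+ n.
Proof.
have d1 : (1 - 'X^2 : {poly R})^`() = - ('X *+ 2).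
  by rewrite derivB derivXn (derivC 1) sub0r expr1.
rewrite deriv_exp d1 /= -[LHS]mulr_natr -mulr_natr polyCM !polyC_natr.
move: ('X) ((1 - 'X^2) ^+ n) => x u; ring.
Qed.

Lemma sq_bound (y s : R) : 0 <= s -> `|y| <= s -> y ^+ 2 <= s ^+ 2.
Proof. by move=> s0 ys; rewrite -real_normK ?num_real // lerXn2r ?nnegrE. Qed.

(** The exponent [n^2] gives decay [w = 1 / (1 + n^2 t^2)]; the factor [n^2 t] brought down by the
    derivative is controlled by [n^2 t^2 w <= 1]. *)
Lemma bump_bounded (n : nat) : (0 < n)%N -> kernel_bounded n%:R (bump n).
Proof.
move=> n0 t t1; have t2 : 0 <= 1 - t ^+ 2 by rewrite subr_ge0 sq_le1.
have t3 : 1 - t ^+ 2 <= 1 by rewrite gerBl sqr_ge0.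
have n1 : 1 <= n%:R :> R by rewrite ler1n.
have := bernoulli_sq_le (n ^ 2) t1; rewrite natrX; set x := n%:R in n1 *.
set y := (1 - t ^+ 2) ^+ _ => hy.
have y0 : 0 <= y by exact: exprn_ge0.
have s0 := sqr_ge0 t.
have p1 : 1 <= 1 + x ^+ 2 * t ^+ 2 by rewrite lerDl mulr_ge0 // sqr_ge0.
have p0 : 0 < 1 + x ^+ 2 * t ^+ 2 by exact: lt_le_trans p1.
set w := (1 + x ^+ 2 * t ^+ 2)^-1 in hy *.
have w0 : 0 < w by rewrite invr_gt0.
have w1 : w <= 1 by rewrite invf_le1.
have wE : w * (1 + x ^+ 2 * t ^+ 2) = 1 by rewrite mulVf // gt_eqF.
rewrite /bump deriv_1subX2 !hornerM horner_1subX2 -/y hornerN hornerX hornerC.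
rewrite horner_1subX2 [_ ^+ (n ^ 2).+1]exprS -/y [(n ^ 2).+1%:R](_ : _ = x ^+ 2 + 1 :> R); last first.
  by rewrite -natr1 natrX.
split.
  apply: (@le_trans _ _ (w ^+ 2)); last by nra.
  apply: sq_bound; first exact: ltW.
  rewrite ger0_norm ?mulr_ge0 //; apply: le_trans hy; exact: ler_piMl.
have h : (x ^+ 2 * t ^+ 2) * w <= 1 by nra.
apply: (@le_trans _ _ ((2 * (x ^+ 2 + 1) * `|t| * w) ^+ 2)).
  apply: sq_bound; first by rewrite !mulr_ge0 ?addr_ge0 ?sqr_ge0 // ltW.
  have c0 : 0 <= 2 * (x ^+ 2 + 1) by rewrite mulr_ge0 // addr_ge0 // sqr_ge0.
  rewrite normrM normrM normrN (ger0_norm c0) (ger0_norm y0).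
  by rewrite ler_wpM2l // mulr_ge0.
rewrite !exprMn real_normK ?num_real //.
have x2 : 1 <= x ^+ 2 by rewrite exprn_ege1.
move: (x ^+ 2) (t ^+ 2) x2 s0 h w0 => a b a1 b0 h w0.
have : 4 * (a + 1) ^+ 2 * b <= 16 * a ^+ 2 * b.
  by rewrite ler_wpM2r //; nra.
have : 16 * a * (a * b * w) * w <= 16 * a * w.
  rewrite -[leRHS]mulr1 [leLHS](_ : _ = 16 * a * w * (a * b * w)); last by ring.
  by rewrite ler_wpM2l // !mulr_ge0 // ?ltW //; lra.
move=> h1 h2; have w2 : 0 <= w ^+ 2 by exact: sqr_ge0.
have := ler_wpM2r w2 h2; have : 0 <= a * w by rewrite mulr_ge0 // ltW //; lra.
by lra.
Qed.

Definition peak (n : nat) : {poly R} := n%:R%:P * 'X * (1 - 'X^2) ^+ (n ^ 2).*2.+1.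

(** The exponent is twice that of [bump], up to one: of the resulting decay [w^2], one factor
    absorbs the [1 + n^2 t^2] from the derivative and the other remains. *)
Lemma peak_bounded (n : nat) : (0 < n)%N -> kernel_bounded n%:R (peak n).
Proof.
move=> n0 t t1; have t2 : 0 <= 1 - t ^+ 2 by rewrite subr_ge0 sq_le1.
have t3 : 1 - t ^+ 2 <= 1 by rewrite gerBl sqr_ge0.
have n1 : 1 <= n%:R :> R by rewrite ler1n.
have := bernoulli_sq_le (n ^ 2) t1; rewrite natrX; set x := n%:R in n1 *.
set y := (1 - t ^+ 2) ^+ _ => hy.
have y0 : 0 <= y by exact: exprn_ge0.
have s0 := sqr_ge0 t.
have p1 : 1 <= 1 + x ^+ 2 * t ^+ 2 by rewrite lerDl mulr_ge0 // sqr_ge0.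
have p0 : 0 < 1 + x ^+ 2 * t ^+ 2 by exact: lt_le_trans p1.
set w := (1 + x ^+ 2 * t ^+ 2)^-1 in hy *.
have w0 : 0 < w by rewrite invr_gt0.
have w1 : w <= 1 by rewrite invf_le1.
have wE : w * (1 + x ^+ 2 * t ^+ 2) = 1 by rewrite mulVf // gt_eqF.
have yy : y ^+ 2 <= w ^+ 2 by apply: sq_bound; [exact: ltW|rewrite ger0_norm].
have pE : (1 - t ^+ 2) ^+ (n ^ 2).*2 = y ^+ 2 by rewrite -exprM muln2.
have h : (x ^+ 2 * t ^+ 2) * w <= 1 by nra.
have yw : y ^+ 2 <= w by apply: (le_trans yy); rewrite expr2 ler_piMl // ltW.
have x0 : 0 <= x by exact: le_trans n1.
rewrite /peak !derivM !derivC mul0r add0r derivX mulr1 deriv_1subX2.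
rewrite !(hornerM, hornerD, hornerN, hornerC, hornerX, horner_1subX2) [_ ^+ (n ^ 2).*2.+1]exprS pE; split.
  apply: (@le_trans _ _ ((x * `|t| * w) ^+ 2)); last first.
    rewrite !exprMn real_normK ?num_real //.
    have -> : x ^+ 2 * t ^+ 2 * w ^+ 2 = (x ^+ 2 * t ^+ 2 * w) * w by ring.
    apply: (@le_trans _ _ (1 * w)); last by lra.
    by rewrite ler_wpM2r // ltW.
  apply: sq_bound; first by rewrite !mulr_ge0 // ltW.
  rewrite -/x normrM normrM (ger0_norm x0) (ger0_norm (mulr_ge0 t2 (sqr_ge0 y))).
  rewrite ler_wpM2l ?mulr_ge0 //; apply: le_trans yw; exact: ler_piMl (sqr_ge0 _) _.
have E : (n ^ 2).*2.+1%:R = 2 * x ^+ 2 + 1 :> R by rewrite -natr1 -mul2n natrM natrX.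
rewrite E.
apply: (@le_trans _ _ ((6 * x * w) ^+ 2)); last first.
  rewrite !exprMn; have -> : 36 * x ^+ 2 * w = 6 ^+ 2 * x ^+ 2 * w by ring.
  rewrite ler_wpM2l ?mulr_ge0 ?sqr_ge0 // expr2 ler_piMl // ltW //.
apply: sq_bound; first by rewrite !mulr_ge0 // ltW.
have -> : x * ((1 - t ^+ 2) * y ^+ 2) + x * t * (- (2 * (2 * x ^+ 2 + 1)) * t * y ^+ 2) =
   x * y ^+ 2 * ((1 - t ^+ 2) - 2 * (2 * x ^+ 2 + 1) * t ^+ 2) by ring.
rewrite normrM (ger0_norm (mulr_ge0 x0 (sqr_ge0 y))) (mulrC 6) -(mulrA x (y ^+ 2)) -(mulrA x 6) ler_wpM2l //.
have b : `|1 - t ^+ 2 - 2 * (2 * x ^+ 2 + 1) * t ^+ 2| <= 6 * (1 + x ^+ 2 * t ^+ 2).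
  have x2 : 1 <= x ^+ 2 by rewrite exprn_ege1.
  move: (x ^+ 2) (t ^+ 2) x2 s0 t2 t3 => a b a1 b0 b1 _.
  by rewrite ler_norml; apply/andP; split; nra.
apply: (@le_trans _ _ (w ^+ 2 * (6 * (1 + x ^+ 2 * t ^+ 2)))).
  by apply: ler_pM => //; exact: sqr_ge0.
have -> : w ^+ 2 * (6 * (1 + x ^+ 2 * t ^+ 2)) = 6 * w * (w * (1 + x ^+ 2 * t ^+ 2)) by ring.
by rewrite wE mulr1.
Qed.

End Kernels.

(** * Functionals of B*_0 growth *)

Section Sublinear.
Variables (R : realType) (d : nat).
Local Notation C := R[i].
Local Notation Rd := 'rV[R]_d.
Local Notation Cd := 'rV[C]_d.
Local Notation Zd := 'rV[int]_d.
Implicit Types (a b n : Zd) (x y : Rd) (F G : Cd -> C) (w : Zd -> C) (X t : R).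

(** The B*_0 condition on coefficients, stated for finite families of distinct lattice points inside
    a ball, so that only finite sums over lists occur. *)
Definition sublinear w := forall eta : R, 0 < eta -> exists2 rho0 : R, 0 < rho0 &
  forall rho, rho0 <= rho -> forall S : seq Zd, uniq S ->
    (forall n, n \in S -> lattice_norm R n < rho) ->
    \sum_(n <- S) cmod (w n) ^+ 2 <= eta * rho.

(* Reduces the weighted sum of [sublinear_weighted] to sums over the balls of
   radius [2 ^ i * X], with geometrically decreasing coefficients. *)
Lemma weight_dyadic X t (I : nat) : 0 < X -> 0 <= t -> t < 2 ^+ I * X ->
  (X + t ^+ 2 / X)^-1 <= \sum_(i < I.+1) 4 * 4^-1 ^+ i / X * (t < 2 ^+ i * X)%R%:R.
Proof.
move=> X0 t0; elim: I => [|I IH].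
  rewrite expr0 mul1r big_ord_recl big_ord0 addr0 /= !expr0 mul1r mulr1 => -> ; rewrite mulr1.
  rewrite -[4 / X]mulrC -[leLHS]mulr1; apply: ler_pM => //.
  - by rewrite invr_ge0 addr_ge0 ?divr_ge0 ?sqr_ge0 // ltW.
  - by rewrite lef_pV2 ?posrE // ?lerDl ?divr_ge0 ?sqr_ge0 ?ltr_wpDr // ?divr_ge0 ?sqr_ge0 ?ltW.
  - by lra.
have pos i : 0 <= 4 * 4^-1 ^+ i / X * (t < 2 ^+ i * X)%R%:R.
  by rewrite !mulr_ge0 ?invr_ge0 ?exprn_ge0 ?invr_ge0 // ltW.
have [tI _|tI tI1] := ltP t (2 ^+ I * X).
  by rewrite big_ord_recr /=; apply: (le_trans (IH tI)); rewrite lerDl.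
rewrite big_ord_recr /= tI1 mulr1.
apply: (@le_trans _ _ (4 * 4^-1 ^+ I.+1 / X)); last by rewrite lerDr sumr_ge0.
have -> : 4 * 4^-1 ^+ I.+1 / X = (4 ^+ I * X)^-1 :> R.
  by rewrite exprS mulrA mulfV ?pnatr_eq0 // mul1r exprVn invfM.
have p4 : 0 < 4 ^+ I * X by rewrite mulr_gt0 // exprn_gt0.
have pX : 0 <= t ^+ 2 / X by rewrite divr_ge0 ?sqr_ge0 // ltW.
rewrite lef_pV2 ?posrE //; last by rewrite ltr_wpDr.
apply: (@le_trans _ _ (t ^+ 2 / X)); last by rewrite lerDr ltW.
rewrite ler_pdivlMr // -mulrA -expr2.
have -> : 4 ^+ I * X ^+ 2 = (2 ^+ I * X) ^+ 2 by rewrite exprMn -exprM mulnC exprM; congr (_ ^+ _ * _); ring.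
by rewrite lerXn2r ?nnegrE // mulr_ge0 ?exprn_ge0 // ltW.
Qed.

Lemma lattice_norm_ge0 n : 0 <= lattice_norm R n.
Proof. exact: sqrtr_ge0. Qed.

Lemma geometric_le2 (I : nat) : \sum_(i < I) (2^-1 : R) ^+ i <= 2.
Proof.
suff -> : \sum_(i < I) (2^-1 : R) ^+ i = 2 - 2 * 2^-1 ^+ I.
  by rewrite gerBl mulr_ge0 // exprn_ge0 // invr_ge0.
elim: I => [|I IH]; first by rewrite big_ord0 expr0 mulr1 subrr.
by rewrite big_ord_recr /= IH exprS; field.
Qed.

(** The ball of radius [2^i X] contributes at most [(eta / 8) 2^i X], with coefficient
    [4 * 4^-i / X]. The product is [(eta / 2) 2^-i], and these add up to at most [eta]. *)
Lemma sublinear_weighted w (eta : R) : sublinear w -> 0 < eta -> exists2 X0 : R, 0 < X0 &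
  forall X, X0 <= X -> forall S : seq Zd, uniq S ->
    \sum_(n <- S) cmod (w n) ^+ 2 / (X + lattice_norm R n ^+ 2 / X) <= eta.
Proof.
move=> sw eta0; have [|rho0 r0 H] := sw (eta / 8); first by rewrite divr_gt0.
exists rho0 => // X hX S uS; have X0 : 0 < X by exact: lt_le_trans hX.
have [I HI] : exists I, forall n, n \in S -> lattice_norm R n < 2 ^+ I * X.
  pose T := \sum_(n <- S) lattice_norm R n.
  have T0 : 0 <= T by apply: sumr_ge0 => n _; exact: lattice_norm_ge0.
  exists (Num.Def.archi_bound (T / X)) => n nS.
  apply: (@le_lt_trans _ _ T).
    rewrite /T (big_rem n nS) /= lerDl sumr_ge0 // => m _; exact: lattice_norm_ge0.
  rewrite -ltr_pdivrMr //; apply: (lt_le_trans (archi_boundP _)); first by rewrite divr_ge0 // ltW.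
  by rewrite -natrX ler_nat ltnW // ltn_expl.
apply: (@le_trans _ _ (\sum_(n <- S) \sum_(i < I.+1)
   4 * 4^-1 ^+ i / X * (cmod (w n) ^+ 2 * (lattice_norm R n < 2 ^+ i * X)%R%:R))).
  rewrite big_seq [leRHS]big_seq; apply: ler_sum => n nS.
  apply: (le_trans (ler_wpM2l (sqr_ge0 _) (weight_dyadic X0 (lattice_norm_ge0 n) (HI n nS)))).
  by rewrite mulr_sumr; apply: ler_sum => i _; rewrite mulrCA.
rewrite exchange_big /=.
apply: (@le_trans _ _ (\sum_(i < I.+1) (eta / 2) * 2^-1 ^+ i)); last first.
  rewrite -mulr_sumr; apply: (le_trans (ler_wpM2l _ (geometric_le2 _))); first by rewrite divr_ge0 // ltW.
  by rewrite divfK // pnatr_eq0.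
apply: ler_sum => i _; rewrite -mulr_sumr.
have hi : \sum_(n <- S) cmod (w n) ^+ 2 * (lattice_norm R n < 2 ^+ i * X)%R%:R <= eta / 8 * (2 ^+ i * X).
  have := H (2 ^+ i * X) _ [seq n <- S | lattice_norm R n < 2 ^+ i * X].
  rewrite big_filter => h; under eq_bigr do rewrite mulr_natr mulrb; rewrite -big_mkcond; apply: h.
  - by apply: (le_trans hX); rewrite ler_peMl ?exprn_ege1 ?ler1n // ltW.
  - exact: filter_uniq.
  - by move=> n; rewrite mem_filter => /andP[].
apply: (le_trans (ler_wpM2l _ hi)).
  by rewrite divr_ge0 ?mulr_ge0 ?exprn_ge0 ?invr_ge0 // ltW.
rewrite le_eqVlt; apply/orP; left; apply/eqP.
have -> : 4^-1 = 2^-1 * 2^-1 :> R by field.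
rewrite exprMn; have e : 2^-1 ^+ i * 2 ^+ i = 1 :> R by rewrite exprVn mulVf // expf_neq0.
transitivity ((eta / 2) * 2^-1 ^+ i * (2^-1 ^+ i * 2 ^+ i)); last by rewrite e mulr1.
by field; rewrite gt_eqF.
Qed.

Definition linear_on_trig (v : (Cd -> C) -> C) := forall (c : C) F G,
  laurent_trig F -> laurent_trig G -> v (fun z => c * F z + G z) = c * v F + v G.

Lemma linear_on_trigZ v (c : C) F : linear_on_trig v -> laurent_trig F -> v (fun z => c * F z) = c * v F.
Proof.
move=> lv LF; have := lv c F (fun=> 0) LF (laurent_cst d 0).
have -> : v (fun=> 0) = 0.
  have := lv 1 (fun=> 0) (fun=> 0) (laurent_cst d 0) (laurent_cst d 0).
  under eq_fun do rewrite mulr0 addr0; rewrite mul1r => /eqP.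
  by rewrite -subr_eq0 opprD addrA subrr sub0r oppr_eq0 => /eqP.
by rewrite addr0; under eq_fun do rewrite addr0.
Qed.

Lemma linear_on_trig_sum v (A : seq Zd) (c : Zd -> C) : linear_on_trig v ->
  v (fun z => \sum_(a <- A) c a * character a z) = \sum_(a <- A) c a * v (character a).
Proof.
move=> lv; elim: A => [|a A IH].
  rewrite big_nil -[RHS](mul0r (v (fun=> 0))) -linear_on_trigZ //; last exact: laurent_cst.
  by congr v; apply/funext => z; rewrite big_nil mul0r.
rewrite big_cons -IH -lv; first by congr v; apply/funext => z; rewrite big_cons.
- exact: laurent_character.
- by exists A, c.
Qed.

Definition energy X F : R := X * msq F + X^-1 * \sum_j msq (pd j F).

Lemma energyE X (A : seq Zd) (c : Zd -> C) : uniq A -> 0 < X ->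
  energy X (fun z => \sum_(a <- A) c a * character a z) =
  \sum_(a <- A) cmod (c a) ^+ 2 * (X + lattice_norm R a ^+ 2 / X).
Proof.
move=> uA X0; rewrite /energy parseval //.
have pdE j : pd j (fun z => \sum_(a <- A) c a * character a z) =
    fun z => \sum_(a <- A) (c a * ('i * (a 0 j)%:~R)) * character a z.
  elim: A {uA} => [|a A IH].
    under eq_fun do rewrite big_nil; rewrite pd_cst.
    by apply/funext => z; rewrite big_nil.
  under eq_fun do rewrite big_cons; rewrite pdD ?pd_mono ?IH.
  - by apply/funext => z; rewrite big_cons.
  - exact: laurent_mono.
  - by exists A, c.
have ->: \sum_j msq (pd j (fun z => \sum_(a <- A) c a * character a z)) =
    \sum_(a <- A) cmod (c a) ^+ 2 * lattice_norm R a ^+ 2.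
  under eq_bigr do rewrite pdE parseval //.
  rewrite exchange_big; apply: eq_bigr => a _ /=.
  rewrite sqr_sqrtr ?mulr_sumr; last by apply: sumr_ge0 => j _; exact: sqr_ge0.
  apply: eq_bigr => j _; rewrite !cmodM cmodi mul1r exprMn; congr (_ * _).
  by rewrite -(rmorph_int (real_complex R)) cmodR real_normK // num_real.
rewrite !mulr_sumr -big_split; apply: eq_bigr => a _ /=; ring.
Qed.

Lemma sublinear_energy v (e P0 : R) : linear_on_trig v -> sublinear (fun a => v (character a)) ->
  0 < e -> 0 < P0 -> exists2 X0 : R, 0 < X0 & forall X, X0 <= X -> forall F, laurent_trig F ->
    energy X F <= P0 -> cmod (v F) <= e.
Proof.
move=> lv sv e0 P00; have eta0 : 0 < e ^+ 2 / P0 by rewrite divr_gt0 // exprn_gt0.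
have [X0 X00 H] := sublinear_weighted sv eta0.
exists X0 => // X hX F LF; have [A [c [uA _ ->]]] := laurent_reduced LF.
have Xp : 0 < X by exact: lt_le_trans hX.
rewrite energyE // linear_on_trig_sum //; have := H X hX A uA.
set q := fun a => X + lattice_norm R a ^+ 2 / X.
have q0 a : 0 < q a by rewrite ltr_wpDr // divr_ge0 ?sqr_ge0 // ltW.
set V := \sum_(n <- A) _ => hV hc; set U := \sum_(a <- A) _ in hc.
apply: (le_trans (cmod_sum _ _ _)).
(* Young's inequality, term by term, with weights for which the energy and the dual sum contribute
   [e / 2] each. *)
apply: (@le_trans _ _ (e / (2 * P0) * U + P0 / (2 * e) * V)).
  rewrite /U /V !mulr_sumr -big_split; apply: ler_sum => a _ /=; rewrite cmodM.
  set s := cmod (c a); set t := cmod _; have h := sqr_ge0 (e / P0 * s * q a - t).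
  rewrite -subr_ge0.
  have -> : e / (2 * P0) * (s ^+ 2 * q a) + P0 / (2 * e) * (t ^+ 2 / q a) - s * t =
     (P0 / (2 * e) / q a) * (e / P0 * s * q a - t) ^+ 2.
    by field; rewrite !gt_eqF.
  by rewrite mulr_ge0 // !divr_ge0 ?mulr_ge0 // ltW.
have h1 : e / (2 * P0) * U <= e / (2 * P0) * P0.
  by rewrite ler_wpM2l // divr_ge0 ?mulr_ge0 // ltW.
have h2 : P0 / (2 * e) * V <= P0 / (2 * e) * (e ^+ 2 / P0).
  by rewrite ler_wpM2l // divr_ge0 ?mulr_ge0 // ltW.
apply: (le_trans (lerD h1 h2)); rewrite le_eqVlt; apply/orP; left; apply/eqP.
by field; rewrite !gt_eqF.
Qed.

End Sublinear.

(** * Energy of kernels composed with a real trigonometric polynomial *)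

Section Energy.
Variables (R : realType) (d : nat).
Local Notation C := R[i].
Local Notation Rd := 'rV[R]_d.
Local Notation Cd := 'rV[C]_d.
Local Notation Zd := 'rV[int]_d.
Implicit Types (x y : Rd) (F G B : Cd -> C) (X t : R) (q : {poly R}).

Definition compose q F : Cd -> C := fun z => (map_poly (real_complex R) q).[F z].

Lemma laurent_compose q F : laurent_trig F -> laurent_trig (compose q F).
Proof. exact: laurent_horner. Qed.

Lemma pd_horner j (q : {poly C}) F : laurent_trig F ->
  pd j (fun z => q.[F z]) = fun z => q^`().[F z] * pd j F z.
Proof.
move=> LF; elim/poly_ind: q => [|q c IH].
  under eq_fun do rewrite horner0; rewrite pd_cst.
  by apply/funext => z; rewrite deriv0 horner0 mul0r.
under eq_fun do rewrite hornerMXaddC.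
rewrite pdD; [|by apply: laurentM => //; exact: laurent_horner|exact: laurent_cst].
rewrite pd_cst pdM ?IH //; last exact: laurent_horner.
by apply/funext => z; rewrite derivD derivM derivX derivC addr0 !hornerE; ring.
Qed.

Lemma pd_compose j q F : laurent_trig F ->
  pd j (compose q F) = fun z => compose q^`() F z * pd j F z.
Proof. by move=> LF; rewrite /compose pd_horner // deriv_map. Qed.

Section RealValued.
Variable p : Cd -> C.
Hypotheses (Lp : laurent_trig p) (p_real : forall x, complex.Im (p (complexify x)) = 0)
  (p_le1 : forall x, cmod (p (complexify x)) <= 1).

Let P x : R := complex.Re (p (complexify x)).

Lemma real_valuedE x : p (complexify x) = (P x)%:C.
Proof. by apply: complex_eqP => //=; rewrite p_real. Qed.

Lemma composeE q x : compose q p (complexify x) = (q.[P x])%:C.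
Proof. by rewrite /compose real_valuedE horner_map. Qed.

Lemma real_valued_le1 x : `|P x| <= 1.
Proof. by rewrite -cmodR -real_valuedE. Qed.

(* Integration by parts against an antiderivative [K] of [q], which is of size
   [1/X] uniformly, whereas [q] itself is only bounded. *)
Lemma mean_concentrated B j : laurent_trig B ->
  exists2 C0 : R, 0 <= C0 & forall X (c : R) q, 0 < X -> 0 <= c ->
    (forall t, `|t| <= 1 -> 0 <= q.[t] <= c / (1 + X ^+ 2 * t ^+ 2)) ->
    cmod (mean (fun x => B (complexify x) * pd j p (complexify x) * compose q p (complexify x)))
    <= C0 * c / X.
Proof.
move=> LB; have [b b0 Hb] := laurent_bounded (laurent_pd j LB).
exists (b * 2) => [|X c q X0 c0 hq]; first by rewrite mulr_ge0.
have [K [Kq K0]] := poly_antiderivative q.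
have LK := laurent_compose K Lp; have LBd := laurent_pd j LB; have Lpd := laurent_pd j Lp.
have Lq := laurent_compose q Lp.
have := mean_pd j (laurentM LB LK); rewrite pdM // pd_compose // Kq.
have -> : (fun x => pd j B (complexify x) * compose K p (complexify x) +
    B (complexify x) * (compose q p (complexify x) * pd j p (complexify x))) =
  fun x => pd j B (complexify x) * compose K p (complexify x) +
    B (complexify x) * pd j p (complexify x) * compose q p (complexify x).
  by apply/funext => x; rewrite mulrA mulrAC.
have t1 := real_trigM (real_trig_laurent LBd) (real_trig_laurent LK).
have t2 := real_trigM (real_trigM (real_trig_laurent LB) (real_trig_laurent Lpd)) (real_trig_laurent Lq).
rewrite (meanD t1 t2) addrC => /eqP; rewrite addr_eq0 => /eqP ->; rewrite cmodN.
apply: cmod_mean_le => // x; rewrite cmodM -!mulrA (mulrA 2); apply: ler_pM => //; try exact: cmod_ge0.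
by rewrite composeE cmodR (antiderivative_bound X0 c0 Kq K0) // real_valued_le1.
Qed.

Lemma msq_le F G : laurent_trig F -> laurent_trig G ->
  (forall x, cmod (F (complexify x)) ^+ 2 <= complex.Re (G (complexify x))) ->
  msq F <= cmod (mean (fun x => G (complexify x))).
Proof.
move=> LF LG h; apply: le_trans (le_trans (ler_norm _) (Re_le_cmod _)).
apply: Re_mean_le => [||x].
- by apply: real_trigM; [|apply: real_trigJ]; exact: real_trig_laurent.
- exact: real_trig_laurent.
- by rewrite mulJ_cmod /=.
Qed.

Lemma msq_bound F (b : R) : laurent_trig F -> (forall x, cmod (F (complexify x)) <= b) ->
  msq F <= b ^+ 2.
Proof.
move=> LF h; apply: le_trans (ler_norm _) _; apply: le_trans (Re_le_cmod _) _.
apply: cmod_mean_le => [|x].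
  by apply: real_trigM; [|apply: real_trigJ]; exact: real_trig_laurent.
by rewrite cmodM cmodJ expr2; apply: ler_pM => //; exact: cmod_ge0.
Qed.

Lemma msqD_le F G : laurent_trig F -> laurent_trig G ->
  msq (fun z => F z + G z) <= 2 * msq F + 2 * msq G.
Proof.
move=> LF LG; rewrite /msq.
have tt H : laurent_trig H -> real_trig (fun x => H (complexify x) * conjc (H (complexify x))).
  by move=> LH; apply: real_trigM; [|apply: real_trigJ]; exact: real_trig_laurent.
have t2 H : laurent_trig H -> real_trig (fun x => 2%:C * (H (complexify x) * conjc (H (complexify x)))).
  by move=> LH; apply: real_trigM; [exact: real_trig_cst|exact: tt].
rewrite -[2 * _]Re_realM -(meanZ _ (tt _ LF)) -[2 * complex.Re _]Re_realM -(meanZ _ (tt _ LG)).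
rewrite -ReD -(meanD (t2 _ LF) (t2 _ LG)); apply: Re_mean_le => [||x].
- exact: tt (laurentD LF LG).
- by apply: real_trigD; exact: t2.
- rewrite ReD !Re_realM !mulJ_cmod /=; have h := cmodD (F (complexify x)) (G (complexify x)).
  move: (cmod _) (cmod (F _)) (cmod (G _)) h (cmod_ge0 (F (complexify x) + G (complexify x))) => c a b h c0.
  apply: (@le_trans _ _ ((a + b) ^+ 2)); first by rewrite lerXn2r ?nnegrE // (le_trans c0).
  by have := sqr_ge0 (a - b); rewrite !expr2; lra.
Qed.

(** Write [|B p_j q(p)|^2] as [(|B|^2 p_j) p_j q(p)^2]: one factor [p_j] goes into the multiplier,
    the other is kept for the integration by parts. *)
Lemma kernel_msq B j : laurent_trig B -> exists2 C0 : R, 0 <= C0 &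
  forall X (m : R) q, 0 < X -> 0 <= m ->
    (forall t, `|t| <= 1 -> q.[t] ^+ 2 <= m / (1 + X ^+ 2 * t ^+ 2)) ->
    msq (fun z => B z * pd j p z * compose q p z) <= C0 * m / X.
Proof.
move=> LB; have [B' LB' B'E] := laurent_conj LB; have Lpd := laurent_pd j Lp.
have [C0 C00 H] := mean_concentrated j (laurentM (laurentM LB LB') Lpd).
exists C0 => // X m q X0 m0 hq; have Lq r := laurent_compose r Lp.
have h : forall t, `|t| <= 1 -> 0 <= (q ^+ 2).[t] <= m / (1 + X ^+ 2 * t ^+ 2).
  by move=> t t1; rewrite horner_exp sqr_ge0 hq.
apply: le_trans (H X m (q ^+ 2) X0 m0 h).
apply: (@msq_le _ (fun z => B z * B' z * pd j p z * pd j p z * compose (q ^+ 2) p z)).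
- by apply: laurentM => //; exact: laurentM.
- by apply: laurentM => //; apply: laurentM => //; apply: laurentM => //; exact: laurentM.
- move=> x; have pj : conjc (pd j p (complexify x)) = pd j p (complexify x).
    have := laurent_real_pd j x Lp p_real.
    by case: (pd j p _) => a b /= ->; rewrite oppr0.
  have -> : B (complexify x) * B' (complexify x) * pd j p (complexify x) * pd j p (complexify x) *
     compose (q ^+ 2) p (complexify x) =
     (B (complexify x) * pd j p (complexify x) * compose q p (complexify x)) *
     conjc (B (complexify x) * pd j p (complexify x) * compose q p (complexify x)).
    rewrite !conjcM pj B'E !composeE horner_exp.
    have -> : conjc (q.[P x])%:C = (q.[P x])%:C by apply: complex_eqP => //=; rewrite oppr0.
    by rewrite rmorphXn /=; ring.
  by rewrite mulJ_cmod.
Qed.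

(** In the [i]-th derivative, the term with [q(p)] is bounded by [|q| <= 6]. The term with [q'(p)]
    carries a factor [p_i], so the mean-square estimate applies to it with multiplier [B p_j] and
    [m = 36 X^2]. Each constant [72] is [2 * 36], the [2] coming from the square of a sum. *)
Lemma kernel_energy B j : laurent_trig B -> exists2 P0 : R, 0 < P0 &
  forall X q, 1 <= X -> kernel_bounded X q ->
    energy X (fun z => B z * pd j p z * compose q p z) <= P0.
Proof.
move=> LB; have Lpd i := laurent_pd i Lp; have LBp := laurentM LB (Lpd j).
have [C0 C00 H0] := kernel_msq j LB.
have /boolp.choice[C1 H1] : forall i, exists C1 : R, 0 <= C1 /\
    forall X q, 1 <= X -> kernel_bounded X q ->
    X^-1 * msq (pd i (fun z => B z * pd j p z * compose q p z)) <= C1.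
  move=> i; have [C1 C10 H1] := kernel_msq i LBp.
  have [S S0 HS] := laurent_bounded (laurent_pd i LBp).
  exists (72 * S ^+ 2 + 72 * C1); split; first by rewrite addr_ge0 ?mulr_ge0 ?sqr_ge0.
  move=> X q X1 hq; have X0 : 0 < X by exact: lt_le_trans X1.
  have Lq r := laurent_compose r Lp.
  rewrite pdM // pd_compose //.
  have -> : (fun z => pd i (fun z => B z * pd j p z) z * compose q p z +
      B z * pd j p z * (compose q^`() p z * pd i p z)) =
    fun z => pd i (fun z => B z * pd j p z) z * compose q p z +
      (B z * pd j p z) * pd i p z * compose q^`() p z.
    have e (a b c k m : C) : a * b + c * (k * m) = a * b + c * m * k by ring.
    by apply/funext => z; exact: e.
  have La := laurentM (laurent_pd i LBp) (Lq q).
  have Lb := laurentM (laurentM LBp (Lpd i)) (Lq q^`()).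
  rewrite mulrC ler_pdivrMr //; apply: (le_trans (msqD_le La Lb)).
  have ha : msq (fun z => pd i (fun z => B z * pd j p z) z * compose q p z) <= (S * 6) ^+ 2.
    apply: msq_bound => // x; rewrite cmodM composeE cmodR.
    apply: ler_pM => //; first exact: cmod_ge0.
    have [h _] := hq _ (real_valued_le1 x).
    rewrite -(@ler_pXn2r _ 2) ?nnegrE // real_normK ?num_real //; apply: (le_trans h).
    rewrite ler_pdivrMr; last by rewrite ltr_wpDr // mulr_ge0 ?sqr_ge0.
    have := mulr_ge0 (sqr_ge0 X) (sqr_ge0 (P x)); rewrite mulrDr => s0.
    by rewrite !expr2 in s0 *; lra.
  have hb : msq (fun z => (B z * pd j p z) * pd i p z * compose q^`() p z) <= C1 * (36 * X ^+ 2) / X.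
    apply: H1 => //; first by rewrite mulr_ge0 // sqr_ge0.
    by move=> t /hq[].
  have e : C1 * (36 * X ^+ 2) / X = 36 * C1 * X by field; rewrite gt_eqF.
  rewrite e exprMn in ha hb.
  have hS : S ^+ 2 <= S ^+ 2 * X by rewrite ler_peMr ?sqr_ge0.
  by move: ha hb hS; rewrite [6 ^+ 2]expr2; move: (S ^+ 2) => s; lra.
exists (36 * C0 + \sum_i C1 i + 1).
  have := mulr_ge0 (ler0n R 36) C00; have : 0 <= \sum_i C1 i by apply: sumr_ge0 => i _; exact: (H1 i).1.
  by lra.
move=> X q X1 hq; have X0 : 0 < X by exact: lt_le_trans X1.
have h1 : X * msq (fun z => B z * pd j p z * compose q p z) <= 36 * C0.
  rewrite mulrC -ler_pdivlMr // (mulrC 36); apply: H0 => // t /hq[] //.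
have h2 : X^-1 * \sum_i msq (pd i (fun z => B z * pd j p z * compose q p z)) <= \sum_i C1 i.
  by rewrite mulr_sumr; apply: ler_sum => i _; apply: (H1 i).2.
by rewrite /energy; lra.
Qed.

Lemma sublinear_kernel v B j (e : R) : linear_on_trig v ->
  sublinear (fun a => v (character a)) -> laurent_trig B -> 0 < e ->
  exists N : nat, forall n q, (N < n)%N -> kernel_bounded n%:R q ->
    cmod (v (fun z => B z * pd j p z * compose q p z)) <= e.
Proof.
move=> lv sv LB e0; have [P0 P00 HP] := kernel_energy j LB.
have [X0 X00 HX] := sublinear_energy lv sv e0 P00.
exists (Num.Def.archi_bound X0) => n q hn hq.
have n1 : 1 <= n%:R :> R by rewrite ler1n (leq_ltn_trans _ hn).
apply: HX (HP _ _ n1 hq).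
  apply: ltW; apply: (lt_trans (archi_boundP (ltW X00))); by rewrite ltr_nat.
apply: laurentM; last exact: laurent_compose.
by apply: laurentM => //; exact: laurent_pd.
Qed.

(* [v (B p_j) = v (B p_j bump(p))], since [1 - bump] is divisible by ['X]; the
   right-hand side is small. *)
Lemma annihilates_gradient v B j : linear_on_trig v ->
  sublinear (fun a => v (character a)) ->
  (forall F, laurent_trig F -> v (fun z => p z * F z) = 0) ->
  laurent_trig B -> v (fun z => B z * pd j p z) = 0.
Proof.
move=> lv sv vp LB; apply/eqP; rewrite -cmod_eq0 eq_le cmod_ge0 andbT.
apply/ler_addgt0Pl => e e0; rewrite addr0.
have [N HN] := sublinear_kernel j lv sv LB e0.
have := HN N.+1 (bump R N.+1) (ltnSn _) (@bump_bounded R _ (ltn0Sn N)).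
suff -> : v (fun z => B z * pd j p z * compose (bump R N.+1) p z) = v (fun z => B z * pd j p z) by [].
have : root (bump R N.+1 - 1) 0.
  by rewrite /root hornerD hornerN hornerC horner_1subX2 expr0n subr0 expr1n subrr.
move/factor_theorem => [r]; rewrite subr0 => /eqP; rewrite subr_eq => /eqP rE.
have Lr := laurent_compose r Lp; have Lpd := laurent_pd j Lp.
have := lv 1 _ _ (laurentM Lp (laurentM (laurentM LB Lpd) Lr)) (laurentM LB Lpd).
rewrite (vp _ (laurentM (laurentM LB Lpd) Lr)) mulr0 add0r => <-; congr v.
have cE z : compose (bump R N.+1) p z = compose r p z * p z + 1.
  by rewrite /compose rE rmorphD rmorphM /= map_polyX rmorph1 !hornerE.
have e' (a b k m : C) : a * b * (k * m + 1) = 1 * (m * (a * b * k)) + a * b by ring.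
by apply/funext => z; rewrite cE; exact: e'.
Qed.

End RealValued.

End Energy.

(** * Lower bounds for grid averages *)

Section GridLowerBound.
Variables (R : realType) (d M : nat) (j : 'I_d).
Local Notation Rd := 'rV[R]_d.
Local Notation T := {ffun 'I_d -> 'I_M}.

Definition update (k : T) (t : 'I_M) : T := [ffun i => if i == j then t else k i].

(** The line through a grid point in the direction [j] is listed once for each of its [M] points. *)
Lemma sum_fiber (g : T -> R) : M%:R * \sum_k g k = \sum_k \sum_t g (update k t).
Proof.
rewrite pair_big /= (reindex (fun u : T * 'I_M => (update u.1 u.2, u.1 j))) /=; last first.
  exists (fun u : T * 'I_M => (update u.1 u.2, u.1 j)) => -[k t] _ /=;
    by congr (_, _); rewrite ?ffunE ?eqxx //; apply/ffunP => i; rewrite !ffunE; case: eqVneq => [->|].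
rewrite -(pair_big xpredT xpredT (fun k t => g (update (update k t) (k j)))) /=.
rewrite mulr_sumr; apply: eq_bigr => k _; rewrite -[M in LHS]card_ord mulr_natl -sumr_const.
apply: eq_bigr => t _; congr g; apply/ffunP => i; rewrite !ffunE.
by case: eqVneq => [->|].
Qed.

Lemma card_small_box (q m : nat) : (0 < q)%N -> M = (q * m)%N ->
  \sum_(k : T) [forall i, (q * k i < M)%N]%:R = m%:R ^+ d :> R.
Proof.
move=> q0 ME.
transitivity (\sum_(k : T) \prod_i ((q * k i < M)%N%:R : R)).
  apply: eq_bigr => k _; case: forallP => [H|H]; first by rewrite big1 // => i _; rewrite H.
  have [i /negPf Hi] : exists i, ~~ (q * k i < M)%N.
    by apply: contrapT => h; apply: H => i; apply: contraT => hi; exfalso; apply: h; exists i.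
  by rewrite (bigD1 i) //= Hi mul0r.
rewrite -(bigA_distr_bigA (fun (i : 'I_d) (t : 'I_M) => (q * t < M)%N%:R : R)).
rewrite prodr_const card_ord; congr (_ ^+ d).
rewrite (eq_bigr (fun t : 'I_M => if (t < m)%N then 1 else 0 : R)); last first.
  move=> t _; have -> : (q * t < M)%N = (t < m)%N by rewrite -[RHS](ltn_pmul2l q0) -ME.
  by case: (t < m)%N.
rewrite -big_mkcond -(big_ord_widen M (fun=> 1 : R)) ?sumr_const ?card_ord //.
by rewrite ME leq_pmull.
Qed.

Definition line_point (y : Rd) (k : T) (t : R) : Rd :=
  \row_i (y 0 i + if i == j then t else 2 * pi * (k i)%:R / M%:R).

Lemma grid_update y k t :
  y + grid_point R (update k t) = line_point y k (2 * pi * (t : nat)%:R / M%:R).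
Proof. by apply/rowP => i; rewrite !mxE ffunE; case: ifP. Qed.

(** A Fubini argument on the grid: a proportion [q^-d] of the indices gives lines that meet
    [Re G >= b] in an interval of length [2 pi / e], and such an interval holds [w = M / e]
    consecutive grid points. Divisibility of [M] makes both counts exact. *)
Lemma avg_lower (G : Rd -> R[i]) (q e m w : nat) (y : Rd) (b : R) :
  (0 < q)%N -> (4 <= e)%N -> (0 < M)%N -> M = (q * m)%N -> M = (e * w)%N ->
  (forall x, 0 <= complex.Re (G x)) -> 0 <= b ->
  (forall k : T, (forall i, (q * k i < M)%N) -> exists2 a : R, 0 <= a <= 2 &
     forall t, a <= t <= a + 2 * pi / e%:R -> b <= complex.Re (G (line_point y k t))) ->
  q%:R ^- d * e%:R^-1 * b <= complex.Re (avg M y G).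
Proof.
move=> q0 e4 M0 ME Mw G0 b0 H; rewrite Re_avg.
have M0' : 0 < M%:R :> R by rewrite ltr0n.
have q0' : 0 < q%:R :> R by rewrite ltr0n.
have e0' : 0 < e%:R :> R by rewrite ltr0n (leq_trans _ e4).
have w0 : (0 < w)%N by move: M0; rewrite Mw muln_gt0 => /andP[].
have m0 : (0 < m)%N by move: M0; rewrite ME muln_gt0 => /andP[].
rewrite -(ler_pM2l M0') [leRHS]mulrCA.
rewrite (sum_fiber (fun k => complex.Re (G (y + grid_point R k)))).
have Hk (k : T) : [forall i, (q * k i < M)%N]%:R * (w%:R * b) <=
    \sum_t complex.Re (G (y + grid_point R (update k t))).
  case: forallP => [hk|_]; last by rewrite mul0r sumr_ge0.
  rewrite mul1r; have [a /andP[a0 a2] Ha] := H k hk.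
  pose t0 := (Num.truncn (a * M%:R / (2 * pi))).+1.
  have tp : 0 < 2 * pi :> R by rewrite mulr_gt0 // pi_gt0.
  have s0 : 0 <= a * M%:R / (2 * pi) by rewrite divr_ge0 ?(ltW tp) // mulr_ge0 // ltW.
  have ht0 : a * M%:R / (2 * pi) < t0%:R by apply: truncnS_gt.
  have ht1 : (t0.-1)%:R <= a * M%:R / (2 * pi) by rewrite /= truncn_le.
  have t0E : t0%:R = (t0.-1)%:R + 1 :> R by rewrite natr1.
  have bnd (i : nat) : (t0 <= i < t0 + w)%N ->
      a <= 2 * pi * i%:R / M%:R <= a + 2 * pi / e%:R.
    move=> /andP[h1 h2]; apply/andP; split.
      rewrite ler_pdivlMr // [leRHS]mulrC -ler_pdivrMr //; apply: (le_trans (ltW ht0)).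
      by rewrite ler_nat.
    have h3 : i%:R + 1 <= t0%:R + w%:R :> R by rewrite natr1 -natrD ler_nat.
    have h4 : i%:R <= a * M%:R / (2 * pi) + w%:R by rewrite t0E in h3; lra.
    rewrite ler_pdivrMr // [leLHS]mulrC -ler_pdivlMr //; apply: (le_trans h4).
    have MR : M%:R = e%:R * w%:R :> R by rewrite Mw natrM.
    rewrite le_eqVlt; apply/orP; left; apply/eqP; rewrite MR.
    move: (@pi R) (lt0r_neq0 (pi_gt0 R)) => P P0; field.
    by rewrite P0 gt_eqF.
  (* The interval does not wrap around: [a <= 2] and [e >= 4] give
     [a + 2 pi / e <= 2 + pi / 2 < 2 pi]. *)
  have tM : (t0 + w <= M)%N.
    have : (t0 <= (t0 + w).-1 < t0 + w)%N by case: (w) w0 => // w' _; rewrite addnS /= leq_addr ltnSn.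
    move=> /bnd /andP[_ hb]; suff : ((t0 + w).-1 < M)%N by case: (t0 + w)%N.
    rewrite -(ltr_nat R); have pi2 := pi_ge2 R.
    have he : 2 * pi / e%:R <= pi / 2 :> R.
      rewrite ler_pdivrMr //; have : 4 <= e%:R :> R by rewrite ler_nat.
      by have := pi_gt0 R; nra.
    have h5 : a + 2 * pi / e%:R < 2 * pi by lra.
    have := le_lt_trans hb h5.
    by rewrite ltr_pdivrMr // ltr_pM2l.
  pose F (t : nat) := complex.Re (G (line_point y k (2 * pi * t%:R / M%:R))).
  have -> : \sum_t complex.Re (G (y + grid_point R (update k t))) = \sum_(0 <= t < M) F t.
    by rewrite big_mkord; apply: eq_bigr => t _; rewrite grid_update.
  have F0 t : 0 <= F t by exact: G0.
  rewrite (@big_cat_nat _ _ _ t0) //=; last by apply: leq_trans tM; exact: leq_addr.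
  rewrite (@big_cat_nat _ _ _ (t0 + w) t0 M) //=; last exact: leq_addr.
  have s1 : 0 <= \sum_(0 <= i < t0) F i by apply: sumr_ge0.
  have s2 : 0 <= \sum_(t0 + w <= i < M) F i by apply: sumr_ge0.
  have s3 : w%:R * b <= \sum_(t0 <= i < t0 + w) F i.
    rewrite -[w in leLHS](addKn t0) mulr_natl -sumr_const_nat.
    by apply: ler_sum_nat => i hi; apply: Ha; exact: bnd.
  by lra.
have := ler_sum (index_enum T) (fun (k : T) (_ : true) => Hk k).
rewrite -mulr_suml (card_small_box q0 ME) => hs.
apply: le_trans (ler_wpM2l _ hs); last by rewrite invr_ge0 exprn_ge0.
rewrite le_eqVlt; apply/orP; left; apply/eqP.
have -> : m%:R = M%:R / q%:R :> R by rewrite ME natrM mulrAC mulfV ?mul1r // gt_eqF.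
have -> : w%:R = M%:R / e%:R :> R by rewrite Mw natrM mulrAC mulfV ?mul1r // gt_eqF.
rewrite expr_div_n; field.
by rewrite !gt_eqF ?exprn_gt0.
Qed.

End GridLowerBound.

(** * Vanishing on the real regular set *)

Section ResonantValues.
Variables (R : realType) (d : nat).
Local Notation C := R[i].
Local Notation Rd := 'rV[R]_d.
Local Notation Cd := 'rV[C]_d.
Local Notation Zd := 'rV[int]_d.
Implicit Types (x y : Rd) (F G B : Cd -> C) (X t : R) (q : {poly R}).

(** [peak] without its factor [t]. In [peak(p)] that factor becomes a factor [p], which the equation
    converts into [g], and the remaining kernel is nonnegative. *)
Definition even_peak (n : nat) : {poly R} := n%:R%:P * (1 - 'X^2) ^+ (n ^ 2).*2.+1.

Lemma even_peak_ge0 n t : `|t| <= 1 -> 0 <= (even_peak n).[t].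
Proof.
move=> t1; rewrite hornerM hornerC horner_1subX2 mulr_ge0 // exprn_ge0 //.
by rewrite subr_ge0 sq_le1.
Qed.

Lemma peakE n : peak R n = even_peak n * 'X.
Proof. by rewrite /peak /even_peak mulrAC. Qed.

(** By Bernoulli the power is at least [1 - (2 n^2 + 1) / (4 n^2) = 1/2 - 1 / (4 n^2)], hence at
    least [1/4]. *)
Lemma even_peak_lower n t : (0 < n)%N -> `|t| <= (2 * n%:R)^-1 ->
  n%:R / 4 <= (even_peak n).[t].
Proof.
move=> n0 ht; have n1 : 1 <= n%:R :> R by rewrite ler1n.
have n0' : 0 < n%:R :> R by exact: lt_le_trans n1.
rewrite hornerM hornerC horner_1subX2 ler_pM2l //.
have t2 : t ^+ 2 <= (4 * n%:R ^+ 2)^-1.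
  rewrite -real_normK ?num_real //; apply: (@le_trans _ _ ((2 * n%:R)^-1 ^+ 2)).
    by rewrite lerXn2r ?nnegrE // invr_ge0 mulr_ge0.
  by rewrite exprVn exprMn expr2 -natrM.
have bern (s : R) (N : nat) : 0 <= s <= 1 -> 1 - N%:R * s <= (1 - s) ^+ N.
  move=> /andP[s0 s1]; elim: N => [|N IH]; first by rewrite mul0r subr0 expr0.
  rewrite exprS; apply: (@le_trans _ _ ((1 - s) * (1 - N%:R * s))).
    have : 0 <= s * (N%:R * s) by rewrite !mulr_ge0.
    by rewrite -natr1; lra.
  by rewrite ler_wpM2l // subr_ge0.
have h : (4 * n%:R ^+ 2)^-1 <= 1 :> R.
  by rewrite invf_le1 ?mulr_gt0 ?exprn_gt0 //; have := exprn_ege1 2 n1; lra.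
apply: (le_trans _ (bern _ _ _)); last by rewrite sqr_ge0 (le_trans t2).
have NE : (n ^ 2).*2.+1%:R = 2 * n%:R ^+ 2 + 1 :> R by rewrite -natr1 -mul2n natrM natrX.
rewrite NE.
have h2 : (2 * n%:R ^+ 2 + 1) * t ^+ 2 <= (2 * n%:R ^+ 2 + 1) * (4 * n%:R ^+ 2)^-1.
  by rewrite ler_wpM2l // addr_ge0 // mulr_ge0 // sqr_ge0.
have h3 : (2 * n%:R ^+ 2 + 1) * (4 * n%:R ^+ 2)^-1 = 2^-1 + (4 * n%:R ^+ 2)^-1 :> R.
  by field; rewrite gt_eqF.
have h4 : (4 * n%:R ^+ 2)^-1 <= 4^-1 :> R.
  by rewrite lef_pV2 ?posrE ?mulr_gt0 ?exprn_gt0 //; have := exprn_ege1 2 n1; lra.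
by lra.
Qed.

Variable p : Cd -> C.
Hypotheses (Lp : laurent_trig p) (p_real : forall x, complex.Im (p (complexify x)) = 0)
  (p_le1 : forall x, cmod (p (complexify x)) <= 1).

Let P x : R := complex.Re (p (complexify x)).

Lemma line_lipschitz j F (L : R) x t s : laurent_trig F ->
  (forall x, cmod (pd j F (complexify x)) <= L) ->
  `|complex.Re (F (complexify x + t%:C *: basis_vec C j)) -
    complex.Re (F (complexify x + s%:C *: basis_vec C j))| <= L * `|t - s|.
Proof.
move=> LF HL; pose f (t : R) := complex.Re (F (complexify x + t%:C *: basis_vec C j)).
wlog st : s t / s <= t.
  move=> W; have [|/ltW] := leP s t; first exact: W.
  by rewrite distrC [`|t - s|]distrC; exact: W.
have df (u : R) := laurent_Re_is_derive (complexify x) j u LF.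
have cf : {within `[s, t], continuous f}.
  by apply: continuous_subspaceT; exact: laurent_Re_line_continuous.
have [c _ ->] := MVT_segment st (fun u _ => df u) cf.
rewrite normrM ler_wpM2r //; apply: (le_trans (Re_le_cmod _)).
by rewrite -complexify_basis -complexifyZ -complexifyD.
Qed.

(* [p] changes sign along each line in direction [j] near [x0]; the constants
   are uniform in the line. *)
Lemma line_window (j : 'I_d) x0 (r0 : R) : 0 < r0 -> p (complexify x0) = 0 ->
  0 < complex.Re (pd j p (complexify x0)) ->
  exists (dl r1 L : R), [/\ 0 < dl < r0, 0 < r1 < r0, 0 < L &
    forall x, (forall i, i != j -> `|x 0 i - x0 0 i| < r1) -> x 0 j = x0 0 j ->
      exists2 t0, - dl <= t0 <= dl & forall t,
        `|P (x + t *: basis_vec R j)| <= L * `|t - t0|].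
Proof.
move=> r00 px0 pj0; have Lpd := laurent_pd j Lp.
have [r rp Hr] := laurent_Re_near (complexify x0) Lpd pj0.
pose r' := Num.min r r0; have r'0 : 0 < r' by rewrite lt_min rp r00.
have r'r : r' <= r by rewrite ge_min lexx.
have r'r0 : r' <= r0 by rewrite ge_min lexx orbT.
pose dl : R := r' / 2; have dl0 : 0 < dl by rewrite divr_gt0.
have dlr : dl < r' by rewrite /dl; lra.
pose f x (t : R) := complex.Re (p (complexify x + t%:C *: basis_vec C j)).
have fE x t : P (x + t *: basis_vec R j) = f x t.
  by rewrite /f /P complexifyD complexifyZ complexify_basis.
have inc t1 t2 : - r' < t1 -> t1 < t2 -> t2 < r' -> f x0 t1 < f x0 t2.
  move=> h1 h2 h3; apply: (@laurent_Re_increasing R d p j x0 r Lp pj0).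
  - by move=> y hy; exact: Hr.
  - by move=> i _; rewrite subrr normr0.
  - move=> t /andP[ht1 ht2]; rewrite addrAC subrr add0r ltr_norml.
    by apply/andP; split; lra.
  - exact: h2.
have f0 : f x0 0 = 0 by rewrite /f scale0r addr0 px0.
have [nr nd] : - r' < - dl /\ - dl < 0 by clearbody dl; clear -dlr dl0; split; lra.
have fneg : 0 < - f x0 (- dl) by rewrite oppr_gt0 -f0; apply: inc.
have fpos : 0 < f x0 dl by rewrite -f0; apply: inc; rewrite // oppr_lt0.
have [s1 s10 Hs1] := laurent_Re_near (complexify x0 + (- dl)%:C *: basis_vec C j) Lp fneg.
have [s2 s20 Hs2] := laurent_Re_near (complexify x0 + dl%:C *: basis_vec C j) Lp fpos.
pose r1 : R := Num.min r' (Num.min s1 s2) / 2.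
have r1p : 0 < r1 by rewrite divr_gt0 // !lt_min rp r00 s10 s20.
have r1E : 2 * r1 = Num.min r' (Num.min s1 s2) by rewrite /r1; field.
have r1r : 2 * r1 <= r' by rewrite r1E ge_min lexx.
have r1s1 : 2 * r1 <= s1 by rewrite r1E !ge_min lexx orbT.
have r1s2 : 2 * r1 <= s2 by rewrite r1E !ge_min lexx !orbT.
have [L0 L00 HL] := laurent_bounded Lpd.
clearbody r1 dl r'.
have rb : 0 < r1 < r0 by clear -r1p r1r r'r0; lra.
exists dl, r1, (L0 + 1); split=> //; [by rewrite dl0 (lt_le_trans dlr)|by rewrite ltr_wpDl|].
move=> x hx xj.
have E (a : R) : complexify x + a%:C *: basis_vec C j =
    complexify x0 + a%:C *: basis_vec C j + complexify (x - x0).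
  by rewrite addrAC -complexifyD subrKC.
have XB i : `|(x - x0) 0 i| < 2 * r1.
  rewrite !mxE; have [->|ij] := eqVneq i j; first by rewrite xj subrr normr0 mulr_gt0.
  by apply: lt_trans (hx i ij) _; rewrite mulr_natl mulr2n ltrDl.
have g1 : f x (- dl) < 0.
  have := Hs1 (x - x0) (fun i => lt_le_trans (XB i) r1s1).
  rewrite -E -/(f x (- dl)) -/(f x0 (- dl)) ltr_norml => /andP[_].
  by rewrite ltrBlDr addNr.
have g2 : 0 < f x dl.
  have := Hs2 (x - x0) (fun i => lt_le_trans (XB i) r1s2).
  rewrite -E -/(f x dl) -/(f x0 dl) ltr_norml => /andP[+ _].
  by rewrite ltrBrDr addNr.
have dle : - dl <= dl by rewrite ge0_cp ?ltW.
have [|t0 ht0 ft0] := IVT0 dle (laurent_Re_line_continuous (z := complexify x) (w := basis_vec C j) Lp).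
  by rewrite -/(f x (- dl)) -/(f x dl); move: g1 g2; move: (f x _) (f x _) => a1 a2 g1 g2; rewrite nmulr_rle0 // ltW.
exists t0 => // t; rewrite fE -[f x t]subr0 -[X in _ - X]ft0.
apply: (line_lipschitz x t t0 Lp (L := L0 + 1)) => y.
by apply: (le_trans (HL y)); rewrite lerDl.
Qed.

(** Each line in the direction [j] near [x0] has a zero of [p], and close to it [even_peak n] is at
    least [n / 4] on an interval of length of order [1 / n]. The two orders cancel, so the bound
    does not depend on [n]. *)
Lemma even_peak_mean_lower j x0 h : laurent_trig h -> p (complexify x0) = 0 ->
  0 < complex.Re (pd j p (complexify x0)) ->
  (forall x, 0 <= complex.Re (h (complexify x))) -> 0 < complex.Re (h (complexify x0)) ->
  exists2 c : R, 0 < c & forall n, (0 < n)%N ->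
    c <= complex.Re (mean (fun x => h (complexify x) * compose (even_peak n) p (complexify x))).
Proof.
move=> Lh px0 pj0 h0 hx0.
pose hm : R := complex.Re (h (complexify x0)) / 2.
have hm0 : 0 < hm by rewrite divr_gt0.
have [rh rh0 Hh] := laurent_Re_near (complexify x0) Lh hm0.
pose r0 : R := Num.min rh 1; have r00 : 0 < r0 by rewrite lt_min rh0 ltr01.
have r0h : r0 <= rh by rewrite ge_min lexx.
have r01 : r0 <= 1 by rewrite ge_min lexx orbT.
have [dl [r1 [L [/andP[dl0 dlr] /andP[r10 r1r] L0 HW]]]] := line_window r00 px0 pj0.
have tp : 0 < 2 * pi :> R by rewrite mulr_gt0 // pi_gt0.
have [q q0 Hq] : exists2 q : nat, (0 < q)%N & 2 * pi / q%:R <= r1.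
  exists (Num.Def.archi_bound (2 * pi / r1)).+1 => //.
  rewrite ler_pdivrMr // [leRHS]mulrC -ler_pdivrMr //; apply: ltW.
  apply: (lt_trans (archi_boundP _)); first by rewrite divr_ge0 ?ltW.
  by rewrite ltr_nat.
(* On an interval of length [2 pi / (n E)] from the zero, [|p|] stays below [1 / (2 n)], by the
   Lipschitz constant [L], and the point does not leave the window of radius [r0]. *)
have [E E4 [HE1 HE2]] : exists2 E : nat, (4 <= E)%N &
    2 * pi / E%:R <= (2 * L)^-1 /\ 2 * pi / E%:R < r0 - dl.
  pose B := 2 * pi * (2 * L) + 2 * pi / (r0 - dl).
  have rd : 0 < r0 - dl by lra.
  have b1 : 0 < 2 * pi * (2 * L) by rewrite mulr_gt0 // mulr_gt0.
  have b2 : 0 < 2 * pi / (r0 - dl) by rewrite divr_gt0.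
  have := archi_boundP (ltW (addr_gt0 b1 b2)); set a := Num.Def.archi_bound _ => ha.
  have haE : a%:R <= (a + 4)%:R :> R by rewrite ler_nat leq_addr.
  have a0 : 0 < (a + 4)%:R :> R by lra.
  exists (a + 4)%N; first by rewrite leq_addl.
  split.
    by rewrite ler_pdivrMr // [leRHS]mulrC ler_pdivlMr ?mulr_gt0 //; lra.
  by rewrite ltr_pdivrMr // [ltRHS]mulrC -ltr_pdivrMr //; lra.
have E0 : 0 < E%:R :> R by rewrite ltr0n (leq_trans _ E4).
have q0' : 0 < q%:R :> R by rewrite ltr0n.
exists (q%:R ^- d * hm / (4 * E%:R)).
  by rewrite divr_gt0 // ?mulr_gt0 // invr_gt0 exprn_gt0.
move=> n n0; have n0' : 0 < n%:R :> R by rewrite ltr0n.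
have n1 : 1 <= n%:R :> R by rewrite ler1n.
have Lc := laurent_compose (even_peak n) Lp.
have [M0 HM] := meanP (real_trigM (real_trig_laurent Lh) (real_trig_laurent Lc)).
(* A multiple of [q] and of [n E], as the counting requires, and above the threshold from which the
   grid average is the mean. *)
pose M := (q * (n * E * M0.+1))%N.
have Mlt : (M0 < M)%N.
  by rewrite /M !mulnA leq_pmull // !muln_gt0 q0 n0 (leq_trans _ E4).
have M0' : (0 < M)%N by exact: leq_ltn_trans Mlt.
have M0R : 0 < M%:R :> R by rewrite ltr0n.
(* Starting the grid at [x0 - dl e_j] makes the parameter of the zero nonnegative: it becomes
   [t0 + dl], between [0] and [2]. *)
rewrite -(HM M (x0 - dl *: basis_vec R j) Mlt).
have ReG x : complex.Re (h (complexify x) * compose (even_peak n) p (complexify x)) =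
    complex.Re (h (complexify x)) * (even_peak n).[P x].
  by rewrite composeE // mulrC Re_realM mulrC.
have -> : q%:R ^- d * hm / (4 * E%:R) = q%:R ^- d * (n * E)%:R^-1 * (hm * (n%:R / 4)) :> R.
  by rewrite natrM; field; rewrite !gt_eqF ?exprn_gt0.
apply: (@avg_lower R d M j _ q (n * E)%N (n * E * M0.+1)%N (q * M0.+1)%N) => //.
- by apply: (leq_trans E4); rewrite leq_pmull.
- by rewrite /M mulnCA.
- by move=> x; rewrite ReG mulr_ge0 // even_peak_ge0 // real_valued_le1.
- by rewrite mulr_ge0 ?divr_ge0 // ltW.
move=> k hk.
pose x : Rd := \row_i (x0 0 i + if i == j then 0 else 2 * pi * (k i)%:R / M%:R).
have hx i : i != j -> `|x 0 i - x0 0 i| < r1.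
  move=> /negPf ij; rewrite mxE ij addrAC subrr add0r ger0_norm; last first.
    by rewrite divr_ge0 // mulr_ge0 // ltW.
  apply: lt_le_trans Hq.
  have hkq : (k i)%:R / M%:R < q%:R^-1 :> R.
    by rewrite ltr_pdivrMr // [ltRHS]mulrC ltr_pdivlMr // -natrM ltr_nat mulnC.
  by rewrite -(mulrA (2 * pi) (k i)%:R) ltr_pM2l.
have [||t0 /andP[t0a t0b] Ht] := HW x; [exact: hx|by rewrite mxE eqxx addr0|].
have e1 : 2 * pi / (n * E)%:R <= (n%:R * (2 * L))^-1 :> R.
  by rewrite natrM !invfM mulrCA -invfM; rewrite ler_wpM2l ?invr_ge0 ?ler0n.
have e2 : 2 * pi / (n * E)%:R < r0 - dl :> R.
  apply: le_lt_trans HE2; rewrite ler_pM2l // lef_pV2 ?posrE ?ltr0n ?muln_gt0 ?n0 //.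
  - by rewrite ler_nat leq_pmull.
  - by rewrite (leq_trans _ E4).
  - by rewrite (leq_trans _ E4).
exists (t0 + dl); first by apply/andP; split; lra.
move=> t /andP[ta tb].
have lpE : line_point j (x0 - dl *: basis_vec R j) k t = x + (t - dl) *: basis_vec R j.
  apply/rowP => i; rewrite !mxE eqxx /=; case: (i == j); rewrite ?mulr1 ?mulr0; ring.
rewrite lpE ReG; apply: ler_pM; [exact: ltW|by rewrite divr_ge0 // ltW| |].
  have hnear i : `|(x + (t - dl) *: basis_vec R j - x0) 0 i| < rh.
    apply: lt_le_trans r0h; have [->|ij] := eqVneq i j.
      by rewrite !mxE !eqxx /= mulr1 addr0 addrAC subrr add0r ltr_norml; apply/andP; split; lra.
    have := hx i ij; rewrite !mxE (negPf ij) /= mulr0n mulr0 addr0; lra.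
  have := Hh _ hnear; rewrite -complexifyD subrKC ltr_norml => /andP[+ _].
  by rewrite /hm; lra.
apply: even_peak_lower => //; apply: (le_trans (Ht _)).
have ht : `|t - dl - t0| <= (n%:R * (2 * L))^-1 by rewrite ger0_norm; lra.
apply: (le_trans (ler_wpM2l (ltW L0) ht)).
rewrite le_eqVlt; apply/orP; left; apply/eqP; field.
by rewrite !gt_eqF.
Qed.

(* With [B = conj g * p_j], the small number [v (B p_j peak(p))] is the mean of
   [|g p_j|^2 even_peak(p)], which is bounded below if [g x0 <> 0]. *)
Lemma resonant_value_eq0 v g j x0 : linear_on_trig v ->
  sublinear (fun a => v (character a)) -> laurent_trig g ->
  (forall F, laurent_trig F -> v (fun z => p z * F z) = mean (fun x => g (complexify x) * F (complexify x))) ->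
  p (complexify x0) = 0 -> 0 < complex.Re (pd j p (complexify x0)) ->
  g (complexify x0) = 0.
Proof.
move=> lv sv Lg vp px0 pj0; apply: contrapT => /eqP g0.
have [g' Lg' g'E] := laurent_conj Lg; have Lpd := laurent_pd j Lp.
pose B z := g' z * pd j p z; have LB : laurent_trig B by exact: laurentM.
pose h z := g z * (B z * pd j p z).
have Lh : laurent_trig h by apply: laurentM => //; exact: laurentM.
have hE x : h (complexify x) = (cmod (g (complexify x)) ^+ 2 * complex.Re (pd j p (complexify x)) ^+ 2)%:C.
  have pdE : pd j p (complexify x) = (complex.Re (pd j p (complexify x)))%:C.
    by apply: complex_eqP => //; rewrite laurent_real_pd.
  rewrite /h /B g'E; move: pdE; move: (pd j p _) => w ->; move: (g _) => u /=.
  by rewrite (rmorphM (real_complex R)) /= -mulJ_cmod (expr2 (complex.Re w)) (rmorphM (real_complex R)) /=; ring.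
have h0 x : 0 <= complex.Re (h (complexify x)) by rewrite hE /= mulr_ge0 ?sqr_ge0.
have hx0 : 0 < complex.Re (h (complexify x0)).
  by rewrite hE /= mulr_gt0 // exprn_gt0 // cmod_gt0.
have [c c0 Hc] := even_peak_mean_lower Lh px0 pj0 h0 hx0.
have c2 : 0 < c / 2 by rewrite divr_gt0.
have [N HN] := sublinear_kernel Lp p_real p_le1 j lv sv LB c2.
have := HN N.+1 (peak R N.+1) (ltnSn _) (@peak_bounded R _ (ltn0Sn N)).
have LE := laurent_compose (even_peak N.+1) Lp.
have pkE z : compose (peak R N.+1) p z = compose (even_peak N.+1) p z * p z.
  by rewrite /compose peakE rmorphM /= map_polyX hornerM hornerX.
have e1 (a b k m : C) : a * b * (k * m) = m * (a * b * k) by ring.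
have -> : v (fun z => B z * pd j p z * compose (peak R N.+1) p z) =
    v (fun z => p z * (B z * pd j p z * compose (even_peak N.+1) p z)).
  by congr v; apply/funext => z; rewrite pkE; exact: e1.
rewrite (vp _ (laurentM (laurentM LB Lpd) LE)).
have -> : (fun x => g (complexify x) * (B (complexify x) * pd j p (complexify x) *
    compose (even_peak N.+1) p (complexify x))) =
  fun x => h (complexify x) * compose (even_peak N.+1) p (complexify x).
  by apply/funext => x; rewrite mulrA.
have := Hc N.+1 (ltn0Sn N); set m := mean _ => h1 h2.
have := le_trans (le_trans (ler_norm _) (Re_le_cmod m)) h2.
by lra.
Qed.

End ResonantValues.

(** * Integration over the torus *)

Section RiemannSums.
Variable R : realType.
Local Notation mu := (@lebesgue_measure R).
Implicit Types (f : R -> R) (a b c e L : R).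

Lemma lipschitz_continuous f L : (forall s t, `|f s - f t| <= L * `|s - t|) -> continuous f.
Proof.
move=> fL t; apply/cvgrPdist_le => e e0; near=> s.
apply: (le_trans (fL t s)); have L1 : 0 < `|L| + 1 by rewrite ltr_wpDl.
apply: (@le_trans _ _ ((`|L| + 1) * `|t - s|)).
  by rewrite ler_wpM2r // (le_trans (ler_norm L)) // lerDl.
rewrite mulrC -ler_pdivlMr //; near: s.
by apply: cvgr_dist_le => //; rewrite divr_gt0.
Unshelve. all: by end_near. Qed.

Lemma continuous_integrable_itv f a b : continuous f -> mu.-integrable `[a, b] (EFin \o f).
Proof.
move=> cf; apply: continuous_compact_integrable; first exact: segment_compact.
exact: continuous_subspaceT.
Qed.

Lemma integral_oc_near f a b c e : a <= b -> continuous f ->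
  (forall t, a <= t <= b -> `|f t - c| <= e) ->
  `|\int[mu]_(t in `]a, b]) f t - (b - a) * c| <= (b - a) * e.
Proof.
move=> ab cf fc.
have mE : fine (mu `]a, b]) = b - a.
  rewrite lebesgue_measure_itv /= lte_fin; move: ab; rewrite le_eqVlt => /predU1P[->|->] //.
  by rewrite ltxx subrr.
have fi : mu.-integrable `]a, b] (EFin \o f).
  by apply: (integrableS _ _ _ (continuous_integrable_itv a b cf)) => //; exact: subset_itv_oc_cc.
have ci r : mu.-integrable `]a, b] (EFin \o (fun=> r : R)).
  apply: (integrableS _ _ _ (@continuous_integrable_itv _ a b _)) => //; first exact: subset_itv_oc_cc.
  exact: cst_continuous.
have cE r : \int[mu]_(t in `]a, b]) r = (b - a) * r.
  by rewrite Rintegral_cst // mE mulrC.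
have bnd t : `]a, b]%classic t -> c - e <= f t <= c + e.
  rewrite /= in_itv /= => /andP[at_ tb]; rewrite -ler_distlC distrC fc // tb ltW //.
rewrite distrC ler_distlC -mulrBr -mulrDr -!cE; apply/andP; split; apply: le_Rintegral => //.
- by move=> t /bnd /andP[].
- by move=> t /bnd /andP[].
Qed.

(** Left endpoint sums: each of the [M] intervals of length [h] contributes an error of at most
    [L h^2]. *)
Lemma riemann_sum f L (M : nat) : (0 < M)%N -> 0 <= L ->
  (forall s t, `|f s - f t| <= L * `|s - t|) ->
  `|\int[mu]_(t in `[0, 2 * pi]) f t - (2 * pi / M%:R) * \sum_(k < M) f (2 * pi * k%:R / M%:R)|
  <= (2 * pi) ^+ 2 * L / M%:R.
Proof.
move=> M0 L0 fL; have cf := lipschitz_continuous fL; set h := 2 * pi / M%:R.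
have M0' : 0 < M%:R :> R by rewrite ltr0n.
have h0 : 0 <= h by rewrite divr_ge0 // mulr_ge0 // pi_ge0.
have hk (k : nat) : 2 * pi * k%:R / M%:R = k%:R * h by rewrite /h mulrAC mulrC.
have step n : `|\int[mu]_(t in `[0, n%:R * h]) f t - h * \sum_(k < n) f (k%:R * h)| <= n%:R * (L * h ^+ 2).
  elim: n => [|n IH].
    by rewrite !mul0r big_ord0 mulr0 subr0 set_itv1 Rintegral_set1 normr0.
  have e1 : n.+1%:R * h - n%:R * h = h by rewrite -natr1; ring.
  have le1 : n%:R * h <= n.+1%:R * h by rewrite -subr_ge0 e1.
  have n0 : 0 <= n%:R * h by rewrite mulr_ge0.
  have := @Rintegral_itvB R f (BLeft 0) (BRight (n.+1%:R * h)) (n%:R * h)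
    (continuous_integrable_itv _ _ cf) _ _.
  rewrite !bnd_simp n0 le1 => /(_ isT isT) e2.
  have := @integral_oc_near f _ _ (f (n%:R * h)) (L * h) le1 cf _.
  rewrite e1 => H; rewrite big_ord_recr /= mulrDr.
  have {}H : `|\int[mu]_(t in `]n%:R * h, n.+1%:R * h]) f t - h * f (n%:R * h)| <= h * (L * h).
    apply: H => t /andP[t1 t2]; apply: (le_trans (fL _ _)); rewrite ler_wpM2l //.
    by rewrite ger0_norm ?subr_ge0 // lerBlDr; apply: (le_trans t2); rewrite -lerBlDr e1.
  rewrite -e2 in H.
  move: (\int[mu]_(t in `[0, n.+1%:R * h]) f t) (\int[mu]_(t in `[0, n%:R * h]) f t)
    (\sum_(k < n) _) (f _) H IH => u v s w H IH.
  rewrite -natr1 mulrDl mul1r.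
  have -> : u - (h * s + h * w) = (v - h * s) + (u - v - h * w) by ring.
  apply: (le_trans (ler_normD _ _)); apply: lerD => //.
  by rewrite expr2 (mulrCA L).
have := step M; have -> : M%:R * h = 2 * pi by rewrite /h mulrC divfK // gt_eqF.
under eq_bigr do rewrite -hk; move=> H; apply: (le_trans H).
by rewrite le_eqVlt; apply/orP; left; apply/eqP; rewrite /h; move: (@pi R) => P; field; rewrite gt_eqF.
Qed.

(** The [l^1] distance suits arguments that change one coordinate at a time. *)
Definition lip1 (d : nat) (L : R) (F : 'rV[R]_d -> R) :=
  forall x y, `|F x - F y| <= L * \sum_i `|x 0 i - y 0 i|.

Definition ravg (d M : nat) (F : 'rV[R]_d -> R) : R :=
  M%:R ^- d * \sum_(k : {ffun 'I_d -> 'I_M}) F (grid_point R k).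

Definition ffun_cons (d M : nat) (t : 'I_M) (k : {ffun 'I_d -> 'I_M}) : {ffun 'I_d.+1 -> 'I_M} :=
  [ffun i => if unlift ord0 i is Some i' then k i' else t].

Definition vcons (d : nat) (t : R) (y : 'rV[R]_d) : 'rV[R]_d.+1 := row_mx (t%:M : 'rV_1) y.

Lemma vcons0 d t (y : 'rV[R]_d) : vcons t y 0 ord0 = t.
Proof.
have -> : ord0 = lshift d ord0 :> 'I_(1 + d) by apply: val_inj.
transitivity (row_mx (t%:M : 'rV_1) y (0 : 'I_1) (lshift d ord0)) => //.
by rewrite row_mxEl mxE eqxx.
Qed.

Lemma vcons_lift d t (y : 'rV[R]_d) i : vcons t y 0 (lift ord0 i) = y 0 i.
Proof.
have -> : lift ord0 i = rshift 1 i :> 'I_(1 + d) by apply: val_inj.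
transitivity (row_mx (t%:M : 'rV_1) y (0 : 'I_1) (rshift 1 i)) => //.
by rewrite row_mxEr.
Qed.

Lemma grid_point_cons d M (t : 'I_M) (k : {ffun 'I_d -> 'I_M}) :
  grid_point R (ffun_cons t k) = vcons (2 * pi * t%:R / M%:R) (grid_point R k).
Proof.
apply/rowP => i; rewrite mxE ffunE.
case: (unliftP ord0 i) => [i'|] ->; first by rewrite vcons_lift mxE.
by rewrite vcons0.
Qed.

Lemma ravg_cons d M (F : 'rV[R]_d.+1 -> R) :
  ravg M F = M%:R^-1 * \sum_(t < M) ravg M (fun y => F (vcons (2 * pi * t%:R / M%:R) y)).
Proof.
rewrite /ravg -mulr_sumr mulrA exprS invfM; congr (_ * _).
rewrite pair_big /= (reindex (fun u : 'I_M * {ffun 'I_d -> 'I_M} => ffun_cons u.1 u.2)) /=.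
  by apply: eq_bigr => -[t k] _ /=; rewrite grid_point_cons.
exists (fun k : {ffun 'I_d.+1 -> 'I_M} => (k ord0, [ffun i => k (lift ord0 i)])).
  move=> [t k] _ /=; rewrite ffunE unlift_none; congr (_, _).
  by apply/ffunP => i; rewrite !ffunE liftK.
move=> k _ /=; apply/ffunP => i; rewrite ffunE.
by case: (unliftP ord0 i) => [i'|] ->; rewrite ?ffunE.
Qed.

Lemma lip1_vcons d L (F : 'rV[R]_d.+1 -> R) t : lip1 L F -> lip1 L (fun y => F (vcons t y)).
Proof.
move=> FL x y; apply: (le_trans (FL _ _)); rewrite big_ord_recl !vcons0 subrr normr0 add0r.
by under eq_bigr do rewrite !vcons_lift.
Qed.

Lemma ravg_le d M (F G : 'rV[R]_d -> R) (c : R) : (0 < M)%N -> (forall x, `|F x - G x| <= c) ->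
  `|ravg M F - ravg M G| <= c.
Proof.
move=> M0 H; rewrite /ravg -mulrBr -sumrB normrM ger0_norm ?invr_ge0 ?exprn_ge0 //.
have Md : 0 < M%:R ^+ d :> R by rewrite exprn_gt0 // ltr0n.
rewrite mulrC ler_pdivrMr //; apply: (le_trans (ler_norm_sum _ _ _)).
apply: (le_trans (ler_sum _ (fun k _ => H _))).
by rewrite sumr_const card_ffun !card_ord -[c *+ _]mulr_natr natrX.
Qed.

Lemma norm_sub_near (u v a b c e : R) : `|u - a| <= e -> `|v - b| <= e -> `|a - b| <= c ->
  `|u - v| <= c + 2 * e.
Proof. by rewrite !ler_norml => /andP[? ?] /andP[? ?] /andP[? ?]; apply/andP; split; lra. Qed.

Lemma natr_inv_small (e B : R) : 0 < e -> 0 <= B -> exists M : nat, (0 < M)%N /\ B / M%:R <= e.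
Proof.
move=> e0 B0; exists (Num.Def.archi_bound (B / e)).+1; split=> //.
rewrite ler_pdivrMr // mulrC -ler_pdivrMr //.
apply: ltW; apply: (lt_le_trans (archi_boundP _)); first by rewrite divr_ge0 // ltW.
by rewrite ler_nat.
Qed.

(** Induction on the dimension, with [K] independent of [F], [L] and [M]. The outer Riemann sum
    needs the inner integral to be Lipschitz; this is read off from its own grid averages, with [N]
    large. *)
Lemma box_integral_avg d : exists2 K : R, 0 <= K & forall L (F : 'rV[R]_d -> R) (M : nat),
  0 <= L -> lip1 L F -> (0 < M)%N ->
  `|box_integral F - (2 * pi) ^+ d * ravg M F| <= K * L / M%:R.
Proof.
elim: d => [|d [K K0 IH]].
  exists 0 => // L F M L0 FL M0; rewrite /ravg /= !expr0 !mul1r mul0r mul0r invr1 mul1r.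
  have e : forall k : {ffun 'I_0 -> 'I_M}, F (grid_point R k) = F 0.
    by move=> k; congr F; apply/rowP => -[].
  rewrite (eq_bigr _ (fun k _ => e k)) sumr_const card_ffun !card_ord.
  by rewrite expn0 mulr1n subrr normr0.
set P : R := 2 * pi in IH *; have P0 : 0 <= P by rewrite mulr_ge0 // pi_ge0.
exists (P ^+ d.+2 + P * K) => [|L F M L0 FL M0].
  by rewrite addr_ge0 ?(exprn_ge0 _ P0) // mulr_ge0.
pose I t := box_integral (fun y => F (vcons t y)).
have Ilip s t : `|I s - I t| <= (P ^+ d * L) * `|s - t|.
  apply/ler_addgt0Pl => e e0.
  have [N [N0 HN]] := natr_inv_small e0 (mulr_ge0 (mulr_ge0 (ler0n R 2) K0) L0).
  have h1 := IH L _ N L0 (lip1_vcons s FL) N0.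
  have h2 := IH L _ N L0 (lip1_vcons t FL) N0.
  have h3 : `|ravg N (fun y => F (vcons s y)) - ravg N (fun y => F (vcons t y))| <= L * `|s - t|.
    apply: ravg_le => // x; apply: (le_trans (FL _ _)); rewrite big_ord_recl !vcons0.
    by rewrite big1 ?addr0 // => i _; rewrite !vcons_lift subrr normr0.
  have h4 : `|P ^+ d * ravg N (fun y => F (vcons s y)) - P ^+ d * ravg N (fun y => F (vcons t y))|
      <= P ^+ d * L * `|s - t|.
    by rewrite -mulrBr normrM ger0_norm ?exprn_ge0 // -mulrA ler_wpM2l // exprn_ge0.
  have := norm_sub_near h1 h2 h4; rewrite -/(I s) -/(I t) => h5; apply: (le_trans h5).
  rewrite addrC lerD2r; apply: le_trans HN.
  by rewrite !mulrA.
have c0 : 0 <= P ^+ d * L by rewrite mulr_ge0 // exprn_ge0.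
have := riemann_sum M0 c0 Ilip; rewrite -/P => h1.
have M0' : 0 < M%:R :> R by rewrite ltr0n.
have -> : box_integral F = \int[mu]_(t in `[0, P]) I t by [].
pose A (k : 'I_M) := ravg M (fun y => F (vcons (P * k%:R / M%:R) y)).
have h2 : `|P / M%:R * \sum_(k < M) I (P * k%:R / M%:R) - P ^+ d.+1 * ravg M F| <= P * K * L / M%:R.
  rewrite ravg_cons -/P exprS.
  have -> : P / M%:R * \sum_(k < M) I (P * k%:R / M%:R) -
      P * P ^+ d * (M%:R^-1 * \sum_(k < M) A k) =
      P / M%:R * \sum_(k < M) (I (P * k%:R / M%:R) - P ^+ d * A k).
    have -> : \sum_(k < M) (I (P * k%:R / M%:R) - P ^+ d * A k) =
        \sum_(k < M) I (P * k%:R / M%:R) - P ^+ d * \sum_(k < M) A k.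
      by rewrite sumrB mulr_sumr.
    ring.
  rewrite normrM ger0_norm ?divr_ge0 //.
  have -> : P * K * L / M%:R = P / M%:R * (M%:R * (K * L / M%:R)) by field; rewrite gt_eqF.
  rewrite ler_wpM2l ?divr_ge0 //; apply: (le_trans (ler_norm_sum _ _ _)).
  have h k : `|I (P * k%:R / M%:R) - P ^+ d * ravg M (fun y => F (vcons (P * k%:R / M%:R) y))| <= K * L / M%:R.
    exact: IH L0 (lip1_vcons _ FL) M0.
  apply: (le_trans (ler_sum _ (fun (k : 'I_M) _ => h k))).
  by rewrite sumr_const card_ord -[_ *+ M]mulr_natl.
have -> : (P ^+ d.+2 + P * K) * L / M%:R = P ^+ 2 * (P ^+ d * L) / M%:R + P * K * L / M%:R.
  by rewrite !exprS; ring.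
by apply: (le_trans (ler_distD _ _ _)); apply: lerD h1 h2.
Qed.

End RiemannSums.

(** * Smooth periodic functions *)

Section SmoothFunctions.
Variables (R : realType) (d : nat).
Local Notation C := R[i].
Local Notation Rd := 'rV[R]_d.
Local Notation Cd := 'rV[C]_d.
Local Notation Zd := 'rV[int]_d.
Implicit Types (a : Zd) (x y v : Rd) (g h : Rd -> R) (F : Cd -> C) (t L : R).

Lemma line_is_derive g x v t (l : R) : is_derive (x + t *: v) v g l <->
  is_derive t (1 : R) (fun s : R => g (x + s *: v)) l.
Proof.
have E : (fun h : R => h^-1 *: ((fun s : R => g (x + s *: v)) (h *: (1 : R) + t) - g (x + t *: v))) =
         (fun h : R => h^-1 *: (g (h *: v + (x + t *: v)) - g (x + t *: v))).
  apply/funext => h; congr (_ *: (g _ - _)).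
  by rewrite -[h *: (1 : R)]/(h * 1) mulr1 scalerDl addrCA.
split=> -[H1 H2]; split.
- by move: H1; rewrite /derivable /= -E.
- by move: H2; rewrite /derive /= -E.
- by move: H1; rewrite /derivable /= E.
- by move: H2; rewrite /derive /= E.
Qed.

Lemma is_derive_partial j g x t : (forall x, derivable g x (basis_vec R j)) ->
  is_derive t (1 : R) (fun s : R => g (x + s *: basis_vec R j))
    (partial j g (x + t *: basis_vec R j)).
Proof. by move=> dg; apply/line_is_derive; exact: DeriveDef. Qed.

(** Telescoping over points that agree with [x] in the first coordinates and with [y] in the others,
    and the mean value theorem at each step. *)
Lemma lip1_partial g L : 0 <= L -> (forall j x, derivable g x (basis_vec R j)) ->
  (forall j x, `|partial j g x| <= L) -> lip1 L g.
Proof.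
move=> L0 dg gL x y.
pose z (k : nat) : Rd := \row_i (if (i < k)%N then x 0 i else y 0 i).
have zd : z d = x by apply/rowP => i; rewrite mxE ltn_ord.
have z0 : z 0%N = y by apply/rowP => i; rewrite mxE.
rewrite -{1}zd -{1}z0 -(telescope_sumr (fun k => g (z k)) (leq0n d)) mulr_sumr big_mkord.
apply: (le_trans (ler_norm_sum _ _ _)); apply: ler_sum => j _.
pose f (t : R) := g (z j + t *: basis_vec R j).
have zE (t : R) : t = x 0 j - y 0 j -> z j.+1 = z j + t *: basis_vec R j.
  move=> ->; apply/rowP => i; rewrite !mxE eqxx /= ltnS leq_eqVlt.
  have [->|ij] := eqVneq i j; first by rewrite eqxx ltnn /= mulr1; ring.
  by rewrite (inj_eq val_inj) (negPf ij) /= mulr0 addr0.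
have df t := is_derive_partial (z j) t (dg j).
have fL (s t : R) : s <= t -> `|f t - f s| <= L * (t - s).
  move=> st; have cf : {within `[s, t], continuous f}.
    by apply: derivable_within_continuous => u _; have [] := df u.
  have [c _ ->] := MVT_segment st (fun u _ => df u) cf.
  by rewrite normrM (ger0_norm (_ : 0 <= t - s)) ?subr_ge0 // ler_wpM2r // subr_ge0.
rewrite (zE _ erefl); have -> : z j = z j + 0 *: basis_vec R j by rewrite scale0r addr0.
set u := x 0 j - y 0 j; rewrite scale0r addr0 -/(f u).
have -> : g (z j) = f 0 by rewrite /f scale0r addr0.
have [u0|u0] := leP 0 u; first by rewrite (ger0_norm u0); have := fL 0 u u0; rewrite subr0.
by rewrite (ltr0_norm u0) distrC; have := fL u 0 (ltW u0); rewrite sub0r.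
Qed.

Lemma lip1_continuous g L : 0 <= L -> lip1 L g -> continuous g.
Proof.
move=> L0 gL x; apply/(@cvgrPdist_le R R^o Rd (nbhs x) (nbhs_filter x) g (g x)) => e e0; apply/nbhs_ballP.
have c0 : 0 < L * d%:R + 1 by rewrite ltr_wpDl // mulr_ge0.
exists (e / (L * d%:R + 1)) => /=; first by rewrite divr_gt0.
move=> y xy; apply: (le_trans (gL _ _)).
have h i : `|x 0 i - y 0 i| <= e / (L * d%:R + 1) by have [_ /(_ 0 i)] := xy; rewrite -ball_normE => /ltW.
apply: (@le_trans _ _ (L * (d%:R * (e / (L * d%:R + 1))))).
  rewrite ler_wpM2l //; apply: (le_trans (ler_sum _ (fun i _ => h i))).
  by rewrite sumr_const card_ord -[_ *+ d]mulr_natl.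
by rewrite !mulrA ler_pdivrMr // mulrC ler_pM2l // lerDl.
Qed.

Definition rperiodic g := forall a x, g (x + \row_(j < d) (2 * pi * (a 0 j)%:~R)) = g x.

Lemma rperiodic_bounded g : continuous g -> rperiodic g ->
  exists2 B : R, 0 <= B & forall x, `|g x| <= B.
Proof.
move=> cg pg; pose A : set Rd := [set v | forall i : 'I_d, `[0, 2 * pi]%classic (v ord0 i)].
have cA : compact A by apply: (@rV_compact R d (fun=> `[0, 2 * pi]%classic)) => i; exact: segment_compact.
have A0 : A 0 by move=> i; rewrite /= mxE in_itv /= lexx mulr_ge0 // pi_ge0.
have cng : {within A, continuous (fun x => `|g x|)}.
  by apply: continuous_subspaceT => x; apply: (@continuous_comp _ _ _ g (@Num.norm _ R)); [exact: cg|exact: norm_continuous].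
have [c cAc Hc] := @compact_EVT_max _ R (fun x => `|g x|) A (ex_intro _ _ A0) cA cng.
exists `|g c| => // x.
have tp : 0 < 2 * pi :> R by rewrite mulr_gt0 // pi_gt0.
pose a : Zd := \row_j (- Num.floor (x 0 j / (2 * pi))).
rewrite -(pg a x); apply: Hc; rewrite inE => i; rewrite /= !mxE in_itv /=.
have /andP[f1 f2] := floor_itv (x 0 i / (2 * pi)).
rewrite rmorphN mulrN subr_ge0 lerBlDr; apply/andP; split.
  by rewrite mulrC -ler_pdivlMr.
move: f2; rewrite ltr_pdivrMr // rmorphD /= mulrDl mul1r mulrC addrC => /ltW.
by [].
Qed.

Lemma rperiodic_partial j g : rperiodic g -> rperiodic (partial j g).
Proof.
move=> pg a x; rewrite /partial /derive; set l := \row_i _; set v := basis_vec R j.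
have -> : (fun h : R => h^-1 *: ((g \o shift (x + l)) (h *: v) - g (x + l))) =
    (fun h : R => h^-1 *: ((g \o shift x) (h *: v) - g x)).
  by apply/funext => h /=; rewrite addrA !pg.
by [].
Qed.

Lemma rperiodic_iter_partial r g : rperiodic g -> rperiodic (iter_partial r g).
Proof. by move=> pg; elim: r => //= j r IH; exact: rperiodic_partial. Qed.

Lemma smooth_iter_partial r g : smooth g -> smooth (iter_partial r g).
Proof. by move=> sg r'; rewrite /iter_partial -foldr_cat; exact: sg. Qed.

Lemma smooth_lip1 g : smooth g -> rperiodic g -> exists2 L : R, 0 <= L & lip1 L g.
Proof.
move=> sg pg.
have /boolp.choice[B HB] : forall j, exists B : R, 0 <= B /\ forall x, `|partial j g x| <= B.
  move=> j; have [B B0 HB] := rperiodic_bounded (proj1 (sg [:: j])) (rperiodic_partial j pg).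
  by exists B.
have S0 : 0 <= \sum_j B j by apply: sumr_ge0 => j _; exact: (HB j).1.
exists (\sum_j B j) => //; apply: lip1_partial => // [j x|j x].
  exact: (proj2 (sg [::])).
apply: (le_trans ((HB j).2 x)); rewrite (bigD1 j) //= lerDl.
by apply: sumr_ge0 => i _; exact: (HB i).1.
Qed.

Lemma iter_partialB r g h : smooth g -> smooth h ->
  iter_partial r (fun x => g x - h x) = fun x => iter_partial r g x - iter_partial r h x.
Proof.
move=> sg sh; elim: r => //= j r IH; rewrite IH; apply/funext => x.
by rewrite /partial deriveB //; [exact: (proj2 (sg r))|exact: (proj2 (sh r))].
Qed.

Lemma smoothB g h : smooth g -> smooth h -> smooth (fun x => g x - h x).
Proof.
move=> sg sh r; rewrite iter_partialB //; split.
  by move=> x; apply: (@continuousB _ _ _ (iter_partial r g) (iter_partial r h)); [exact: (proj1 (sg r))|exact: (proj1 (sh r))].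
by move=> j x; apply: derivableB; [exact: (proj2 (sg r))|exact: (proj2 (sh r))].
Qed.

Definition trig_part F x : R := complex.Re (F (complexify x)).

Lemma trig_part_is_derive F j x : laurent_trig F ->
  is_derive x (basis_vec R j) (trig_part F) (trig_part (pd j F) x).
Proof.
move=> LF; have := laurent_Re_is_derive (complexify x) j 0 LF.
have E (s : R) : complexify x + s%:C *: basis_vec C j = complexify (x + s *: basis_vec R j).
  by rewrite complexifyD complexifyZ complexify_basis.
under eq_fun do rewrite E; rewrite E => h.
have : is_derive (x + 0 *: basis_vec R j) (basis_vec R j) (trig_part F)
   (trig_part (pd j F) (x + 0 *: basis_vec R j)) by apply/line_is_derive.
by rewrite scale0r addr0.
Qed.

Lemma partial_trig_part j F : laurent_trig F -> partial j (trig_part F) = trig_part (pd j F).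
Proof.
move=> LF; apply/funext => x; have := trig_part_is_derive j x LF.
by rewrite /partial => h; rewrite derive_val.
Qed.

Lemma iter_partial_trig_part r F : laurent_trig F -> exists2 G, laurent_trig G &
  iter_partial r (trig_part F) = trig_part G.
Proof.
move=> LF; elim: r => [|j r [G LG /= ->]]; first by exists F.
by exists (pd j G); [exact: laurent_pd|exact: partial_trig_part].
Qed.

Lemma trig_part_lip1 F : laurent_trig F -> exists2 L : R, 0 <= L & lip1 L (trig_part F).
Proof.
move=> LF; have /boolp.choice[B HB] : forall j, exists B : R, 0 <= B /\
    forall x, cmod (pd j F (complexify x)) <= B.
  by move=> j; have [B B0 HB] := laurent_bounded (laurent_pd j LF); exists B.
have S0 : 0 <= \sum_j B j by apply: sumr_ge0 => j _; exact: (HB j).1.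
exists (\sum_j B j) => //; apply: lip1_partial => // [j x|j x].
  by have [] := trig_part_is_derive j x LF.
rewrite partial_trig_part //; apply: (le_trans (Re_le_cmod _)); apply: (le_trans ((HB j).2 x)).
by rewrite (bigD1 j) //= lerDl; apply: sumr_ge0 => i _; exact: (HB i).1.
Qed.

Lemma trig_part_smooth F : laurent_trig F -> smooth (trig_part F).
Proof.
move=> LF r; have [G LG ->] := iter_partial_trig_part r LF; split.
  by have [L L0] := trig_part_lip1 LG; exact: lip1_continuous.
by move=> j x; have [] := trig_part_is_derive j x LG.
Qed.

Lemma ImE F : (fun x => complex.Im (F (complexify x))) = trig_part (fun z => (- 'i) * F z) :> (Rd -> R).
Proof. by apply/funext => x; rewrite /trig_part ReM /=; lra. Qed.

Lemma complexify_lattice a x : complexify (x + \row_(j < d) (2 * pi * (a 0 j)%:~R)) =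
  complexify x + lattice_vec R a.
Proof. by rewrite complexifyD; congr (_ + _); apply/rowP => j; rewrite !mxE. Qed.

Lemma laurent_test_function F : laurent_trig F -> test_function (fun x => F (complexify x)).
Proof.
move=> LF; split.
- by move=> a x; rewrite complexify_lattice laurent_lattice.
- exact: trig_part_smooth.
- by rewrite ImE; apply: trig_part_smooth; exact: laurentZ.
Qed.

End SmoothFunctions.

(** * The integral over the torus as a limit of grid averages *)

Section TorusIntegral.
Variables (R : realType) (d : nat).
Local Notation C := R[i].
Local Notation Rd := 'rV[R]_d.
Local Notation Cd := 'rV[C]_d.
Local Notation Zd := 'rV[int]_d.
Local Notation vol := ((2 * pi) ^+ d : R).
Implicit Types (a : Zd) (x y : Rd) (G H : Rd -> C) (F : Cd -> C) (M : nat) (L B t : R).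

Definition clip L G := forall x y, cmod (G x - G y) <= L * \sum_i `|x 0 i - y 0 i|.
Definition lipschitz G := exists2 L : R, 0 <= L & clip L G.
Definition bounded_by B G := forall x, cmod (G x) <= B.

Lemma vol_gt0 : 0 < vol.
Proof. by rewrite exprn_gt0 // mulr_gt0 // pi_gt0. Qed.

Lemma lipschitz_parts G L1 L2 : 0 <= L1 -> 0 <= L2 -> lip1 L1 (fun x => complex.Re (G x)) ->
  lip1 L2 (fun x => complex.Im (G x)) -> lipschitz G.
Proof.
move=> L10 L20 h1 h2; exists (L1 + L2); first exact: addr_ge0.
move=> x y; apply: (le_trans (cmod_le_ReIm _)); rewrite mulrDl.
by apply: lerD; rewrite ?ReD ?ReN ?ImD ?ImN; [exact: h1|exact: h2].
Qed.

Lemma lipschitz_laurent F : laurent_trig F -> lipschitz (fun x => F (complexify x)).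
Proof.
move=> LF; have [L1 L10 h1] := trig_part_lip1 LF.
have [L2 L20 h2] := trig_part_lip1 (laurentZ (- 'i) LF).
by apply: (lipschitz_parts L10 L20) => //; rewrite ImE.
Qed.

Lemma rperiodic_Re G : Defs.periodic G -> rperiodic (fun x => complex.Re (G x)).
Proof. by move=> pG a x /=; rewrite pG. Qed.

Lemma rperiodic_Im G : Defs.periodic G -> rperiodic (fun x => complex.Im (G x)).
Proof. by move=> pG a x /=; rewrite pG. Qed.

Lemma lipschitz_test G : test_function G -> lipschitz G.
Proof.
move=> [pG sR sI]; have [L1 L10 h1] := smooth_lip1 sR (rperiodic_Re pG).
have [L2 L20 h2] := smooth_lip1 sI (rperiodic_Im pG).
exact: lipschitz_parts h1 h2.
Qed.

Lemma bounded_test G : test_function G -> exists2 B : R, 0 <= B & bounded_by B G.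
Proof.
move=> [pG sR sI]; have [B1 B10 h1] := rperiodic_bounded (proj1 (sR [::])) (rperiodic_Re pG).
have [B2 B20 h2] := rperiodic_bounded (proj1 (sI [::])) (rperiodic_Im pG).
exists (B1 + B2); first exact: addr_ge0.
by move=> x; apply: (le_trans (cmod_le_ReIm _)); apply: lerD; [exact: h1|exact: h2].
Qed.

Lemma lipschitz_cst (c : C) : lipschitz (fun=> c).
Proof. by exists 0 => // x y; rewrite subrr cmod0 mul0r. Qed.

Lemma lipschitzD G H : lipschitz G -> lipschitz H -> lipschitz (fun x => G x + H x).
Proof.
move=> [L1 L10 h1] [L2 L20 h2]; exists (L1 + L2); first exact: addr_ge0.
move=> x y; rewrite opprD addrACA mulrDl; apply: (le_trans (cmodD _ _)).
by apply: lerD; [exact: h1|exact: h2].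
Qed.

Lemma lipschitzM G H B1 B2 : 0 <= B1 -> 0 <= B2 -> bounded_by B1 G -> bounded_by B2 H ->
  lipschitz G -> lipschitz H -> lipschitz (fun x => G x * H x).
Proof.
move=> B10 B20 b1 b2 [L1 L10 h1] [L2 L20 h2]; exists (L1 * B2 + B1 * L2).
  by rewrite addr_ge0 // mulr_ge0.
move=> x y; have -> : G x * H x - G y * H y = (G x - G y) * H x + G y * (H x - H y) by ring.
apply: (le_trans (cmodD _ _)); rewrite !cmodM mulrDl; apply: lerD.
  rewrite mulrAC; apply: ler_pM; rewrite ?cmod_ge0 //; exact: h1.
rewrite -mulrA; apply: ler_pM; rewrite ?cmod_ge0 //; exact: h2.
Qed.

Lemma lipschitzMl F G B : laurent_trig F -> bounded_by B G -> 0 <= B -> lipschitz G ->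
  lipschitz (fun x => G x * F (complexify x)).
Proof.
move=> LF bG B0 lG; have [B' B'0 b'] := laurent_bounded LF.
exact: lipschitzM B0 B'0 bG b' lG (lipschitz_laurent LF).
Qed.

Lemma lipschitzZ (c : C) G : lipschitz G -> lipschitz (fun x => c * G x).
Proof.
move=> [L L0 h]; exists (cmod c * L); first by rewrite mulr_ge0 // cmod_ge0.
by move=> x y; rewrite -mulrBr cmodM -mulrA ler_wpM2l ?cmod_ge0.
Qed.

(** Limit of grid averages with rate [1 / M]. It characterises the integral of a Lipschitz function,
    and linearity and bounds are deduced from it rather than from the iterated integral. *)
Definition torus_lim G (t : C) := exists2 K : R, 0 <= K & forall M, (0 < M)%N ->
  cmod (t - vol%:C * avg M 0 G) <= K / M%:R.

Lemma le_inv_nat (c K : R) (N : nat) : 0 <= K ->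
  (forall M, (N < M)%N -> c <= K / M%:R) -> c <= 0.
Proof.
move=> K0 h; apply/ler_addgt0Pl => e e0; rewrite addr0.
have [M [M0 HM]] := natr_inv_small e0 K0.
apply: (le_trans (h (N.+1 * M)%N _)); first by rewrite leq_pmulr.
apply: le_trans HM; rewrite ler_wpM2l // lef_pV2 ?posrE ?ltr0n ?muln_gt0 //.
by rewrite ler_nat leq_pmull.
Qed.

Lemma torus_lim_unique G (t t' : C) : torus_lim G t -> torus_lim G t' -> t = t'.
Proof.
move=> [K K0 h] [K' K'0 h']; apply/eqP; rewrite -subr_eq0 -cmod_eq0 eq_le cmod_ge0 andbT.
apply: (@le_inv_nat _ (K + K') 0); first exact: addr_ge0.
move=> M M0; set c := vol%:C * avg M 0 G.
have -> : t - t' = (t - c) - (t' - c) by ring.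
by apply: (le_trans (cmodB _ _)); rewrite mulrDl; apply: lerD; [exact: h|exact: h'].
Qed.

Lemma Im_avg M y G :
  complex.Im (avg M y G) = M%:R ^- d * \sum_(k : {ffun 'I_d -> 'I_M}) complex.Im (G (y + grid_point R k)).
Proof.
rewrite /avg (_ : (M%:R ^- d : C) = (M%:R ^- d : R)%:C); last first.
  by rewrite fmorphV rmorphXn /= rmorph_nat.
by rewrite Im_realM Im_sum.
Qed.

Lemma torus_limP G : lipschitz G -> torus_lim G (torus_integral G).
Proof.
move=> [L L0 lG]; have [K K0 h] := box_integral_avg R d.
exists (2 * (K * L)); first by rewrite !mulr_ge0.
move=> M M0.
have l1 : lip1 L (fun x => complex.Re (G x)).
  by move=> x y; apply: le_trans (lG x y); rewrite -ReN -ReD Re_le_cmod.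
have l2 : lip1 L (fun x => complex.Im (G x)).
  by move=> x y; apply: le_trans (lG x y); rewrite -ImN -ImD Im_le_cmod.
have h1 := h _ _ _ L0 l1 M0; have h2 := h _ _ _ L0 l2 M0.
apply: (le_trans (cmod_le_ReIm _)); rewrite ReD ReN ImD ImN Re_realM Im_realM.
have -> : complex.Re (avg M 0 G) = ravg M (fun x => complex.Re (G x)).
  by rewrite Re_avg; congr (_ * _); apply: eq_bigr => k _; rewrite add0r.
have -> : complex.Im (avg M 0 G) = ravg M (fun x => complex.Im (G x)).
  by rewrite Im_avg; congr (_ * _); apply: eq_bigr => k _; rewrite add0r.
have -> : 2 * (K * L) / M%:R = K * L / M%:R + K * L / M%:R by ring.
exact: lerD h1 h2.
Qed.

Lemma torus_integral_lin (c : C) G H : lipschitz G -> lipschitz H ->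
  torus_integral (fun x => c * G x + H x) = c * torus_integral G + torus_integral H.
Proof.
move=> lG lH; apply: (@torus_lim_unique (fun x => c * G x + H x)).
  by apply: torus_limP; apply: lipschitzD => //; exact: lipschitzZ.
have [K K0 h] := torus_limP lG; have [K' K'0 h'] := torus_limP lH.
exists (cmod c * K + K'); first by rewrite addr_ge0 // mulr_ge0 // cmod_ge0.
move=> M M0; rewrite avgD avgZ.
set u := torus_integral G in h *; set v := torus_integral H in h' *.
have -> : c * u + v - vol%:C * (c * avg M 0 G + avg M 0 H) =
  c * (u - vol%:C * avg M 0 G) + (v - vol%:C * avg M 0 H) by ring.
have -> : (cmod c * K + K') / M%:R = cmod c * (K / M%:R) + K' / M%:R by ring.
apply: (le_trans (cmodD _ _)); apply: lerD; last exact: h'.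
by rewrite cmodM ler_wpM2l ?cmod_ge0 // h.
Qed.

Lemma torus_integral0 : torus_integral ((fun=> 0) : Rd -> C) = 0.
Proof.
have := torus_integral_lin 1 (lipschitz_cst 0) (lipschitz_cst 0).
under eq_fun do rewrite mulr0 addr0; rewrite mul1r => /eqP.
by rewrite -subr_eq0 opprD addrA subrr sub0r oppr_eq0 => /eqP.
Qed.

Lemma torus_integralZ (c : C) G : lipschitz G ->
  torus_integral (fun x => c * G x) = c * torus_integral G.
Proof.
move=> lG; have := torus_integral_lin c lG (lipschitz_cst 0).
by rewrite torus_integral0 addr0; under eq_fun do rewrite addr0.
Qed.

Lemma torus_integralB G H : lipschitz G -> lipschitz H ->
  torus_integral (fun x => G x - H x) = torus_integral G - torus_integral H.
Proof.
move=> lG lH; have := torus_integral_lin (-1) lH lG.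
rewrite mulN1r addrC => <-; congr torus_integral; apply/funext => x.
by rewrite mulN1r addrC.
Qed.

Lemma lipschitz_sum (I : Type) (r : seq I) (f : I -> Rd -> C) : (forall i, lipschitz (f i)) ->
  lipschitz (fun x => \sum_(i <- r) f i x).
Proof.
move=> lf; elim: r => [|i r IH].
  by under eq_fun do rewrite big_nil; exact: lipschitz_cst.
by under eq_fun do rewrite big_cons; exact: lipschitzD.
Qed.

Lemma torus_integral_sum (I : Type) (r : seq I) (f : I -> Rd -> C) : (forall i, lipschitz (f i)) ->
  torus_integral (fun x => \sum_(i <- r) f i x) = \sum_(i <- r) torus_integral (f i).
Proof.
move=> lf; elim: r => [|i r IH].
  by under eq_fun do rewrite big_nil; rewrite big_nil torus_integral0.
rewrite big_cons -IH -[torus_integral (f i)]mul1r -torus_integral_lin //; last exact: lipschitz_sum.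
by congr torus_integral; apply/funext => x; rewrite big_cons mul1r.
Qed.

Lemma torus_integral_mean G : lipschitz G -> real_trig G ->
  torus_integral G = vol%:C * mean G.
Proof.
move=> lG tG; have [K K0 h] := torus_limP lG; have [N HN] := meanP tG.
apply/eqP; rewrite -subr_eq0 -cmod_eq0 eq_le cmod_ge0 andbT.
apply: (@le_inv_nat _ K N) => // M NM; rewrite -(HN M 0 NM); apply: h.
exact: leq_ltn_trans NM.
Qed.

Lemma torus_integral_bound G B : 0 <= B -> lipschitz G -> bounded_by B G ->
  cmod (torus_integral G) <= vol * B.
Proof.
move=> B0 lG bG; have [K K0 h] := torus_limP lG.
rewrite -subr_le0; apply: (@le_inv_nat _ K 0) => // M M0.
rewrite lerBlDl -[torus_integral G](subrK (vol%:C * avg M 0 G)).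
apply: (le_trans (cmodD _ _)); rewrite addrC; apply: lerD; last exact: h.
rewrite cmodM cmodR ger0_norm; last by rewrite ltW // vol_gt0.
by rewrite ler_wpM2l ?(ltW vol_gt0) //; exact: cmod_avg_le.
Qed.

Lemma torus_integral_le G H : lipschitz G -> lipschitz H ->
  (forall x, cmod (G x) <= complex.Re (H x)) ->
  cmod (torus_integral G) <= complex.Re (torus_integral H).
Proof.
move=> lG lH GH; have [K K0 h] := torus_limP lG; have [K' K'0 h'] := torus_limP lH.
rewrite -subr_le0; apply: (@le_inv_nat _ (K + K') 0); first exact: addr_ge0.
move=> M M0; have /h h1 := M0; have /h' h2 := M0.
have e1 : cmod (avg M 0 G) <= complex.Re (avg M 0 H).
  rewrite Re_avg /avg cmodM cmodV cmodX.
  have -> : cmod (M%:R : C) = M%:R by rewrite -(rmorph_nat (real_complex R)) cmodR ger0_norm.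
  rewrite ler_wpM2l ?invr_ge0 ?exprn_ge0 //; apply: (le_trans (cmod_sum _ _ _)).
  by apply: ler_sum => k _; exact: GH.
have e2 : cmod (torus_integral G) <= K / M%:R + vol * cmod (avg M 0 G).
  rewrite -[torus_integral G](subrK (vol%:C * avg M 0 G)).
  apply: (le_trans (cmodD _ _)); apply: lerD => //.
  by rewrite cmodM cmodR ger0_norm // ltW // vol_gt0.
have e3 := le_trans (ler_norm _) (le_trans (Re_le_cmod _) (eq_ind_r (fun z => z <= _) h2 (cmod_subC (vol%:C * avg M 0 H) (torus_integral H)))).
rewrite ReD ReN Re_realM in e3; have e4 := ler_wpM2l (ltW vol_gt0) e1.
rewrite mulrDl; lra.
Qed.

(** A shift by one grid step permutes the grid cyclically, up to a period. *)
Lemma periodic_line_avg j M G : Defs.periodic G -> (0 < M)%N ->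
  avg M 0 (fun x => G (x + (2 * pi / M%:R) *: basis_vec R j)) = avg M 0 G.
Proof.
move=> pG M0; congr (_ * _).
pose s (k : {ffun 'I_d -> 'I_M}) : {ffun 'I_d -> 'I_M} := update j k (ordS (k j)).
have s_inj : bijective s.
  exists (fun k => update j k (ord_pred (k j))) => k; apply/ffunP => i; rewrite !ffunE;
    by case: eqVneq => [->|//]; rewrite eqxx ?ordSK ?ord_predK.
rewrite [RHS](reindex s) /=; last exact: onW_bij.
apply: eq_bigr => k _; rewrite !add0r.
have MR : M%:R != 0 :> R by rewrite pnatr_eq0 -lt0n.
(* The period that makes up for the passage from the last index to [0]. *)
pose a : Zd := \row_i (if (i == j) && ((k j).+1 == M) then 1 else 0).
rewrite -(pG a (grid_point R (s k))); congr G; apply/rowP => i; rewrite !mxE !ffunE eqxx /=.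
case: (eqVneq i j) => [->|ij] /=; last by rewrite !mulr0 !addr0.
case: (eqVneq (k j).+1 M) => [kM|kM] /=.
  have e : (k j)%:R = M%:R - 1 :> R by rewrite -[in RHS]kM -natr1 addrK.
  have -> : ((k j).+1 %% M)%N = 0%N by rewrite [in RHS](esym (modnn M)) kM.
  by rewrite e; field.
have kl : ((k j).+1 < M)%N by rewrite ltn_neqAle kM ltn_ord.
by rewrite (modn_small kl) -natr1; field.
Qed.

(** The difference quotient over one grid step has average zero by periodicity, and it differs from
    [G'] by [O(1 / M)]. *)
Lemma torus_integral_derivative j G G' : Defs.periodic G -> lipschitz G' ->
  (forall x t, is_derive t (1 : R) (fun t => complex.Re (G (x + t *: basis_vec R j)))
    (complex.Re (G' (x + t *: basis_vec R j)))) ->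
  (forall x t, is_derive t (1 : R) (fun t => complex.Im (G (x + t *: basis_vec R j)))
    (complex.Im (G' (x + t *: basis_vec R j)))) ->
  torus_integral G' = 0.
Proof.
move=> pG lG' dR dI; apply: torus_lim_unique (torus_limP lG') _.
have [L L0 hL] := lG'.
exists (vol * (2 * L * (2 * pi))).
  by rewrite !mulr_ge0 ?pi_ge0 // ltW ?vol_gt0.
move=> M M0; set h : R := 2 * pi / M%:R.
have h0 : 0 < h by rewrite divr_gt0 ?ltr0n // mulr_gt0 // pi_gt0.
rewrite sub0r cmodN cmodM cmodR ger0_norm ?(ltW vol_gt0) // -mulrA ler_wpM2l ?(ltW vol_gt0) //.
have -> : 2 * L * (2 * pi) / M%:R = 2 * (L * h) by rewrite /h; ring.
pose D x := (h^-1)%:C * (G (x + h *: basis_vec R j) - G x).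
have D0 : avg M 0 D = 0.
  rewrite avgZ (_ : avg M 0 _ = 0) ?mulr0 //.
  have -> : (fun x => G (x + h *: basis_vec R j) - G x) =
      fun x => G (x + h *: basis_vec R j) + (-1) * G x.
    by apply/funext => x; rewrite mulN1r.
  by rewrite avgD avgZ periodic_line_avg // mulN1r subrr.
have -> : avg M 0 G' = avg M 0 (fun x => G' x + (-1) * D x).
  by rewrite avgD avgZ D0 mulr0 addr0.
apply: cmod_avg_le => // x; rewrite mulN1r.
have part (f f' : R -> R) : (forall t, is_derive t (1 : R) f (f' t)) ->
    (forall t, 0 <= t <= h -> `|f' 0 - f' t| <= L * t) ->
    `|f' 0 - h^-1 * (f h - f 0)| <= L * h.
  move=> df hf; have cf : {within `[0, h], continuous f}.
    by apply: derivable_within_continuous => u _; have [] := df u.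
  have [c] := MVT_segment (ltW h0) (fun u _ => df u) cf.
  rewrite in_itv /= => /andP[c0 ch] ->; rewrite subr0 mulrCA mulVf ?gt_eqF // mulr1.
  by apply: (le_trans (hf c _)); rewrite ?c0 // ler_wpM2l.
have G'x t : 0 <= t <= h -> cmod (G' x - G' (x + t *: basis_vec R j)) <= L * t.
  move=> /andP[t0 th]; apply: (le_trans (hL _ _)); rewrite ler_wpM2l //.
  rewrite (bigD1 j) //= big1 => [|i ij].
    by rewrite !mxE !eqxx mulr1 opprD addrA subrr add0r normrN ger0_norm // addr0.
  by rewrite !mxE (negPf ij) andbF mulr0 addr0 subrr normr0.
have x0 : x = x + 0 *: basis_vec R j by rewrite scale0r addr0.
apply: (le_trans (cmod_le_ReIm _)); rewrite ReD ReN ImD ImN /D Re_realM Im_realM.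
rewrite ReD ReN ImD ImN mulr_natl mulr2n; apply: lerD; rewrite {1 3}x0.
- apply: (part (fun t => complex.Re (G (x + t *: basis_vec R j)))
    (fun t => complex.Re (G' (x + t *: basis_vec R j)))) => // t th.
  rewrite -x0; apply: le_trans (G'x t th); rewrite -ReN -ReD; exact: Re_le_cmod.
- apply: (part (fun t => complex.Im (G (x + t *: basis_vec R j)))
    (fun t => complex.Im (G' (x + t *: basis_vec R j)))) => // t th.
  rewrite -x0; apply: le_trans (G'x t th); rewrite -ImN -ImD; exact: Im_le_cmod.
Qed.

End TorusIntegral.

(** * Density of trigonometric polynomials *)

Section Fejer.
Variables (R : realType) (d : nat).
Local Notation C := R[i].
Local Notation Rd := 'rV[R]_d.
Local Notation Cd := 'rV[C]_d.
Local Notation Zd := 'rV[int]_d.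
Local Notation vol := ((2 * pi) ^+ d : R).
Implicit Types (a : Zd) (x y : Rd) (F G : Cd -> C) (phi psi : Rd -> C) (n : nat).

(** With [s] the remainder of [t] modulo [2 pi] in [[- pi, pi]]: for [|s| <= 1/2] the sine controls
    [s], and otherwise [1 - cos s] is at least the constant [k = 1 - cos (1/2)]. *)
Lemma angle_bound : exists2 K : R, 0 <= K & forall t : R, exists m : int,
  `|t - 2 * pi * m%:~R| <= K * cmod (expC ('i * t%:C) - 1).
Proof.
pose k : R := 1 - cos 2^-1.
have pi2 := pi_ge2 R.
have k0 : 0 < k.
  rewrite subr_gt0 -[X in _ < X](@cos0 R) ltr_cos // in_itv /= ?lexx ?pi_ge0 //.
  by apply/andP; split; lra.
exists (2 + pi / k); first by rewrite addr_ge0 // divr_ge0 ?pi_ge0 // ltW.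
move=> t; have tp : 0 < 2 * pi :> R by rewrite mulr_gt0 // pi_gt0.
pose m := Num.floor (t / (2 * pi) + 2^-1); exists m.
set s := t - _; have := floor_itv (t / (2 * pi) + 2^-1); rewrite -/m rmorphD /= => /andP[f1 f2].
have st : t / (2 * pi) = s / (2 * pi) + m%:~R.
  by rewrite /s mulrBl [2 * pi * _ / _]mulrAC mulfV ?gt_eqF // mul1r subrK.
have s1 : - 2^-1 <= s / (2 * pi) <= 2^-1 by rewrite st in f1 f2; apply/andP; split; lra.
have {s1} sp : `|s| <= pi.
  rewrite ler_norml; move: s1; rewrite ler_pdivlMr // ler_pdivrMr // => /andP[h1 h2].
  by apply/andP; split; lra.
have -> : expC ('i * t%:C) = expC ('i * s%:C) :> C.
  have -> : t = s + 2 * pi * m%:~R by rewrite /s subrK.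
  by rewrite rmorphD mulrDr expCD expC_2pi mulr1.
rewrite expCi; set w := _ - 1.
have pk0 : 0 <= pi / k by rewrite divr_ge0 ?pi_ge0 // ltW.
have [sh|sh] := leP `|s| 2^-1.
  have h1 : `|sin s| <= cmod w.
    by apply: le_trans (Im_le_cmod _); rewrite /w ImD ImN /= subr0.
  have h2 := sin_sub_le s.
  have h3 : `|s| ^+ 3 <= 4^-1 * `|s|.
    rewrite exprS mulrC ler_wpM2r //; have h := normr_ge0 s.
    by rewrite expr2; nra.
  have h4 : `|s| <= `|sin s| + `|sin s - s|.
    by rewrite -{1}(subKr (sin s) s); exact: ler_normB.
  have := cmod_ge0 w; have := normr_ge0 s; nra.
have h1 : k <= cmod w.
  apply: le_trans (Re_le_cmod _); rewrite /w ReD ReN /= distrC; apply: le_trans (ler_norm _).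
  have -> : cos s = cos `|s|.
    by have [s0|s0] := leP 0 s; [rewrite ger0_norm|rewrite ltr0_norm // cosN].
  rewrite /k lerD2l lerN2; apply: ltW; rewrite ltr_cos // in_itv /= ?normr_ge0 ?sp //.
  by apply/andP; split; lra.
have h2 : `|s| <= pi / k * cmod w.
  by apply: (le_trans sp); rewrite mulrAC ler_pdivlMr // ler_wpM2l ?pi_ge0.
by have := cmod_ge0 w; nra.
Qed.

(** The modulus of continuity in terms of [|expC ('i * theta) - 1|]: these quantities are well
    defined on the torus, and multiplied by a Dirichlet sum they telescope. *)
Lemma periodic_lipschitz psi : Defs.periodic psi -> lipschitz psi ->
  exists2 K : R, 0 <= K & forall x y, cmod (psi y - psi x) <=
    K * \sum_j cmod (character (delta_mx 0 j) (complexify (y - x)) - 1).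
Proof.
move=> pp [L L0 hL]; have [K K0 HK] := angle_bound.
exists (L * K) => [|x y]; first exact: mulr_ge0.
have /boolp.choice[m Hm] := fun j : 'I_d => HK ((y - x) 0 j).
pose a : Zd := \row_j (- m j).
rewrite -(pp a y); apply: (le_trans (hL _ _)); rewrite -mulrA ler_wpM2l // mulr_sumr.
apply: ler_sum => j _.
have -> : (y + \row_j0 (2 * pi * (a 0 j0)%:~R)) 0 j - x 0 j = (y - x) 0 j - 2 * pi * (m j)%:~R.
  by rewrite !mxE rmorphN /=; ring.
apply: (le_trans (Hm j)); rewrite ler_wpM2l //.
rewrite character_complexify (bigD1 j) //= big1 => [|i ij].
  by rewrite addr0 (_ : (delta_mx 0 j : Zd) 0 j = 1) ?mul1r // mxE !eqxx.
by rewrite mxE (negPf ij) andbF mul0r.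
Qed.

Definition pdr (r : seq 'I_d) F : Cd -> C := foldr (@pd R d) F r.

Lemma laurent_pdr r F : laurent_trig F -> laurent_trig (pdr r F).
Proof. by move=> LF; elim: r => //= j r IH; exact: laurent_pd. Qed.

Lemma iter_partial_trig_partE r F : laurent_trig F ->
  iter_partial r (trig_part F) = trig_part (pdr r F).
Proof.
by move=> LF; elim: r => //= j r ->; rewrite partial_trig_part //; exact: laurent_pdr.
Qed.

Lemma pdrZ r (c : C) F : laurent_trig F -> pdr r (fun z => c * F z) = fun z => c * pdr r F z.
Proof.
by move=> LF; elim: r => //= j r ->; rewrite pdZ //; exact: laurent_pdr.
Qed.

Lemma cpartial_laurent r F x : laurent_trig F ->
  cpartial r (fun y => F (complexify y)) x = pdr r F (complexify x).
Proof.
move=> LF; apply: complex_eqP => /=.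
  by rewrite -[LHS]/(iter_partial r (trig_part F) x) iter_partial_trig_partE.
rewrite ImE iter_partial_trig_partE; last exact: laurentZ.
by rewrite pdrZ // /trig_part ReM /=; lra.
Qed.

Lemma test_cpartial r phi : test_function phi -> test_function (cpartial r phi).
Proof.
move=> [pp sR sI]; split; [|exact: smooth_iter_partial|exact: smooth_iter_partial].
move=> a x; apply: complex_eqP => /=.
  exact: (rperiodic_iter_partial r (rperiodic_Re pp)).
exact: (rperiodic_iter_partial r (rperiodic_Im pp)).
Qed.

Lemma lipschitz_testM phi F : test_function phi -> laurent_trig F ->
  lipschitz (fun x => phi x * F (complexify x)).
Proof.
move=> tp LF; have [B B0 b] := bounded_test tp.
exact: lipschitzMl LF b B0 (lipschitz_test tp).
Qed.

Lemma trig_im_is_derive j x F : laurent_trig F ->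
  is_derive x (basis_vec R j) (fun y => complex.Im (F (complexify y)))
    (complex.Im (pd j F (complexify x))).
Proof.
move=> LF; rewrite ImE; apply: is_derive_eq (trig_part_is_derive j x (laurentZ (- 'i) LF)) _.
by rewrite /trig_part pdZ // ReM /=; lra.
Qed.

Lemma torus_integral_by_parts j phi a : test_function phi ->
  torus_integral (fun x => cpartial [:: j] phi x * character a (complexify x)) =
  - ('i * (a 0 j)%:~R) * torus_integral (fun x => phi x * character a (complexify x)).
Proof.
move=> tp; have Lc := laurent_character R a; set k := 'i * (a 0 j)%:~R : C.
have l1 := lipschitz_testM (test_cpartial [:: j] tp) Lc.
have l2 := lipschitz_testM tp Lc.
suff h : torus_integral (fun x => k * (phi x * character a (complexify x)) +
    cpartial [:: j] phi x * character a (complexify x)) = 0.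
  rewrite torus_integral_lin // in h; apply/eqP; rewrite -subr_eq0 mulNr opprK addrC.
  by apply/eqP.
have [pp sR sI] := tp.
have scE (u v : R) : u *: v = u * v by [].
apply: (@torus_integral_derivative R d j (fun x => phi x * character a (complexify x))).
- by move=> b x; rewrite pp complexify_lattice laurent_lattice.
- by apply: lipschitzD => //; exact: lipschitzZ.
- move=> x t.
  have d1 := is_derive_partial x t (fun y => proj2 (sR [::]) j y).
  have d2 := is_derive_partial x t (fun y => proj2 (sI [::]) j y).
  have d3 := proj1 (line_is_derive _ _ _ _ _) (trig_part_is_derive j (x + t *: basis_vec R j) Lc).
  have d4 := proj1 (line_is_derive _ _ _ _ _) (trig_im_is_derive j (x + t *: basis_vec R j) Lc).
  have := is_deriveB (is_deriveM d1 d3) (is_deriveM d2 d4).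
  rewrite /trig_part pd_character -/k => h.
  have -> : (fun t : R => complex.Re (phi (x + t *: basis_vec R j) * character a (complexify (x + t *: basis_vec R j)))) =
    (fun t : R => complex.Re (phi (x + t *: basis_vec R j)) * complex.Re (character a (complexify (x + t *: basis_vec R j))) -
      complex.Im (phi (x + t *: basis_vec R j)) * complex.Im (character a (complexify (x + t *: basis_vec R j)))).
    by apply/funext => s; rewrite ReM.
  apply: is_derive_eq h _; rewrite /cpartial /=.
  move: (partial j _ _) (partial j _ _) (phi _) (character a _) => p1 p2 [u1 u2] [w1 w2].
  by case: (k) => k1 k2; rewrite !scE !ReD !ReM !ImM /=; ring.
- move=> x t.
  have d1 := is_derive_partial x t (fun y => proj2 (sR [::]) j y).
  have d2 := is_derive_partial x t (fun y => proj2 (sI [::]) j y).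
  have d3 := proj1 (line_is_derive _ _ _ _ _) (trig_part_is_derive j (x + t *: basis_vec R j) Lc).
  have d4 := proj1 (line_is_derive _ _ _ _ _) (trig_im_is_derive j (x + t *: basis_vec R j) Lc).
  have := is_deriveD (is_deriveM d1 d4) (is_deriveM d2 d3).
  rewrite /trig_part pd_character -/k => h.
  have -> : (fun t : R => complex.Im (phi (x + t *: basis_vec R j) * character a (complexify (x + t *: basis_vec R j)))) =
    (fun t : R => complex.Re (phi (x + t *: basis_vec R j)) * complex.Im (character a (complexify (x + t *: basis_vec R j))) +
      complex.Im (phi (x + t *: basis_vec R j)) * complex.Re (character a (complexify (x + t *: basis_vec R j)))).
    by apply/funext => s; rewrite ImM.
  apply: is_derive_eq h _; rewrite /cpartial /=.
  move: (partial j _ _) (partial j _ _) (phi _) (character a _) => p1 p2 [u1 u2] [w1 w2].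
  by case: (k) => k1 k2; rewrite !scE !ImD !ImM !ReM /= ?ImM ?ReM /=; ring.
Qed.

End Fejer.

(** * Fejer means of test functions *)

Section FejerKernel.
Variables (R : realType) (d : nat).
Local Notation C := R[i].
Local Notation Rd := 'rV[R]_d.
Local Notation Cd := 'rV[C]_d.
Local Notation Zd := 'rV[int]_d.
Local Notation vol := ((2 * pi) ^+ d : R).
Implicit Types (a : Zd) (x y : Rd) (F G : Cd -> C) (phi psi : Rd -> C) (n : nat).

Definition nat_vec n (b : {ffun 'I_d -> 'I_n}) : Zd := \row_j (b j : nat)%:Z.

Lemma nat_vec_inj n : injective (@nat_vec n).
Proof.
move=> f g /rowP fg; apply/ffunP => j; apply/val_inj.
by have := fg j; rewrite !mxE => -[].
Qed.

Lemma parseval_nat_vec n (P : pred {ffun 'I_d -> 'I_n}) (c : Zd -> C) :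
  msq (fun z => \sum_(b | P b) c (nat_vec b) * character (nat_vec b) z) =
  \sum_(b | P b) cmod (c (nat_vec b)) ^+ 2.
Proof.
pose A := [seq nat_vec b | b <- enum P].
have -> : (fun z => \sum_(b | P b) c (nat_vec b) * character (nat_vec b) z) =
    fun z => \sum_(a <- A) c a * character a z.
  by apply/funext => z; rewrite big_map big_enum.
rewrite parseval ?big_map ?big_enum // map_inj_uniq ?enum_uniq //; exact: nat_vec_inj.
Qed.

(** For [predT] this is a Dirichlet kernel centred at [x], with exponents in [{0, ..., n-1}^d]; its
    squared modulus over [n^d] is the Fejer kernel. The predicate allows one coordinate to be left
    out of the sum. *)
Definition shifted_sum n (P : pred {ffun 'I_d -> 'I_n}) x : Cd -> C := fun z =>
  \sum_(b | P b) character (- nat_vec b) (complexify x) * character (nat_vec b) z.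

Lemma laurent_shifted_sum n P x : laurent_trig (@shifted_sum n P x).
Proof. by apply: laurent_sum => b; exact: laurent_mono. Qed.

Lemma msq_shifted_sum n (P : pred {ffun 'I_d -> 'I_n}) x :
  msq (shifted_sum P x) = \sum_(b | P b) 1.
Proof.
rewrite (@parseval_nat_vec n P (fun a => character (- a) (complexify x))).
by apply: eq_bigr => b _; rewrite cmod_character expr1n.
Qed.

Lemma msq_dirichlet n x : msq (@shifted_sum n predT x) = n%:R ^+ d.
Proof. by rewrite msq_shifted_sum sumr_const card_ffun !card_ord natrX. Qed.

Lemma sum_zero_coord n j : n.+1%:R * \sum_(b : {ffun 'I_d -> 'I_n.+1} | b j == 0) 1 = n.+1%:R ^+ d :> R.
Proof.
rewrite big_mkcond (sum_fiber j) -natrX.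
rewrite (eq_bigr (fun=> 1)) ?sumr_const ?card_ffun ?card_ord //.
move=> k _; rewrite (bigD1 ord0) //= !ffunE eqxx eqxx big1 ?addr0 // => t t0.
by rewrite ffunE eqxx (negPf t0).
Qed.

Definition shift_var x j : Cd -> C := fun z =>
  character (- delta_mx 0 j) (complexify x) * character (delta_mx 0 j) z.

Lemma laurent_shift_var x j : laurent_trig (shift_var x j).
Proof. exact: laurent_mono. Qed.

Lemma shift_varE x j y : shift_var x j (complexify y) = character (delta_mx 0 j) (complexify (y - x)).
Proof.
rewrite complexifyD complexifyN character_addr mulrC; congr (_ * _).
rewrite characterN; have := character_addr (delta_mx 0 j : Zd) (- complexify x) (complexify x).
by rewrite addNr character_at0 => h; rewrite -[LHS]mul1r h mulfK // character_neq0.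
Qed.

Lemma character_nat_vec n (b : {ffun 'I_d -> 'I_n}) x z :
  character (- nat_vec b) (complexify x) * character (nat_vec b) z = \prod_i shift_var x i z ^+ b i.
Proof.
have e (w : Cd) : character (nat_vec b) w = \prod_i character (delta_mx 0 i) w ^+ b i.
  rewrite characterE; apply: eq_bigr => i _; rewrite mxE -exprnP; congr (_ ^+ _).
  rewrite characterE (bigD1 i) //= big1 ?mulr1 => [|l li]; first by rewrite mxE !eqxx expr1z.
  by rewrite mxE (negPf li) andbF expr0z.
rewrite characterN !e -prodfV -big_split; apply: eq_bigr => i _ /=.
by rewrite -exprVn -exprMn -characterN.
Qed.

Lemma dirichlet_factor n x j z : shifted_sum (n := n.+1) predT x z =
  (\sum_(t < n.+1) shift_var x j z ^+ t) *
  shifted_sum (fun b : {ffun 'I_d -> 'I_n.+1} => b j == 0) x z.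
Proof.
pose W i := shift_var x i z.
have -> : shifted_sum (n := n.+1) predT x z = \prod_i \sum_(t < n.+1) W i ^+ t.
  rewrite bigA_distr_bigA; apply: eq_bigr => b _; exact: character_nat_vec.
rewrite (bigD1 j) //=; congr (_ * _).
pose f (i : 'I_d) (t : 'I_n.+1) : C := if i == j then (t == 0)%:R else W i ^+ t.
have fj t : f j t = (t == 0)%:R by rewrite /f eqxx.
have fi i t : i != j -> f i t = W i ^+ t by rewrite /f => /negPf ->.
have -> : shifted_sum (fun b : {ffun 'I_d -> 'I_n.+1} => b j == 0) x z =
    \sum_(b : {ffun 'I_d -> 'I_n.+1}) \prod_i f i (b i).
  rewrite /shifted_sum big_mkcond; apply: eq_bigr => b _.
  rewrite character_nat_vec [RHS](bigD1 j) //= fj.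
  case: ifP => [/eqP b0|_]; last by rewrite mul0r.
  rewrite (bigD1 j) //= b0 expr0 !mul1r.
  by apply: eq_bigr => i ij; rewrite fi.
rewrite -(bigA_distr_bigA f) [RHS](bigD1 j) //= (bigD1 ord0) //= fj eqxx.
have -> : \sum_(t < n.+1 | t != ord0) f j t = 0.
  by apply: big1 => t t0; rewrite fj (negPf t0).
rewrite addr0 mul1r.
by apply: eq_bigr => i ij; apply: eq_bigr => t _; rewrite fi.
Qed.

Lemma msq_mono F G (c : R) : 0 <= c -> laurent_trig F -> laurent_trig G ->
  (forall x, cmod (F (complexify x)) <= c * cmod (G (complexify x))) ->
  msq F <= c ^+ 2 * msq G.
Proof.
move=> c0 LF LG h; rewrite /msq -Re_realM.
have tt H : laurent_trig H -> real_trig (fun x => H (complexify x) * conjc (H (complexify x))).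
  by move=> LH; apply: real_trigM; [|apply: real_trigJ]; exact: real_trig_laurent.
rewrite -(meanZ _ (tt _ LG)); apply: Re_mean_le => [||x]; first exact: tt.
  by apply: real_trigM; [exact: real_trig_cst|exact: tt].
rewrite Re_realM !mulJ_cmod /= -exprMn lerXn2r ?nnegrE ?mulr_ge0 ?cmod_ge0 //.
Qed.

Definition shift_dirichlet n x j : Cd -> C := fun z =>
  (shift_var x j z - 1) * shifted_sum (n := n) predT x z.

Lemma laurent_shift_dirichlet n x j : laurent_trig (shift_dirichlet n x j).
Proof.
apply: laurentM; last exact: laurent_shifted_sum.
by apply: laurentB; [exact: laurent_shift_var|exact: laurent_cst].
Qed.

(** The factor [shift_var - 1] telescopes the geometric sum in the coordinate [j] to modulus at most
    [2], and the other coordinates leave [n.+1 ^ (d - 1)] terms. For the Fejer kernel this is a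
    second moment of order [1 / n]. *)
Lemma msq_shift_dirichlet n x j : msq (shift_dirichlet n.+1 x j) <= 4 / n.+1%:R * n.+1%:R ^+ d.
Proof.
pose D0 := shifted_sum (fun b : {ffun 'I_d -> 'I_n.+1} => b j == 0) x.
have h : msq (shift_dirichlet n.+1 x j) <= 2 ^+ 2 * msq D0.
  apply: msq_mono => //; [exact: laurent_shift_dirichlet|exact: laurent_shifted_sum|].
  move=> y; rewrite /shift_dirichlet (dirichlet_factor n x j) mulrA -subrX1 cmodM.
  rewrite ler_wpM2r ?cmod_ge0 //; apply: (le_trans (cmodB _ _)).
  by rewrite cmodX shift_varE cmod_character expr1n cmod1.
apply: (le_trans h); rewrite msq_shifted_sum -(sum_zero_coord n j).
by rewrite mulrA mulfVK ?pnatr_eq0 // expr2; lra.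
Qed.

(** The Fejer mean of [psi], written out as a trigonometric polynomial. Summing over pairs [b], [b']
    produces the triangular weights. *)
Definition fejer n psi : Cd -> C := fun z =>
  \sum_(b : {ffun 'I_d -> 'I_n}) \sum_(b' : {ffun 'I_d -> 'I_n})
    ((vol * n%:R ^+ d)^-1%:C *
      torus_integral (fun y => psi y * character (nat_vec b - nat_vec b') (complexify y))) *
    character (nat_vec b' - nat_vec b) z.

Lemma laurent_fejer n psi : laurent_trig (fejer n psi).
Proof. by apply: laurent_sum => b; apply: laurent_sum => b'; exact: laurent_mono. Qed.

Lemma pd_sum j (I : Type) (r : seq I) (f : I -> Cd -> C) : (forall i, laurent_trig (f i)) ->
  pd j (fun z => \sum_(i <- r) f i z) = fun z => \sum_(i <- r) pd j (f i) z.
Proof.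
move=> Lf; elim: r => [|i r IH].
  by under eq_fun do rewrite big_nil; rewrite pd_cst; apply/funext => z; rewrite big_nil.
under eq_fun do rewrite big_cons; rewrite pdD // ?IH; last exact: laurent_sum.
by apply/funext => z; rewrite big_cons.
Qed.

Lemma pd_fejer j n phi : test_function phi -> pd j (fejer n phi) = fejer n (cpartial [:: j] phi).
Proof.
move=> tp; rewrite /fejer pd_sum; last first.
  by move=> b; apply: laurent_sum => b'; exact: laurent_mono.
apply/funext => z; apply: eq_bigr => b _.
rewrite pd_sum; last by move=> b'; exact: laurent_mono.
apply: eq_bigr => b' _; rewrite pd_mono torus_integral_by_parts //.
rewrite !mxE !rmorphB /=; ring.
Qed.

Lemma pdr_fejer r n phi : test_function phi -> pdr r (fejer n phi) = fejer n (cpartial r phi).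
Proof.
move=> tp; elim: r => [|j r IH] /=.
  by congr fejer; apply/funext => x; rewrite /cpartial /=; case: (phi x).
by rewrite IH; exact: (pd_fejer j n (test_cpartial r tp)).
Qed.

Definition energy_density F y : C := F (complexify y) * conjc (F (complexify y)).

Lemma real_trig_lipschitz (G : Rd -> C) : real_trig G -> lipschitz G.
Proof. by move=> [F LF /funext ->]; exact: lipschitz_laurent. Qed.

Lemma real_trig_energy_density F : laurent_trig F -> real_trig (energy_density F).
Proof. by move=> LF; apply: real_trigM; [|apply: real_trigJ]; exact: real_trig_laurent. Qed.

Lemma Re_torus_energy_density F : laurent_trig F ->
  complex.Re (torus_integral (energy_density F)) = vol * msq F.
Proof.
move=> LF; have tF := real_trig_energy_density LF.
by rewrite torus_integral_mean ?Re_realM //; exact: real_trig_lipschitz.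
Qed.

Lemma lipschitz_testMr phi (G : Rd -> C) : test_function phi -> real_trig G -> lipschitz (fun y => phi y * G y).
Proof. by move=> tp [F LF /funext ->]; exact: lipschitz_testM. Qed.

Lemma fejerE n phi x : test_function phi ->
  fejer n phi (complexify x) = (vol * n%:R ^+ d)^-1%:C *
    torus_integral (fun y => phi y * energy_density (shifted_sum (n := n) predT x) y).
Proof.
move=> tp; set k := _%:C.
have Lc a := lipschitz_testM tp (laurent_character R a).
have -> : (fun y => phi y * energy_density (shifted_sum (n := n) predT x) y) = fun y =>
  \sum_(b : {ffun 'I_d -> 'I_n}) \sum_(b' : {ffun 'I_d -> 'I_n})
    character (nat_vec b' - nat_vec b) (complexify x) *
    (phi y * character (nat_vec b - nat_vec b') (complexify y)).
  apply/funext => y; rewrite /energy_density /shifted_sum mulr_suml mulr_sumr.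
  apply: eq_bigr => b _; rewrite conjc_sum mulr_sumr mulr_sumr; apply: eq_bigr => b' _.
  by rewrite conjcM !characterJ opprK !characterD; ring.
rewrite torus_integral_sum; last first.
  by move=> b; apply: lipschitz_sum => b'; apply: lipschitzZ; exact: Lc.
rewrite mulr_sumr; apply: eq_bigr => b _.
rewrite torus_integral_sum; last by move=> b'; apply: lipschitzZ; exact: Lc.
rewrite mulr_sumr; apply: eq_bigr => b' _.
by rewrite torus_integralZ // mulrA [LHS]mulrAC; ring.
Qed.

Lemma Im_mean (G : Rd -> C) : real_trig G -> (forall x, complex.Im (G x) = 0) ->
  complex.Im (mean G) = 0.
Proof.
move=> /meanP[M HM] h; rewrite -(HM M.+1 0) // Im_avg big1 ?mulr0 //.
Qed.

(** By [u <= eta + u^2 / eta], the modulus of continuity under the integral splits into a part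
    weighted by the total mass [1] of the kernel and a part weighted by its second moment, at most
    [4 / n.+1]. The factor [d] in the constant comes from the sum over the coordinates. *)
Lemma fejer_near phi : test_function phi -> exists2 K : R, 0 <= K &
  forall n x (eta : R), 0 < eta ->
    cmod (fejer n.+1 phi (complexify x) - phi x) <= K * (eta + 4 / (n.+1%:R * eta)).
Proof.
move=> tp; have [pp _ _] := tp.
have [K K0 HK] := periodic_lipschitz pp (lipschitz_test tp).
exists (K * d%:R) => [|n x eta e0]; first by rewrite mulr_ge0.
rewrite fejerE //; set N : R := n.+1%:R ^+ d; set c : R := vol * N.
have N0 : 0 < N by rewrite exprn_gt0.
have c0 : 0 < c by rewrite mulr_gt0 // vol_gt0.
set D := shifted_sum _ x; have LD : laurent_trig D by exact: laurent_shifted_sum.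
have tE := real_trig_energy_density LD; have lE := real_trig_lipschitz tE.
have EE F y : energy_density F y = (cmod (F (complexify y)) ^+ 2)%:C by exact: mulJ_cmod.
have TE : torus_integral (energy_density D) = c%:C.
  rewrite torus_integral_mean // /c rmorphM /=; congr (_ * _).
  apply: complex_eqP => /=; first by rewrite -[LHS]/(msq D) msq_dirichlet.
  by apply: Im_mean => // y; rewrite EE.
have lphi := lipschitz_testMr tp tE.
have lphix := lipschitzZ (phi x) lE.
set T := torus_integral _.
have -> : (c^-1)%:C * T - phi x = (c^-1)%:C *
    torus_integral (fun y => phi y * energy_density D y - phi x * energy_density D y).
  rewrite torus_integralB // torus_integralZ // TE mulrBr -/T; congr (_ - _).
  by rewrite mulrCA -rmorphM mulVf ?mulr1 // gt_eqF.
pose V j := shift_dirichlet n.+1 x j.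
have LV j : laurent_trig (V j) by exact: laurent_shift_dirichlet.
pose Hj j y := (K * eta)%:C * energy_density D y + (K / eta)%:C * energy_density (V j) y.
have lV j := real_trig_lipschitz (real_trig_energy_density (LV j)).
have lHj j : lipschitz (Hj j) by apply: lipschitzD; apply: lipschitzZ.
have lH : lipschitz (fun y => \sum_j Hj j y) by exact: lipschitz_sum.
rewrite cmodM cmodR ger0_norm ?invr_ge0 ?(ltW c0) // ler_pdivrMl //.
have lB : lipschitz (fun y => phi y * energy_density D y - phi x * energy_density D y).
  have -> : (fun y => phi y * energy_density D y - phi x * energy_density D y) =
      fun y => phi y * energy_density D y + (-1) * (phi x * energy_density D y).
    by apply/funext => y; rewrite mulN1r.
  by apply: lipschitzD => //; exact: lipschitzZ.
have dens y : cmod (phi y * energy_density D y - phi x * energy_density D y) <=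
    complex.Re (\sum_j Hj j y).
  rewrite -mulrBl cmodM EE cmodR ger0_norm ?sqr_ge0 // Re_sum.
  apply: (le_trans (ler_wpM2r (sqr_ge0 _) (HK x y))).
  rewrite mulr_sumr mulr_suml; apply: ler_sum => j _.
  rewrite ReD !Re_realM !EE /= /V /shift_dirichlet cmodM shift_varE exprMn -/D.
  set u := cmod (_ - 1); set w := cmod (D _).
  have hu : u <= eta + u ^+ 2 / eta.
    rewrite -lerBlDl ler_pdivlMr //; have h1 := sqr_ge0 (u - eta).
    have h2 := sqr_ge0 u; have h3 := sqr_ge0 eta.
    by rewrite !expr2 in h1 h2 h3 *; lra.
  have := ler_wpM2l (mulr_ge0 K0 (sqr_ge0 w)) hu; rewrite mulrDr => h.
  by apply: le_trans (le_trans h _); rewrite le_eqVlt; apply/orP; left; apply/eqP; ring.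
apply: (le_trans (torus_integral_le lB lH dens)).
rewrite torus_integral_sum // Re_sum.
have hj j : complex.Re (torus_integral (Hj j)) <= c * (K * (eta + 4 / (n.+1%:R * eta))).
  rewrite torus_integral_lin //; last exact: lipschitzZ.
  rewrite torus_integralZ // ReD !Re_realM !Re_torus_energy_density // msq_dirichlet -/N.
  have hm := msq_shift_dirichlet n x j; rewrite -/N in hm.
  have k0 : 0 <= K / eta * vol by apply: mulr_ge0; [rewrite divr_ge0 // ltW|rewrite ltW // vol_gt0].
  have := ler_wpM2l k0 hm; rewrite -/(V j) => h2.
  rewrite /c; apply: (@le_trans _ _ (K * eta * (vol * N) + K / eta * vol * (4 / n.+1%:R * N))).
    by rewrite lerD2l mulrA.
  rewrite le_eqVlt; apply/orP; left; apply/eqP.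
  by move: (n.+1%:R : R) (ltr0n R n.+1) => q /= q0; field; rewrite !gt_eqF // q0.
apply: (le_trans (ler_sum _ (fun j _ => hj j))).
rewrite sumr_const card_ord -[_ *+ d]mulr_natl le_eqVlt; apply/orP; left; apply/eqP; ring.
Qed.

(** Fejer means commute with partial derivatives, so that uniform approximation of each derivative
    suffices. *)
Lemma trig_dense phi (N : nat) (e : R) : test_function phi -> 0 < e ->
  exists2 F, laurent_trig F & forall r x, (size r <= N)%N ->
    cmod (cpartial r phi x - pdr r F (complexify x)) <= e.
Proof.
move=> tp e0.
have /boolp.choice[m Hm] : forall r, exists m : nat, forall n, (m <= n)%N ->
    forall x, cmod (fejer n.+1 (cpartial r phi) (complexify x) - cpartial r phi x) <= e.
  move=> r; have [K K0 HK] := fejer_near (test_cpartial r tp).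
  have k1 : 0 < 2 * (K + 1) by lra.
  have [eta eta0 etaE] : exists2 eta : R, 0 < eta & (K + 1) * (2 * eta) = e.
    by exists (e / (2 * (K + 1))); [rewrite divr_gt0|field; rewrite gt_eqF // ltr_wpDl].
  have [m [m0 hm]] := natr_inv_small eta0 (ltW (divr_gt0 (ltr0n R 4) eta0)).
  exists m => n mn x; apply: (le_trans (HK n x eta eta0)).
  have h : 4 / (n.+1%:R * eta) <= eta.
    apply: le_trans hm; rewrite invfM mulrA mulrAC.
    apply: ler_wpM2l; first by apply: ltW; rewrite divr_gt0.
    by rewrite lef_pV2 ?posrE ?ltr0n // ler_nat (leq_trans mn).
  rewrite -etaE.
  move: h; move: (4 / (n.+1%:R * eta)) => q h.
  have h' : eta + q <= 2 * eta by lra.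
  apply: (le_trans (ler_wpM2l K0 h')); rewrite [leRHS]mulrDl mul1r lerDl.
  by lra.
(* The sum over the finitely many words of length at most [N] dominates each of their thresholds
   [m]. *)
pose n := (\sum_(k < N.+1) \sum_(t : k.-tuple 'I_d) m t)%N.
exists (fejer n.+1 phi); first exact: laurent_fejer.
move=> r x rN; rewrite pdr_fejer // cmod_subC; apply: Hm.
rewrite /n (bigD1 (Ordinal (rN : size r < N.+1)%N)) //= (bigD1 (in_tuple r)) //= -addnA.
exact: leq_addr.
Qed.

End FejerKernel.

(** * Functionals annihilated by [p] *)

Section Annihilated.
Variables (R : realType) (d : nat).
Local Notation C := R[i].
Local Notation Rd := 'rV[R]_d.
Local Notation Cd := 'rV[C]_d.
Local Notation Zd := 'rV[int]_d.
Implicit Types (a b : Zd) (x y : Rd) (F G p g : Cd -> C) (v : (Cd -> C) -> C) (w : Zd -> C).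

Lemma sublinearZ (c : C) w : sublinear w -> sublinear (fun a => c * w a).
Proof.
move=> sw eta eta0; have k0 : 0 < cmod c ^+ 2 + 1 by rewrite ltr_wpDl // sqr_ge0.
have [rho0 r0 H] := sw _ (divr_gt0 eta0 k0); exists rho0 => // rho hr S uS hS.
have := H rho hr S uS hS; rewrite -(ler_pM2l k0) => h.
have -> : eta * rho = (cmod c ^+ 2 + 1) * (eta / (cmod c ^+ 2 + 1) * rho).
  by rewrite mulrA [_ * (eta / _)]mulrC divfK // gt_eqF.
apply: le_trans h; under eq_bigr do rewrite cmodM exprMn.
rewrite -mulr_sumr ler_wpM2r ?lerDl //; apply: sumr_ge0 => n _; exact: sqr_ge0.
Qed.

Lemma sublinearB w w' : sublinear w -> sublinear w' -> sublinear (fun a => w a - w' a).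
Proof.
move=> sw sw' eta eta0; have e4 : 0 < eta / 4 by rewrite divr_gt0.
have [r1 r10 H1] := sw _ e4; have [r2 r20 H2] := sw' _ e4.
exists (Num.max r1 r2); first by rewrite lt_max r10.
move=> rho; rewrite ge_max => /andP[h1 h2] S uS hS.
have a1 := H1 rho h1 S uS hS; have a2 := H2 rho h2 S uS hS.
apply: (@le_trans _ _ (\sum_(n <- S) (2 * cmod (w n) ^+ 2 + 2 * cmod (w' n) ^+ 2))).
  apply: ler_sum => n _; have h := cmodB (w n) (w' n).
  move: (cmod (w n)) (cmod (w' n)) (cmod _) (cmod_ge0 (w n - w' n)) h => s t u u0 h.
  apply: (@le_trans _ _ ((s + t) ^+ 2)); first by rewrite lerXn2r ?nnegrE // (le_trans u0).
  by have := sqr_ge0 (s - t); rewrite !expr2; lra.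
by rewrite big_split -!mulr_sumr /=; move: (\sum_(_ <- S) _) (\sum_(_ <- S) _) a1 a2 => s t; lra.
Qed.

(** A trigonometric polynomial has finitely many nonzero coefficients. The sum of their squares is
    at most [K^2], hence below [eta rho] for large [rho]. *)
Lemma sublinear_mean g : laurent_trig g ->
  sublinear (fun a => mean (fun x => g (complexify x) * character a (complexify x))).
Proof.
move=> [A [c gE]]; pose w2 b := \sum_(a <- A) c a * (a + b == 0)%:R.
have wE b : mean (fun x => g (complexify x) * character b (complexify x)) = w2 b.
  have -> : (fun x => g (complexify x) * character b (complexify x)) = fun x =>
     \sum_(a <- A) c a * character (a + b) (complexify x).
    apply/funext => x; rewrite gE mulr_suml; apply: eq_bigr => a _.
    by rewrite characterD mulrA.
  rewrite mean_sum => [|a]; last by apply: real_trigM; [exact: real_trig_cst|apply: real_trig_laurent; exact: laurent_character].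
  apply: eq_bigr => a _; rewrite meanZ ?mean_character //.
  by apply: real_trig_laurent; exact: laurent_character.
pose K := \sum_(a <- A) cmod (c a).
have K0 : 0 <= K by apply: sumr_ge0 => a _; exact: cmod_ge0.
have cw b : cmod (w2 b) <= \sum_(a <- A) cmod (c a) * (a + b == 0)%:R.
  apply: (le_trans (cmod_sum _ _ _)); apply: ler_sum => a _; rewrite cmodM.
  by case: (_ == _); rewrite ?cmod1 ?cmod0.
have cwK b : cmod (w2 b) <= K.
  apply: (le_trans (cw b)); apply: ler_sum => a _.
  by case: (_ == _); rewrite ?mulr1 ?mulr0 ?cmod_ge0.
move=> eta eta0; exists (K ^+ 2 / eta + 1); first by rewrite ltr_wpDl // divr_ge0 ?sqr_ge0 // ltW.
move=> rho hr S uS _; under eq_bigr do rewrite wE.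
apply: (@le_trans _ _ (K ^+ 2)); last first.
  by rewrite mulrC -ler_pdivrMr //; apply: le_trans hr; rewrite lerDl.
apply: (@le_trans _ _ (\sum_(b <- S) K * \sum_(a <- A) cmod (c a) * (a + b == 0)%:R)).
  by apply: ler_sum => b _; rewrite expr2; apply: ler_pM; rewrite ?cmod_ge0.
rewrite -mulr_sumr expr2 ler_wpM2l // exchange_big; apply: ler_sum => a _.
rewrite -mulr_sumr -[leRHS]mulr1 ler_wpM2l ?cmod_ge0 //.
under eq_bigr do rewrite addrC addr_eq0; rewrite -natr_sum -[leRHS]/(1%:R) ler_nat.
rewrite (eq_bigr (fun b => if b == - a then 1%N else 0%N)); last by move=> b _; case: (_ == _).
by rewrite -big_mkcond sum1_count -/(count_mem (- a) S) count_uniq_mem //; case: (_ \in _).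
Qed.

(** The kernels are controlled on [[-1, 1]] only, so the values of [p] have to be brought there. *)
Lemma real_rescale p : laurent_trig p -> exists2 c : R, 0 < c &
  forall x, cmod (c%:C * p (complexify x)) <= 1.
Proof.
move=> Lp; have [B B0 HB] := laurent_bounded Lp.
have B1 : 0 < B + 1 by lra.
exists (B + 1)^-1; first by rewrite invr_gt0.
move=> x; rewrite cmodM cmodR ger0_norm ?invr_ge0 ?(ltW B1) // mulrC ler_pdivrMr // mul1r.
by apply: (le_trans (HB x)); rewrite lerDl.
Qed.

Lemma exists_sign_scale (c r : R) : 0 < c -> r != 0 -> exists2 s : R, `|s| = c & 0 < s * r.
Proof.
move=> c0 r0; have [h|h|h] := ltgtP 0 r.
- by exists c; [rewrite gtr0_norm|rewrite mulr_gt0].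
- by exists (- c); [rewrite normrN gtr0_norm|rewrite mulNr -mulrN mulr_gt0 // oppr_gt0].
- by rewrite -h eqxx in r0.
Qed.

(** Removes the normalisation: [p] is scaled below [1] in modulus, with the sign that makes its
    [j]-th derivative positive at [x0]. *)
Lemma resonant_value v p g j x0 : linear_on_trig v -> sublinear (fun a => v (character a)) ->
  laurent_trig p -> (forall x, complex.Im (p (complexify x)) = 0) -> laurent_trig g ->
  (forall F, laurent_trig F ->
    v (fun z => p z * F z) = mean (fun x => g (complexify x) * F (complexify x))) ->
  p (complexify x0) = 0 -> pd j p (complexify x0) != 0 -> g (complexify x0) = 0.
Proof.
move=> lv sv Lp pR Lg vp px0 pj; have [c c0 Hc] := real_rescale Lp.
have [s [s0 sH sP]] : exists s : R, [/\ s != 0, forall x, cmod (s%:C * p (complexify x)) <= 1 &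
    0 < complex.Re (pd j (fun z => s%:C * p z) (complexify x0))].
  have pjR : complex.Re (pd j p (complexify x0)) != 0.
    apply: contra pj => /eqP h; apply/eqP/complex_eqP => //; exact: laurent_real_pd.
  have h3 (s : R) : complex.Re (pd j (fun z => s%:C * p z) (complexify x0)) =
      s * complex.Re (pd j p (complexify x0)).
    by rewrite (congr1 (fun F => F (complexify x0)) (pdZ j s%:C Lp)) Re_realM.
  have [s sc sr] := exists_sign_scale c0 pjR.
  exists s; split; last by rewrite (h3 s).
    by rewrite -normr_gt0 sc.
  move=> x; apply: le_trans (Hc x).
  by rewrite !cmodM !cmodR sc ger0_norm // ltW.
have Lsp : laurent_trig (fun z => s%:C * p z) by exact: laurentZ.
have Lsg : laurent_trig (fun z => s%:C * g z) by exact: laurentZ.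
have spR x : complex.Im (s%:C * p (complexify x)) = 0 by rewrite Im_realM pR mulr0.
have svp F : laurent_trig F -> v (fun z => s%:C * p z * F z) =
    mean (fun x => s%:C * g (complexify x) * F (complexify x)).
  move=> LF; under eq_fun do rewrite -mulrA.
  rewrite (linear_on_trigZ _ lv (laurentM Lp LF)) vp //.
  rewrite -(meanZ _ (real_trigM (real_trig_laurent Lg) (real_trig_laurent LF))).
  by congr mean; apply/funext => x; rewrite mulrA.
have spx0 : s%:C * p (complexify x0) = 0 by rewrite px0 mulr0.
have := resonant_value_eq0 Lsp spR sH lv sv Lsg svp spx0 sP.
move/eqP; rewrite mulf_eq0 => /orP[/eqP sC|/eqP //].
by move/eqP: s0; case; have := congr1 (@complex.Re R) sC.
Qed.

Lemma gradient_annihilates v p j F : linear_on_trig v -> sublinear (fun a => v (character a)) ->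
  laurent_trig p -> (forall x, complex.Im (p (complexify x)) = 0) ->
  (forall F, laurent_trig F -> v (fun z => p z * F z) = 0) -> laurent_trig F ->
  v (fun z => pd j p z * F z) = 0.
Proof.
move=> lv sv Lp pR vp LF; have [c c0 Hc] := real_rescale Lp.
have Lcp : laurent_trig (fun z => c%:C * p z) by exact: laurentZ.
have cpR x : complex.Im (c%:C * p (complexify x)) = 0 by rewrite Im_realM pR mulr0.
have vcp G : laurent_trig G -> v (fun z => c%:C * p z * G z) = 0.
  move=> LG; under eq_fun do rewrite -mulrA.
  by rewrite linear_on_trigZ ?vp ?mulr0 //; exact: laurentM.
have := annihilates_gradient Lcp cpR Hc j lv sv vcp LF; rewrite (pdZ j c%:C Lp).
have -> : (fun z => F z * (c%:C * pd j p z)) = fun z => c%:C * (pd j p z * F z).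
  by apply/funext => z; ring.
rewrite linear_on_trigZ //; last by apply: laurentM => //; exact: laurent_pd.
move/eqP; rewrite mulf_eq0 => /orP[/eqP cC|/eqP //].
by move: c0; have := congr1 (@complex.Re R) cC => /= ->; rewrite ltxx.
Qed.

Lemma lattice_norm_le1 (n : Zd) : lattice_norm R n <= \sum_j `|(n 0 j)%:~R : R|.
Proof.
have S0 : 0 <= \sum_j `|(n 0 j)%:~R : R| by exact: sumr_ge0.
rewrite -[leRHS]ger0_norm // -sqrtr_sqr ler_wsqrtr // expr2 mulr_suml.
apply: ler_sum => j _; rewrite -real_normK ?num_real // expr2 ler_wpM2l //.
by rewrite (bigD1 j) //= lerDl sumr_ge0.
Qed.

Lemma le_add_sqr_div (s t : R) : 0 < s -> t <= s + t ^+ 2 / s.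
Proof.
move=> s0; rewrite -lerBlDl ler_pdivlMr //; have := sqr_ge0 (t - s).
by have := sqr_ge0 t; have := sqr_ge0 s; rewrite !expr2; lra.
Qed.

(** The [n] translates of [B] along [sg e_j] stay in a ball of radius at most [2 n]. There the sums
    of squares are at most [2 n eta], whereas the lower bound makes them at least a fixed multiple
    of [n]. *)
Lemma sublinear_not_bounded_below (w : Zd -> C) (B : seq Zd) (k : Zd -> R) (sg : int) j (delta : R) :
  sublinear w -> `|sg|%N = 1%N -> 0 < delta -> (forall b, 0 <= k b) ->
  ~ (forall m : nat, delta <= \sum_(b <- B) k b * cmod (w (b + (sg * m%:Z) *: delta_mx 0 j))).
Proof.
move=> sw sg1 d0 k0 H.
have sgv : sg = 1 \/ sg = -1.
  by case: (sg) sg1 => [[|[|m]]|[|m]] //; [left|right].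
have sgE : sg * sg = 1 by case: sgv => ->.
have sgn1 : `|sg%:~R : R| = 1.
  by case: sgv => ->; rewrite ?rmorphN1 ?normrN1 ?normr1.
have [K KE K1] : exists2 K : R, \sum_(b <- B) k b <= K & 0 < K.
  exists (\sum_(b <- B) k b + 1); first by rewrite lerDl.
  by rewrite ltr_wpDl // sumr_ge0.
have Kn : K != 0 by exact: lt0r_neq0.
(* Chosen so that the final upper bound [4 K * K * (eta * 2 n)] is half of the lower bound
   [n delta^2]. *)
have [eta eta0 etaE] : exists2 eta : R, 0 < eta & eta = delta ^+ 2 / (16 * K ^+ 2).
  by exists (delta ^+ 2 / (16 * K ^+ 2)); rewrite // divr_gt0 ?exprn_gt0 // mulr_gt0 // exprn_gt0.
have [rho0 r00 Hr] := sw eta eta0.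
pose beta : R := \sum_(b <- B) \sum_i `|(b 0 i)%:~R : R| + 1.
have beta1 : 1 <= beta by rewrite lerDr; apply: sumr_ge0 => b _; apply: sumr_ge0.
have hbeta b : b \in B -> \sum_i `|(b 0 i)%:~R : R| <= beta.
  move=> bB; apply: (@le_trans _ _ (beta - 1)); last by rewrite gerBl.
  by rewrite /beta addrK (big_rem b bB) /= lerDl; apply: sumr_ge0 => b' _; exact: sumr_ge0.
clearbody beta.
have [n [n0 nr nb]] : exists n : nat, [/\ (0 < n)%N, rho0 <= n%:R & beta <= n%:R].
  have b0 : 0 <= beta by exact: le_trans ler01 beta1.
  have rb : 0 <= rho0 + beta by rewrite addr_ge0 // ltW.
  have h : rho0 + beta <= (Num.Def.archi_bound (rho0 + beta)).+1%:R.
    by apply: (le_trans (ltW (archi_boundP rb))); rewrite ler_nat.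
  exists (Num.Def.archi_bound (rho0 + beta)).+1; split=> //; apply: le_trans h.
    by rewrite lerDl.
  by rewrite lerDr ltW.
have n0' : 0 < n%:R :> R by rewrite ltr0n.
pose pt b (m : nat) : Zd := b + (sg * m%:Z) *: delta_mx 0 j.
have pt_inj b : injective (pt b).
  move=> m m' /addrI /(congr1 (fun a : Zd => a 0 j)); rewrite !mxE !eqxx !mulr1 => h.
  have := congr1 (fun i : int => sg * i) h; rewrite !mulrA sgE !mul1r => -[] //.
have hb b : b \in B -> \sum_(m < n) cmod (w (pt b m)) ^+ 2 <= eta * (2 * n%:R).
  move=> bB; have := Hr (n%:R + beta) _ [seq pt b m | m <- iota 0 n] _ _.
  rewrite big_map -[n in iota 0 n]subn0 big_mkord => h.
  apply: (le_trans (h _ _ _)).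
  - by apply: (le_trans nr); rewrite lerDl (le_trans ler01).
  - by rewrite map_inj_uniq ?iota_uniq //; exact: pt_inj.
  - move=> a /mapP[m]; rewrite mem_iota subn0 add0n /= => mn ->.
    apply: (le_lt_trans (lattice_norm_le1 _)).
    apply: (@le_lt_trans _ _ (m%:R + \sum_i `|(b 0 i)%:~R : R|)).
      rewrite (bigD1 j) //= [X in _ <= _ + X](bigD1 j) //= addrA; apply: lerD.
        rewrite !mxE !eqxx mulr1 rmorphD /= addrC; apply: (le_trans (ler_normD _ _)).
        rewrite lerD2l rmorphM normrM /= sgn1 mul1r.
        by rewrite -pmulrn ger0_norm.
      by apply: ler_sum => i ij; rewrite !mxE (negPf ij) andbF mulr0 addr0.
    by apply: ltr_leD; [rewrite ltr_nat|exact: hbeta].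
  - by rewrite ler_wpM2l ?(ltW eta0) // mulr_natl mulr2n lerD2l.
have hm m : delta ^+ 2 <= 4 * K * \sum_(b <- B) k b * cmod (w (pt b m)) ^+ 2.
  pose s := delta / (2 * K); have s0 : 0 < s by rewrite divr_gt0 // mulr_gt0.
  have h1 : \sum_(b <- B) k b * cmod (w (pt b m)) <=
      \sum_(b <- B) (k b * s + k b * cmod (w (pt b m)) ^+ 2 / s).
    apply: ler_sum => b _; rewrite -mulrA -mulrDr ler_wpM2l //; set t := cmod _.
    exact: le_add_sqr_div.
  have h2 := le_trans (H m) h1; rewrite big_split -!mulr_suml /= in h2.
  set Sg := \sum_(b <- B) k b * _ ^+ 2 in h2 *.
  have h3 : (\sum_(b <- B) k b) * s <= delta / 2.
    apply: (@le_trans _ _ (K * s)); first by rewrite ler_wpM2r ?(ltW s0).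
    by rewrite /s le_eqVlt; apply/orP; left; apply/eqP; field.
  have h4 : delta / 2 <= Sg / s by lra.
  rewrite ler_pdivlMr // in h4.
  have h5 : delta / 2 * s = delta ^+ 2 / (4 * K) by rewrite /s; field.
  by rewrite h5 ler_pdivrMr ?mulr_gt0 // mulrC in h4.
have := ler_sum (index_enum 'I_n) (fun (m : 'I_n) (_ : true) => hm m).
rewrite sumr_const card_ord -mulr_sumr exchange_big /= -[_ *+ n]mulr_natl.
under eq_bigr do rewrite -mulr_sumr.
move=> h; have h6 : \sum_(b <- B) k b * \sum_(m < n) cmod (w (pt b m)) ^+ 2 <= K * (eta * (2 * n%:R)).
  apply: (@le_trans _ _ (\sum_(b <- B) k b * (eta * (2 * n%:R)))).
    by rewrite big_seq [leRHS]big_seq; apply: ler_sum => b bB; rewrite ler_wpM2l // hb.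
  rewrite -mulr_suml ler_wpM2r //.
  by rewrite mulr_ge0 ?(ltW eta0) // mulr_ge0.
have K4 : 0 <= 4 * K by rewrite mulr_ge0 // ltW.
have := le_trans h (ler_wpM2l K4 h6).
have -> : 4 * K * (K * (eta * (2 * n%:R))) = n%:R * delta ^+ 2 / 2.
  by rewrite etaE; field.
have : 0 < n%:R * delta ^+ 2 by rewrite mulr_gt0 // exprn_gt0.
by lra.
Qed.

Lemma annihilated_eq0 v p (j : 'I_d) : linear_on_trig v -> sublinear (fun a => v (character a)) ->
  laurent_trig p -> (forall x, complex.Im (p (complexify x)) = 0) ->
  (forall F, laurent_trig F -> v (fun z => p z * F z) = 0) ->
  discrete_subset (sng_set p) -> forall F, laurent_trig F -> v F = 0.
Proof.
move=> lv sv Lp pR vp ds F0 LF0; apply: contrapT => /eqP vF0.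
pose J F := laurent_trig F /\ forall G, laurent_trig G -> v (fun z => F z * G z) = 0.
have vadd F G : laurent_trig F -> laurent_trig G -> v (fun z => F z + G z) = v F + v G.
  by move=> LF LG; have := lv 1 F G LF LG; rewrite mul1r; under eq_fun do rewrite mul1r.
have IJ : laurent_ideal J.
  split.
  - split; first exact: laurent_cst.
    move=> G LG; have := linear_on_trigZ 0 lv LG; rewrite mul0r; exact.
  - move=> F G [LF hF] [LG hG]; split; first exact: laurentD.
    move=> H LH; under eq_fun do rewrite mulrDl.
    by rewrite vadd ?hF ?hG ?addr0 //; exact: laurentM.
  - move=> H F LH [LF hF]; split; first exact: laurentM.
    move=> G LG; under eq_fun do rewrite mulrAC mulrC; apply: hF; exact: laurentM.
have Jp : J p by [].
have Jd i : J (pd i p).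
  split=> [|G LG]; [exact: laurent_pd|exact: gradient_annihilates].
have [r r0 [_ Jr]] := ideal_discrete_zeros j IJ ds (fun z (h : forall F, laurent_trig F -> J F -> F z = 0) =>
  ex_intro2 _ _ z (conj (h p Lp Jp) (fun i => h (pd i p) (laurent_pd i Lp) (Jd i))) erefl).
have [Q [c [LQ vQ Hc]]] := eigenfunctional r0 LF0 vF0 (fun (k : C) F LF => linear_on_trigZ k lv LF) Jr.
have [B [k QE]] := LQ; pose e : Zd := delta_mx 0 j.
pose mu (a : Zd) := v (fun z => Q z * character a z).
have LQc a : laurent_trig (fun z => Q z * character a z) by apply: laurentM => //; exact: laurent_character.
(* The Fourier coefficients of the functional [Q v] form a geometric progression of ratio [c] along
   [e_j]. Going forwards if [|c| >= 1] and backwards otherwise, they stay at least [|v Q|] in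
   modulus. *)
have mu_step a : mu (a + e) = c * mu a.
  have h := Hc _ (laurent_character R a); rewrite /mu -linear_on_trigZ //.
  apply/eqP; rewrite -subr_eq0 -h.
  have -> : (fun z => (tvar j z - c) * (Q z * character a z)) = fun z =>
      (-1) * (c * (Q z * character a z)) + Q z * character (a + e) z.
    by apply/funext => z; rewrite characterD /tvar -/e; ring.
  by rewrite lv ?mulN1r 1?addrC //; exact: laurentZ.
have mu0 : mu 0 = v Q.
  by rewrite /mu; congr v; apply/funext => z; rewrite character0 mulr1.
have mu_le a : cmod (mu a) <= \sum_(b <- B) cmod (k b) * cmod (v (character (b + a))).
  have -> : mu a = \sum_(b <- B) k b * v (character (b + a)).
    rewrite /mu; have -> : (fun z => Q z * character a z) = fun z => \sum_(b <- B) k b * character (b + a) z.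
      apply/funext => z; rewrite QE mulr_suml; apply: eq_bigr => b _.
      by rewrite characterD mulrA.
    elim: B {QE} => [|b B IH].
      rewrite big_nil; under eq_fun do rewrite big_nil.
      by have := linear_on_trigZ 0 lv LF0; rewrite mul0r; under eq_fun do rewrite mul0r.
    rewrite big_cons -IH; under eq_fun do rewrite big_cons.
    rewrite vadd ?linear_on_trigZ //; [exact: laurent_character|exact: laurent_mono|].
    by apply: laurent_sum => b'; exact: laurent_mono.
  by apply: (le_trans (cmod_sum _ _ _)); apply: ler_sum => b _; rewrite cmodM.
have del0 : 0 < cmod (v Q) by rewrite cmod_gt0.
have [c1|c1] := leP 1 (cmod c).
- apply: (@sublinear_not_bounded_below _ B (fun b => cmod (k b)) 1 j _ sv _ del0) => //.
    by move=> b; exact: cmod_ge0.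
  move=> m; apply: le_trans (mu_le _); rewrite mul1r.
  suff -> : mu (m%:Z *: e) = c ^+ m * v Q.
    by rewrite cmodM cmodX ler_peMl ?cmod_ge0 // exprn_ege1.
  elim: m => [|m IH]; first by rewrite scale0r mu0 mul1r.
  by rewrite intS scalerDl scale1r addrC mu_step IH exprS mulrA.
- apply: (@sublinear_not_bounded_below _ B (fun b => cmod (k b)) (-1) j _ sv _ del0) => //.
    by move=> b; exact: cmod_ge0.
  move=> m; apply: le_trans (mu_le _); rewrite mulN1r.
  have E : v Q = c ^+ m * mu (- m%:Z *: e).
    elim: m => [|m IH]; first by rewrite oppr0 scale0r mu0 mul1r.
    have h := mu_step (- (m.+1)%:Z *: e).
    rewrite IH exprSr -mulrA -h; congr (_ * mu _).
    by rewrite intS opprD scalerDl scaleN1r addrAC addNr add0r.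
  rewrite E cmodM cmodX ler_piMl ?cmod_ge0 // exprn_ile1 ?cmod_ge0 // ltW //.
Qed.

End Annihilated.

(** * Reduction to scalar equations *)

Section Assembly.
Variables (R : realType) (d : nat).
Local Notation C := R[i].
Local Notation Rd := 'rV[R]_d.
Local Notation Cd := 'rV[C]_d.
Local Notation Zd := 'rV[int]_d.
Local Notation vol := ((2 * pi) ^+ d : R).
Implicit Types (n : Zd) (x y : Rd) (F G : Cd -> C) (u : functional R d) (phi psi : Rd -> C).

Lemma finite_lattice_ball (rho : R) : finite_set [set n : Zd | lattice_norm R n < rho].
Proof.
pose N := Num.Def.archi_bound `|rho|.
apply: (@sub_finite_set _ _ (range (@box_index d N))); last first.
  by apply: finite_image; exact: finite_finset.
move=> n /= nr; pose f : {ffun 'I_d -> 'I_(N.*2.+1)} := [ffun j => inord `|(n ord0 j + N%:Z)%R|%N].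
have HN j : (`|n ord0 j|%N <= N)%N.
  rewrite -(ler_nat R) natr_absz -[leLHS]/(`|n ord0 j|%:~R : R).
  rewrite intr_norm; apply: (@le_trans _ _ `|rho|); last exact/ltW/archi_boundP.
  apply: le_trans (le_trans (ltW nr) (ler_norm _)).
  rewrite -sqrtr_sqr ler_wsqrtr // (bigD1 j) //= lerDl.
  by apply: sumr_ge0 => i _; exact: sqr_ge0.
exists f => //; apply/rowP => j; have := HN j; rewrite mxE ffunE; move: (n ord0 j) => t Ht.
by rewrite inordK; lia.
Qed.

Lemma sum_sub_le (T : eqType) (S S' : seq T) (f : T -> R) : uniq S -> uniq S' ->
  {subset S <= S'} -> (forall t, 0 <= f t) -> \sum_(t <- S) f t <= \sum_(t <- S') f t.
Proof.
move=> uS uS' SS f0; rewrite [leRHS](bigID (fun t => t \in S)) /= -[leLHS]addr0.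
apply: lerD; last by apply: sumr_ge0.
rewrite -[leRHS]big_filter le_eqVlt; apply/orP; left; apply/eqP; apply: perm_big.
apply: uniq_perm => //; first exact: filter_uniq.
by move=> t; rewrite mem_filter; case tS : (t \in S) => //=; rewrite SS.
Qed.

Lemma lattice_normN n : lattice_norm R (- n) = lattice_norm R n.
Proof.
by congr Num.sqrt; apply: eq_bigr => j _; rewrite mxE rmorphN sqrrN.
Qed.

(** The [n]-th Fourier coefficient pairs [u] with the character of [- n]; balls are symmetric, so
    the list [S] may be negated. *)
Lemma Bstar0_sublinear u : Bstar0 u ->
  sublinear (fun n => u (fun x => character n (complexify x))).
Proof.
move=> [_ u0] eta eta0; set w := fun n => u (fun x => character n (complexify x)).
pose q : R := Num.sqrt (2 * pi) ^- d.
have q0 : 0 < q by rewrite invr_gt0 exprn_gt0 // sqrtr_gt0 mulr_gt0 // pi_gt0.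
have fE n : sqmod (fourier u n) = q ^+ 2 * cmod (w (- n)) ^+ 2.
  by rewrite sqmodE /fourier cmodM cmodR exprMn (ger0_norm (ltW q0)).
have e0 : 0 < eta * q ^+ 2 by rewrite mulr_gt0 // exprn_gt0.
have : \forall rho \near +oo, mean_fourier u rho < eta * q ^+ 2.
  have := @cvgr_lt _ _ _ _ _ _ u0 _ e0; exact.
move=> [A [Ar HA]].
exists (`|A| + 1) => [|rho hr S uS hS]; first by rewrite ltr_wpDl.
have rA : A < rho by apply: (le_lt_trans (ler_norm A)); lra.
have r0 : 0 < rho by apply: (lt_le_trans _ hr); rewrite ltr_wpDl.
have := HA rho rA; rewrite /= /mean_fourier fsbig_finite; last exact: finite_lattice_ball.
rewrite mulrC ltr_pdivrMr // => /ltW h.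
have q2 : 0 < q ^+ 2 by rewrite exprn_gt0.
rewrite -(ler_pM2l q2); apply: le_trans (le_trans _ h) _; last first.
  by rewrite le_eqVlt; apply/orP; left; apply/eqP; ring.
rewrite mulr_sumr.
have -> : \sum_(n <- S) q ^+ 2 * cmod (w n) ^+ 2 = \sum_(n <- [seq - n | n <- S]) sqmod (fourier u n).
  by rewrite big_map; apply: eq_bigr => n _; rewrite fE opprK.
apply: sum_sub_le.
- by rewrite map_inj_uniq //; exact: oppr_inj.
- exact: finmap.fset_uniq.
- move=> n /mapP[m mS ->]; have := hS m mS; rewrite -lattice_normN => hm.
  by apply: etrans (in_fset_set (finite_lattice_ball rho) (- m)) _; apply: mem_set.
- by move=> n; rewrite sqmodE sqr_ge0.
Qed.

Lemma laurent_det s (M : Cd -> 'M[C]_s) : (forall i j, laurent_trig (fun z => M z i j)) ->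
  laurent_trig (fun z => \det (M z)).
Proof.
move=> LM; apply: laurent_sum => sg; apply: laurentM; first exact: laurent_cst.
by apply: laurent_prod => i; exact: LM.
Qed.

Lemma laurent_adj s (M : Cd -> 'M[C]_s) i j : (forall i j, laurent_trig (fun z => M z i j)) ->
  laurent_trig (fun z => (\adj (M z)) i j).
Proof.
move=> LM; under eq_fun do rewrite mxE; apply: laurentM; first exact: laurent_cst.
apply: laurent_det => i' j'; under eq_fun do rewrite !mxE; exact: LM.
Qed.

Lemma hermitian_det_real s (A : 'M[C]_s) : A \is hermsymmx -> complex.Im (\det A) = 0.
Proof.
move=> /eqP; rewrite expr0 scale1r => AE.
have e : conjc (\det A) = \det A.
  rewrite -(det_map_mx (@conjc R)) -det_tr; congr (\det _); apply/matrixP => i j.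
  by rewrite [RHS](congr1 (fun M : matrix C s s => M i j) AE) !mxE.
by have := congr1 (@complex.Im R) e; case: (\det A) => a b /= h; lra.
Qed.

Lemma hermitian_sub_real s (A : 'M[C]_s) (l : R) : A \is hermsymmx -> A - (l%:C)%:M \is hermsymmx.
Proof.
move=> /eqP; rewrite expr0 scale1r => AE; apply/eqP; rewrite expr0 scale1r {1}AE.
apply/matrixP => i j; rewrite !mxE eq_sym rmorphB /=; congr (_ - _).
by rewrite rmorphMn /=; congr (_ *+ _); apply: complex_eqP => //=; rewrite oppr0.
Qed.

Definition on_trig u : (Cd -> C) -> C := fun F => u (fun x => F (complexify x)).

Lemma on_trig_linear u : is_distribution u -> linear_on_trig (on_trig u).
Proof.
by move=> [lu _] c F G LF LG; apply: lu; exact: laurent_test_function.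
Qed.

Lemma linear_on_trig_bigsum v (I : Type) (r : seq I) (f : I -> Cd -> C) : linear_on_trig v ->
  (forall i, laurent_trig (f i)) ->
  v (fun z => \sum_(i <- r) f i z) = \sum_(i <- r) v (f i).
Proof.
move=> lv Lf; elim: r => [|i r IH].
  rewrite big_nil; under eq_fun do rewrite big_nil.
  rewrite -[RHS](mul0r (v (fun=> 0))) -(linear_on_trigZ _ lv (laurent_cst d (0 : C))).
  by congr v; apply/funext => z; rewrite mul0r.
rewrite big_cons -IH -[v (f i)]mul1r -lv //; last exact: laurent_sum.
by congr v; apply/funext => z; rewrite big_cons mul1r.
Qed.

(** A distribution is bounded by some [C^N] norm, for which trigonometric polynomials are dense in
    test functions. The difference of the two sides at [phi] equals that at the small remainder
    [psi]. *)
Lemma eq_dist_laurent u q : is_distribution u -> laurent_trig q ->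
  (forall F, laurent_trig F -> on_trig u F =
    torus_integral (fun x => q (complexify x) * F (complexify x))) ->
  eq_dist u (dist_of_fun (fun x => q (complexify x))).
Proof.
move=> [lu [N [K uK]]] Lq uq phi tphi; rewrite /dist_of_fun.
have [B B0 HB] := laurent_bounded Lq; have lq := lipschitz_laurent Lq.
have lqM psi : test_function psi -> lipschitz (fun x => q (complexify x) * psi x).
  move=> tp; have := lipschitz_testM tp Lq.
  by congr lipschitz; apply/funext => x; rewrite mulrC.
apply/eqP; rewrite -subr_eq0 -cmod_eq0 eq_le cmod_ge0 andbT.
apply/ler_addgt0Pl => e e0; rewrite addr0.
have c0 : 0 < `|K| + vol * B + 1.
  by rewrite ltr_wpDl // addr_ge0 // mulr_ge0 // ltW // vol_gt0.
have [F LF HF] := trig_dense N tphi (divr_gt0 e0 c0).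
set m := e / _ in HF; have m0 : 0 < m by rewrite divr_gt0.
have tF := laurent_test_function LF.
pose psi x := (-1) * F (complexify x) + phi x.
have psiE : psi = fun x => phi x - F (complexify x).
  by apply/funext => x; rewrite /psi mulN1r addrC.
have tpsi : test_function psi.
  have [p1 s1 s1'] := tphi; have [p2 s2 s2'] := tF; rewrite psiE; split.
  - by move=> a x; rewrite p1 p2.
  - have -> : (fun x => complex.Re (phi x - F (complexify x))) = fun x => complex.Re (phi x) - complex.Re (F (complexify x)).
      by apply/funext => x; rewrite ReD ReN.
    exact: smoothB.
  - have -> : (fun x => complex.Im (phi x - F (complexify x))) = fun x => complex.Im (phi x) - complex.Im (F (complexify x)).
      by apply/funext => x; rewrite ImD ImN.
    exact: smoothB.
have psi_le r x : (size r <= N)%N -> cmod (cpartial r psi x) <= m.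
  move=> rN; have := HF r x rN; rewrite -(cpartial_laurent r x LF).
  have [p1 s1 s1'] := tphi; have [p2 s2 s2'] := tF.
  congr (cmod _ <= _); rewrite psiE; apply: complex_eqP; rewrite ?ReD ?ReN ?ImD ?ImN /=.
    have -> : (fun x => complex.Re (phi x - F (complexify x))) = fun x => complex.Re (phi x) - complex.Re (F (complexify x)).
      by apply/funext => y; rewrite ReD ReN.
    by rewrite iter_partialB.
  have -> : (fun x => complex.Im (phi x - F (complexify x))) = fun x => complex.Im (phi x) - complex.Im (F (complexify x)).
    by apply/funext => y; rewrite ImD ImN.
  by rewrite iter_partialB.
have h1 : cmod (u psi) <= K * m.
  rewrite -lec_cmod; apply: uK => // r x rN; rewrite lec_cmod; exact: psi_le.
have h2 : cmod (torus_integral (fun x => q (complexify x) * psi x)) <= vol * (B * m).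
  apply: torus_integral_bound; [by rewrite mulr_ge0 // ltW|exact: lqM|].
  move=> x; rewrite cmodM; apply: ler_pM; rewrite ?cmod_ge0 //.
  have := psi_le [::] x (leq0n N); congr (cmod _ <= _).
  by rewrite /cpartial /=; case: (psi x).
have e1 : u psi = - on_trig u F + u phi by rewrite lu // mulN1r.
have e2 : torus_integral (fun x => q (complexify x) * psi x) =
    - on_trig u F + torus_integral (fun x => q (complexify x) * phi x).
  rewrite (uq F LF) -mulN1r -torus_integral_lin; [|exact: lqM|exact: lqM].
  by congr torus_integral; apply/funext => x; rewrite /psi; ring.
have -> : u phi - torus_integral (fun x => q (complexify x) * phi x) =
   u psi - torus_integral (fun x => q (complexify x) * psi x).
  by rewrite e1 e2; ring.
apply: (le_trans (cmodB _ _)); apply: (le_trans (lerD h1 h2)).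
have hK : K * m <= `|K| * m by rewrite ler_wpM2r ?(ltW m0) // ler_norm.
have -> : e = (`|K| + vol * B + 1) * m by rewrite /m mulrC divfK // gt_eqF.
have -> : (`|K| + vol * B + 1) * m = `|K| * m + vol * (B * m) + m by ring.
by rewrite -[leLHS]addr0; apply: lerD; [apply: lerD|exact: ltW].
Qed.

(** Test the [j]-th equation against the entry [(i, j)] of the adjugate times [G], and sum over [j];
    the components other than [u i] drop out. *)
Lemma adjugate_equation s (M : Cd -> 'M[C]_s) (u : 'I_s -> functional R d) (F : 'I_s -> Cd -> C)
    i G : (forall k, is_distribution (u k)) -> (forall i j, laurent_trig (fun z => M z i j)) ->
  (forall j, laurent_trig (F j)) ->
  (forall j G, laurent_trig G -> \sum_k on_trig (u k) (fun z => M z j k * G z) =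
    torus_integral (fun x => F j (complexify x) * G (complexify x))) ->
  laurent_trig G ->
  on_trig (u i) (fun z => \det (M z) * G z) =
  torus_integral (fun x => (\sum_j (\adj (M (complexify x))) i j * F j (complexify x)) * G (complexify x)).
Proof.
move=> du LM LF eqn LG; have lu k := on_trig_linear (du k).
pose A j z := (\adj (M z)) i j.
have LA j : laurent_trig (A j) by exact: laurent_adj.
have LAG j : laurent_trig (fun z => A j z * G z) by exact: laurentM.
have LMAG j k : laurent_trig (fun z => M z j k * (A j z * G z)) by exact: laurentM.
have h j := eqn j _ (LAG j).
transitivity (\sum_j \sum_k on_trig (u k) (fun z => M z j k * (A j z * G z))).
  rewrite exchange_big /= (bigD1 i) //=.
  have h0 k : k != i -> \sum_j on_trig (u k) (fun z => M z j k * (A j z * G z)) = 0.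
    move=> ki; rewrite -(linear_on_trig_bigsum _ (lu k) (LMAG^~ k)).
    rewrite -[RHS](mul0r (on_trig (u k) (fun=> 0))) -(linear_on_trigZ _ (lu k) (laurent_cst d (0 : C))).
    congr on_trig; apply/funext => z; rewrite mul0r.
    have := congr1 (fun N : matrix C s s => N i k) (mul_adj_mx (M z)).
    rewrite !mxE eq_sym (negPf ki) mulr0n => h1.
    transitivity ((\sum_j (\adj (M z)) i j * M z j k) * G z); last by rewrite h1 mul0r.
    by rewrite mulr_suml; apply: eq_bigr => j _; rewrite /A; ring.
  rewrite (eq_bigr _ h0) big1_eq addr0.
  rewrite -(linear_on_trig_bigsum _ (lu i) (LMAG^~ i)); congr on_trig; apply/funext => z.
  have := congr1 (fun N : matrix C s s => N i i) (mul_adj_mx (M z)); rewrite !mxE eqxx mulr1n => <-.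
  by rewrite mulr_suml; apply: eq_bigr => j _; rewrite /A; ring.
rewrite (eq_bigr _ (fun j _ => h j)) -torus_integral_sum; last first.
  by move=> j; apply: (@lipschitz_laurent R d (fun z => F j z * (A j z * G z))); exact: laurentM.
by congr torus_integral; apply/funext => x; rewrite mulr_suml; apply: eq_bigr => j _; rewrite /A; ring.
Qed.

Lemma divisible_on_trig u p g (j0 j1 : 'I_d) : (j0 : nat) = 0%N -> j1 != j0 -> Bstar0 u ->
  laurent_trig p -> (forall x, complex.Im (p (complexify x)) = 0) ->
  discrete_subset (sng_set p) ->
  (forall t, reg_set p t -> exists x,
     connected_component (reg_set p) t (ctorus_pi (complexify x))) ->
  laurent_trig g ->
  (forall G, laurent_trig G -> on_trig u (fun z => p z * G z) =
    torus_integral (fun x => g (complexify x) * G (complexify x))) ->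
  exists2 q, laurent_trig q & forall G, laurent_trig G -> on_trig u G =
    torus_integral (fun x => q (complexify x) * G (complexify x)).
Proof.
move=> j00 j10 Bu Lp pR ds rc Lg up; have du := Bu.1.1.
have vol0 : vol%:C != 0 :> C by apply/eqP => /(congr1 (@complex.Re R)) /= /eqP; rewrite gt_eqF ?vol_gt0.
have tM q G : laurent_trig q -> laurent_trig G ->
    torus_integral (fun x => q (complexify x) * G (complexify x)) =
    vol%:C * mean (fun x => q (complexify x) * G (complexify x)).
  move=> Lq LG; have LqG := laurentM Lq LG.
  by apply: torus_integral_mean; [exact: (lipschitz_laurent LqG)|exact: (real_trig_laurent LqG)].
(* Dividing by the volume of the torus turns integrals of trigonometric polynomials into means. *)
pose v F := (vol%:C)^-1 * on_trig u F.
have lu := on_trig_linear du.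
have lv : linear_on_trig v by move=> c F G LF LG; rewrite /v lu //; ring.
have sv : sublinear (fun a => v (character a)).
  exact: (sublinearZ (vol%:C)^-1 (Bstar0_sublinear Bu)).
have vp G : laurent_trig G -> v (fun z => p z * G z) = mean (fun x => g (complexify x) * G (complexify x)).
  by move=> LG; rewrite /v up // tM // mulKf.
have g0 x : p (complexify x) = 0 -> ~ grad_vanishes p (complexify x) -> g (complexify x) = 0.
  move=> px ng; have [j pj] : exists j, pd j p (complexify x) != 0.
    apply: contrapT => h; apply: ng; apply/grad_vanishesE => j; apply: contrapT => /eqP pj.
    by apply: h; exists j.
  exact: (resonant_value lv sv Lp pR Lg vp px pj).
have [q Lq qE] := fermi_divides j00 j10 Lp pR ds rc Lg g0.
exists q => //; pose m F := mean (fun x => q (complexify x) * F (complexify x)).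
have tq F : laurent_trig F -> real_trig (fun x => q (complexify x) * F (complexify x)).
  by move=> LF; apply: real_trigM; exact: real_trig_laurent.
have lm : linear_on_trig m.
  move=> c F G LF LG; rewrite /m -(meanZ _ (tq _ LF)) -meanD.
  - by congr mean; apply/funext => x; ring.
  - by apply: real_trigM; [exact: real_trig_cst|exact: tq].
  - exact: tq.
pose v' F := v F - m F.
have lv' : linear_on_trig v' by move=> c F G LF LG; rewrite /v' lv // lm //; ring.
have sv' : sublinear (fun a => v' (character a)) by apply: sublinearB => //; exact: sublinear_mean.
have v'p F : laurent_trig F -> v' (fun z => p z * F z) = 0.
  move=> LF; rewrite /v' vp // /m; apply/eqP; rewrite subr_eq0; apply/eqP; congr mean.
  by apply/funext => x; rewrite qE mulrA.
move=> G LG; have := annihilated_eq0 j0 lv' sv' Lp pR v'p ds LG.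
rewrite /v' /v => /eqP; rewrite subr_eq0 => /eqP h.
by rewrite tM // -/(m G) -h mulVKf.
Qed.

End Assembly.

Theorem theorem5p1 (R : realType) (d s : nat) (d_ge2 : (2 <= d)%N)
    (s_ge1 : (1 <= s)%N)
    (H0 : 'rV[R[i]]_d -> 'M[R[i]]_s)
    (H0_trig : forall j k : 'I_s, laurent_trig (fun z => H0 z j k))
    (H0_herm : forall x : 'rV[R]_d, H0 (complexify x) \is hermsymmx)
    (T1 : set R) (T1_sub : T1 `<=` spectrum H0)
    (sng_discrete : forall l : R, (spectrum H0 `\` T1) l ->
       discrete_subset (fermi_sng H0 l%:C))
    (reg_components : forall l : R, (spectrum H0 `\` T1) l ->
       forall t, fermi_reg H0 l%:C t ->
         let X := connected_component (fermi_reg H0 l%:C) t `&` @real_torus R d in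
         X !=set0 /\ torus_analytic_submanifold d.-1 X)
    (l : R) (hl : (spectrum H0 `\` T1) l)
    (u : 'I_s -> functional R d) (hu : forall j, Bstar0 (u j))
    (f : 'rV[R]_d -> 'cV[R[i]]_s) (hf : trig_polynomial f)
    (equation : forall j : 'I_s,
       eq_dist
         (mulmx_dist (fun x => H0 (complexify x) - (l%:C)%:M) u j)
         (dist_of_fun (fun x => f x j 0))) :
  is_trig_polynomial_dist u.
Proof.
have d0 : (0 < d)%N by exact: ltnW.
(* [j0] carries the distinguished exponential; [j1], available since [d >= 2], is the direction in
   which curves of zeros are produced. *)
pose j0 := Ordinal d0; pose j1 := Ordinal d_ge2.
have j10 : j1 != j0 by [].
pose M z : 'M[R[i]]_s := H0 z - (l%:C)%:M.
have LM i j : laurent_trig (fun z => M z i j).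
  under eq_fun do rewrite !mxE; apply: laurentB; [exact: H0_trig|exact: laurent_cst].
pose p := charpoly_at H0 l%:C.
have Lp : laurent_trig p by exact: laurent_det.
have pR x : complex.Im (p (complexify x)) = 0.
  exact/hermitian_det_real/hermitian_sub_real.
have rc t : reg_set p t -> exists x, connected_component (reg_set p) t (ctorus_pi (complexify x)).
  by move=> /(reg_components l hl)[[t' [ct [x _ xE]]] _]; exists x; move: ct; rewrite -xE.
have [F HF] := boolp.choice hf.
have LF j : laurent_trig (F j) by exact: (HF j).1.
have eqn j G : laurent_trig G -> \sum_k on_trig (u k) (fun z => M z j k * G z) =
    torus_integral (fun x => F j (complexify x) * G (complexify x)).
  move=> LG; have := equation j _ (laurent_test_function LG); rewrite /mulmx_dist /dist_of_fun.
  move=> h; have -> : (fun x => F j (complexify x) * G (complexify x)) = fun x => f x j 0 * G (complexify x).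
    by apply/funext => x; rewrite (HF j).2.
  exact: h.
pose g i z := \sum_j (\adj (M z)) i j * F j z.
have Lg i : laurent_trig (g i).
  by apply: laurent_sum => j; apply: laurentM => //; exact: laurent_adj.
have /boolp.choice[q Hq] : forall i, exists q, laurent_trig q /\
    forall G, laurent_trig G -> on_trig (u i) G =
      torus_integral (fun x => q (complexify x) * G (complexify x)).
  move=> i; have [|q Lq Hq] := divisible_on_trig (erefl : (j0 : nat) = 0%N) j10 (hu i) Lp pR
    (sng_discrete l hl) rc (Lg i) _; last by exists q.
  by move=> G LG; apply: adjugate_equation => // k; case: (hu k) => -[].
exists (fun x => \col_j q j (complexify x)); split=> [j|j].
  by exists (q j); split=> [|x]; [exact: (Hq j).1|rewrite mxE].
have -> : (fun x => (\col_j q j (complexify x)) j 0) = fun x => q j (complexify x).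
  by apply/funext => x; rewrite mxE.
by apply: eq_dist_laurent; [case: (hu j) => -[]|exact: (Hq j).1|exact: (Hq j).2].
Qed.
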